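(* Let $(\eta,\boldsymbol{u}_1,\boldsymbol{u}_2,P_1,P_2)$ be a (classical) solution of the steady internal wave problem (as defined in the context) such that (i) the vorticities $\boldsymbol{\omega}_1$ and $\boldsymbol{\omega}_2$ are constant, parallel (i.e. linearly dependent), and nonzero; and (ii) $\|\boldsymbol{u}_1\|_{C^0}<\infty$ and $\|\boldsymbol{u}_2\|_{C^0}<\infty$ (i.e. $\boldsymbol{u}_i$ is bounded on $\Omega_i$ for $i=1,2$). Then the solution is either a trivially three-dimensional shear flow or two dimensional (both as defined in the context). If moreover $\rho_1\neq\rho_2$, then the solution is necessarily two dimensional.
   Context: Steady internal wave problem. Fix constants $h_1,h_2>0$ (depths), $\rho_1,\rho_2>0$ (densities) and $g>0$ (gravitational acceleration), and Cartesian coordinates $(x,y,z)\in\mathbb{R}^3$ with $z$ vertical. The interface is the graph of a function $\eta\in C^1(\mathbb{R}^2)$, $\eta=\eta(x,y)$, with $-h_1<\inf\eta$ and $\sup\eta<h_2$. The lower and upper fluid layers are $$\Omega_1=\{(x,y,z)\in\mathbb{R}^3: -h_1<z<\eta(x,y)\},\qquad \Omega_2=\{(x,y,z)\in\mathbb{R}^3:\eta(x,y)<z<h_2\}.$$ A (classical) solution consists of such an $\eta$ together with velocity fields $\boldsymbol{u}_i=(u_i,v_i,w_i)\in C^1(\overline{\Omega_i};\mathbb{R}^3)$ and pressures $P_i\in C^1(\overline{\Omega_i})$, $i=1,2$, such that: (1) $\rho_i(\boldsymbol{u}_i\cdot\nabla)\boldsymbol{u}_i=-\nabla P_i+\rho_i(0,0,-g)$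 in $\Omega_i$, for $i=1,2$; (2) $\nabla\cdot\boldsymbol{u}_i=0$ in $\Omega_i$, for $i=1,2$; (3) $u_i\eta_x+v_i\eta_y=w_i$ on $z=\eta(x,y)$, for $i=1,2$; (4) $P_1=P_2$ on $z=\eta(x,y)$; (5) $w_1=0$ on $z=-h_1$ and $w_2=0$ on $z=h_2$. The functions $\boldsymbol{u}_i$, $P_i$ are not assumed bounded, periodic, or to have any prescribed behavior at infinity unless stated. The vorticity in $\Omega_i$ is $\boldsymbol{\omega}_i=\nabla\times\boldsymbol{u}_i=(\partial_y w_i-\partial_z v_i,\ \partial_z u_i-\partial_x w_i,\ \partial_x v_i-\partial_y u_i)$. The problem is invariant under rotations about the $z$-axis (rotating both the coordinates and the velocity vectors), and the following notions are understood up to such a rotation. Trivially three-dimensional shear flow: after some rotation about the $z$-axis, the solution has the form $$\boldsymbol{u}_i=(\beta_i z+k_i,\,0,\,0)\ \text{ in }\Omega_i\quad(i=1,2),\qquad \eta(x,y)=H(y),$$ for some constants $\beta_1,\beta_2,k_1,k_2\in\mathbb{R}$ and some function $H\in C^1(\mathbb{R};(-h_1,h_2))$. Two dimensional: after some rotation about the $z$-axis, $\eta=\eta(x)$ does not depend on $y$, $\boldsymbol{u}_i$ and $P_i$ do not depend on $y$, and the second velocity component is constant in each layer; that is, $\boldsymbol{u}_i=(u_i(x,z),V_i,w_i(x,z))$ with $V_i\in\mathbb{R}$ constant, and $P_i=P_i(x,z)$, for $i=1,2$. *)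

(* Defs.v *)
From HB Require Import structures.
From mathcomp Require Import all_boot all_order all_algebra.
From mathcomp Require Import all_classical all_reals all_analysis.

Set Implicit Arguments.
Unset Strict Implicit.
Unset Printing Implicit Defensive.

Import Order.TTheory GRing.Theory Num.Theory.
Import numFieldNormedType.Exports.

Local Open Scope classical_set_scope.
Local Open Scope ring_scope.

(* Points and vectors are row vectors; the coordinates x, y, z of p : 'rV[R]_3
   are p 0 0, p 0 1, p 0 2. *)
Definition vec2 (R : realType) (x y : R) : 'rV[R]_2 :=
  \row_j [:: x; y]`_j.

Definition vec3 (R : realType) (x y z : R) : 'rV[R]_3 :=
  \row_j [:: x; y; z]`_j.

Definition horiz (R : realType) (p : 'rV[R]_3) : 'rV[R]_2 :=
  vec2 (p 0 0) (p 0 1).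

Definition partial (R : realType) (n : nat) (V : normedModType R)
    (j : 'I_n.+1) (f : 'rV[R]_n.+1 -> V) (p : 'rV[R]_n.+1) : V :=
  'D_(delta_mx 0 j) f p.

(* f belongs to C^1(closure D), for D open: f is continuous on closure D, and
   its first partial derivatives exist in D and extend continuously to
   closure D. For D = setT this is C^1 on the whole space. *)
Definition C1_closure (R : realType) (n : nat) (V : normedModType R)
    (D : set 'rV[R]_n.+1) (f : 'rV[R]_n.+1 -> V) : Prop :=
  {within closure D, continuous f} /\
  forall j : 'I_n.+1,
    (forall p, D p -> derivable f p (delta_mx 0 j)) /\
    exists g : 'rV[R]_n.+1 -> V,
      {within closure D, continuous g} /\
      forall p, D p -> g p = partial j f p.

Section vector_calculus.
Context (R : realType).
Implicit Types (u : 'rV[R]_3 -> 'rV[R]_3) (P : 'rV[R]_3 -> R).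

Definition grad P (p : 'rV[R]_3) : 'rV[R]_3 :=
  \row_j partial j P p.

Definition convect u (p : 'rV[R]_3) : 'rV[R]_3 :=
  \sum_(j < 3) u p 0 j *: partial j u p.

Definition divergence u (p : 'rV[R]_3) : R :=
  \sum_(j < 3) partial j u p 0 j.

Definition curl u (p : 'rV[R]_3) : 'rV[R]_3 :=
  vec3 (partial 1 u p 0 2 - partial 2 u p 0 1)
       (partial 2 u p 0 0 - partial 0 u p 0 2)
       (partial 0 u p 0 1 - partial 1 u p 0 0).

End vector_calculus.

(* The fields are total functions; only the values of u1, P1 (resp. u2, P2) on
   the closure of the lower (resp. upper) layer are meaningful, and only those
   are constrained below. *)
Record flow (R : realType) := Flow {
  elevation : 'rV[R]_2 -> R;
  u1 : 'rV[R]_3 -> 'rV[R]_3;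
  u2 : 'rV[R]_3 -> 'rV[R]_3;
  P1 : 'rV[R]_3 -> R;
  P2 : 'rV[R]_3 -> R
}.

Section internal_waves.
Context (R : realType).
Implicit Types (F : flow R) (e : 'rV[R]_2 -> R) (u : 'rV[R]_3 -> 'rV[R]_3)
  (P : 'rV[R]_3 -> R) (D : set 'rV[R]_3).

Definition lower_layer (h1 : R) e : set 'rV[R]_3 :=
  [set p : 'rV[R]_3 | - h1 < p 0 2 < e (horiz p)].

Definition upper_layer (h2 : R) e : set 'rV[R]_3 :=
  [set p : 'rV[R]_3 | e (horiz p) < p 0 2 < h2].

Definition interface e : set 'rV[R]_3 :=
  [set p : 'rV[R]_3 | p 0 2 = e (horiz p)].

Definition euler (rho g : R) D u P : Prop :=
  forall p, D p ->
    rho *: convect u p = - grad P p + rho *: vec3 0 0 (- g).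

Definition incompressible D u : Prop :=
  forall p, D p -> divergence u p = 0.

Definition kinematic e u : Prop :=
  forall p, interface e p ->
    u p 0 0 * partial 0 e (horiz p) +
    u p 0 1 * partial 1 e (horiz p) = u p 0 2.

(* inf and sup are taken in the extended reals, so that the two bounds also
   express that the elevation is bounded. *)
Record classical_solution (h1 h2 rho1 rho2 g : R) F : Prop := {
  eta_C1 : C1_closure setT (elevation F);
  eta_inf : ((- h1)%:E < ereal_inf [set (elevation F q)%:E | q in setT])%E;
  eta_sup : (ereal_sup [set (elevation F q)%:E | q in setT] < h2%:E)%E;
  u1_C1 : C1_closure (lower_layer h1 (elevation F)) (u1 F);
  u2_C1 : C1_closure (upper_layer h2 (elevation F)) (u2 F);
  P1_C1 : C1_closure (lower_layer h1 (elevation F)) (P1 F);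
  P2_C1 : C1_closure (upper_layer h2 (elevation F)) (P2 F);
  euler1 : euler rho1 g (lower_layer h1 (elevation F)) (u1 F) (P1 F);
  euler2 : euler rho2 g (upper_layer h2 (elevation F)) (u2 F) (P2 F);
  div1 : incompressible (lower_layer h1 (elevation F)) (u1 F);
  div2 : incompressible (upper_layer h2 (elevation F)) (u2 F);
  kinematic1 : kinematic (elevation F) (u1 F);
  kinematic2 : kinematic (elevation F) (u2 F);
  dynamic : forall p, interface (elevation F) p -> P1 F p = P2 F p;
  bed_bc : forall p : 'rV[R]_3, p 0 2 = - h1 -> u1 F p 0 2 = 0;
  lid_bc : forall p : 'rV[R]_3, p 0 2 = h2 -> u2 F p 0 2 = 0
}.

Definition rot2 (t : R) (q : 'rV[R]_2) : 'rV[R]_2 :=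
  vec2 (cos t * q 0 0 - sin t * q 0 1) (sin t * q 0 0 + cos t * q 0 1).

Definition rot3 (t : R) (p : 'rV[R]_3) : 'rV[R]_3 :=
  vec3 (cos t * p 0 0 - sin t * p 0 1) (sin t * p 0 0 + cos t * p 0 1) (p 0 2).

Definition rotate (t : R) F : flow R := {|
  elevation := fun q => elevation F (rot2 (- t) q);
  u1 := fun p => rot3 t (u1 F (rot3 (- t) p));
  u2 := fun p => rot3 t (u2 F (rot3 (- t) p));
  P1 := fun p => P1 F (rot3 (- t) p);
  P2 := fun p => P2 F (rot3 (- t) p)
|}.

Definition shear_form (h1 h2 : R) F : Prop :=
  (exists b1 b2 k1 k2 : R,
    (forall p, lower_layer h1 (elevation F) p ->
       u1 F p = vec3 (b1 * p 0 2 + k1) 0 0) /\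
    (forall p, upper_layer h2 (elevation F) p ->
       u2 F p = vec3 (b2 * p 0 2 + k2) 0 0)) /\
  exists H : R -> R,
    [/\ forall y, derivable H y 1,
        continuous (derive1 H),
        forall y, - h1 < H y < h2
      & forall q, elevation F q = H (q 0 1)].

Definition two_dim_layer D u P : Prop :=
  exists (U W Q : R -> R -> R) (V : R), forall p, D p ->
    u p = vec3 (U (p 0 0) (p 0 2)) V (W (p 0 0) (p 0 2)) /\
    P p = Q (p 0 0) (p 0 2).

Definition two_dim_form (h1 h2 : R) F : Prop :=
  [/\ exists H : R -> R, forall q, elevation F q = H (q 0 0),
      two_dim_layer (lower_layer h1 (elevation F)) (u1 F) (P1 F)
    & two_dim_layer (upper_layer h2 (elevation F)) (u2 F) (P2 F)].

Definition trivially_3d_shear (h1 h2 : R) F : Prop :=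
  exists t : R, shear_form h1 h2 (rotate t F).

Definition two_dimensional (h1 h2 : R) F : Prop :=
  exists t : R, two_dim_form h1 h2 (rotate t F).

End internal_waves.

(* Main.v *)
Require Import Defs.
From HB Require Import structures.
From mathcomp Require Import all_boot all_order all_algebra.
From mathcomp Require Import ring lra.
From mathcomp Require Import all_classical all_reals all_analysis.
Set Implicit Arguments.
Unset Strict Implicit.
Unset Printing Implicit Defensive.
Import Order.TTheory GRing.Theory Num.Theory.
Import numFieldNormedType.Exports.
Local Open Scope classical_set_scope.
Local Open Scope ring_scope.

(** A plane on which a bounded field has constant vertical vorticity carries
    none (bounded_plane_irrotational), so the two vorticities are horizontal,
    and after a rotation they point in the direction of y. The Bernoulli function
    has the gradient of the density times the vector product of velocity and
    vorticity, so it does not depend on y. It follows that neither do u, w and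
    the pressure, and that v is constant: each layer carries a planar flow of
    constant vorticity on its projection along y (planar_layer, fluid_layer).
    Subtracting the uniform shear from such a flow leaves a solution of the
    Cauchy-Riemann equations. Only the interface can still depend on y, and the
    question is whether it does.

    Suppose that eta_y is not zero somewhere. Above the station x in question the
    two projected layers overlap, and every point of the overlap is a height of
    the interface, so the two planar pressures agree on an open set. Pressure
    almost determines a planar flow (reconstruction): wherever the second
    derivatives of the velocity are not zero, the densities agree and each
    velocity is the same constant multiple of the other. Otherwise the second
    derivatives vanish on the overlap, and by unique continuation everywhere.

    In the latter case both layers are bounded uniform shears. The pressures
    then give equal densities, and the kinematic conditions are two Burgers
    equations for eta. A nontrivial solution on the whole plane would have
    straight characteristics that meet, which leaves only the trivially
    three-dimensional shear flow (burgers_flat, straight_shear).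

    In the former case the flow below and the multiple of the flow above fit
    together into one flow between the two walls, over the open set E of
    stations at which the interface is not level in y, and the interface is a
    stream surface of it (curved_flat). If E is the whole line, the vertical
    velocity is a bounded harmonic function on a strip with zero boundary
    values, hence zero, and the flow is a uniform shear, contrary to the
    assumption. Otherwise consider a component of E (wave_all_flat). The
    integral of - V eta_y from an end of the component is a function of x and eta
    alone, namely the stream function up to a constant (mass_psi). It is
    also the y-derivative of the integral of - V eta. Call the former the mass and
    the latter the flux.

    - Mass times eta_y is a y-derivative at fixed x, which bounds the integral
      of the squared mass over all y (energy_bounded). Hence the increment of
      the flux over a window of fixed length tends to zero at both ends of the
      y-axis.
    - At a critical point in x of this increment the heights at both ends of the
      window agree, hence the masses agree, and the y-derivative vanishes as
      well. This gives a maximum principle (transport_max, window), by which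
      the increment is controlled by its values at the far side of the interval.
    - If the component is bounded, its other end is level too, and the increment
      is zero (finite_flat).
    - If the component is a half line, the flow tends exponentially to a shear
      gam (z - z0) downstream (far_field). Heights are carried along the curves
      y' = 1 / U, so they travel across the stream at different limiting
      rates; a faster height behind a slower one would catch up with it, which is
      impossible for a graph (no_crossing). As the mass comes close to zero at
      both ends of the y-axis, far downstream the interface either settles at z0
      or stays on one side of it. In the first situation the flux increments
      tend to zero downstream, in the second U has a sign on the interface and
      the maximum principle needs no information at the far side
      (settled_flat, split_flat).

    In all cases the flux increments vanish, so the mass does, and eta_y is
    zero on E after all: the interface is level in y and the solution is two
    dimensional. The theory of harmonic functions that is used (analyticity,
    Cauchy estimates, unique continuation, decay in strips) is developed for
    Cauchy-Riemann pairs by means of circle integrals. *)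

(** * Derivatives and antiderivatives of functions of one variable *)

Section calculus.
Context {R : realType}.
Implicit Types (f g F : R -> R) (x y d e r : R).

Definition deriv f x d := is_derive (x : R) (1 : R) f d.

Let scaleE (a b : R) : a *: b = a * b. Proof. by []. Qed.

(** Unordered segments, so that estimates need no case distinction on the
    order of the endpoints. *)
Definition btw (a b x : R) := (a <= x <= b) || (b <= x <= a).

Lemma contP f x : {for x, continuous f} <->
  forall e, 0 < e -> exists2 d : R, 0 < d & forall y, `|y - x| < d -> `|f y - f x| < e.
Proof.
split=> [/cvgrPdist_lt cf e e0|H].
  have := cf e e0; rewrite near_nbhs => /nbhs_ballP[d /= d0 Hd].
  by exists d => // y yx; rewrite distrC; apply: Hd; rewrite /ball/= distrC.
apply/cvgrPdist_lt => e e0; have [d d0 Hd] := H e e0.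
by apply/nbhs_ballP; exists d => //= y; rewrite /ball/= distrC => /Hd; rewrite distrC.
Qed.

(** Joint continuity, phrased with a curried function because the partial
    functions are what gets differentiated. *)
Definition cont2 (f : R -> R -> R) x y :=
  {for (x, y), continuous (fun p : R * R => f p.1 p.2)}.

Lemma cont2P (f : R -> R -> R) x y : cont2 f x y <->
  forall e, 0 < e -> exists2 d : R, 0 < d & forall x' y', `|x' - x| < d ->
    `|y' - y| < d -> `|f x' y' - f x y| < e.
Proof.
split=> [/cvgrPdist_lt cf e e0|H].
  have /nbhs_ballP[d /= d0 Hd] := cf e e0.
  exists d => // x' y' xx yy; rewrite distrC.
  by apply: (Hd (x', y')); split; rewrite /ball/= distrC.
apply/cvgrPdist_lt => e e0; have [d d0 Hd] := H e e0.
apply: filterS (nbhsx_ballx (x, y) d d0) => -[x' y'] [/=].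
by rewrite /ball/= distrC => xx; rewrite distrC => yy; rewrite distrC; exact: Hd.
Qed.

Lemma derivP f x d : deriv f x d <->
  forall e, 0 < e -> exists2 r : R, 0 < r & forall h, `|h| < r ->
    `|f (x + h) - f x - d * h| <= e * `|h|.
Proof.
split=> [[df <-] e e0|H].
  move: df => /cvgrPdist_le /(_ e e0) /nbhs_ballP[r /= r0 Hr].
  exists r => // h hr; have [->|h0] := eqVneq h 0.
    by rewrite addr0 subrr mulr0 subr0 normr0 mulr0.
  have := Hr h; rewrite /ball/= sub0r normrN => /(_ hr h0).
  rewrite -[X in `|X - _|]/('D_1 f x) /= => Hh.
  rewrite -(ler_pM2r (x := `|h|^-1)) ?invr_gt0 ?normr_gt0// -mulrA mulfV ?normr_eq0// mulr1.
  rewrite -normfV -normrM; apply: le_trans Hh.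
  rewrite le_eqVlt; apply/orP; left; apply/eqP; rewrite -normrN; congr (`|_|).
  by rewrite /= !scaleE mulr1 (addrC h); field.
have L : (fun h => h^-1 *: ((f \o shift x) (h *: 1) - f x)) @ 0^' --> d.
  apply/cvgrPdist_le => e e0; have [r r0 Hr] := H e e0.
  apply/nbhs_ballP; exists r => //= h; rewrite /ball/= sub0r normrN => hr h0.
  have := Hr h hr.
  rewrite -(ler_pM2r (x := `|h|^-1)) ?invr_gt0 ?normr_gt0// -[leRHS]mulrA mulfV ?normr_eq0// mulr1.
  rewrite -normfV -normrM; apply: le_trans.
  rewrite le_eqVlt; apply/orP; left; apply/eqP; rewrite -normrN; congr (`|_|).
  by rewrite /= !scaleE mulr1 (addrC h); field.
by apply: DeriveDef; [apply/cvg_ex; exists d|apply/cvg_lim].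
Qed.

Lemma deriv_ext f g x d : (forall y, f y = g y) -> deriv f x d -> deriv g x d.
Proof. by move=> /funext ->. Qed.

Lemma deriv_near f g x d r : 0 < r -> (forall y, `|y - x| < r -> f y = g y) ->
  deriv f x d -> deriv g x d.
Proof.
move=> r0 fg /derivP H; apply/derivP => e e0; have [s s0 Hs] := H e e0.
exists (Num.min r s); first by rewrite lt_min r0.
move=> h; rewrite lt_min => /andP[hr hs].
rewrite -!fg ?subrr ?normr0//; first exact: Hs.
by rewrite addrC addKr.
Qed.

Lemma deriv_eq f x d d' : deriv f x d -> d = d' -> deriv f x d'.
Proof. by move=> ? <-. Qed.

Lemma deriv_uniq f x d d' : deriv f x d -> deriv f x d' -> d = d'.
Proof. by move=> [_ <-] [_ <-]. Qed.

Lemma deriv_cont f x d : deriv f x d -> {for x, continuous f}.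
Proof. by move=> [df _]; apply/differentiable_continuous/derivable1_diffP. Qed.

Lemma derivC (c : R) x : deriv (fun=> c) x 0. Proof. exact: is_derive_cst. Qed.
Lemma derivI x : deriv (fun y => y) x 1. Proof. exact: is_derive_id. Qed.
Lemma derivD f g x a b : deriv f x a -> deriv g x b ->
  deriv (fun y => f y + g y) x (a + b).
Proof. by rewrite /deriv => ? ?; exact: is_deriveD. Qed.
Lemma derivN f x a : deriv f x a -> deriv (fun y => - f y) x (- a).
Proof. by rewrite /deriv => ?; exact: is_deriveN. Qed.
Lemma derivB f g x a b : deriv f x a -> deriv g x b ->
  deriv (fun y => f y - g y) x (a - b).
Proof. by rewrite /deriv => ? ?; exact: is_deriveB. Qed.
Lemma derivM f g x a b : deriv f x a -> deriv g x b ->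
  deriv (fun y => f y * g y) x (a * g x + f x * b).
Proof.
rewrite /deriv => ? ?.
have H : is_derive x 1 (f * g) (f x *: b + g x *: a) by exact: is_deriveM.
by apply: is_derive_eq H _; rewrite !scaleE; ring.
Qed.
Lemma derivZ f x a (c : R) : deriv f x a -> deriv (fun y => c * f y) x (c * a).
Proof. by move=> df; apply: deriv_eq (derivM (derivC c x) df) _; ring. Qed.
Lemma derivX2 f x a : deriv f x a -> deriv (fun y => f y ^+ 2) x (2 * f x * a).
Proof. by move=> df; apply: deriv_eq (derivM df df) _; ring. Qed.
Lemma deriv_comp f g x a b : deriv g x b -> deriv f (g x) a ->
  deriv (fun y => f (g y)) x (a * b).
Proof.
by rewrite /deriv => ? ?; exact: is_derive1_comp.
Qed.
Lemma derivV f x a : f x != 0 -> deriv f x a ->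
  deriv (fun y => (f y)^-1) x (- a / f x ^+ 2).
Proof.
rewrite /deriv => f0 df.
have H := is_deriveV f0 df.
by apply: is_derive_eq H _; rewrite !scaleE; field.
Qed.

Lemma btwC a b x : btw a b x = btw b a x. Proof. by rewrite /btw orbC. Qed.
Lemma btwl a b : btw a b a. Proof. by rewrite /btw lexx; case: leP => // /ltW ->. Qed.
Lemma btwr a b : btw a b b. Proof. by rewrite btwC btwl. Qed.

Lemma cont_within f a b : (forall x, a <= x <= b -> {for x, continuous f}) ->
  {within `[a, b], continuous f}.
Proof.
move=> H; apply: continuous_in_subspaceT => x.
by rewrite inE /= in_itv /= => /H.
Qed.

Lemma mvt f df a b : (forall x, btw a b x -> deriv f x (df x)) ->
  exists2 c, btw a b c & f b - f a = df c * (b - a).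
Proof.
wlog ab : a b / a <= b => [W H|H].
  case: (leP a b) => [ab|/ltW ba]; first exact: W.
  have [|c cb E] := W b a ba; first by move=> x; rewrite btwC; exact: H.
  by exists c; [rewrite btwC|rewrite -opprB E; ring].
have [x|x xab|c cab E] := @MVT_segment R f df a b ab.
- by rewrite in_itv/= => /andP[/ltW ax /ltW xb]; apply: H; rewrite /btw ax xb.
- by apply: cont_within xab => y yab; apply: (@deriv_cont _ _ (df y)); apply: H; rewrite /btw yab.
by exists c => //; move: cab; rewrite in_itv/= /btw => ->.
Qed.

Lemma deriv0_const f a b : (forall x, btw a b x -> deriv f x 0) -> f b = f a.
Proof.
by move=> H; have [c _] := @mvt f (fun=> 0) a b H; rewrite mul0r => /subr0_eq.
Qed.

Lemma deriv_lip f df (K : R) a b : (forall x, btw a b x -> deriv f x (df x)) ->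
  (forall x, btw a b x -> `|df x| <= K) -> `|f b - f a| <= K * `|b - a|.
Proof.
move=> H HK; have [c cab ->] := mvt H.
by rewrite normrM ler_wpM2r// HK.
Qed.

Lemma deriv_ge0_le f df a b : a <= b ->
  (forall x, a <= x <= b -> deriv f x (df x)) ->
  (forall x, a <= x <= b -> 0 <= df x) -> f a <= f b.
Proof.
move=> ab H H0.
have btwE x : btw a b x -> a <= x <= b.
  by case/orP => // /andP[bx xa]; rewrite (le_trans ab bx) (le_trans xa ab).
have [|c /btwE cab E] := @mvt f df a b; first by move=> x /btwE; exact: H.
by rewrite -subr_ge0 E mulr_ge0 ?subr_ge0// H0.
Qed.

(** A maximum attained at the left end of an interval still bounds the slope
    there; the next lemma is the mirror image. *)
Lemma deriv_max_right f x d r : deriv f x d -> 0 < r ->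
  (forall y, x < y < x + r -> f y <= f x) -> d <= 0.
Proof.
move=> /derivP H r0 Hm; rewrite leNgt; apply/negP => d0.
have d2 : 0 < d / 2 by lra.
have [s s0 Hs] := H (d / 2) d2.
pose h := Num.min r s / 2.
have h0 : 0 < h by rewrite divr_gt0// lt_min r0.
have hm : h < Num.min r s by rewrite /h ltr_pdivrMr// ltr_pMr ?lt_min ?r0// ltr1n.
have [hr hs] : h < r /\ h < s by move: hm; rewrite lt_min => /andP[].
have := Hs h; rewrite (gtr0_norm h0) => /(_ hs) /ler_normlP[H1 _].
have := Hm (x + h); rewrite ltrDl h0 ltrD2l hr => /(_ isT) H2.
have H3 := mulr_gt0 d0 h0.
move: H1 H2; set A := f (x + h); set B := f x => H1 H2; lra.
Qed.

Lemma deriv_max_left f x d r : deriv f x d -> 0 < r ->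
  (forall y, x - r < y < x -> f y <= f x) -> 0 <= d.
Proof.
move=> df r0 Hm; rewrite -oppr_le0.
have dg : deriv (fun y => f (- y)) (- x) (- d).
  apply: deriv_eq (_ : d * - 1 = _); last by ring.
  apply: (@deriv_comp f -%R); last by rewrite opprK.
  exact: derivN (derivI _).
apply: deriv_max_right dg r0 _ => y /andP[xy yx]; rewrite opprK Hm//.
by rewrite ltrNr -opprB opprK addrC yx/= ltrNl.
Qed.

Fact prim_key : unit. Proof. by []. Qed.
(** The sign convention for x < c makes this an antiderivative on both sides
    of the base point c. *)
Definition prim : (R -> R) -> R -> R -> R := locked_with prim_key (fun f c x =>
  if c <= x then \int[lebesgue_measure]_(t in `[c, x]) f t
  else - \int[lebesgue_measure]_(t in `[x, c]) f t).

Lemma primxx f c : prim f c c = 0.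
Proof. by rewrite /prim unlock lexx set_itv1 Rintegral_set1. Qed.

Lemma cont_integrable f a b : (forall t, a <= t <= b -> {for t, continuous f}) ->
  lebesgue_measure.-integrable `[a, b] (EFin \o f).
Proof.
move=> H; apply: continuous_compact_integrable; first exact: segment_compact.
exact: cont_within.
Qed.

Lemma RintegralB_split f a b c : a <= b <= c ->
  (forall t, a <= t <= c -> {for t, continuous f}) ->
  \int[lebesgue_measure]_(t in `[a, c]) f t =
  \int[lebesgue_measure]_(t in `[a, b]) f t + \int[lebesgue_measure]_(t in `[b, c]) f t.
Proof.
move=> /andP[ab bc] cf.
have -> : \int[lebesgue_measure]_(t in `[b, c]) f t = \int[lebesgue_measure]_(t in `]b, c]) f t.
  rewrite Rintegral_itv_obnd_cbnd//.
  apply: integrableS (@cont_integrable f a c cf) => //.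
  by apply: subset_itv; rewrite bnd_simp.
rewrite addrC; apply/eqP; rewrite -subr_eq; apply/eqP.
by apply: (@Rintegral_itvB _ f (BLeft a) (BRight c) b); rewrite ?bnd_simp//; exact: cont_integrable.
Qed.

(** The fundamental theorem of calculus is applied from a point a to the
    left of both c and x, which turns both branches of the definition into a
    difference of two integrals from a. *)
Lemma prim_deriv f lo hi c x : lo < c < hi -> lo < x < hi ->
  (forall t, lo < t < hi -> {for t, continuous f}) ->
  deriv (prim f c) x (f x).
Proof.
move=> /andP[lc ch] /andP[lx xh] cf.
have [a la [ac ax]] : exists2 a, lo < a & a < c /\ a < x.
  exists ((lo + Num.min c x) / 2).
    by rewrite midf_lt ?lt_min ?lc.
  have := @midf_lt R lo (Num.min c x); rewrite lt_min lc lx => /(_ isT)[_].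
  by rewrite lt_min => /andP[].
have [u xu uh] : exists2 u, x < u & u < hi.
  by exists ((x + hi) / 2); rewrite midf_lt.
have cfa t s : a <= t -> s < hi -> forall y, t <= y <= s -> {for y, continuous f}.
  move=> at' sh y /andP[ty ys]; apply: cf.
  by rewrite (lt_le_trans la (le_trans at' ty)) (le_lt_trans ys sh).
pose G y := \int[lebesgue_measure]_(t in `[a, y]) f t.
have dG : deriv G x (f x).
  have := @continuous_FTC1_closed R f a x u xu (cont_integrable (cfa a u (lexx _) uh)).
  move=> /(_ ax (cf x _)) []; first by rewrite lx xh.
  by move=> dF eF; apply: DeriveDef; [exact: dF|rewrite -eF derive1E].
apply: (@deriv_near (fun y => G y - G c) _ _ _ (Num.min (x - a) (hi - x))).
- by rewrite lt_min !subr_gt0 ax.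
- move=> y; rewrite lt_min => /andP[y1 y2].
  have ay : a < y by move: y1; rewrite distrC => /ltr_normlW; lra.
  have yh : y < hi by move: y2 => /ltr_normlW; lra.
  rewrite /prim /G unlock; case: leP => cy.
    rewrite (@RintegralB_split f a c y) ?(ltW ac)//; last exact: cfa.
    by ring.
  rewrite (@RintegralB_split f a y c) ?(ltW ay) ?(ltW cy)//; last exact: cfa.
  by ring.
by apply: deriv_eq (derivB dG (derivC _ _)) _; rewrite subr0.
Qed.

Lemma primT_deriv f c x : (forall t, {for t, continuous f}) -> deriv (prim f c) x (f x).
Proof.
move=> cf; apply: (@prim_deriv f (Num.min c x - 1) (Num.max c x + 1)).
- by rewrite ltrBlDr ltr_pwDr ?ge_min ?lexx//= ltr_pwDr ?le_max ?lexx.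
- by rewrite ltrBlDr ltr_pwDr ?ge_min ?lexx ?orbT//= ltr_pwDr ?le_max ?lexx ?orbT.
by move=> t _; exact: cf.
Qed.
End calculus.

(** * Functions of two variables *)

Section calculus2.
Context {R : realType}.
Implicit Types (f F : R -> R -> R) (x y d e r : R).

Lemma cont2C (c : R) x y : cont2 (fun _ _ => c) x y.
Proof. exact: cst_continuous. Qed.
Lemma cont2D f g x y : cont2 f x y -> cont2 g x y -> cont2 (fun a b => f a b + g a b) x y.
Proof. by move=> cf cg; exact: (@continuousD _ _ _ (fun p : R * R => f p.1 p.2) (fun p : R * R => g p.1 p.2)). Qed.
Lemma cont2N f x y : cont2 f x y -> cont2 (fun a b => - f a b) x y.
Proof. by move=> cf; exact: (@continuousN _ _ _ (fun p : R * R => f p.1 p.2)). Qed.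
Lemma cont2B f g x y : cont2 f x y -> cont2 g x y -> cont2 (fun a b => f a b - g a b) x y.
Proof. by move=> cf cg; exact: (@continuousB _ _ _ (fun p : R * R => f p.1 p.2) (fun p : R * R => g p.1 p.2)). Qed.
Lemma cont2M f g x y : cont2 f x y -> cont2 g x y -> cont2 (fun a b => f a b * g a b) x y.
Proof. by move=> cf cg; exact: (@continuousM _ _ (fun p : R * R => f p.1 p.2) (fun p : R * R => g p.1 p.2)). Qed.
Lemma cont2X x y : cont2 (fun a _ => a) x y. Proof. exact: cvg_fst. Qed.
Lemma cont2Y x y : cont2 (fun _ b => b) x y. Proof. exact: cvg_snd. Qed.
Lemma cont2_comp f p q x y : {for x, continuous p} -> {for y, continuous q} ->
  cont2 f (p x) (q y) -> cont2 (fun a b => f (p a) (q b)) x y.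
Proof.
move=> /contP cp /contP cq /cont2P cf; apply/cont2P => e /cf[d d0 Hd].
have [d1 d10 H1] := cp d d0; have [d2 d20 H2] := cq d d0.
exists (Num.min d1 d2); first by rewrite lt_min d10.
by move=> a b; rewrite !lt_min => /andP[a1 _] /andP[_ b2]; apply: Hd; [exact: H1|exact: H2].
Qed.
Lemma cont2_comp1 f p q x : {for x, continuous p} -> {for x, continuous q} ->
  cont2 f (p x) (q x) -> {for x, continuous (fun a => f (p a) (q a))}.
Proof.
move=> /contP cp /contP cq /cont2P cf; apply/contP => e /cf[d d0 Hd].
have [d1 d10 H1] := cp d d0; have [d2 d20 H2] := cq d d0.
exists (Num.min d1 d2); first by rewrite lt_min d10.
by move=> a; rewrite !lt_min => /andP[a1 a2]; apply: Hd; [exact: H1|exact: H2].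
Qed.
Lemma cont2_gen f P Q x y : cont2 P x y -> cont2 Q x y ->
  cont2 f (P x y) (Q x y) -> cont2 (fun a b => f (P a b) (Q a b)) x y.
Proof.
move=> /cont2P cp /cont2P cq /cont2P cf; apply/cont2P => e /cf[d d0 Hd].
have [d1 d10 H1] := cp d d0; have [d2 d20 H2] := cq d d0.
exists (Num.min d1 d2); first by rewrite lt_min d10.
by move=> a b; rewrite !lt_min => /andP[a1 a2] /andP[b1 b2]; apply: Hd; [exact: H1|exact: H2].
Qed.
Lemma cont2_swap f x y : cont2 f x y -> cont2 (fun a b => f b a) y x.
Proof.
move=> /cont2P cf; apply/cont2P => e /cf[d d0 Hd].
by exists d => // a b aa bb; exact: Hd.
Qed.
Lemma cont2_near f g x y r : 0 < r ->
  (forall a b, `|a - x| < r -> `|b - y| < r -> f a b = g a b) ->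
  cont2 f x y -> cont2 g x y.
Proof.
move=> r0 fg /cont2P cf; apply/cont2P => e /cf[d d0 Hd].
exists (Num.min d r); first by rewrite lt_min d0.
move=> a b; rewrite !lt_min => /andP[a1 a2] /andP[b1 b2].
by rewrite -!fg ?subrr ?normr0//; exact: Hd.
Qed.

(** Compactness of the segment: the moduli of continuity along it can be
    chosen uniform. *)
Lemma tube f x0 c b e : (forall t, btw c b t -> cont2 f x0 t) -> 0 < e ->
  exists2 d : R, 0 < d & forall x t, `|x - x0| < d -> btw c b t ->
    `|f x t - f x0 t| < e.
Proof.
move=> cf e0.
pose K := `[Num.min c b, Num.max c b]%classic : set R.
have KE t : btw c b t -> K t.
  by rewrite /K /= in_itv/= ge_min le_max => /orP[] /andP[-> ->]; rewrite ?orbT.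
have EK t : K t -> btw c b t.
  rewrite /K /= in_itv/= ge_min le_max /btw.
  by case: (leP c b) (leP c t) (leP t b) (leP b t) (leP t c) => + [] + [] + [] + [] //=; lra.
have := (compact_near_coveringP K).1 (@segment_compact _ _ _) R (nbhs x0)
  (fun x t => `|f x t - f x0 t| < e).
case.
  move=> t /EK /cf /cont2P /(_ (e / 2)) [|d d0 Hd]; first by lra.
  exists (ball t d, ball x0 d); first by split; exact: nbhsx_ballx.
  move=> [t' x] [/=]; rewrite /ball/= [`|t - t'|]distrC [`|x0 - x|]distrC => tt xx.
  have H1 := Hd x t' xx tt.
  have H2 := Hd x0 t'; rewrite subrr normr0 in H2; have {}H2 := H2 d0 tt.
  rewrite (_ : f x t' - f x0 t' = (f x t' - f x0 t) - (f x0 t' - f x0 t)); last by ring.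
  by rewrite (le_lt_trans (ler_normB _ _))//; lra.
move=> d /= d0 Hd; exists d => // x t xx /KE; apply: Hd.
by rewrite /ball/= distrC.
Qed.

(** The antiderivatives P x and G are arbitrary ones: the error term of the
    difference quotient vanishes at c and has a small derivative in t, so the
    mean value inequality bounds it. *)
Lemma param_deriv F Fx (P : R -> R -> R) (G : R -> R) c b x0 r : 0 < r ->
  (forall x t, `|x - x0| < r -> btw c b t -> deriv (F^~ t) x (Fx x t)) ->
  (forall t, btw c b t -> cont2 Fx x0 t) ->
  (forall x t, `|x - x0| < r -> btw c b t -> deriv (P x) t (F x t)) ->
  (forall t, btw c b t -> deriv G t (Fx x0 t)) ->
  (forall x, `|x - x0| < r -> P x c = 0) -> G c = 0 ->
  deriv (P^~ b) x0 (G b).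
Proof.
move=> r0 dF cF dP dG P0 G0; apply/derivP => e e0.
have e1 : 0 < e / (1 + `|b - c|) by rewrite divr_gt0// ltr_pwDl.
have [d d0 Hd] := tube cF e1.
exists (Num.min d r); first by rewrite lt_min d0.
move=> h; rewrite lt_min => /andP[hd hr].
have xh x : btw x0 (x0 + h) x -> `|x - x0| <= `|h|.
  by case/orP => /andP[]; case: (ger0P h) => ?; case: (ger0P (x - x0)); lra.
have x00 : `|x0 - x0| < r by rewrite subrr normr0.
have xh0 : `|x0 + h - x0| < r by rewrite addrC addKr.
pose g t := P (x0 + h) t - P x0 t - h * G t.
have dg t : btw c b t -> deriv g t (F (x0 + h) t - F x0 t - h * Fx x0 t).
  move=> ct; apply: derivB; first by apply: derivB; exact: dP.
  by apply: derivZ; exact: dG.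
have := @deriv_lip _ g _ (e / (1 + `|b - c|) * `|h|) c b dg.
have gc : g c = 0 by rewrite /g !P0// G0 mulr0; ring.
rewrite gc subr0 /g (mulrC h) => H; apply: le_trans (H _) _.
  move=> t ct.
  have [|x xx E] := @mvt _ (F^~ t) (Fx^~ t) x0 (x0 + h).
    by move=> x /xh xx; apply: dF => //; exact: le_lt_trans hr.
  rewrite E (_ : _ - _ = (Fx x t - Fx x0 t) * h); last by ring.
  rewrite normrM ler_wpM2r// ltW// Hd//.
  exact: le_lt_trans (xh _ xx) hd.
rewrite (_ : _ * _ * _ = e * `|h| * (`|b - c| / (1 + `|b - c|))); last first.
  by field; rewrite gt_eqF// ltr_pwDl.
rewrite ler_piMr ?mulr_ge0 ?(ltW e0)// ler_pdivrMr ?ltr_pwDl// mul1r lerDr.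
by [].
Qed.

Lemma param_cont F (P : R -> R -> R) c b x0 r : 0 < r ->
  (forall t, btw c b t -> cont2 F x0 t) ->
  (forall x t, `|x - x0| < r -> btw c b t -> deriv (P x) t (F x t)) ->
  (forall x, `|x - x0| < r -> P x c = 0) ->
  {for x0, continuous (P^~ b)}.
Proof.
move=> r0 cF dP P0; apply/contP => e e0.
have e1 : 0 < e / (1 + `|b - c|) by rewrite divr_gt0// ltr_pwDl.
have [d d0 Hd] := tube cF e1.
exists (Num.min d r); first by rewrite lt_min d0.
move=> x; rewrite lt_min => /andP[xd xr].
have x00 : `|x0 - x0| < r by rewrite subrr normr0.
have dg t : btw c b t -> deriv (fun t => P x t - P x0 t) t (F x t - F x0 t).
  by move=> ct; apply: derivB; exact: dP.
have := @deriv_lip _ _ _ (e / (1 + `|b - c|)) c b dg.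
rewrite !P0// subrr subr0 => H; apply: le_lt_trans (H _) _.
  by move=> t ct; rewrite ltW// Hd.
rewrite mulrAC ltr_pdivrMr ?ltr_pwDl// ltr_pM2l//.
by rewrite ltrDr.
Qed.

Lemma diff2 f fx fy x0 y0 r : 0 < r ->
  (forall x y, `|x - x0| < r -> `|y - y0| < r ->
     deriv (f^~ y) x (fx x y) /\ deriv (f x) y (fy x y)) ->
  cont2 fx x0 y0 -> cont2 fy x0 y0 ->
  forall e, 0 < e -> exists2 d : R, 0 < d & forall x y, `|x - x0| < d -> `|y - y0| < d ->
   `|f x y - f x0 y0 - fx x0 y0 * (x - x0) - fy x0 y0 * (y - y0)|
      <= e * (`|x - x0| + `|y - y0|).
Proof.
move=> r0 df /cont2P cx /cont2P cy e e0.
have [d1 d10 H1] := cx e e0; have [d2 d20 H2] := cy e e0.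
exists (Num.min r (Num.min d1 d2)); first by rewrite !lt_min r0 d10.
move=> x y; rewrite !lt_min => /and3P[xr x1 x2] /and3P[yr y1 y2].
have bx a b z : btw a b z -> `|z - a| <= `|b - a|.
  by case/orP => /andP[]; case: (ger0P (b - a)) => ?; case: (ger0P (z - a)); lra.
have [|a /bx ax Ea] := @mvt _ (f^~ y) (fx^~ y) x0 x.
  by move=> z /bx zz; apply: (df z y _ yr).1; exact: le_lt_trans xr.
have [|b /bx ab Eb] := @mvt _ (f x0) (fy x0) y0 y.
  move=> z /bx zz; apply: (df x0 z _ _).2; first by rewrite subrr normr0.
  exact: le_lt_trans yr.
rewrite (_ : _ - _ = (fx a y - fx x0 y0) * (x - x0) + (fy x0 b - fy x0 y0) * (y - y0)); last first.
  have -> : f x y - f x0 y0 = (f x y - f x0 y) + (f x0 y - f x0 y0) by ring.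
  by rewrite Ea Eb; ring.
apply: le_trans (ler_normD _ _) _; rewrite !normrM mulrDr lerD// ler_wpM2r// ltW//.
  by apply: H1 => //; exact: le_lt_trans x1.
by apply: H2; [rewrite subrr normr0|exact: le_lt_trans y2].
Qed.

Lemma chain2 f fx fy (p q : R -> R) t0 a b r : 0 < r ->
  (forall x y, `|x - p t0| < r -> `|y - q t0| < r ->
     deriv (f^~ y) x (fx x y) /\ deriv (f x) y (fy x y)) ->
  cont2 fx (p t0) (q t0) -> cont2 fy (p t0) (q t0) ->
  deriv p t0 a -> deriv q t0 b ->
  deriv (fun t => f (p t) (q t)) t0 (fx (p t0) (q t0) * a + fy (p t0) (q t0) * b).
Proof.
move=> r0 df cx cy dp dq.
set A := fx _ _; set B := fy _ _; apply/derivP => e e0.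
pose C := 4 * (1 + `|a| + `|b| + `|A| + `|B|).
have C0 : 0 < C.
  by rewrite /C mulr_gt0//; have := normr_ge0 a; have := normr_ge0 b;
     have := normr_ge0 A; have := normr_ge0 B; lra.
pose e1 := Num.min 1 (e / C).
have e10 : 0 < e1 by rewrite lt_min ltr01 divr_gt0.
have e11 : e1 <= 1 by rewrite ge_min lexx.
have e1C : e1 * C <= e by rewrite -ler_pdivlMr// ge_min lexx orbT.
have [d d0 Hd] := diff2 r0 df cx cy e10.
have /contP/(_ d d0)[r1 r10 H1] := deriv_cont dp.
have /contP/(_ d d0)[r2 r20 H2] := deriv_cont dq.
have [r3 r30 H3] := (derivP _ _ _).1 dp e1 e10.
have [r4 r40 H4] := (derivP _ _ _).1 dq e1 e10.
exists (Num.min (Num.min r1 r2) (Num.min r3 r4)); first by rewrite !lt_min r10 r20 r30.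
move=> h; rewrite !lt_min => /andP[/andP[h1 h2] /andP[h3 h4]].
have th : t0 + h - t0 = h by ring.
have := Hd (p (t0 + h)) (q (t0 + h)).
move=> /(_ (H1 _ _) (H2 _ _)); rewrite th => /(_ h1 h2); rewrite -/A -/B.
have := H3 h h3; have := H4 h h4.
set P := p _ - p t0; set Q := q _ - q t0; set D := f _ _ - _.
move=> HQ HP HD.
have nh := normr_ge0 h.
have bP : `|P| <= (e1 + `|a|) * `|h|.
  rewrite (_ : P = (P - a * h) + a * h); last by ring.
  by rewrite (le_trans (ler_normD _ _))// mulrDl lerD// normrM.
have bQ : `|Q| <= (e1 + `|b|) * `|h|.
  rewrite (_ : Q = (Q - b * h) + b * h); last by ring.
  by rewrite (le_trans (ler_normD _ _))// mulrDl lerD// normrM.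
rewrite (_ : D - _ = (D - A * P - B * Q) + A * (P - a * h) + B * (Q - b * h)); last by ring.
have B1 : `|A * (P - a * h)| <= `|A| * (e1 * `|h|) by rewrite normrM ler_wpM2l.
have B2 : `|B * (Q - b * h)| <= `|B| * (e1 * `|h|) by rewrite normrM ler_wpM2l.
apply: le_trans (ler_normD _ _) _; apply: le_trans (lerD (ler_normD _ _) (lexx _)) _.
have HD2 : `|D - A * P - B * Q| <= e1 * ((2 + `|a| + `|b|) * `|h|).
  apply: le_trans HD _; rewrite ler_pM2l//.
  have : e1 * `|h| <= 1 * `|h| by rewrite ler_wpM2r.
  by move: bP bQ; rewrite !mulrDl; lra.
have E : e1 * C * `|h| <= e * `|h| by rewrite ler_wpM2r.
apply: le_trans E; rewrite (_ : e1 * C * `|h| = e1 * (C * `|h|)); last by ring.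
apply: (@le_trans _ _ (e1 * ((2 + `|a| + `|b|) * `|h|) + `|A| * (e1 * `|h|) + `|B| * (e1 * `|h|))).
  by rewrite !lerD.
rewrite (_ : _ + _ = e1 * ((2 + `|a| + `|b| + `|A| + `|B|) * `|h|)); last by ring.
rewrite ler_pM2l// ler_wpM2r// /C.
by have := normr_ge0 a; have := normr_ge0 b; have := normr_ge0 A; have := normr_ge0 B; lra.
Qed.

(** The function L^2 exp(-2Kx) does not increase. *)
Lemma gronwall (L L' : R -> R) (K a b : R) : a <= b ->
  (forall x, a <= x <= b -> deriv L x (L' x)) ->
  (forall x, a <= x <= b -> `|L' x| <= K * `|L x|) -> L a = 0 -> L b = 0.
Proof.
move=> ab dL HL La.
pose phi x := - (L x ^+ 2 * expR (- (2 * K) * x)).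
have dphi x : a <= x <= b ->
    deriv phi x (- ((2 * L x * L' x) * expR (- (2 * K) * x)
                    + L x ^+ 2 * (expR (- (2 * K) * x) * (- (2 * K) * 1)))).
  move=> xab; apply: derivN; apply: derivM; first by apply: derivX2; exact: dL.
  apply: (@deriv_comp _ expR); first by apply: derivZ; exact: derivI.
  exact: is_derive_expR.
have := deriv_ge0_le ab dphi; rewrite /phi La expr0n/= mul0r oppr0 => H.
have : L b ^+ 2 <= 0.
  rewrite -(pmulr_lle0 _ (expR_gt0 (- (2 * K) * b))) -oppr_ge0; apply: H => x xab.
  set E := expR _; rewrite (_ : - _ = 2 * (K * L x ^+ 2 - L x * L' x) * E); last by ring.
  rewrite mulr_ge0 ?expR_ge0// mulr_ge0// subr_ge0.
  apply: le_trans (ler_norm _) _; rewrite normrM -(real_normK (num_real (L x))).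
  by rewrite expr2 mulrA mulrC ler_wpM2r// HL.
move=> H0; apply/eqP; rewrite -sqrf_eq0 eq_le H0 sqr_ge0.
by [].
Qed.
End calculus2.

(** * Extrema, induction along segments, and transport *)

Section tools.
Context {R : realType}.
Implicit Types (x y d e r : R).

Lemma EVT2 (f : R -> R -> R) a b c d : a <= b -> c <= d ->
  (forall x y, a <= x <= b -> c <= y <= d -> cont2 f x y) ->
  exists x0 y0, [/\ a <= x0 <= b, c <= y0 <= d &
    forall x y, a <= x <= b -> c <= y <= d -> f x y <= f x0 y0].
Proof.
move=> ab cd cf.
have := @compact_EVT_max (R * R)%type R (fun p => f p.1 p.2) (`[a, b] `*` `[c, d]).
case.
- by exists (a, c); split; rewrite /= in_itv/= lexx.
- by apply: compact_setX; exact: segment_compact.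
- apply: continuous_in_subspaceT => -[x y].
  by rewrite inE => -[/=]; rewrite !in_itv/= => xx yy; exact: cf.
move=> [x0 y0]; rewrite inE => -[/=]; rewrite !in_itv/= => xx yy H.
exists x0, y0; split => // x y xab ycd.
by apply: (H (x, y)); rewrite inE; split; rewrite /= in_itv.
Qed.

Lemma IVTc (f : R -> R) a b v : a <= b -> (forall x, a <= x <= b -> {for x, continuous f}) ->
  (f a <= v <= f b \/ f b <= v <= f a) -> exists2 c, a <= c <= b & f c = v.
Proof.
move=> ab cf H; have [||c] := @IVT R f a b v ab.
- exact: cont_within.
- by rewrite ge_min le_max; case: H => /andP[-> ->]; rewrite ?orbT.
by rewrite in_itv/= => ? ?; exists c.
Qed.

(** The supremum of the initial segments on which P holds can neither fail
    P, by closedness, nor lie before b, by openness. *)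
Lemma seg_ind (P : R -> Prop) a b : a <= b -> P a ->
  (forall t, a <= t <= b -> P t ->
     exists2 d : R, 0 < d & forall s, a <= s <= b -> `|s - t| < d -> P s) ->
  (forall t, a <= t <= b ->
     (forall d, 0 < d -> exists s, [/\ a <= s <= b, `|s - t| < d & P s]) -> P t) ->
  P b.
Proof.
move=> ab Pa Ho Hc.
pose S := [set t | a <= t <= b /\ forall s, a <= s <= t -> P s].
have Sa : S a.
  by split; [rewrite lexx|move=> s /andP[h1 h2]; rewrite (_ : s = a)//; apply/eqP; rewrite eq_le h1 h2].
have ubS : ubound S b by move=> t [/andP[]].
have hS : has_sup S by split; [exists a|exists b].
set t0 := sup S.
have at0 : a <= t0 by apply: ub_le_sup => //; exists b.
have t0b : t0 <= b by apply: ge_sup => //; exists a.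
have below s : a <= s < t0 -> P s.
  move=> /andP[as' st]; have st0 : 0 < t0 - s by rewrite subr_gt0.
  have [t [_ Ht] st'] := sup_adherent st0 hS.
  by apply: Ht; rewrite as'/=; move: st'; rewrite -/t0; lra.
have Pt0 : P t0.
  apply: Hc => [|d d0]; first by rewrite at0.
  have [t [/andP[at' tb] Ht] tt] := sup_adherent d0 hS.
  have tt0 : t <= t0 by apply: sup_upper_bound => //; split => //; rewrite at'.
  exists t; rewrite at' tb; split => //; last by apply: Ht; rewrite at' lexx.
  by rewrite distrC ger0_norm ?subr_ge0//; move: tt; rewrite -/t0; lra.
have [->//|t0b'] := eqVneq b t0.
have {}t0b' : t0 < b by rewrite lt_neqAle eq_sym t0b'.
have [|d d0 Hd] := Ho t0 _ Pt0; first by rewrite at0.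
pose s := Num.min b (t0 + d / 2).
have s0 : t0 < s by rewrite lt_min t0b'/=; lra.
have sb : s <= b by rewrite ge_min lexx.
have sd : s <= t0 + d / 2 by rewrite ge_min lexx orbT.
have : s <= t0.
  apply: sup_upper_bound => //; split; first by rewrite sb (le_trans at0 (ltW s0)).
  move=> s' /andP[as1 s1s].
  have [s1t|ts1] := ltP s' t0; first by apply: below; rewrite as1.
  apply: Hd; first by rewrite as1 (le_trans s1s).
  by rewrite ger0_norm ?subr_ge0//; lra.
by rewrite leNgt s0.
Qed.

Lemma seg_ind2 (P : R -> Prop) a b : P a ->
  (forall t, btw a b t -> P t ->
     exists2 d : R, 0 < d & forall s, `|s - t| < d -> P s) ->
  (forall t, btw a b t ->
     (forall d, 0 < d -> exists2 s, `|s - t| < d & P s) -> P t) ->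
  forall t, btw a b t -> P t.
Proof.
move=> Pa Ho Hc t /orP[|] /andP[at' tb].
  apply: (@seg_ind P a t) => //.
    move=> u /andP[au ut] Pu; have [|d d0 Hd] := Ho u _ Pu; last by exists d => // s _; exact: Hd.
    by rewrite /btw au (le_trans ut).
  move=> u /andP[au ut] Hu; apply: Hc => [|d /Hu[s [_ ? ?]]]; last by exists s.
  by rewrite /btw au (le_trans ut).
rewrite -(opprK t); apply: (@seg_ind (fun u => P (- u)) (- a) (- t)).
- by rewrite lerN2.
- by rewrite opprK.
- move=> u /andP[au ut] Pu; have [|d d0 Hd] := Ho (- u) _ Pu.
    by apply/orP; right; lra.
  by exists d => // s _ su; apply: Hd; rewrite -opprD normrN.
- move=> u /andP[au ut] Hu; apply: Hc; first by apply/orP; right; lra.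
  move=> d /Hu[s [_ su Ps]]; exists (- s) => //.
  by rewrite -opprD normrN.
Qed.

(** A maximum principle for transport in the direction of x. If D exceeded K,
    the function D - e (y - a) would have a maximum above K off the sides y = a
    and x = x0. There D_x = 0 and D_y >= e > 0 at an interior point, against the
    hypothesis; at the outflow side x = x1 one only knows D_x >= 0, whence the
    alternative assumed there. *)
Lemma transport_max (D Dx Dy : R -> R -> R) x0 x1 a b K :
  x0 < x1 -> a <= b ->
  (forall x y, x0 <= x <= x1 -> a <= y <= b -> cont2 D x y) ->
  (forall x y, x0 < x <= x1 -> a <= y <= b ->
     deriv (D^~ y) x (Dx x y) /\ deriv (D x) y (Dy x y)) ->
  (forall x y, x0 < x < x1 -> a <= y <= b -> Dx x y = 0 -> Dy x y <= 0) ->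
  (forall y, a <= y <= b -> D x1 y <= K \/ (0 <= Dx x1 y -> Dy x1 y <= 0)) ->
  (forall y, a <= y <= b -> D x0 y <= K) ->
  (forall x, x0 <= x <= x1 -> D x a <= K) ->
  forall x y, x0 <= x <= x1 -> a <= y <= b -> D x y <= K.
Proof.
move=> x01 ab cD dD H3 H4 H5 H6 x y xx yy; rewrite leNgt; apply/negP => DK.
(* small enough for the perturbed function to exceed K at (x, y) still *)
pose e := (D x y - K) / (2 * (1 + (b - a))).
have e0 : 0 < e by rewrite divr_gt0 ?subr_gt0//; lra.
have eb : e * (b - a) < D x y - K.
  rewrite /e mulrAC ltr_pdivrMr; last by lra.
  rewrite ltr_pM2l ?subr_gt0//; lra.
have cphi x' y' : x0 <= x' <= x1 -> a <= y' <= b ->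
    cont2 (fun x y => D x y - e * (y - a)) x' y'.
  move=> h1 h2; apply: cont2B; first exact: cD.
  apply: cont2M; first exact: cont2C.
  by apply: cont2B; [exact: cont2Y|exact: cont2C].
have [xm [ym [xxm yym Hm]]] := EVT2 (ltW x01) ab cphi.
have DM : K < D xm ym.
  have := Hm x y xx yy; move: yy yym => /andP[y1 y2] /andP[y3 y4].
  have : e * (y - a) <= e * (b - a) by rewrite ler_wpM2l ?(ltW e0)// lerD2r.
  have : 0 <= e * (ym - a) by rewrite mulr_ge0 ?(ltW e0)// subr_ge0.
  by lra.
have xm0 : x0 < xm.
  rewrite lt_neqAle; move: xxm => /andP[-> _]; rewrite andbT; apply/eqP => E.
  by move: DM; rewrite -E ltNge H5.
have ym0 : a < ym.
  rewrite lt_neqAle; move: yym => /andP[-> _]; rewrite andbT; apply/eqP => E.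
  by move: DM; rewrite -E ltNge H6.
have xm1 : xm <= x1 by case/andP: xxm.
have ym1 : ym <= b by case/andP: yym.
have [dx dy] : deriv (D^~ ym) xm (Dx xm ym) /\ deriv (D xm) ym (Dy xm ym).
  by apply: dD => //; rewrite xm0.
have dxl : 0 <= Dx xm ym.
  have x0' : 0 < xm - x0 by rewrite subr_gt0.
  apply: deriv_max_left dx x0' _ => z /andP[z1 z2].
  have := Hm z ym; rewrite yym => /(_ _ isT); rewrite lerD2r; apply.
  by apply/andP; split; lra.
have dyl : 0 <= Dy xm ym - e.
  have a0' : 0 < ym - a by rewrite subr_gt0.
  have dphi : deriv (fun y => D xm y - e * (y - a)) ym (Dy xm ym - e).
    apply: derivB dy _; apply: deriv_eq (derivZ e (derivB (derivI ym) (derivC a ym))) _.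
    by rewrite subr0 mulr1.
  apply: deriv_max_left dphi a0' _ => z /andP[z1 z2].
  by apply: Hm => //; apply/andP; split; lra.
have [xlt|xge] := ltP xm x1.
  have dxr : Dx xm ym <= 0.
    have x0' : 0 < x1 - xm by rewrite subr_gt0.
    apply: deriv_max_right dx x0' _ => z /andP[z1 z2].
    have := Hm z ym; rewrite yym => /(_ _ isT); rewrite lerD2r; apply.
    by apply/andP; split; lra.
  have : Dy xm ym <= 0.
    by apply: H3 => //; [rewrite xm0|apply/eqP; rewrite eq_le dxr].
  by lra.
have E : xm = x1 by apply/eqP; rewrite eq_le xm1.
move: DM dxl dyl; rewrite E => DM dxl dyl.
have [|/(_ dxl)] := H4 ym yym; last by lra.
by rewrite leNgt DM.
Qed.

Lemma nondecreasing_cauchy (f : R -> R) (M : R) : {homo f : x y / x <= y} ->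
  (forall x, f x <= M) ->
  forall e, 0 < e -> exists Y, forall y z, Y <= y -> Y <= z -> f z - f y < e.
Proof.
move=> nf fM e e0.
have hS : has_sup (range f) by split; [exists (f 0), 0|exists M => _ [x _ <-]].
have [_ [Y _ <-] HY] := sup_adherent e0 hS.
exists Y => y z Yy Yz.
have H1 := nf _ _ Yy.
have : f z <= sup (range f) by apply: sup_upper_bound => //; exists z.
by lra.
Qed.

(** Subtracting or adding K/k exp(-kx) makes f monotone and keeps it bounded. *)
Lemma exp_decay_limit (f f' : R -> R) (K k x0 : R) : 0 < k ->
  (forall x, x0 <= x -> deriv f x (f' x)) ->
  (forall x, x0 <= x -> `|f' x| <= K * expR (- k * x)) ->
  exists l, forall x, x0 <= x -> `|f x - l| <= K / k * expR (- k * x).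
Proof.
move=> k0 df Hf.
pose E x := K / k * expR (- k * x).
have dE x : deriv E x (- (K * expR (- k * x))).
  apply: deriv_eq (derivZ (K / k) (@deriv_comp _ expR _ _ _ _
    (derivZ (- k) (derivI x)) (is_derive_expR _))) _.
  by field; rewrite gt_eqF.
have lo x y : x0 <= x -> x <= y -> f x - E x <= f y - E y.
  move=> xx xy; apply: (@deriv_ge0_le _ (fun t => f t - E t) (fun t => f' t - - (K * expR (- k * t)))) => //.
    by move=> t /andP[xt _]; apply: derivB => //; apply: df; exact: le_trans xt.
  move=> t /andP[xt _]; have := Hf t (le_trans xx xt).
  by case/ler_normlP; lra.
have hi x y : x0 <= x -> x <= y -> f y + E y <= f x + E x.
  move=> xx xy; rewrite -lerN2.
  apply: (@deriv_ge0_le _ (fun t => - (f t + E t)) (fun t => - (f' t + - (K * expR (- k * t))))) => //.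
    by move=> t /andP[xt _]; apply: derivN; apply: derivD => //; apply: df; exact: le_trans xt.
  move=> t /andP[xt _]; have := Hf t (le_trans xx xt).
  by case/ler_normlP; lra.
have K0 : 0 <= K.
  by have := le_trans (normr_ge0 _) (Hf x0 (lexx _)); rewrite pmulr_lge0// expR_gt0.
have E0 x : 0 <= E x by rewrite mulr_ge0 ?expR_ge0// divr_ge0// ltW.
have lohi x y : x0 <= x -> x0 <= y -> f x - E x <= f y + E y.
  move=> xx yy; case: (leP x y) => [xy|/ltW yx].
    by apply: le_trans (lo x y xx xy) _; have := E0 y; lra.
  by apply: le_trans (hi y x yy yx); have := E0 x; lra.
pose S := [set f x - E x | x in [set x | x0 <= x]].
have hS : has_sup S.
  split; first by exists (f x0 - E x0), x0 => //=.
  by exists (f x0 + E x0) => _ [x /= xx <-]; exact: lohi.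
exists (sup S) => x xx; rewrite -/(E x); apply/ler_normlP; split.
  rewrite opprB lerBlDr addrC; apply: ge_sup; first by case: hS.
  by move=> _ [y /= yy <-]; exact: lohi.
rewrite lerBlDr addrC -lerBlDr; apply: sup_upper_bound => //.
by exists x.
Qed.
End tools.

(** * Cauchy-Riemann pairs and circle integrals *)

Section holomorphic.
Context {R : realType}.
Implicit Types (a b g h : R -> R -> R) (x z r : R) (O : R -> R -> Prop).

Fact pdx_key : unit. Proof. by []. Qed.
Definition pdx : (R -> R -> R) -> R -> R -> R :=
  locked_with pdx_key (fun f x z => derive1 (fun s => f s z) x).

Lemma pdxE f x z d : deriv (f^~ z) x d -> pdx f x z = d.
Proof. by move=> [_ <-]; rewrite /pdx unlock derive1E. Qed.

Definition open2 O := forall x z, O x z ->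
  exists2 r : R, 0 < r & forall x' z', `|x' - x| < r -> `|z' - z| < r -> O x' z'.

(** The Cauchy-Riemann equations for a - i b as a function of x + i z,
    together with continuity of the derivative. *)
Definition cr O a b := forall x z, O x z ->
  [/\ deriv (a^~ z) x (pdx a x z), deriv (a x) z (pdx b x z),
      deriv (b^~ z) x (pdx b x z), deriv (b x) z (- pdx a x z)
    & cont2 (pdx a) x z /\ cont2 (pdx b) x z].

Lemma cr_intro O a b a1 b1 : open2 O ->
  (forall x z, O x z ->
    [/\ deriv (a^~ z) x (a1 x z), deriv (a x) z (b1 x z),
        deriv (b^~ z) x (b1 x z), deriv (b x) z (- a1 x z)
      & cont2 a1 x z /\ cont2 b1 x z]) ->
  cr O a b /\ (forall x z, O x z -> pdx a x z = a1 x z /\ pdx b x z = b1 x z).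
Proof.
move=> oO H.
have E x z : O x z -> pdx a x z = a1 x z /\ pdx b x z = b1 x z.
  by move=> /H[h1 _ h3 _ _]; split; exact: pdxE.
split => // x z Oxz; have [E1 E2] := E x z Oxz.
have [h1 h2 h3 h4 [h5 h6]] := H x z Oxz; rewrite E1 E2; split => //.
have [r r0 Hr] := oO x z Oxz.
split; [apply: (cont2_near r0) h5|apply: (cont2_near r0) h6].
  by move=> x' z' xx zz; rewrite (E _ _ (Hr _ _ xx zz)).1.
by move=> x' z' xx zz; rewrite (E _ _ (Hr _ _ xx zz)).2.
Qed.

Lemma cr_sub O O' a b : (forall x z, O' x z -> O x z) -> cr O a b -> cr O' a b.
Proof. by move=> OO H x z /OO/H. Qed.

Lemma cr_near O a b a' b' : open2 O -> (forall x z, O x z -> a x z = a' x z /\ b x z = b' x z) ->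
  cr O a b -> cr O a' b'.
Proof.
move=> oO E H; suff [] : cr O a' b' /\ forall x z, O x z -> pdx a' x z = pdx a x z /\ pdx b' x z = pdx b x z by [].
apply: cr_intro => // x z Oxz; have [h1 h2 h3 h4 h5] := H x z Oxz.
have [r r0 Hr] := oO x z Oxz; have z0 : `|z - z| < r by rewrite subrr normr0.
have x0 : `|x - x| < r by rewrite subrr normr0.
split => //.
- by apply: (deriv_near r0) h1 => y yx; exact: (E _ _ (Hr _ _ yx z0)).1.
- by apply: (deriv_near r0) h2 => y yx; exact: (E _ _ (Hr _ _ x0 yx)).1.
- by apply: (deriv_near r0) h3 => y yx; exact: (E _ _ (Hr _ _ yx z0)).2.
- by apply: (deriv_near r0) h4 => y yx; exact: (E _ _ (Hr _ _ x0 yx)).2.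
Qed.

(** Multiplication by i. *)
Lemma cr_rot O a b : open2 O -> cr O a b -> cr O b (fun x z => - a x z).
Proof.
move=> oO H; suff [] : cr O b (fun x z => - a x z) /\
  forall x z, O x z -> pdx b x z = pdx b x z /\ pdx (fun x z => - a x z) x z = - pdx a x z by [].
apply: cr_intro => // x z /H [h1 h2 h3 h4 [h5 h6]].
by split => //; [exact: derivN|exact: derivN|split => //; exact: cont2N].
Qed.

Lemma cr_comb O a b a' b' (k : R) : open2 O -> cr O a b -> cr O a' b' ->
  cr O (fun x z => a x z - k * a' x z) (fun x z => b x z - k * b' x z) /\
  (forall x z, O x z -> pdx (fun x z => a x z - k * a' x z) x z = pdx a x z - k * pdx a' x z /\
     pdx (fun x z => b x z - k * b' x z) x z = pdx b x z - k * pdx b' x z).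
Proof.
move=> oO H H'; apply: cr_intro => // x z Oxz.
have [h1 h2 h3 h4 [h5 h6]] := H x z Oxz.
have [i1 i2 i3 i4 [i5 i6]] := H' x z Oxz.
have C c y : cont2 c x z -> cont2 (fun x z => y * c x z) x z.
  by move=> cc; apply: cont2M => //; exact: cont2C.
split.
- by apply: derivB => //; exact: derivZ.
- by apply: derivB => //; exact: derivZ.
- by apply: derivB => //; exact: derivZ.
- by apply: deriv_eq (derivB h4 (derivZ k i4)) _; ring.
- by split; apply: cont2B => //; exact: C.
Qed.

Lemma cr_cont2 O a b x z : open2 O -> cr O a b -> O x z -> cont2 a x z /\ cont2 b x z.
Proof.
move=> oO H Oxz; have [r r0 Hr] := oO x z Oxz.
have [_ _ _ _ [ca cb]] := H x z Oxz.
have key (f fz : R -> R -> R) : (forall x z, O x z -> deriv (f^~ z) x (pdx f x z) /\ deriv (f x) z (fz x z)) ->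
    cont2 (pdx f) x z -> cont2 fz x z -> cont2 f x z.
  move=> df cx cz; have [||d d0 Hd] := @diff2 R f (pdx f) fz x z r r0 _ cx cz 1.
  - by move=> x' z' xx zz; apply: df; exact: Hr.
  - exact: ltr01.
  pose M := 1 + `|pdx f x z| + `|fz x z|.
  have M0 : 0 < M by rewrite /M -addrA ltr_pwDl// addr_ge0.
  apply/cont2P => e e0; exists (Num.min d (e / (4 * M))).
    by rewrite lt_min d0 divr_gt0// mulr_gt0.
  move=> x' z'; rewrite !lt_min => /andP[x1 x2] /andP[z1 z2].
  have := Hd x' z' x1 z1; rewrite mul1r => H1.
  rewrite ltr_pdivlMr ?mulr_gt0// in x2; rewrite ltr_pdivlMr ?mulr_gt0// in z2.
  have : `|f x' z' - f x z| <= M * (`|x' - x| + `|z' - z|).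
    rewrite (_ : f x' z' - f x z = (f x' z' - f x z - pdx f x z * (x' - x) - fz x z * (z' - z))
       + pdx f x z * (x' - x) + fz x z * (z' - z)); last by ring.
    apply: le_trans (ler_normD _ _) _; apply: le_trans (lerD (ler_normD _ _) (lexx _)) _.
    rewrite !normrM.
    have := normr_ge0 (x' - x); have := normr_ge0 (z' - z).
    have := normr_ge0 (pdx f x z); have := normr_ge0 (fz x z).
    move: H1; rewrite /M; nra.
  by move/le_lt_trans; apply; move: x2 z2; nra.
split.
  by apply: (key a (pdx b)) => // x' z' /H[].
apply: (key b (fun x z => - pdx a x z)) => //; last exact: cont2N.
by move=> x' z' /H[].
Qed.

Let T : R := pi *+ 2.

Lemma cosT : cos T = 1. Proof. exact: cos2pi. Qed.
Lemma sinT : sin T = 0. Proof. exact: sin2pi. Qed.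

Definition sq O x z r := forall x' z', `|x' - x| < r -> `|z' - z| < r -> O x' z'.

Lemma sqW O x z r r' : r' <= r -> sq O x z r -> sq O x z r'.
Proof. by move=> rr H x' z' xx zz; apply: H; exact: lt_le_trans rr. Qed.

Lemma circ_in x z r R0 t : `|r| < R0 ->
  `|x + r * cos t - x| < R0 /\ `|z + r * sin t - z| < R0.
Proof.
move=> rR; rewrite !(addrC _ (r * _)) !addrK !normrM; split.
  by apply: le_lt_trans rR; rewrite ler_piMr// cos_max.
by apply: le_lt_trans rR; rewrite ler_piMr// sin_max.
Qed.

Lemma dcosf x r t : deriv (fun t => x + r * cos t) t (- (r * sin t)).
Proof.
apply: deriv_eq (derivD (derivC x t) (derivZ r (is_derive_cos t))) _.
by rewrite add0r mulrN.
Qed.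
Lemma dsinf x r t : deriv (fun t => x + r * sin t) t (r * cos t).
Proof.
apply: deriv_eq (derivD (derivC x t) (derivZ r (is_derive_sin t))) _.
by rewrite add0r.
Qed.

Lemma circ_cont g (k : R -> R) x z r t : cont2 g (x + r * cos t) (z + r * sin t) ->
  continuous k ->
  {for t, continuous (fun t => g (x + r * cos t) (z + r * sin t) * k t)}.
Proof.
move=> cg ck; apply: continuousM; last exact: ck.
apply: (@cont2_comp1 _ g (fun t => x + r * cos t) (fun t => z + r * sin t)) => //.
- exact: deriv_cont (dcosf _ _ _).
- exact: deriv_cont (dsinf _ _ _).
Qed.

Section circle.
Variables (O : R -> R -> Prop) (a b : R -> R -> R).
Hypotheses (oO : open2 O) (crab : cr O a b).

Lemma circ_deriv x z r t : O (x + r * cos t) (z + r * sin t) ->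
  deriv (fun t => a (x + r * cos t) (z + r * sin t)) t
    (r * (pdx b (x + r * cos t) (z + r * sin t) * cos t
          - pdx a (x + r * cos t) (z + r * sin t) * sin t)) /\
  deriv (fun t => b (x + r * cos t) (z + r * sin t)) t
    (- r * (pdx b (x + r * cos t) (z + r * sin t) * sin t
          + pdx a (x + r * cos t) (z + r * sin t) * cos t)).
Proof.
move=> Op; have [d d0 Hd] := oO Op.
have [h1 h2 h3 h4 [h5 h6]] := crab Op.
split.
  apply: deriv_eq (@chain2 _ a (pdx a) (pdx b) _ _ t _ _ d d0 _ h5 h6 (dcosf x r t) (dsinf z r t)) _.
    by move=> x' z' xx zz; have [] := crab (Hd _ _ xx zz).
  by ring.
apply: deriv_eq (@chain2 _ b (pdx b) (fun x z => - pdx a x z) _ _ t _ _ d d0 _ h6 (cont2N h5) (dcosf x r t) (dsinf z r t)) _.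
  by move=> x' z' xx zz; have [] := crab (Hd _ _ xx zz).
by ring.
Qed.

(** Circle integrals of g against a trigonometric weight. The mean value
    formulas below express values and derivatives of a Cauchy-Riemann pair by
    such integrals, which is how higher regularity is obtained. *)
Definition J (k : R -> R) g r x z : R :=
  prim (fun t => g (x + r * cos t) (z + r * sin t) * k t) 0 T.

Section J.
Variables (k : R -> R) (g : R -> R -> R).
Hypothesis ck : continuous k.
Hypothesis cg : forall x z, O x z -> cont2 g x z.

Lemma J_prim x z r R0 t : `|r| < R0 -> sq O x z R0 ->
  deriv (prim (fun t => g (x + r * cos t) (z + r * sin t) * k t) 0) t
    (g (x + r * cos t) (z + r * sin t) * k t).
Proof.
move=> rR HR; apply: (@primT_deriv _ (fun t => g (x + r * cos t) (z + r * sin t) * k t)) => s; apply: circ_cont => //.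
by apply: cg; have [? ?] := circ_in x z s rR; exact: HR.
Qed.

Lemma J_dr (gx gz : R -> R -> R) x z r R0 : `|r| < R0 -> sq O x z R0 ->
  (forall x z, O x z -> deriv (g^~ z) x (gx x z) /\ deriv (g x) z (gz x z)) ->
  (forall x z, O x z -> cont2 gx x z) -> (forall x z, O x z -> cont2 gz x z) ->
  deriv (fun r => J k g r x z) r
    (prim (fun t => (gx (x + r * cos t) (z + r * sin t) * cos t +
                     gz (x + r * cos t) (z + r * sin t) * sin t) * k t) 0 T).
Proof.
move=> rR HR dg cx cz.
pose Fx r t := (gx (x + r * cos t) (z + r * sin t) * cos t +
                     gz (x + r * cos t) (z + r * sin t) * sin t) * k t.
have d0 : 0 < R0 - `|r| by rewrite subr_gt0.
have rr s : `|s - r| < R0 - `|r| -> `|s| < R0.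
  by move=> sr; rewrite -(subrK r s); apply: le_lt_trans (ler_normD _ _) _; rewrite -ltrBrDr.
have Oc s t : `|s| < R0 -> O (x + s * cos t) (z + s * sin t).
  by move=> sR; have [? ?] := circ_in x z t sR; exact: HR.
have c2 (f : R -> R -> R) s t : `|s| < R0 -> (forall x z, O x z -> cont2 f x z) ->
    cont2 (fun s t => f (x + s * cos t) (z + s * sin t)) s t.
  move=> sR cf; apply: (@cont2_gen _ f (fun s t => x + s * cos t) (fun s t => z + s * sin t)); last by apply: cf; exact: Oc.
  - apply: cont2D; first exact: cont2C.
    apply: cont2M; first exact: cont2X.
    by apply: (@cont2_comp _ (fun _ c => c) id cos); [exact: cvg_id|exact: continuous_cos|exact: cont2Y].
  - apply: cont2D; first exact: cont2C.
    apply: cont2M; first exact: cont2X.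
    by apply: (@cont2_comp _ (fun _ c => c) id sin); [exact: cvg_id|exact: continuous_sin|exact: cont2Y].
have c1 (f : R -> R) s t : continuous f -> cont2 (fun _ t => f t) s t.
  by move=> cf; apply: (@cont2_comp _ (fun _ c => c) id f); [exact: cvg_id|exact: cf|exact: cont2Y].
have cFx s t : `|s| < R0 -> cont2 Fx s t.
  move=> sR; apply: cont2M; last exact: c1.
  by apply: cont2D; apply: cont2M; (try exact: c2); apply: c1; [exact: continuous_cos|exact: continuous_sin].
apply: (@param_deriv _ (fun r t => g (x + r * cos t) (z + r * sin t) * k t) Fx
  (fun r => prim (fun t => g (x + r * cos t) (z + r * sin t) * k t) 0) (prim (Fx r) 0) 0 T r _ d0).
- move=> s t /rr sR _.
  have Op := Oc s t sR; have [d d00 Hd] := oO Op.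
  have dp (y c : R) : deriv (fun s => y + s * c) s c.
    by apply: deriv_eq (derivD (derivC y s) (derivM (derivI s) (derivC c s))) _; ring.
  have H := @chain2 _ g gx gz (fun s => x + s * cos t) (fun s => z + s * sin t) s _ _ d d00 _ (cx _ _ Op) (cz _ _ Op) (dp x (cos t)) (dp z (sin t)).
  apply: deriv_eq (derivM (H _) (derivC (k t) s)) _.
    by move=> x' z' xx zz; apply: dg; exact: Hd.
  by rewrite /Fx; ring.
- by move=> t _; exact: cFx.
- by move=> s t /rr sR _; exact: J_prim sR HR.
- move=> t _; apply: primT_deriv => s.
  by apply: (@cont2_comp1 _ Fx (fun=> r) id) => //; [exact: cst_continuous|exact: cFx].
- by move=> s _; rewrite primxx.
- by rewrite primxx.
Qed.

Lemma J_dx (gx : R -> R -> R) x z r R0 : `|r| < R0 -> sq O x z R0 ->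
  (forall x z, O x z -> deriv (g^~ z) x (gx x z)) ->
  (forall x z, O x z -> cont2 gx x z) ->
  deriv (fun x => J k g r x z) x (J k gx r x z).
Proof.
move=> rR HR dg cx.
pose Fx x t := gx (x + r * cos t) (z + r * sin t) * k t.
have d0 : 0 < R0 - `|r| by rewrite subr_gt0.
have Oc s t : `|s - x| < R0 - `|r| -> O (s + r * cos t) (z + r * sin t).
  move=> sR; apply: HR; last by have [] := circ_in x z t rR.
  rewrite (_ : _ - x = (s - x) + r * cos t); last by ring.
  apply: le_lt_trans (ler_normD _ _) _; rewrite -ltrBrDr; apply: lt_le_trans sR _.
  by rewrite lerD2l lerN2 normrM ler_piMr// cos_max.
have c1 (f : R -> R) s t : continuous f -> cont2 (fun _ t => f t) s t.
  by move=> cf; apply: (@cont2_comp _ (fun _ c => c) id f); [exact: cvg_id|exact: cf|exact: cont2Y].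
have cFx s t : `|s - x| < R0 - `|r| -> cont2 Fx s t.
  move=> sR; apply: cont2M; last exact: c1.
  apply: (@cont2_gen _ gx (fun s t => s + r * cos t) (fun s t => z + r * sin t)); last by apply: cx; exact: Oc.
  - apply: cont2D; first exact: cont2X.
    by apply: cont2M; [exact: cont2C|apply: c1; exact: continuous_cos].
  - apply: cont2D; first exact: cont2C.
    by apply: cont2M; [exact: cont2C|apply: c1; exact: continuous_sin].
apply: (@param_deriv _ (fun x t => g (x + r * cos t) (z + r * sin t) * k t) Fx
  (fun x => prim (fun t => g (x + r * cos t) (z + r * sin t) * k t) 0) (prim (Fx x) 0) 0 T x _ d0).
- move=> s t sR _; have Op := Oc s t sR.
  have ds : deriv (fun s => s + r * cos t) s 1.
    by apply: deriv_eq (derivD (derivI s) (derivC (r * cos t) s)) _; ring.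
  by apply: deriv_eq (derivM (deriv_comp ds (dg _ _ Op)) (derivC (k t) s)) _; rewrite /Fx; ring.
- by move=> t _; apply: cFx; rewrite subrr normr0.
- move=> s t sR _; apply: (@primT_deriv _ (fun t => g (s + r * cos t) (z + r * sin t) * k t)).
  by move=> u; apply: circ_cont => //; apply: cg; exact: Oc.
- move=> t _; apply: primT_deriv => s.
  by apply: (@cont2_comp1 _ Fx (fun=> x) id) => //; [exact: cst_continuous|apply: cFx; rewrite subrr normr0].
- by move=> s _; rewrite primxx.
- by rewrite primxx.
Qed.

Lemma J_dz (gz : R -> R -> R) x z r R0 : `|r| < R0 -> sq O x z R0 ->
  (forall x z, O x z -> deriv (g x) z (gz x z)) ->
  (forall x z, O x z -> cont2 gz x z) ->
  deriv (fun z => J k g r x z) z (J k gz r x z).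
Proof.
move=> rR HR dg cx.
pose Fx z t := gz (x + r * cos t) (z + r * sin t) * k t.
have d0 : 0 < R0 - `|r| by rewrite subr_gt0.
have Oc s t : `|s - z| < R0 - `|r| -> O (x + r * cos t) (s + r * sin t).
  move=> sR; apply: HR; first by have [] := circ_in x z t rR.
  rewrite (_ : _ - z = (s - z) + r * sin t); last by ring.
  apply: le_lt_trans (ler_normD _ _) _; rewrite -ltrBrDr; apply: lt_le_trans sR _.
  by rewrite lerD2l lerN2 normrM ler_piMr// sin_max.
have c1 (f : R -> R) s t : continuous f -> cont2 (fun _ t => f t) s t.
  by move=> cf; apply: (@cont2_comp _ (fun _ c => c) id f); [exact: cvg_id|exact: cf|exact: cont2Y].
have cFx s t : `|s - z| < R0 - `|r| -> cont2 Fx s t.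
  move=> sR; apply: cont2M; last exact: c1.
  apply: (@cont2_gen _ gz (fun s t => x + r * cos t) (fun s t => s + r * sin t)); last by apply: cx; exact: Oc.
  - apply: cont2D; first exact: cont2C.
    by apply: cont2M; [exact: cont2C|apply: c1; exact: continuous_cos].
  - apply: cont2D; first exact: cont2X.
    by apply: cont2M; [exact: cont2C|apply: c1; exact: continuous_sin].
apply: (@param_deriv _ (fun z t => g (x + r * cos t) (z + r * sin t) * k t) Fx
  (fun z => prim (fun t => g (x + r * cos t) (z + r * sin t) * k t) 0) (prim (Fx z) 0) 0 T z _ d0).
- move=> s t sR _; have Op := Oc s t sR.
  have ds : deriv (fun s => s + r * sin t) s 1.
    by apply: deriv_eq (derivD (derivI s) (derivC (r * sin t) s)) _; ring.
  by apply: deriv_eq (derivM (deriv_comp ds (dg _ _ Op)) (derivC (k t) s)) _; rewrite /Fx; ring.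
- by move=> t _; apply: cFx; rewrite subrr normr0.
- move=> s t sR _; apply: (@primT_deriv _ (fun t => g (x + r * cos t) (s + r * sin t) * k t)).
  by move=> u; apply: circ_cont => //; apply: cg; exact: Oc.
- move=> t _; apply: primT_deriv => s.
  by apply: (@cont2_comp1 _ Fx (fun=> z) id) => //; [exact: cst_continuous|apply: cFx; rewrite subrr normr0].
- by move=> s _; rewrite primxx.
- by rewrite primxx.
Qed.

Lemma tube3 (f : R * R -> R -> R) p0 c d e :
  (forall t, btw c d t -> {for (p0, t), continuous (fun q : (R * R) * R => f q.1 q.2)}) ->
  0 < e -> \forall p \near nbhs p0, forall t, btw c d t -> `|f p t - f p0 t| < e.
Proof.
move=> cf e0.
pose K := `[Num.min c d, Num.max c d]%classic : set R.
have KE t : btw c d t -> K t.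
  by rewrite /K /= in_itv/= ge_min le_max => /orP[] /andP[-> ->]; rewrite ?orbT.
have EK t : K t -> btw c d t.
  rewrite /K /= in_itv/= ge_min le_max /btw.
  by case: (leP c d) (leP c t) (leP t d) (leP d t) (leP t c) => + [] + [] + [] + [] //=; lra.
have := (compact_near_coveringP K).1 (@segment_compact _ _ _) (R * R)%type (nbhs p0)
  (fun p t => `|f p t - f p0 t| < e) _.
case.
  move=> t /EK /cf /cvgrPdist_lt /(_ (e / 2)) [|[A B] [/= A0 B0] H]; first by lra.
  exists (B, A); first by split.
  move=> [t' p] [/= Bt Ap].
  have H1 := H (p, t') (conj Ap Bt).
  have H2 := H (p0, t') (conj (nbhs_singleton A0) Bt).
  rewrite /= in H1 H2.
  rewrite (_ : f p t' - f p0 t' = (f p0 t - f p0 t') - (f p0 t - f p t')); last by ring.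
  by rewrite (le_lt_trans (ler_normB _ _))//; lra.
move=> d' /= d0 Hd; exists d' => // p pp t /KE; exact: Hd.
Qed.

Lemma J_cont x z r R0 : `|r| < R0 -> sq O x z R0 -> cont2 (J k g r) x z.
Proof.
move=> rR HR.
have d0 : 0 < R0 - `|r| by rewrite subr_gt0.
have Oc s s' t : `|s - x| < R0 - `|r| -> `|s' - z| < R0 - `|r| -> O (s + r * cos t) (s' + r * sin t).
  move=> sR sR'; apply: HR.
    rewrite (_ : _ - x = (s - x) + r * cos t); last by ring.
    apply: le_lt_trans (ler_normD _ _) _; rewrite -ltrBrDr; apply: lt_le_trans sR _.
    by rewrite lerD2l lerN2 normrM ler_piMr// cos_max.
  rewrite (_ : _ - z = (s' - z) + r * sin t); last by ring.
  apply: le_lt_trans (ler_normD _ _) _; rewrite -ltrBrDr; apply: lt_le_trans sR' _.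
  by rewrite lerD2l lerN2 normrM ler_piMr// sin_max.
have c3 (f : R -> R) (p : R * R) t : continuous f -> {for (p, t), continuous (fun q : (R * R) * R => f q.2)}.
  by move=> cf; apply: (@continuous_comp _ _ _ snd f); [exact: cvg_snd|exact: cf].
pose F (p : R * R) t := g (p.1 + r * cos t) (p.2 + r * sin t) * k t.
have cF t : {for ((x, z), t), continuous (fun q : (R * R) * R => F q.1 q.2)}.
  apply: continuousM; last exact: c3.
  pose P (q : (R * R) * R) := (q.1.1 + r * cos q.2, q.1.2 + r * sin q.2).
  have cP : {for ((x, z), t), continuous P}.
    have C1 : {for ((x, z), t), continuous (fun q : (R * R) * R => q.1.1 + r * cos q.2)}.
      apply: (@continuousD _ _ _ (fun q : (R * R) * R => q.1.1) (fun q => r * cos q.2)).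
        by apply: (@continuous_comp _ _ _ fst fst); exact: cvg_fst.
      by apply: continuousM; [exact: cst_continuous|apply: c3; exact: continuous_cos].
    have C2 : {for ((x, z), t), continuous (fun q : (R * R) * R => q.1.2 + r * sin q.2)}.
      apply: (@continuousD _ _ _ (fun q : (R * R) * R => q.1.2) (fun q => r * sin q.2)).
        by apply: (@continuous_comp _ _ _ fst snd); [exact: cvg_fst|exact: cvg_snd].
      by apply: continuousM; [exact: cst_continuous|apply: c3; exact: continuous_sin].
    exact: cvg_pair C1 C2.
  apply: (@continuous_comp _ _ _ P (fun p : R * R => g p.1 p.2)) => //.
  by apply: cg; apply: Oc; rewrite subrr normr0.
apply/cvgrPdist_le => e e0.
have e1 : 0 < e / (1 + `|T|) by rewrite divr_gt0// ltr_pwDl.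
have [d /= d00 Hd] := (nbhs_ballP _ _).1 (@tube3 F (x, z) 0 T _ (fun t _ => cF t) e1).
pose d1 := Num.min d (R0 - `|r|).
have d10 : 0 < d1 by rewrite lt_min d00.
apply: filterS (nbhsx_ballx (x, z) d1 d10) => -[x' z'] [/=]; rewrite /ball/= => xx zz.
have dg p t : `|p.1 - x| < R0 - `|r| -> `|p.2 - z| < R0 - `|r| -> deriv (prim (F p) 0) t (F p t).
  move=> px pz; apply: (@primT_deriv _ (F p)) => u; rewrite /F; apply: circ_cont => //; apply: cg; exact: Oc.
have := @deriv_lip _ (fun t => prim (F (x', z')) 0 t - prim (F (x, z)) 0 t) (fun t => F (x', z') t - F (x, z) t) (e / (1 + `|T|)) 0 T.
rewrite !primxx subrr !subr0 => H; rewrite distrC; apply: le_trans (H _ _) _.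
- move=> t _; apply: derivB; apply: dg => /=; rewrite ?subrr ?normr0//.
    by rewrite distrC; apply: lt_le_trans xx _; rewrite ge_min lexx orbT.
  by rewrite distrC; apply: lt_le_trans zz _; rewrite ge_min lexx orbT.
- move=> t tT; apply: ltW; apply: (Hd (x', z')) => //; split => /=.
    by apply: lt_le_trans xx _; rewrite ge_min lexx.
  by apply: lt_le_trans zz _; rewrite ge_min lexx.
by rewrite mulrAC ler_pdivrMr ?ltr_pwDl// ler_pM2l// lerDr.
Qed.
End J.
End circle.
End holomorphic.

(** * Regularity and Cauchy estimates *)

Section cauchy.
Context {R : realType}.
Implicit Types (a b g h : R -> R -> R) (x z r : R) (O : R -> R -> Prop).
Let T : R := pi *+ 2.

Lemma contD (f g : R -> R) x : {for x, continuous f} -> {for x, continuous g} ->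
  {for x, continuous (fun t => f t + g t)}.
Proof. by move=> cf cg; exact: (@continuousD _ _ _ f g). Qed.
Lemma contM (f g : R -> R) x : {for x, continuous f} -> {for x, continuous g} ->
  {for x, continuous (fun t => f t * g t)}.
Proof. by move=> cf cg; exact: (@continuousM _ _ f g). Qed.

Lemma cont_one : continuous (fun _ : R => 1 : R). Proof. exact: cst_continuous. Qed.

Lemma T_gt0 : 0 < T. Proof. by rewrite /T mulr2n addr_gt0// pi_gt0. Qed.

Section one_pair.
Variables (O : R -> R -> Prop) (a b : R -> R -> R).
Hypotheses (oO : open2 O) (crab : cr O a b).

Let ca x z : O x z -> cont2 a x z. Proof. by move=> /(cr_cont2 oO crab)[]. Qed.
Let cb x z : O x z -> cont2 b x z. Proof. by move=> /(cr_cont2 oO crab)[]. Qed.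
Let cpa x z : O x z -> cont2 (pdx a) x z. Proof. by move=> /crab[_ _ _ _ []]. Qed.
Let cpb x z : O x z -> cont2 (pdx b) x z. Proof. by move=> /crab[_ _ _ _ []]. Qed.

Section at_point.
Variables (x z R0 : R).
Hypothesis HR : sq O x z R0.

Let Oc r t : `|r| < R0 -> O (x + r * cos t) (z + r * sin t).
Proof. by move=> rR; have [? ?] := circ_in x z t rR; exact: HR. Qed.

Let dprim2 (g h : R -> R -> R) (k l : R -> R) r t : `|r| < R0 -> continuous k -> continuous l ->
  (forall x z, O x z -> cont2 g x z) -> (forall x z, O x z -> cont2 h x z) ->
  deriv (prim (fun t => g (x + r * cos t) (z + r * sin t) * k t
                      + h (x + r * cos t) (z + r * sin t) * l t) 0) t
   (g (x + r * cos t) (z + r * sin t) * k t + h (x + r * cos t) (z + r * sin t) * l t).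
Proof.
move=> rR ck cl cg ch.
apply: (@primT_deriv _ (fun t => g (x + r * cos t) (z + r * sin t) * k t
                      + h (x + r * cos t) (z + r * sin t) * l t)) => s.
by apply: contD; apply: circ_cont => //; [apply: cg|apply: ch]; exact: Oc.
Qed.

(** By the Cauchy-Riemann equations the radial derivative of a is the
    tangential derivative of b up to the factor r, and the latter integrates to
    zero over the circle. *)
Lemma mean_value_der r : `|r| < R0 -> deriv (fun r => J (fun=> 1) a r x z) r 0.
Proof.
move=> rR.
have dab s t : O s t -> deriv (a^~ t) s (pdx a s t) /\ deriv (a s) t (pdx b s t) by move=> /crab[].
apply: deriv_eq (J_dr oO cont_one ca rR HR dab cpa cpb) _.
set q := fun t => _.
have dq t : deriv (prim q 0) t (q t).
  have -> : q = (fun t => pdx a (x + r * cos t) (z + r * sin t) * cos t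
                      + pdx b (x + r * cos t) (z + r * sin t) * sin t).
    by apply/funext => s; rewrite /q mulr1.
  by apply: dprim2 => //; [exact: continuous_cos|exact: continuous_sin].
have [r0|r0] := eqVneq r 0.
  have H := @deriv0_const _ (fun t => prim q 0 t - (pdx a x z * sin t - pdx b x z * cos t)) 0 T.
  have : prim q 0 T - (pdx a x z * sin T - pdx b x z * cos T) =
         prim q 0 0 - (pdx a x z * sin 0 - pdx b x z * cos 0).
    apply: H => t _; apply: deriv_eq (derivB (dq t) (derivB (derivZ (pdx a x z) (is_derive_sin t)) (derivZ (pdx b x z) (is_derive_cos t)))) _.
    by rewrite /q r0 !mul0r !addr0; ring.
  by rewrite primxx cosT sinT sin0 cos0; lra.
have : r * prim q 0 T + b (x + r * cos T) (z + r * sin T) =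
       r * prim q 0 0 + b (x + r * cos 0) (z + r * sin 0).
  apply: (@deriv0_const _ (fun t => r * prim q 0 t + b (x + r * cos t) (z + r * sin t)) 0 T) => t _.
  have [_ db] := circ_deriv oO crab (Oc t rR).
  by apply: deriv_eq (derivD (derivZ r (dq t)) db) _; rewrite /q; ring.
rewrite primxx cosT sinT sin0 cos0 mulr0 => /addIr/eqP.
by rewrite mulf_eq0 (negbTE r0) => /eqP.
Qed.

Lemma mean_value r : 0 <= r < R0 -> J (fun=> 1) a r x z = T * a x z.
Proof.
move=> /andP[r0 rR].
rewrite (@deriv0_const _ (fun r => J (fun=> 1) a r x z) 0 r).
  have R00 : `|(0 : R)| < R0 by rewrite normr0 (le_lt_trans r0).
  have : J (fun=> 1) a 0 x z - T * a x z = prim (fun t : R => a (x + 0 * cos t) (z + 0 * sin t) * 1) 0 0 - 0 * a x z.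
    apply: (@deriv0_const _ (fun t => prim (fun t => a (x + 0 * cos t) (z + 0 * sin t) * 1) 0 t - t * a x z) 0 T) => t _.
    apply: deriv_eq (derivB (J_prim cont_one ca t R00 HR) (derivM (derivI t) (derivC (a x z) t))) _.
    by rewrite !mul0r !addr0; ring.
  by rewrite primxx; lra.
move=> s /orP[|] /andP[s1 s2]; apply: mean_value_der.
  by rewrite ger0_norm// (le_lt_trans s2).
have -> : s = 0 by lra.
  by rewrite normr0; lra.
Qed.
End at_point.

(** The mean value formula on discs, differentiated in x, with the
    divergence theorem on the disc replaced by an integration by parts along
    the circle. *)
Lemma formula_A x z r R0 : 0 < r < R0 -> sq O x z R0 ->
  T * r * pdx a x z = J cos a r x z - J sin b r x z.
Proof.
move=> /andP[r0 rR] HR.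
have rR' : `|r| < R0 by rewrite gtr0_norm.
have E1 : T * pdx a x z = J (fun=> 1) (pdx a) r x z.
  have da s t : O s t -> deriv (a^~ t) s (pdx a s t) by move=> /crab[].
  have d1 := J_dx cont_one ca rR' HR da cpa.
  apply: deriv_uniq d1.
  have d0 : 0 < R0 - r by rewrite subr_gt0.
  apply: (@deriv_near _ (fun x => T * a x z) _ _ _ (R0 - r) d0).
    move=> y yx; rewrite (@mean_value y z (R0 - `|y - x|))//.
      move=> x' z' xx zz; apply: HR; last by apply: lt_le_trans zz _; rewrite gerBl.
      rewrite (_ : x' - x = (x' - y) + (y - x)); last by ring.
      by apply: le_lt_trans (ler_normD _ _) _; rewrite -ltrBrDr.
    by rewrite (ltW r0)/=; lra.
  apply: derivZ; apply: da; apply: HR; rewrite subrr normr0; exact: lt_trans rR.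
have dp k g t : continuous k -> (forall x z, O x z -> cont2 g x z) ->
    deriv (prim (fun t => g (x + r * cos t) (z + r * sin t) * k t) 0) t
    (g (x + r * cos t) (z + r * sin t) * k t).
  by move=> ck cg; exact: J_prim rR' HR.
pose phi t := r * prim (fun t => pdx a (x + r * cos t) (z + r * sin t) * 1) 0 t
  - prim (fun t => a (x + r * cos t) (z + r * sin t) * cos t) 0 t
  + prim (fun t => b (x + r * cos t) (z + r * sin t) * sin t) 0 t
  + a (x + r * cos t) (z + r * sin t) * sin t + b (x + r * cos t) (z + r * sin t) * cos t.
have : phi T = phi 0.
  apply: deriv0_const => t _.
  have Op : O (x + r * cos t) (z + r * sin t) by have [? ?] := circ_in x z t rR'; exact: HR.
  have [da db] := circ_deriv oO crab Op.
  have D1 := derivZ r (dp _ _ t cont_one cpa).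
  have D2 := dp _ _ t (@continuous_cos R) ca.
  have D3 := dp _ _ t (@continuous_sin R) cb.
  have D4 := derivM da (is_derive_sin t).
  have D5 := derivM db (is_derive_cos t).
  apply: deriv_eq (derivD (derivD (derivD (derivB D1 D2) D3) D4) D5) _.
  have := cos2Dsin2 t; set c := cos t; set s := sin t => E.
  transitivity (r * pdx a (x + r * c) (z + r * s) * (1 - (c ^+ 2 + s ^+ 2))); first by ring.
  by rewrite E subrr mulr0.
rewrite /phi !primxx cosT sinT sin0 cos0 !mulr0 !mulr1 -/T -!/(J _ _ _ _ _).
rewrite mulrAC E1 /J -/T; lra.
Qed.
End one_pair.

Lemma J_opp O k g x z r R0 : continuous k -> (forall x z, O x z -> cont2 g x z) ->
  `|r| < R0 -> sq O x z R0 -> J k (fun x z => - g x z) r x z = - J k g r x z.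
Proof.
move=> ck cg rR HR; apply/eqP; rewrite -subr_eq0 opprK; apply/eqP.
have cg' x' z' : O x' z' -> cont2 (fun x z => - g x z) x' z' by move=> /cg; exact: cont2N.
rewrite /J.
rewrite (@deriv0_const _ (fun t => prim (fun t => - g (x + r * cos t) (z + r * sin t) * k t) 0 t
  + prim (fun t => g (x + r * cos t) (z + r * sin t) * k t) 0 t) 0 (pi *+ 2)); first by rewrite !primxx addr0.
move=> t _; apply: deriv_eq (derivD (J_prim ck cg' t rR HR) (J_prim ck cg t rR HR)) _.
by ring.
Qed.

Lemma formula_A2 O a b x z r R0 : open2 O -> cr O a b -> 0 < r < R0 -> sq O x z R0 ->
  T * r * pdx b x z = J cos b r x z + J sin a r x z.
Proof.
move=> oO crab rR HR; rewrite (formula_A oO (cr_rot oO crab) rR HR).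
have rR' : `|r| < R0 by case/andP: rR => r0; rewrite gtr0_norm.
rewrite (J_opp (@continuous_sin R) _ rR' HR) ?opprK// => x' z' Op.
by have [] := cr_cont2 oO crab Op.
Qed.

(** Circle integrals may be differentiated under the integral sign, so the
    formulas above show that the derivatives are differentiable themselves. *)
Lemma cr_pdx O a b : open2 O -> cr O a b -> cr O (pdx a) (pdx b).
Proof.
move=> oO crab x z Oxz.
have ca x' z' : O x' z' -> cont2 a x' z' by move=> /(cr_cont2 oO crab)[].
have cb x' z' : O x' z' -> cont2 b x' z' by move=> /(cr_cont2 oO crab)[].
have cpa x' z' : O x' z' -> cont2 (pdx a) x' z' by move=> /crab[_ _ _ _ []].
have cpb x' z' : O x' z' -> cont2 (pdx b) x' z' by move=> /crab[_ _ _ _ []].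
have cpaN x' z' : O x' z' -> cont2 (fun x z => - pdx a x z) x' z' by move=> /cpa; exact: cont2N.
have [R0 R00 HR] := oO x z Oxz.
pose r := R0 / 2; have r0 : 0 < r by rewrite divr_gt0.
have rR : r < 3 / 4 * R0 by rewrite /r; lra.
have rR' : `|r| < 3 / 4 * R0 by rewrite gtr0_norm.
pose O' := fun x' z' : R => `|x' - x| < R0 / 4 /\ `|z' - z| < R0 / 4.
have oO' : open2 O'.
  move=> x' z' [h1 h2]; exists (Num.min (R0 / 4 - `|x' - x|) (R0 / 4 - `|z' - z|)).
    by rewrite lt_min !subr_gt0 h1.
  move=> x2 z2; rewrite !lt_min => /andP[x3 _] /andP[_ z3]; split.
    rewrite (_ : x2 - x = (x2 - x') + (x' - x)); last by ring.
    by apply: le_lt_trans (ler_normD _ _) _; rewrite -ltrBrDr.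
  rewrite (_ : z2 - z = (z2 - z') + (z' - z)); last by ring.
  by apply: le_lt_trans (ler_normD _ _) _; rewrite -ltrBrDr.
have HR' x' z' : O' x' z' -> sq O x' z' (3 / 4 * R0).
  move=> [h1 h2] x2 z2 x3 z3; apply: HR.
    rewrite (_ : x2 - x = (x2 - x') + (x' - x)); last by ring.
    by apply: le_lt_trans (ler_normD _ _) _; lra.
  rewrite (_ : z2 - z = (z2 - z') + (z' - z)); last by ring.
  by apply: le_lt_trans (ler_normD _ _) _; lra.
have Tr0 : T * r != 0 by rewrite mulf_neq0// gt_eqF// T_gt0.
have OO' x' z' : O' x' z' -> O x' z'.
  by move=> /HR'; apply; rewrite subrr normr0; lra.
pose a2 x z := (T * r)^-1 * (J cos (pdx a) r x z - J sin (pdx b) r x z).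
pose b2 x z := (T * r)^-1 * (J cos (pdx b) r x z + J sin (pdx a) r x z).
have [|H _] := @cr_intro R O' (pdx a) (pdx b) a2 b2 oO'; last first.
  by apply: H; split; rewrite subrr normr0; lra.
move=> x' z' Oxz'; have HRp := HR' x' z' Oxz'.
have cc := @continuous_cos R; have cs := @continuous_sin R.
have rr : 0 < r < 3 / 4 * R0 by rewrite r0.
have FA s t : O' s t -> (T * r)^-1 * (J cos a r s t - J sin b r s t) = pdx a s t.
  by move=> /HR' Hst; rewrite -(formula_A oO crab rr Hst) mulKf.
have FB s t : O' s t -> (T * r)^-1 * (J cos b r s t + J sin a r s t) = pdx b s t.
  by move=> /HR' Hst; rewrite -(formula_A2 oO crab rr Hst) mulKf.
have dax s t : O s t -> deriv (a^~ t) s (pdx a s t) by move=> /crab[].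
have daz s t : O s t -> deriv (a s) t (pdx b s t) by move=> /crab[].
have dbx s t : O s t -> deriv (b^~ t) s (pdx b s t) by move=> /crab[].
have dbz s t : O s t -> deriv (b s) t (- pdx a s t) by move=> /crab[].
have [d d0 Hd] := oO' x' z' Oxz'.
have zz : `|z' - z'| < d by rewrite subrr normr0.
have xx : `|x' - x'| < d by rewrite subrr normr0.
split.
- apply: (deriv_near d0); first by move=> y yx; exact: FA (Hd _ _ yx zz).
  exact: derivZ (derivB (J_dx cc ca rR' HRp dax cpa) (J_dx cs cb rR' HRp dbx cpb)).
- apply: (deriv_near d0); first by move=> y yx; exact: FA (Hd _ _ xx yx).
  apply: deriv_eq (derivZ _ (derivB (J_dz cc ca rR' HRp daz cpb) (J_dz cs cb rR' HRp dbz cpaN))) _.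
  by rewrite (J_opp cs cpa rR' HRp) opprK.
- apply: (deriv_near d0); first by move=> y yx; exact: FB (Hd _ _ yx zz).
  exact: derivZ (derivD (J_dx cc cb rR' HRp dbx cpb) (J_dx cs ca rR' HRp dax cpa)).
- apply: (deriv_near d0); first by move=> y yx; exact: FB (Hd _ _ xx yx).
  apply: deriv_eq (derivZ _ (derivD (J_dz cc cb rR' HRp dbz cpaN) (J_dz cs ca rR' HRp daz cpb))) _.
  by rewrite (J_opp cc cpa rR' HRp) /a2; ring.
- have C1 : cont2 (fun _ _ => (T * r)^-1) x' z' by exact: cont2C.
  have K1 : cont2 (J cos (pdx a) r) x' z' by exact: (J_cont cc cpa rR' HRp).
  have K2 : cont2 (J sin (pdx b) r) x' z' by exact: (J_cont cs cpb rR' HRp).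
  have K3 : cont2 (J cos (pdx b) r) x' z' by exact: (J_cont cc cpb rR' HRp).
  have K4 : cont2 (J sin (pdx a) r) x' z' by exact: (J_cont cs cpa rR' HRp).
  by split; [exact: cont2M C1 (cont2B K1 K2)|exact: cont2M C1 (cont2D K3 K4)].
Qed.

(** Part of Cauchy's theorem: the integral of (a - i b) exp(i t) over a circle
    vanishes. It allows both derivatives to be computed from b alone. *)
Lemma J_orth O a b x z r R0 : open2 O -> cr O a b -> 0 < r < R0 -> sq O x z R0 ->
  J sin a r x z = J cos b r x z.
Proof.
move=> oO crab /andP[r0 rR] HR.
have ca x' z' : O x' z' -> cont2 a x' z' by move=> /(cr_cont2 oO crab)[].
have cb x' z' : O x' z' -> cont2 b x' z' by move=> /(cr_cont2 oO crab)[].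
have cpa x' z' : O x' z' -> cont2 (pdx a) x' z' by move=> /crab[_ _ _ _ []].
have cpb x' z' : O x' z' -> cont2 (pdx b) x' z' by move=> /crab[_ _ _ _ []].
have cpaN x' z' : O x' z' -> cont2 (fun x z => - pdx a x z) x' z' by move=> /cpa; exact: cont2N.
have cc := @continuous_cos R; have cs := @continuous_sin R.
have dab s t : O s t -> deriv (a^~ t) s (pdx a s t) /\ deriv (a s) t (pdx b s t) by move=> /crab[].
have dbb s t : O s t -> deriv (b^~ t) s (pdx b s t) /\ deriv (b s) t (- pdx a s t) by move=> /crab[].
suff H s : btw 0 r s -> deriv (fun r => r * (J sin a r x z - J cos b r x z)) s 0.
  have := deriv0_const H; rewrite mul0r => /eqP; rewrite mulf_eq0 gt_eqF//= subr_eq0.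
  by move/eqP.
move=> sr; have {}sr : `|s| < R0.
  move: sr => /orP[|] /andP[s1 s2]; first by rewrite ger0_norm// (le_lt_trans s2).
  have -> : s = 0 by lra.
  by rewrite normr0; lra.
have D1 := J_dr oO cs ca sr HR dab cpa cpb.
have D2 := J_dr oO cc cb sr HR dbb cpb cpaN.
apply: deriv_eq (derivM (derivI s) (derivB D1 D2)) _.
set q1 := fun t => _ * sin t; set q2 := fun t => _ * cos t.
have Oc t : O (x + s * cos t) (z + s * sin t) by have [? ?] := circ_in x z t sr; exact: HR.
have dp k g t : continuous k -> (forall x z, O x z -> cont2 g x z) ->
    deriv (prim (fun t => g (x + s * cos t) (z + s * sin t) * k t) 0) t
    (g (x + s * cos t) (z + s * sin t) * k t).
  by move=> ck cg; exact: J_prim sr HR.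
have cq g h k l t : (forall x z, O x z -> cont2 g x z) -> (forall x z, O x z -> cont2 h x z) ->
   continuous k -> continuous l -> {for t, continuous (fun t => (g (x + s * cos t) (z + s * sin t) * k t +
      h (x + s * cos t) (z + s * sin t) * l t))}.
  by move=> cg ch ck cl; apply: contD; apply: circ_cont => //; [exact: cg|exact: ch].
have dq1 t : deriv (prim q1 0) t (q1 t).
  by apply: primT_deriv => u; apply: contM; [exact: cq|exact: cs].
have dq2 t : deriv (prim q2 0) t (q2 t).
  by apply: primT_deriv => u; apply: contM; [exact: (cq _ (fun x z => - pdx a x z))|exact: cc].
pose phi t := s * (prim q1 0 t - prim q2 0 t)
  + prim (fun t => a (x + s * cos t) (z + s * sin t) * sin t) 0 t
  - prim (fun t => b (x + s * cos t) (z + s * sin t) * cos t) 0 t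
  + a (x + s * cos t) (z + s * sin t) * cos t + b (x + s * cos t) (z + s * sin t) * sin t.
have : phi T = phi 0.
  apply: deriv0_const => t _.
  have [da db] := circ_deriv oO crab (Oc t).
  have D3 := dp _ _ t cs ca.
  have D4 := dp _ _ t cc cb.
  have D5 := derivM da (is_derive_cos t).
  have D6 := derivM db (is_derive_sin t).
  apply: deriv_eq (derivD (derivD (derivB (derivD (derivZ s (derivB (dq1 t) (dq2 t))) D3) D4) D5) D6) _.
  by rewrite /q1 /q2; ring.
rewrite /phi !primxx cosT sinT sin0 cos0 !mulr0 !mulr1 /J -/T; lra.
Qed.

Lemma J_bound O k g x z r R0 (M : R) : continuous k -> (forall x z, O x z -> cont2 g x z) ->
  (forall t, `|k t| <= 1) -> `|r| < R0 -> sq O x z R0 ->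
  (forall x' z', `|x' - x| < R0 -> `|z' - z| < R0 -> `|g x' z'| <= M) ->
  `|J k g r x z| <= M * T.
Proof.
move=> ck cg k1 rR HR HM.
have := @deriv_lip _ _ _ M 0 T (fun t _ => J_prim ck cg t rR HR).
rewrite primxx !subr0 (gtr0_norm T_gt0); apply => t _.
have [h1 h2] := circ_in x z t rR.
by rewrite normrM -(mulr1 M) ler_pM ?HM.
Qed.

(** Only one of the two conjugate functions has to be bounded. This matters
    in the half strip, where the vertical velocity is small and the horizontal
    one is not. *)
Lemma cauchy_est O a b x z R0 (M : R) : open2 O -> cr O a b -> 0 < R0 -> sq O x z R0 ->
  (forall x' z', `|x' - x| < R0 -> `|z' - z| < R0 -> `|b x' z'| <= M) ->
  `|pdx a x z| <= 4 * M / R0 /\ `|pdx b x z| <= 4 * M / R0.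
Proof.
move=> oO crab R00 HR HM.
have cb x' z' : O x' z' -> cont2 b x' z' by move=> /(cr_cont2 oO crab)[].
pose r := R0 / 2; have r0 : 0 < r by rewrite divr_gt0.
have rR : 0 < r < R0 by rewrite r0 /r; lra.
have rR' : `|r| < R0 by rewrite gtr0_norm//; case/andP: rR.
have Tr0 : 0 < T * r by rewrite mulr_gt0// T_gt0.
have E1 := formula_A2 oO crab rR HR.
have E2 := J_orth oO crab rR HR.
have E3 := formula_A oO crab rR HR.
have E4 := J_orth oO (cr_rot oO crab) rR HR.
rewrite (J_opp (@continuous_cos R) _ rR' HR) in E4; last by move=> ? ? /(cr_cont2 oO crab)[].
have B1 := J_bound (@continuous_sin R) cb (@sin_max R) rR' HR HM.
have B2 := J_bound (@continuous_cos R) cb (@cos_max R) rR' HR HM.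
have key p J0 : T * r * p = 2 * J0 -> `|J0| <= M * T -> `|p| <= 4 * M / R0.
  move=> E B; rewrite -(ler_pM2l Tr0) -{1}(gtr0_norm Tr0) -normrM E normrM gtr0_norm//.
  rewrite (_ : T * r * (4 * M / R0) = 2 * (M * T)); last by rewrite /r; field; rewrite gt_eqF.
  by rewrite ler_pM2l.
split.
  by apply: (key _ (- J sin b r x z)); [rewrite E3; lra|rewrite normrN].
by apply: (key _ (J cos b r x z)); [rewrite E1; lra|].
Qed.
End cauchy.

(** * Unique continuation *)

Section continuation.
Context {R : realType}.
Implicit Types (a b g h : R -> R -> R) (x z r : R) (O : R -> R -> Prop).

Lemma cr_iter O a b n : open2 O -> cr O a b -> cr O (iter n pdx a) (iter n pdx b).
Proof. by move=> oO H; elim: n => //= n IH; exact: cr_pdx. Qed.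

(** Each derivative costs one Cauchy estimate on a square of side s. *)
Lemma iter_bound O a b x z R0 (M s : R) n : open2 O -> cr O a b -> sq O x z R0 -> 0 < s ->
  (forall x' z', `|x' - x| < R0 -> `|z' - z| < R0 -> `|a x' z'| <= M /\ `|b x' z'| <= M) ->
  forall x' z', `|x' - x| < R0 - n%:R * s -> `|z' - z| < R0 - n%:R * s ->
  `|iter n pdx a x' z'| <= M * (4 / s) ^+ n /\ `|iter n pdx b x' z'| <= M * (4 / s) ^+ n.
Proof.
move=> oO crab HR s0 HM; elim: n => [x' z'|n IH x' z' xx zz].
  by rewrite mul0r subr0 expr0 mulr1 /=; exact: HM.
rewrite -natr1 mulrDl mul1r in xx zz.
have ns : 0 <= n%:R * s by rewrite mulr_ge0// ltW.
have tri y (c y' : R) : `|y' - y| < s -> `|y - c| < R0 - (n%:R * s + s) -> `|y' - c| < R0 - n%:R * s.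
  move=> h1 h2; rewrite (_ : y' - c = (y' - y) + (y - c)); last by ring.
  by apply: le_lt_trans (ler_normD _ _) _; lra.
have sqs : sq O x' z' s.
  by move=> x2 z2 h1 h2; apply: HR; [have := tri _ _ _ h1 xx|have := tri _ _ _ h2 zz]; lra.
have [|e1 e2] := @cauchy_est R O _ _ x' z' s (M * (4 / s) ^+ n) oO (cr_iter n oO crab) s0 sqs.
  by move=> x2 z2 h1 h2; apply: (IH _ _ (tri _ _ _ h1 xx) (tri _ _ _ h2 zz)).2.
by rewrite !iterS exprS (_ : M * _ = 4 * (M * (4 / s) ^+ n) / s); [|ring].
Qed.

Lemma derivXn n (s : R) : deriv (fun s : R => s ^+ n.+1) s (n.+1%:R * s ^+ n).
Proof.
elim: n => [|n IH].
  apply: (@deriv_ext _ id) => [y|]; first by rewrite expr1.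
  by apply: deriv_eq (derivI s) _; rewrite expr0 mulr1.
apply: (@deriv_ext _ (fun y : R => y * y ^+ n.+1)) => [y|]; first by rewrite -exprS.
apply: deriv_eq (derivM (derivI s) IH) _.
by rewrite -(natr1 n.+1) exprS; ring.
Qed.

(** Integration raises the order of vanishing by one; iterating this gives the
    Taylor estimate below. *)
Lemma taylor_step (f g : R -> R) (t0 d C : R) n :
  (forall t, `|t - t0| <= d -> deriv f t (g t)) -> f t0 = 0 ->
  (forall t, `|t - t0| <= d -> `|g t| <= C * `|t - t0| ^+ n) ->
  forall t, `|t - t0| <= d -> `|f t| <= C / n.+1%:R * `|t - t0| ^+ n.+1.
Proof.
move=> df f0 Hg t td.
have dpow (c : R) s (sg : R) : deriv (fun s => c / n.+1%:R * (sg * (s - t0)) ^+ n.+1) s (c * sg * (sg * (s - t0)) ^+ n).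
  have dl : deriv (fun s => sg * (s - t0)) s sg.
    by apply: deriv_eq (derivZ sg (derivB (derivI s) (derivC t0 s))) _; ring.
  have dx : deriv (fun s : R => s ^+ n.+1) (sg * (s - t0)) (n.+1%:R * (sg * (s - t0)) ^+ n).
    exact: derivXn.
  apply: deriv_eq (derivZ (c / n.+1%:R) (deriv_comp dl dx)) _.
  have : n.+1%:R != 0 :> R by rewrite pnatr_eq0.
  by move: (n.+1%:R : R) => N N0; field.
case: (leP t0 t) => tt.
  have key (sg : R) : `|sg| = 1 -> 0 <= C / n.+1%:R * (1 * (t - t0)) ^+ n.+1 - sg * f t.
    move=> s1; apply: le_trans (_ : C / n.+1%:R * (1 * (t0 - t0)) ^+ n.+1 - sg * f t0 <= _).
      by rewrite subrr mulr0 expr0n/= mulr0 f0 mulr0 subrr.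
    have in01 s : t0 <= s <= t -> `|s - t0| <= d.
      by move=> /andP[h1 h2]; rewrite ger0_norm ?subr_ge0//; move: td; rewrite ger0_norm ?subr_ge0//; lra.
    apply: (@deriv_ge0_le _ (fun s => C / n.+1%:R * (1 * (s - t0)) ^+ n.+1 - sg * f s)
       (fun s => C * 1 * (1 * (s - t0)) ^+ n - sg * g s) _ _ tt) => s sI.
      by apply: derivB; [exact: dpow|apply: derivZ; apply: df; exact: in01].
    have := Hg s (in01 s sI); rewrite (ger0_norm (x := s - t0)) ?subr_ge0; last by case/andP: sI.
    rewrite /= mulr1 mul1r; apply: le_trans.
    by apply: le_trans (ler_norm _) _; rewrite normrM s1 mul1r.
  rewrite (ger0_norm (x := t - t0)) ?subr_ge0//; have := key 1 (normr1 _); have := key (-1) _.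
  rewrite normrN normr1 => /(_ erefl); rewrite !mul1r mulN1r => h1 h2.
  by move: h1 h2; set E := C / _ * _ => h1 h2; apply/ler_normlP; split; lra.
have tt' := ltW tt.
have key (sg : R) : `|sg| = 1 -> 0 <= C / n.+1%:R * (-1 * (t - t0)) ^+ n.+1 - sg * f t.
  move=> s1; rewrite -oppr_le0; apply: le_trans (_ : _ <= - (C / n.+1%:R * (-1 * (t0 - t0)) ^+ n.+1 - sg * f t0)) _; last first.
    by rewrite subrr mulr0 expr0n/= mulr0 f0 mulr0 subrr oppr0.
  have in01 s : t <= s <= t0 -> `|s - t0| <= d.
    by move=> /andP[h1 h2]; rewrite ler0_norm ?subr_le0//; move: td; rewrite ler0_norm ?subr_le0//; lra.
  apply: (@deriv_ge0_le _ (fun s => - (C / n.+1%:R * (-1 * (s - t0)) ^+ n.+1 - sg * f s))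
     (fun s => - (C * -1 * (-1 * (s - t0)) ^+ n - sg * g s)) _ _ tt') => s sI.
    by apply: derivN; apply: derivB; [exact: dpow|apply: derivZ; apply: df; exact: in01].
  have := Hg s (in01 s sI); rewrite (ler0_norm (x := s - t0)) ?subr_le0; last by case/andP: sI.
  rewrite /= mulN1r opprB mulrN1 => H.
  suff : - (sg * g s) <= C * (t0 - s) ^+ n by rewrite opprB; lra.
  by apply: le_trans H; apply: le_trans (ler_norm _) _; rewrite normrN normrM s1 mul1r.
rewrite (ler0_norm (x := t - t0)) ?subr_le0//; have := key 1 (normr1 _); have := key (-1) _.
rewrite normrN normr1 => /(_ erefl); rewrite !mul1r !mulN1r => h1 h2.
by move: h1 h2; set E := C / _ * _ => h1 h2; apply/ler_normlP; split; lra.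
Qed.

Lemma taylor_zero (phi : nat -> R -> R) (t0 d K : R) n :
  (forall k t, `|t - t0| <= d -> deriv (phi k) t (phi k.+1 t)) ->
  (forall k, phi k t0 = 0) ->
  (forall t, `|t - t0| <= d -> `|phi n t| <= K) ->
  forall t, `|t - t0| <= d -> `|phi 0%N t| <= K / n`!%:R * `|t - t0| ^+ n.
Proof.
move=> dphi phi0 HK.
suff H k t : (k <= n)%N -> `|t - t0| <= d -> `|phi (n - k)%N t| <= K / k`!%:R * `|t - t0| ^+ k.
  by move=> t td; have := H n t (leqnn n) td; rewrite subnn.
elim: k t => [t _ td|k IH t kn td]; first by rewrite subn0 fact0 divr1 expr0 mulr1; exact: HK.
have -> : K / (k.+1)`!%:R = K / k`!%:R / k.+1%:R.
  rewrite factS natrM; have : k`!%:R != 0 :> R by rewrite pnatr_eq0 -lt0n fact_gt0.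
  have : k.+1%:R != 0 :> R by rewrite pnatr_eq0.
  by move: (k.+1%:R : R) (k`!%:R : R) => N N' N0 N0'; field; rewrite N0.
apply: (@taylor_step (phi (n - k.+1)%N) (phi (n - k)%N) t0 d) => //.
  by move=> s sd; rewrite -(subnSK kn); exact: dphi.
by move=> s sd; exact: IH (ltnW kn) sd.
Qed.

(** The n-th term of the exponential series at n is below its sum. It beats
    the growth n^n of the constants in the iterated Cauchy estimates. *)
Lemma expnn_fact n : n%:R ^+ n / n`!%:R <= (expR 1 : R) ^+ n.
Proof.
case: n => [|n]; first by rewrite !expr0 fact0 divr1.
have := @expR_ge1Dxn R n.+1%:R n (ler0n _ _).
by rewrite -expRM_natl mulr1; apply: le_trans; rewrite lerDr.
Qed.

Lemma small_zero (v M q : R) : 0 <= q <= 2^-1 -> (forall n, (0 < n)%N -> `|v| <= M * q ^+ n) -> v = 0.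
Proof.
move=> /andP[q0 q1] H; apply/eqP; rewrite -normr_eq0; apply/negPn/negP => v0.
have {}v0 : 0 < `|v| by rewrite lt_neqAle eq_sym v0 normr_ge0.
have M0 : 0 < M.
  have := H 1%N isT; rewrite expr1 => h; rewrite ltNge; apply/negP => M0.
  by have := mulr_le0_ge0 M0 q0; lra.
pose n := (Num.truncn (M / `|v|)).+1.
have nM : M / `|v| < n%:R by rewrite /n truncnS_gt.
have := H n isT; apply/negP; rewrite -ltNge.
have n2 : n%:R < (2 : R) ^+ n by rewrite -natrX ltr_nat ltn_expl.
rewrite ltr_pdivrMr// in nM.
have : M * q ^+ n <= M * 2^-1 ^+ n by rewrite ler_pM2l// lerXn2r// nnegrE.
move/le_lt_trans; apply; rewrite exprVn ltr_pdivrMr ?exprn_gt0//.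
by apply: lt_trans nM _; rewrite mulrC ltr_pM2l.
Qed.

(** All derivatives vanish; by the Cauchy-Riemann equations the x-derivatives
    determine the others. *)
Definition jet0 a b x z := forall k, iter k pdx a x z = 0 /\ iter k pdx b x z = 0.

(** The fraction of the radius on which the n-th Taylor remainder is bounded
    by M 2^-n, with the n-th derivative estimated on squares of side R0/(2n). *)
Definition kap : R := (16 * expR 1)^-1.
Lemma kap_gt0 : 0 < kap. Proof. by rewrite invr_gt0 mulr_gt0// expR_gt0. Qed.
Lemma kap_lt : kap < 2^-1.
Proof.
rewrite /kap ltf_pV2 ?posrE ?mulr_gt0 ?expR_gt0//.
have := expR_ge1Dx (1 : R); lra.
Qed.

Lemma jet_bound O a b x z R0 (M : R) (phi : nat -> R -> R) t0 : open2 O -> cr O a b -> 0 < R0 -> sq O x z R0 ->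
  (forall x' z', `|x' - x| < R0 -> `|z' - z| < R0 -> `|a x' z'| <= M /\ `|b x' z'| <= M) ->
  (forall k t, `|t - t0| <= kap * R0 -> deriv (phi k) t (phi k.+1 t)) ->
  (forall k, phi k t0 = 0) ->
  (forall k t, `|t - t0| <= kap * R0 -> exists x' z', [/\ `|x' - x| < R0 / 2, `|z' - z| < R0 / 2 &
     `|phi k t| <= Num.max `|iter k pdx a x' z'| `|iter k pdx b x' z'|]) ->
  forall t, `|t - t0| <= kap * R0 -> phi 0%N t = 0.
Proof.
move=> oO crab R00 HR HM dphi phi0 Hphi t td.
apply: (@small_zero _ M (8 * expR 1 * `|t - t0| / R0)).
  rewrite !mulr_ge0 ?expR_ge0 ?invr_ge0 ?(ltW R00)//= ler_pdivrMr//.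
  have : 8 * expR 1 * `|t - t0| <= 8 * expR 1 * (kap * R0).
    by rewrite ler_pM2l// mulr_gt0// expR_gt0.
  move/le_trans; apply; rewrite /kap le_eqVlt; apply/orP; left; apply/eqP.
  by field; rewrite gt_eqF// expR_gt0.
move=> n n0; pose s := R0 / (2 * n%:R).
have nR : (0 : R) < n%:R by rewrite ltr0n.
have s0 : 0 < s by rewrite divr_gt0// mulr_gt0.
have sn : R0 - n%:R * s = R0 / 2 by rewrite /s; field; rewrite gt_eqF.
have M0 : 0 <= M.
  by apply: le_trans (normr_ge0 _) (HM x z _ _).1; rewrite subrr normr0.
have B u : `|u - t0| <= kap * R0 -> `|phi n u| <= M * (4 / s) ^+ n.
  move=> /(Hphi n)[x' [z' [xx zz ph]]]; apply: le_trans ph _.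
  have [|| b1 b2] := @iter_bound O a b x z R0 M s n oO crab HR s0 HM x' z'; rewrite ?sn//.
  by rewrite ge_max b1 b2.
apply: le_trans (taylor_zero dphi phi0 B td) _.
have -> : M * (4 / s) ^+ n / n`!%:R * `|t - t0| ^+ n = M * (n%:R ^+ n / n`!%:R) * (8 * `|t - t0| / R0) ^+ n.
  have -> : 4 / s = n%:R * (8 / R0) by rewrite /s; field; rewrite !gt_eqF.
  by rewrite mulrAC; rewrite !exprMn; ring.
have -> : M * (8 * expR 1 * `|t - t0| / R0) ^+ n = M * expR 1 ^+ n * (8 * `|t - t0| / R0) ^+ n.
  by rewrite -[RHS]mulrA -exprMn; congr (_ * _ ^+ _); ring.
rewrite ler_wpM2r//; first by rewrite exprn_ge0// !mulr_ge0 ?invr_ge0 ?(ltW R00).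
by rewrite ler_wpM2l// expnn_fact.
Qed.

(** The signs + + - - that vertical differentiation produces: the vertical
    derivative exchanges the two functions and changes one sign. *)
Definition vsgn n : R := (-1) ^+ n./2.

Lemma vsgnS n : vsgn n.+1 = (if odd n then - vsgn n else vsgn n).
Proof.
rewrite /vsgn -[n.+1./2]/(uphalf n) uphalf_half.
by case: (odd n); rewrite ?add0n// add1n exprS mulN1r.
Qed.
Lemma vsgn_norm n (v : R) : `|vsgn n * v| = `|v|.
Proof. by rewrite normrM /vsgn normrX normrN normr1 expr1n mul1r. Qed.

(** Analyticity in the form needed: a pair that vanishes to infinite order at
    a point vanishes on a segment whose length depends on the radius only. *)
Lemma jet_local O a b x z R0 (M : R) : open2 O -> cr O a b -> 0 < R0 -> sq O x z R0 ->
  (forall x' z', `|x' - x| < R0 -> `|z' - z| < R0 -> `|a x' z'| <= M /\ `|b x' z'| <= M) ->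
  jet0 a b x z ->
  (forall t, `|t - z| <= kap * R0 -> a x t = 0 /\ b x t = 0) /\
  (forall t, `|t - x| <= kap * R0 -> a t z = 0 /\ b t z = 0).
Proof.
move=> oO crab R00 HR HM j0.
have kR : kap * R0 < R0 / 2 by rewrite mulrC ltr_pM2l// kap_lt.
have x0 : `|x - x| < R0 / 2 by rewrite subrr normr0; lra.
have z0 : `|z - z| < R0 / 2 by rewrite subrr normr0; lra.
have Oz t : `|t - z| <= kap * R0 -> O x t by move=> h; apply: HR; lra.
have Ox t : `|t - x| <= kap * R0 -> O t z by move=> h; apply: HR; lra.
have ci k := cr_iter k oO crab.
split=> t td; split.
(* the n-th vertical derivative is an n-th horizontal one up to a sign *)
- have := @jet_bound O a b x z R0 M (fun n t => vsgn n * (if odd n then iter n pdx b x t else iter n pdx a x t)) z oO crab R00 HR HM.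
  rewrite /vsgn/= expr0; move=> H; rewrite -(mul1r (a x t)); apply: (H _ _ _ t td).
  + move=> k s sd; rewrite -!/(vsgn _) -/(vsgn k.+1) vsgnS /=.
    have [_ h2 _ h4 _] := ci k x s (Oz s sd).
    case: (odd k) => /=; last exact: derivZ.
    by apply: deriv_eq (derivZ (vsgn k) h4) _; ring.
  + by move=> k; case: (j0 k) => -> ->; rewrite if_same mulr0.
  + move=> k s sd; exists x, s; split => //; first lra.
    by rewrite vsgn_norm le_max; case: ifP; rewrite lexx ?orbT.
- have := @jet_bound O a b x z R0 M (fun n t => vsgn n * (if odd n then - iter n pdx a x t else iter n pdx b x t)) z oO crab R00 HR HM.
  rewrite /vsgn/= expr0; move=> H; rewrite -(mul1r (b x t)); apply: (H _ _ _ t td).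
  + move=> k s sd; rewrite -!/(vsgn _) -/(vsgn k.+1) vsgnS /=.
    have [_ h2 _ h4 _] := ci k x s (Oz s sd).
    case: (odd k) => /=; last exact: derivZ.
    by apply: deriv_eq (derivZ (vsgn k) (derivN h2)) _; rewrite /=; ring.
  + by move=> k; case: (j0 k) => -> ->; rewrite oppr0 if_same mulr0.
  + move=> k s sd; exists x, s; split => //; first lra.
    by rewrite vsgn_norm le_max; case: ifP; rewrite ?normrN lexx ?orbT.
- apply: (@jet_bound O a b x z R0 M (fun n t => iter n pdx a t z) x oO crab R00 HR HM _ _ _ t td).
  + by move=> k s sd; have [] := ci k s z (Ox s sd).
  + by move=> k; case: (j0 k).
  + by move=> k s sd; exists s, z; split => //; [lra|rewrite le_max lexx].
- apply: (@jet_bound O a b x z R0 M (fun n t => iter n pdx b t z) x oO crab R00 HR HM _ _ _ t td).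
  + by move=> k s sd; have [] := ci k s z (Ox s sd).
  + by move=> k; case: (j0 k).
  + by move=> k s sd; exists s, z; split => //; [lra|rewrite le_max lexx orbT].
Qed.

Lemma jet_open O a b x z : open2 O -> cr O a b -> O x z -> jet0 a b x z ->
  exists2 d : R, 0 < d & (forall t, `|t - z| < d -> jet0 a b x t) /\
                         (forall t, `|t - x| < d -> jet0 a b t z).
Proof.
move=> oO crab Oxz j0.
have [ca cb] := cr_cont2 oO crab Oxz.
have [r r0 Hr] := oO x z Oxz.
have [d1 d10 H1] := (cont2P _ _ _).1 ca 1 ltr01.
have [d2 d20 H2] := (cont2P _ _ _).1 cb 1 ltr01.
pose R0 := Num.min r (Num.min d1 d2).
have R00 : 0 < R0 by rewrite !lt_min r0 d10.
pose M := `|a x z| + `|b x z| + 1.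
have HR : sq O x z R0 by apply: sqW Hr; rewrite ge_min lexx.
have HM x' z' : `|x' - x| < R0 -> `|z' - z| < R0 -> `|a x' z'| <= M /\ `|b x' z'| <= M.
  rewrite !lt_min => /and3P[_ x1 x2] /and3P[_ z1 z2].
  have := H1 _ _ x1 z1; have := H2 _ _ x2 z2.
  have := lerB_dist (a x' z') (a x z); have := lerB_dist (b x' z') (b x z).
  have := normr_ge0 (a x z); have := normr_ge0 (b x z); rewrite /M; lra.
exists (kap * (R0 / 2)); first by rewrite mulr_gt0 ?kap_gt0// divr_gt0.
have key k : (forall t, `|t - z| <= kap * (R0 / 2) -> iter k pdx a x t = 0 /\ iter k pdx b x t = 0) /\
  (forall t, `|t - x| <= kap * (R0 / 2) -> iter k pdx a t z = 0 /\ iter k pdx b t z = 0).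
  have k0 : (0 : R) < k.+1%:R by rewrite ltr0n.
  pose s := R0 / (2 * k.+1%:R).
  have s0 : 0 < s by rewrite divr_gt0// mulr_gt0.
  have sk : R0 / 2 <= R0 - k%:R * s.
    have -> : k%:R * s = R0 / 2 - s.
      have -> : k%:R = k.+1%:R - 1 :> R by rewrite -natr1 addrK.
      by rewrite /s; move: (k.+1%:R : R) k0 => N N0; field; rewrite gt_eqF.
    lra.
  apply: (@jet_local O _ _ x z (R0 / 2) (M * (4 / s) ^+ k) oO (cr_iter k oO crab)).
  - by rewrite divr_gt0.
  - by apply: sqW HR; lra.
  - by move=> x' z' xx zz; apply: (iter_bound oO crab HR s0 HM); lra.
  - by move=> n; rewrite -!iterD; exact: j0.
split=> t /ltW td k; first exact: (key k).1.
exact: (key k).2.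
Qed.

Lemma jet_closed O a b x z : open2 O -> cr O a b -> O x z ->
  (forall d, 0 < d -> exists x' z', [/\ `|x' - x| < d, `|z' - z| < d & jet0 a b x' z']) ->
  jet0 a b x z.
Proof.
move=> oO crab Oxz H k.
have [ca cb] := cr_cont2 oO (cr_iter k oO crab) Oxz.
have key f : cont2 f x z -> (forall d, 0 < d -> exists x' z', [/\ `|x' - x| < d, `|z' - z| < d & f x' z' = 0]) -> f x z = 0.
  move=> /cont2P cf Hf; apply/eqP; rewrite -normr_eq0; apply/negPn/negP => f0.
  have [|d d0 Hd] := cf `|f x z|; first by rewrite lt_neqAle eq_sym f0 normr_ge0.
  have [x' [z' [h1 h2 h3]]] := Hf d d0.
  by have := Hd _ _ h1 h2; rewrite h3 sub0r normrN ltxx.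
split; apply: key => // d /H[x' [z' [h1 h2 h3]]]; exists x', z'; split => //.
  exact: (h3 k).1.
exact: (h3 k).2.
Qed.

(** The points of infinite order vanishing form an open and closed part of
    the segment. *)
Lemma jet_vert O a b x z1 z2 : open2 O -> cr O a b ->
  (forall t, btw z1 z2 t -> O x t) -> jet0 a b x z1 -> forall t, btw z1 z2 t -> jet0 a b x t.
Proof.
move=> oO crab HO j1; apply: seg_ind2 => // t tI.
  by move=> jt; have [d d0 [Hd _]] := jet_open oO crab (HO t tI) jt; exists d.
move=> Hd; apply: (jet_closed oO crab (HO t tI)) => d d0.
by have [s sd js] := Hd d d0; exists x, s; rewrite subrr normr0.
Qed.

Lemma jet_hor O a b x1 x2 z : open2 O -> cr O a b ->
  (forall t, btw x1 x2 t -> O t z) -> jet0 a b x1 z -> forall t, btw x1 x2 t -> jet0 a b t z.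
Proof.
move=> oO crab HO j1; apply: seg_ind2 => // t tI.
  by move=> jt; have [d d0 [_ Hd]] := jet_open oO crab (HO t tI) jt; exists d.
move=> Hd; apply: (jet_closed oO crab (HO t tI)) => d d0.
by have [s sd js] := Hd d d0; exists s, z; rewrite subrr normr0.
Qed.

Lemma jet0_near a b x z r : 0 < r ->
  (forall x' z', `|x' - x| < r -> `|z' - z| < r -> a x' z' = 0 /\ b x' z' = 0) ->
  jet0 a b x z.
Proof.
move=> r0 H.
have key f k : (forall x' z', `|x' - x| < r -> `|z' - z| < r -> f x' z' = 0) ->
    forall x' z', `|x' - x| < r -> `|z' - z| < r -> iter k pdx f x' z' = 0.
  move=> Hf; elim: k => [//|k IH] x' z' xx zz /=.
  apply: pdxE; apply: (@deriv_near _ (fun=> 0) _ _ _ (r - `|x' - x|)); last exact: derivC.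
    by rewrite subr_gt0.
  move=> y yx; rewrite IH// (_ : y - x = (y - x') + (x' - x)); last by ring.
  by apply: le_lt_trans (ler_normD _ _) _; rewrite -ltrBrDr.
have x0 : `|x - x| < r by rewrite subrr normr0.
have z0 : `|z - z| < r by rewrite subrr normr0.
move=> k; split; apply: key => // x' z' h1 h2.
  exact: (H _ _ h1 h2).1.
exact: (H _ _ h1 h2).2.
Qed.
End continuation.

(** * Harmonic functions in a strip *)

Section strip.
Context {R : realType}.
Implicit Types (a b : R -> R -> R) (x z r : R) (O : R -> R -> Prop).

(** At a maximum the first derivative vanishes, so a positive second
    derivative would make g increase to the right of it. *)
Lemma second_max (g g1 : R -> R) (t0 g2 r : R) : 0 < r ->
  (forall t, `|t - t0| < r -> deriv g t (g1 t)) -> deriv g1 t0 g2 -> 0 < g2 ->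
  (forall t, `|t - t0| < r -> g t <= g t0) -> False.
Proof.
move=> r0 dg dg1 g20 Hm.
have t00 : `|t0 - t0| < r by rewrite subrr normr0.
have g10 : g1 t0 = 0.
  apply/eqP; rewrite eq_le; apply/andP; split.
    apply: deriv_max_right (dg t0 t00) r0 _ => y /andP[y1 y2].
    by apply: Hm; rewrite gtr0_norm; lra.
  apply: deriv_max_left (dg t0 t00) r0 _ => y /andP[y1 y2].
  by apply: Hm; rewrite ltr0_norm; lra.
have g22 : 0 < g2 / 2 by lra.
have [s s0 Hs] := (derivP _ _ _).1 dg1 _ g22.
pose d := Num.min r s / 2.
have d0 : 0 < d by rewrite divr_gt0// lt_min r0.
have [dr ds] : d < r /\ d < s.
  have : d < Num.min r s by rewrite /d ltr_pdivrMr// ltr_pMr ?lt_min ?r0// ltr1n.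
  by rewrite lt_min => /andP[].
have pos h : 0 <= h <= d -> g2 / 2 * h <= g1 (t0 + h).
  move=> /andP[h0 hd]; have := Hs h; rewrite ger0_norm// g10 => /(_ (le_lt_trans hd ds)).
  by case/ler_normlP; lra.
have dG h : 0 <= h <= d -> deriv (fun h => g (t0 + h) - g2 / 2 * (h ^+ 2 / 2)) h (g1 (t0 + h) - g2 / 2 * h).
  move=> /andP[h0 hd].
  have dt : deriv (fun h => t0 + h) h 1 by apply: deriv_eq (derivD (derivC t0 h) (derivI h)) _; ring.
  have th : `|t0 + h - t0| < r by rewrite addrC addKr ger0_norm//; lra.
  apply: deriv_eq (derivB (deriv_comp dt (dg _ th)) (derivZ (g2 / 2) (derivM (derivX2 (derivI h)) (derivC 2^-1 h)))) _.
  by field.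
have := @deriv_ge0_le _ _ _ 0 d (ltW d0) dG.
move=> /(_ _) H; have {}H : g (t0 + 0) - g2 / 2 * (0 ^+ 2 / 2) <= g (t0 + d) - g2 / 2 * (d ^+ 2 / 2).
  by apply: H => h hd; rewrite subr_ge0; exact: pos.
have := Hm (t0 + d); rewrite addrC addKr gtr0_norm// => /(_ dr).
move: H; rewrite addr0 expr0n/= mul0r mulr0 subr0.
have : 0 < g2 / 2 * (d ^+ 2 / 2) by rewrite mulr_gt0// divr_gt0// exprn_gt0.
lra.
Qed.

Section bound.
Variables (O : R -> R -> Prop) (lo hi M x1 x2 : R).
Hypotheses (oO : open2 O) (lohi : lo < hi) (M0 : 0 < M) (x12 : x1 <= x2).
Hypothesis HO : forall x z, x1 <= x <= x2 -> lo < z < hi -> O x z.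

Let H := hi - lo.
Let H0 : 0 < H. Proof. by rewrite /H subr_gt0. Qed.
Let k := (2 * H)^-1.
Let zc := (lo + hi) / 2.
Let bb z := 2 * H ^+ 2 - (z - zc) ^+ 2.
(** Together with the concave profile bb this gives a positive supersolution
    of the Laplace equation that is large at the two ends of the rectangle and
    decays away from them: edge'' = k^2 edge, bb'' = - 2 and k^2 bb <= 1/2. *)
Definition edge x := expR (- k * (x - x1)) + expR (- k * (x2 - x)).
Let B x z := M / H ^+ 2 * (edge x * bb z).
Let edge' x := - k * expR (- k * (x - x1)) + k * expR (- k * (x2 - x)).

Let dE1 x (c : R) : deriv (fun x => expR (- k * (x - c))) x (- k * expR (- k * (x - c))).
Proof.
have dl : deriv (fun x => - k * (x - c)) x (- k).
  by apply: deriv_eq (derivZ (- k) (derivB (derivI x) (derivC c x))) _; ring.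
by apply: deriv_eq (deriv_comp dl (is_derive_expR _)) _; ring.
Qed.
Let dE2 x (c : R) : deriv (fun x => expR (- k * (c - x))) x (k * expR (- k * (c - x))).
Proof.
have dl : deriv (fun x => - k * (c - x)) x k.
  by apply: deriv_eq (derivZ (- k) (derivB (derivC c x) (derivI x))) _; ring.
by apply: deriv_eq (deriv_comp dl (is_derive_expR _)) _; ring.
Qed.
Let dedge x : deriv edge x (edge' x).
Proof. exact: derivD (dE1 _ _) (dE2 _ _). Qed.
Let dedge' x : deriv edge' x (k ^+ 2 * edge x).
Proof.
apply: deriv_eq (derivD (derivZ (- k) (dE1 x x1)) (derivZ k (dE2 x x2))) _.
by rewrite /edge; ring.
Qed.
Let edge_gt0 x : 0 < edge x. Proof. by rewrite addr_gt0 ?expR_gt0. Qed.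
Let dbb z : deriv bb z (- (2 * (z - zc))).
Proof.
apply: deriv_eq (derivB (derivC _ z) (derivX2 (derivB (derivI z) (derivC zc z)))) _.
by ring.
Qed.
Let bb_ge z : lo <= z <= hi -> H ^+ 2 <= bb z.
Proof.
move=> /andP[z1 z2]; rewrite /bb /zc.
have : (z - (lo + hi) / 2) ^+ 2 <= H ^+ 2.
  rewrite -(real_normK (num_real (z - _))) lerXn2r ?nnegrE ?normr_ge0 ?(ltW H0)//.
  by apply/ler_normlP; rewrite /H; split; lra.
lra.
Qed.
Let bb_le z : bb z <= 2 * H ^+ 2.
Proof. by rewrite /bb gerBl sqr_ge0. Qed.
Let MH : 0 < M / H ^+ 2. Proof. by rewrite divr_gt0// exprn_gt0. Qed.

(** At a maximum of b - M/H^2 edge bb above zero both second derivatives of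
    this function would be nonpositive, while their sum is positive because b
    is harmonic and the barrier strictly superharmonic. *)
Lemma strip_upper a b : cr O a b ->
  (forall x z, x1 <= x <= x2 -> lo < z < hi -> b x z <= M) ->
  (forall x, x1 <= x <= x2 -> forall e, 0 < e -> exists2 d : R, 0 < d &
     forall x' z', `|x' - x| < d -> lo < z' < hi -> z' < lo + d \/ hi - d < z' -> `|b x' z'| < e) ->
  forall x z, x1 <= x <= x2 -> lo < z < hi -> b x z <= 2 * M * edge x.
Proof.
move=> crab HM Hb x z xx zz.
pose bt x z := if lo < z < hi then b x z else 0.
have cbt s t : x1 <= s <= x2 -> lo <= t <= hi -> cont2 bt s t.
  move=> ss tt; have [tin|tout] := boolP (lo < t < hi).
    have [_ cb] := cr_cont2 oO crab (HO ss tin).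
    case/andP: tin => t1 t2.
    have r0 : 0 < Num.min (t - lo) (hi - t) by rewrite lt_min !subr_gt0 t1.
    apply: (cont2_near r0) cb => s' t' _; rewrite lt_min => /andP[].
    rewrite !ltr_norml => /andP[h1 h2] /andP[h3 h4].
    by rewrite /bt ifT//; apply/andP; split; lra.
  apply/cont2P => e e0; have [d d0 Hd] := Hb s ss e e0.
  exists d => // s' t' hs ht; rewrite {2}/bt (negbTE tout) subr0 /bt.
  case: ifPn => [t'in|_]; last by rewrite normr0.
  apply: Hd => //; move: ht; rewrite ltr_norml => /andP[h1 h2].
  have [t1|t1] : t = lo \/ t = hi.
    move: tout tt; rewrite negb_and -!leNgt => /orP[] h /andP[h3 h4]; [left|right]; apply/eqP; rewrite eq_le ?h ?h3 ?h4//.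
  - by left; lra.
  - by right; lra.
have dBx s t : deriv (B^~ t) s (M / H ^+ 2 * (edge' s * bb t)).
  apply: deriv_eq (derivZ _ (derivM (dedge s) (derivC (bb t) s))) _.
  by ring.
have dBz s t : deriv (B s) t (M / H ^+ 2 * (edge s * - (2 * (t - zc)))).
  exact: derivZ (derivZ _ (dbb t)).
have cB s t : cont2 B s t.
  apply: cont2M; first exact: cont2C.
  apply: (@cont2_comp _ (fun x y => x * y) edge bb).
  - exact: deriv_cont (dedge s).
  - exact: deriv_cont (dbb t).
  - by apply: cont2M; [exact: cont2X|exact: cont2Y].
have [xm [zm [xxm zzm Hm]]] := @EVT2 _ (fun s t => bt s t - B s t) x1 x2 lo hi x12 (ltW lohi)
  (fun s t h1 h2 => cont2B (cbt s t h1 h2) (cB s t)).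
have edge1 s : s = x1 \/ s = x2 -> 1 <= edge s.
  by case=> ->; rewrite /edge subrr mulr0 expR0 ?lerDl ?lerDr expR_ge0.
have Bge0 s t : lo <= t <= hi -> 0 < B s t.
  move=> tt; rewrite mulr_gt0// mulr_gt0//; apply: lt_le_trans (bb_ge tt).
  by rewrite exprn_gt0.
have : bt x z - B x z <= 0.
  apply: le_trans (Hm x z xx _) _; first by case/andP: zz => /ltW -> /ltW ->.
  have [zin|zout] := boolP (lo < zm < hi); last first.
    by rewrite /bt (negbTE zout) sub0r oppr_le0 ltW// Bge0.
  rewrite leNgt; apply/negP => pos.
  have edgeB s : s = x1 \/ s = x2 -> B s zm >= M.
    move=> /edge1 s1; rewrite /B -(ler_pdivrMl _ _ MH).
    rewrite (_ : (M / H ^+ 2)^-1 * M = 1 * H ^+ 2); last by field; rewrite !gt_eqF.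
    by apply: ler_pM => //; rewrite ?ler01 ?sqr_ge0// bb_ge.
  have [xm1 xm2] : x1 < xm /\ xm < x2.
    have ns s : s = x1 \/ s = x2 -> xm <> s.
      move=> s1 E; have := edgeB s s1; have := HM xm zm xxm zin; move: pos.
      by rewrite /bt zin E; lra.
    case/andP: xxm => h1 h2; split; rewrite lt_neqAle ?h1 ?h2 andbT; apply/eqP => E.
      by apply: (ns x1); [left|].
    by apply: (ns x2); [right|].
  case/andP: zin => z1 z2.
  pose r := Num.min (Num.min (xm - x1) (x2 - xm)) (Num.min (zm - lo) (hi - zm)).
  have r0 : 0 < r by rewrite !lt_min !subr_gt0 xm1 xm2 z1.
  have inx s : `|s - xm| < r -> x1 <= s <= x2.
    by rewrite !lt_min !ltr_norml => /andP[/andP[/andP[? ?] /andP[? ?]] _]; apply/andP; split; lra.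
  have inz s : `|s - zm| < r -> lo < s < hi.
    by rewrite !lt_min !ltr_norml => /andP[_ /andP[/andP[? ?] /andP[? ?]]]; apply/andP; split; lra.
  have Om : O xm zm by apply: HO => //; rewrite z1.
  have crp := cr_pdx oO crab.
  have [_ _ h3 h4 _] := crp xm zm Om.
  have zI : lo < zm < hi by rewrite z1.
  have zcI : lo <= zm <= hi by rewrite (ltW z1) (ltW z2).
  pose gxx := pdx (pdx b) xm zm - M / H ^+ 2 * (k ^+ 2 * edge xm * bb zm).
  pose gzz := - pdx (pdx b) xm zm - M / H ^+ 2 * (edge xm * - 2).
  have sum : 0 < gxx + gzz.
    rewrite /gxx /gzz (_ : _ + _ = M / H ^+ 2 * edge xm * (2 - k ^+ 2 * bb zm)); last by ring.
    apply: mulr_gt0; first exact: mulr_gt0.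
    rewrite subr_gt0.
    apply: (@le_lt_trans _ _ (k ^+ 2 * (2 * H ^+ 2))); first by rewrite ler_wpM2l ?sqr_ge0.
    rewrite /k (_ : _ * _ = 2^-1); last by field; rewrite gt_eqF.
    lra.
  have [gx|gz] : 0 < gxx \/ 0 < gzz.
    by case: (ltP 0 gxx) => h; [left|right]; lra.
  - apply: (@second_max (fun s => b s zm - B s zm) (fun s => pdx b s zm - M / H ^+ 2 * (edge' s * bb zm)) xm gxx r r0) => //.
    + move=> t tr; have [_ _ ? _ _] := crab t zm (HO (inx t tr) zI); exact: derivB.
    + apply: derivB => //; apply: deriv_eq (derivZ _ (derivM (dedge' xm) (derivC (bb zm) xm))) _.
      by ring.
    + move=> t tr; have := Hm t zm (inx t tr) zcI.
      by rewrite /bt zI.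
  - apply: (@second_max (fun s => b xm s - B xm s) (fun s => - pdx a xm s - M / H ^+ 2 * (edge xm * - (2 * (s - zc)))) zm gzz r r0) => //.
    + move=> t tr; have [_ _ _ ? _] := crab xm t (HO xxm (inz t tr)); exact: derivB.
    + have [_ i2 _ _ _] := crp xm zm Om.
      apply: deriv_eq (derivB (derivN i2) (derivZ (M / H ^+ 2) (derivZ (edge xm) (derivN (derivZ 2 (derivB (derivI zm) (derivC zc zm))))))) _.
      by rewrite /gzz; ring.
    + move=> t tr; have := Hm xm t xxm; have /andP[t1 t2] := inz t tr.
      by rewrite (ltW t1) (ltW t2) => /(_ isT); rewrite /bt zI t1 t2.
rewrite /bt zz subr_le0 => /le_trans; apply.
rewrite /B (_ : 2 * M * edge x = M / H ^+ 2 * (edge x * (2 * H ^+ 2))); last by field; rewrite gt_eqF.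
by rewrite ler_pM2l// ler_pM2l// bb_le.
Qed.

Lemma strip_bound a b : cr O a b ->
  (forall x z, x1 <= x <= x2 -> lo < z < hi -> `|b x z| <= M) ->
  (forall x, x1 <= x <= x2 -> forall e, 0 < e -> exists2 d : R, 0 < d &
     forall x' z', `|x' - x| < d -> lo < z' < hi -> z' < lo + d \/ hi - d < z' -> `|b x' z'| < e) ->
  forall x z, x1 <= x <= x2 -> lo < z < hi -> `|b x z| <= 2 * M * edge x.
Proof.
move=> crab HM Hb x z xx zz; apply/ler_normlP; split.
  apply: (@strip_upper _ (fun x z => - b x z) (cr_rot oO (cr_rot oO crab))) => // s t.
    by move=> ss tt; apply: le_trans (HM s t ss tt); rewrite -normrN ler_norm.
  by move=> e /(Hb s t e)[d d0 Hd]; exists d => // x' z' h1 h2 h3; rewrite normrN; exact: Hd.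
apply: (@strip_upper a b) => // s t ss tt.
by apply: le_trans (HM s t ss tt); rewrite ler_norm.
Qed.
End bound.
End strip.

(** * Two planar flows with the same pressure *)

Section reconstruction.
Context {R : realType}.
Implicit Types (x z r : R).

(** Relations between the two layers that hold on an open set can be
    differentiated. *)
Lemma deriv_agree (O : R -> R -> Prop) (f g : R -> R -> R) x z d d' : open2 O -> O x z ->
  (forall x z, O x z -> f x z = g x z) ->
  (deriv (f^~ z) x d -> deriv (g^~ z) x d' -> d = d') /\
  (deriv (f x) z d -> deriv (g x) z d' -> d = d').
Proof.
move=> oO Oxz fg; have [r r0 Hr] := oO x z Oxz.
have x0 : `|x - x| < r by rewrite subrr normr0.
have z0 : `|z - z| < r by rewrite subrr normr0.
split=> d1 d2; apply: deriv_uniq d2; apply: (deriv_near r0) d1 => y yy; apply: fg; exact: Hr.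
Qed.

Definition vel (gam : R) (a : R -> R -> R) x z := a x z + gam * z.
(** The components of the acceleration, gravity being included in the
    vertical one; a is the horizontal velocity minus the uniform shear. *)
Definition accx gam (a w : R -> R -> R) x z := vel gam a x z * pdx a x z + w x z * (pdx w x z + gam).
Definition accz (g gam : R) (a w : R -> R -> R) x z := vel gam a x z * pdx w x z - w x z * pdx a x z + g.
(** Minus half the Laplacian of the pressure divided by the density. *)
Definition lapP (gam : R) (a w : R -> R -> R) x z := pdx a x z ^+ 2 + pdx w x z ^+ 2 + gam * pdx w x z.
Definition lapPx (gam : R) (a w : R -> R -> R) x z :=
  2 * pdx a x z * pdx (pdx a) x z + 2 * pdx w x z * pdx (pdx w) x z + gam * pdx (pdx w) x z.
Definition lapPz (gam : R) (a w : R -> R -> R) x z :=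
  2 * pdx a x z * pdx (pdx w) x z - 2 * pdx w x z * pdx (pdx a) x z - gam * pdx (pdx a) x z.

Lemma euler_derivatives (O : R -> R -> Prop) g gam a w x z : open2 O -> cr O a w -> O x z ->
  let u := vel gam a in let ax := pdx a in let wx := pdx w in let A := pdx ax in let B := pdx wx in
  let A3 := pdx A in let B3 := pdx B in
  [/\ deriv ((accx gam a w)^~ z) x (ax x z ^+ 2 + u x z * A x z + wx x z * (wx x z + gam) + w x z * B x z) /\
      deriv (accx gam a w x) z (wx x z * ax x z + gam * ax x z + u x z * B x z - ax x z * (wx x z + gam) - w x z * A x z),
      deriv ((accz g gam a w)^~ z) x (ax x z * wx x z + u x z * B x z - wx x z * ax x z - w x z * A x z) /\
      deriv (accz g gam a w x) z ((wx x z + gam) * wx x z - u x z * A x z + ax x z ^+ 2 - w x z * B x z),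
      deriv ((lapP gam a w)^~ z) x (lapPx gam a w x z) /\ deriv (lapP gam a w x) z (lapPz gam a w x z) &
      deriv ((lapPx gam a w)^~ z) x (2 * A x z ^+ 2 + 2 * ax x z * A3 x z + 2 * B x z ^+ 2 + 2 * wx x z * B3 x z + gam * B3 x z) /\
      deriv (lapPz gam a w x) z (2 * B x z ^+ 2 - 2 * ax x z * A3 x z + 2 * A x z ^+ 2 - 2 * wx x z * B3 x z - gam * B3 x z)].
Proof.
move=> oO crw Oxz u ax wx A B A3 B3.
have [ax1 az1 wx1 wz1 _] := crw _ _ Oxz.
have cx := cr_pdx oO crw; have [ax2 az2 wx2 wz2 _] := cx x z Oxz.
have cxx := cr_pdx oO cx; have [ax3 az3 wx3 wz3 _] := cxx x z Oxz.
have ux1 : deriv (u^~ z) x (ax x z).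
  by apply: deriv_eq (derivD ax1 (derivC (gam * z) x)) _; rewrite addr0.
have uz1 : deriv (u x) z (wx x z + gam).
  by apply: deriv_eq (derivD az1 (derivZ gam (derivI z))) _; rewrite mulr1.
have wg : deriv ((fun x z => wx x z + gam)^~ z) x (B x z).
  by apply: deriv_eq (derivD wx2 (derivC gam x)) _; rewrite addr0.
have wg' : deriv (fun z => wx x z + gam) z (- A x z).
  by apply: deriv_eq (derivD wz2 (derivC gam z)) _; rewrite addr0.
split; split.
- by apply: deriv_eq (derivD (derivM ux1 ax2) (derivM wx1 wg)) _; rewrite /ax /wx /A /B; ring.
- by apply: deriv_eq (derivD (derivM uz1 az2) (derivM wz1 wg')) _; rewrite /ax /wx /A /B; ring.
- by apply: deriv_eq (derivD (derivB (derivM ux1 wx2) (derivM wx1 ax2)) (derivC g x)) _; rewrite /ax /wx /A /B; ring.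
- by apply: deriv_eq (derivD (derivB (derivM uz1 wz2) (derivM wz1 az2)) (derivC g z)) _; rewrite /ax /wx /A /B; ring.
- by apply: deriv_eq (derivD (derivD (derivX2 ax2) (derivX2 wx2)) (derivZ gam wx2)) _; rewrite /lapPx /ax /wx /A /B; ring.
- by apply: deriv_eq (derivD (derivD (derivX2 az2) (derivX2 wz2)) (derivZ gam wz2)) _; rewrite /lapPz /ax /wx /A /B; ring.
- by apply: deriv_eq (derivD (derivD (derivM (derivZ 2 ax2) ax3) (derivM (derivZ 2 wx2) wx3)) (derivZ gam wx3)) _; rewrite /A3 /B3 /ax /wx /A /B; ring.
- by apply: deriv_eq (derivB (derivB (derivM (derivZ 2 az2) wz3) (derivM (derivZ 2 wz2) az3)) (derivZ gam az3)) _; rewrite /A3 /B3 /ax /wx /A /B; ring.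
Qed.
Section data.
Variables (O : R -> R -> Prop) (rho1 rho2 g gam1 gam2 : R) (a1 w1 p1 a2 w2 p2 : R -> R -> R).
Hypotheses (oO : open2 O) (cr1 : cr O a1 w1) (cr2 : cr O a2 w2).
Hypotheses (rho1_gt0 : 0 < rho1) (rho2_gt0 : 0 < rho2) (g_neq0 : g != 0)
  (gam1_neq0 : gam1 != 0) (gam2_neq0 : gam2 != 0).
Hypothesis dp1 : forall x z, O x z ->
  deriv (p1^~ z) x (- rho1 * accx gam1 a1 w1 x z) /\ deriv (p1 x) z (- rho1 * accz g gam1 a1 w1 x z).
Hypothesis dp2 : forall x z, O x z ->
  deriv (p2^~ z) x (- rho2 * accx gam2 a2 w2 x z) /\ deriv (p2 x) z (- rho2 * accz g gam2 a2 w2 x z).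
Hypothesis pp : forall x z, O x z -> p1 x z = p2 x z.

Let agx f1 f2 x z d d' : (forall x z, O x z -> rho1 * f1 x z = rho2 * f2 x z) -> O x z ->
  deriv (f1^~ z) x d -> deriv (f2^~ z) x d' -> rho1 * d = rho2 * d'.
Proof.
move=> ff Oxz d1 d2.
exact: (deriv_agree _ _ oO Oxz ff).1 (derivZ rho1 d1) (derivZ rho2 d2).
Qed.
Let agz f1 f2 x z d d' : (forall x z, O x z -> rho1 * f1 x z = rho2 * f2 x z) -> O x z ->
  deriv (f1 x) z d -> deriv (f2 x) z d' -> rho1 * d = rho2 * d'.
Proof.
move=> ff Oxz d1 d2.
exact: (deriv_agree _ _ oO Oxz ff).2 (derivZ rho1 d1) (derivZ rho2 d2).
Qed.

Let e1 x z : O x z -> rho1 * accx gam1 a1 w1 x z = rho2 * accx gam2 a2 w2 x z.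
Proof.
move=> Oxz; have [d1 _] := dp1 Oxz; have [d2 _] := dp2 Oxz.
by have := (deriv_agree _ _ oO Oxz pp).1 d1 d2; rewrite !mulNr => /oppr_inj.
Qed.
Let e2 x z : O x z -> rho1 * accz g gam1 a1 w1 x z = rho2 * accz g gam2 a2 w2 x z.
Proof.
move=> Oxz; have [_ d1] := dp1 Oxz; have [_ d2] := dp2 Oxz.
by have := (deriv_agree _ _ oO Oxz pp).2 d1 d2; rewrite !mulNr => /oppr_inj.
Qed.
Let e3 x z : O x z -> rho1 * lapP gam1 a1 w1 x z = rho2 * lapP gam2 a2 w2 x z.
Proof.
move=> Oxz.
have [[h1 _] [_ h2] _ _] := euler_derivatives g gam1 oO cr1 Oxz.
have [[i1 _] [_ i2] _ _] := euler_derivatives g gam2 oO cr2 Oxz.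
have := agx e1 Oxz h1 i1; have := agz e2 Oxz h2 i2.
by rewrite /lapP; lra.
Qed.
Let g12 x z : O x z ->
  rho1 * (vel gam1 a1 x z * pdx (pdx a1) x z + w1 x z * pdx (pdx w1) x z) =
  rho2 * (vel gam2 a2 x z * pdx (pdx a2) x z + w2 x z * pdx (pdx w2) x z) /\
  rho1 * (vel gam1 a1 x z * pdx (pdx w1) x z - w1 x z * pdx (pdx a1) x z) =
  rho2 * (vel gam2 a2 x z * pdx (pdx w2) x z - w2 x z * pdx (pdx a2) x z).
Proof.
move=> Oxz.
have [[h1 h2] [h3 h4] _ _] := euler_derivatives g gam1 oO cr1 Oxz.
have [[i1 i2] [i3 i4] _ _] := euler_derivatives g gam2 oO cr2 Oxz.
have := agx e1 Oxz h1 i1; have := agz e2 Oxz h4 i4.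
have := agz e1 Oxz h2 i2; have := agx e2 Oxz h3 i3.
by split; lra.
Qed.
Let e45 x z : O x z -> rho1 * lapPx gam1 a1 w1 x z = rho2 * lapPx gam2 a2 w2 x z /\
  rho1 * lapPz gam1 a1 w1 x z = rho2 * lapPz gam2 a2 w2 x z.
Proof.
move=> Oxz.
have [_ _ [h1 h2] _] := euler_derivatives g gam1 oO cr1 Oxz.
have [_ _ [i1 i2] _] := euler_derivatives g gam2 oO cr2 Oxz.
by split; [exact: agx e3 Oxz h1 i1|exact: agz e3 Oxz h2 i2].
Qed.

(** The bi-Laplacian of the pressure is a constant multiple of the density
    times the sum of squares that occurs here. *)
Lemma second_order_agree x z : O x z ->
  rho1 * (pdx (pdx a1) x z ^+ 2 + pdx (pdx w1) x z ^+ 2) =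
  rho2 * (pdx (pdx a2) x z ^+ 2 + pdx (pdx w2) x z ^+ 2).
Proof.
move=> Oxz.
have [_ _ _ [h1 h2]] := euler_derivatives g gam1 oO cr1 Oxz.
have [_ _ _ [i1 i2]] := euler_derivatives g gam2 oO cr2 Oxz.
have := agx (fun x z h => (e45 h).1) Oxz h1 i1.
have := agz (fun x z h => (e45 h).2) Oxz h2 i2.
lra.
Qed.

(** In complex notation, with q = u - i v the velocity and A - i B its second
    derivative: the relations say that r q conj(A - i B) and
    r (2 x - i (2 y + c)) conj(A - i B) agree in the two layers. As also
    r |A - i B|^2 agrees, both q and 2 x - i (2 y + c) are multiplied by the same
    complex number from one layer to the other. *)
Lemma ratio_algebra (r1 r2 G c1 c2 u1 v1 x1 y1 A1 B1 u2 v2 x2 y2 A2 B2 : R) :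
  0 < r1 -> 0 < r2 -> 0 < A2 ^+ 2 + B2 ^+ 2 ->
  r1 * (u1 * A1 + v1 * B1) = r2 * (u2 * A2 + v2 * B2) ->
  r1 * (u1 * B1 - v1 * A1) = r2 * (u2 * B2 - v2 * A2) ->
  r1 * (2 * x1 * A1 + 2 * y1 * B1 + c1 * B1) = r2 * (2 * x2 * A2 + 2 * y2 * B2 + c2 * B2) ->
  r1 * (2 * x1 * B1 - 2 * y1 * A1 - c1 * A1) = r2 * (2 * x2 * B2 - 2 * y2 * A2 - c2 * A2) ->
  r1 * (A1 ^+ 2 + B1 ^+ 2) = r2 * (A2 ^+ 2 + B2 ^+ 2) ->
  r1 * (u1 * x1 + v1 * (y1 + c1)) = r2 * (u2 * x2 + v2 * (y2 + c2)) ->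
  r1 * (u1 * y1 - v1 * x1 + G) = r2 * (u2 * y2 - v2 * x2 + G) ->
  let k := (A1 * A2 + B1 * B2) / (A2 ^+ 2 + B2 ^+ 2) in
  let s := (A1 * B2 - B1 * A2) / (A2 ^+ 2 + B2 ^+ 2) in
  [/\ u1 = k * u2 + s * v2, v1 = k * v2 - s * u2,
      r1 * c1 * v1 = r2 * c2 * v2 & r1 * c1 * u1 - r2 * c2 * u2 = 2 * G * (r1 - r2)].
Proof.
move=> r10 r20 N20 g1 g2 l1 l2 N e1' e2'.
set N2 := A2 ^+ 2 + B2 ^+ 2 in N N20 *; move=> k s.
have N2n : N2 != 0 by rewrite gt_eqF.
have r2n : r2 != 0 by rewrite gt_eqF.
have r1n : r1 != 0 by rewrite gt_eqF.
have kN : k * N2 = A1 * A2 + B1 * B2 by rewrite /k divfK.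
have sN : s * N2 = A1 * B2 - B1 * A2 by rewrite /s divfK.
have key p q : r2 * N2 * p = r2 * N2 * q -> p = q.
  by apply: mulfI; rewrite mulf_neq0.
have Eu : u1 = k * u2 + s * v2.
  apply: key; transitivity (r2 * (k * N2 * u2 + s * N2 * v2)); last by ring.
  rewrite -N kN sN.
  transitivity (A1 * (r1 * (u1 * A1 + v1 * B1)) + B1 * (r1 * (u1 * B1 - v1 * A1))); first by ring.
  by rewrite g1 g2; ring.
have Ev : v1 = k * v2 - s * u2.
  apply: key; transitivity (r2 * (k * N2 * v2 - s * N2 * u2)); last by ring.
  rewrite -N kN sN.
  transitivity (B1 * (r1 * (u1 * A1 + v1 * B1)) - A1 * (r1 * (u1 * B1 - v1 * A1))); first by ring.
  by rewrite g1 g2; ring.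
have Ex : 2 * x1 = k * (2 * x2) + s * (2 * y2 + c2).
  apply: key; transitivity (r2 * (k * N2 * (2 * x2) + s * N2 * (2 * y2 + c2))); last by ring.
  rewrite -N kN sN.
  transitivity (A1 * (r1 * (2 * x1 * A1 + 2 * y1 * B1 + c1 * B1)) + B1 * (r1 * (2 * x1 * B1 - 2 * y1 * A1 - c1 * A1))); first by ring.
  by rewrite l1 l2; ring.
have Ey : 2 * y1 + c1 = k * (2 * y2 + c2) - s * (2 * x2).
  apply: key; transitivity (r2 * (k * N2 * (2 * y2 + c2) - s * N2 * (2 * x2))); last by ring.
  rewrite -N kN sN.
  transitivity (B1 * (r1 * (2 * x1 * A1 + 2 * y1 * B1 + c1 * B1)) - A1 * (r1 * (2 * x1 * B1 - 2 * y1 * A1 - c1 * A1))); first by ring.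
  by rewrite l1 l2; ring.
have ks : r1 * (k ^+ 2 + s ^+ 2) = r2.
  apply: (@mulfI _ (N2 ^+ 2)); first by rewrite sqrf_eq0.
  transitivity (r1 * ((k * N2) ^+ 2 + (s * N2) ^+ 2)); first by ring.
  rewrite kN sN; transitivity (r1 * (A1 ^+ 2 + B1 ^+ 2) * N2); first by rewrite /N2; ring.
  by rewrite N; ring.
have D1 : r1 * (u1 * (2 * x1) + v1 * (2 * y1 + c1)) = r2 * (u2 * (2 * x2) + v2 * (2 * y2 + c2)).
  by rewrite Eu Ev Ex Ey -ks; ring.
have D2 : r1 * (u1 * (2 * y1 + c1) - v1 * (2 * x1)) = r2 * (u2 * (2 * y2 + c2) - v2 * (2 * x2)).
  by rewrite Eu Ev Ex Ey -ks; ring.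
by split=> //; lra.
Qed.

Let N1 x z := pdx (pdx a1) x z ^+ 2 + pdx (pdx w1) x z ^+ 2.
Let N2 x z := pdx (pdx a2) x z ^+ 2 + pdx (pdx w2) x z ^+ 2.

Let N12 x z : O x z -> 0 < N1 x z -> 0 < N2 x z.
Proof.
move=> Oxz n1; rewrite -(pmulr_rgt0 _ rho2_gt0) -second_order_agree//.
by rewrite pmulr_rgt0.
Qed.

(** By the algebra above q1 = k q2 with k the quotient of the second
    derivatives. Comparing the accelerations shows that rho gam w agrees, and
    rho gam u up to the constant 2 g (rho1 - rho2). Differentiating twice gives
    k = rho2 gam2 / (rho1 gam1), and differentiating once shows that rho gam^2
    agrees, so k = gam1 / gam2. Inserting this into the relation for u makes the
    constant zero. *)
Lemma reconstruction x z : O x z -> 0 < N1 x z ->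
  [/\ rho1 = rho2, gam1 ^+ 2 = gam2 ^+ 2, gam2 * vel gam1 a1 x z = gam1 * vel gam2 a2 x z &
      gam2 * w1 x z = gam1 * w2 x z].
Proof.
move=> Oxz n1.
pose O' x z := O x z /\ 0 < N1 x z.
have oO' : open2 O'.
  move=> x' z' [Oxz' n1'].
  have c1 := cr_pdx oO (cr_pdx oO cr1).
  have [cA cB] := cr_cont2 oO (cr_pdx oO (cr_pdx oO (cr1))) Oxz'.
  have [cA1 cB1] := cr_cont2 oO (cr_pdx oO cr1) Oxz'.
  have [_ _ _ _ [cA2 cB2]] := (cr_pdx oO cr1) x' z' Oxz'.
  have cN : cont2 N1 x' z'.
    by apply: cont2D; (apply: (@cont2_gen _ (fun a _ => a ^+ 2)); [| |apply: cont2M; exact: cont2X]) => //; exact: cont2C.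
  have [d d0 Hd] := (cont2P _ _ _).1 cN _ n1'.
  have [r r0 Hr] := oO Oxz'.
  exists (Num.min r d); first by rewrite lt_min r0.
  move=> s t; rewrite !lt_min => /andP[s1 s2] /andP[t1 t2]; split; first exact: Hr.
  by have := Hd s t s2 t2; rewrite ltr_norml => /andP[]; lra.
have V x' z' : O' x' z' -> [/\ rho1 * gam1 * w1 x' z' = rho2 * gam2 * w2 x' z' &
   rho1 * gam1 * vel gam1 a1 x' z' - rho2 * gam2 * vel gam2 a2 x' z' = 2 * g * (rho1 - rho2)].
  move=> [Op n1']; have [h1 h2] := g12 Op; have [h4 h5] := e45 Op.
  by have [] := ratio_algebra rho1_gt0 rho2_gt0 (N12 Op n1') h1 h2 h4 h5 (second_order_agree Op) (e1 Op) (e2 Op).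
have V1 x' z' : O' x' z' -> rho1 * gam1 * w1 x' z' = rho2 * gam2 * w2 x' z' by case/V.
have V2 x' z' : O' x' z' -> rho1 * gam1 * vel gam1 a1 x' z' = rho2 * gam2 * vel gam2 a2 x' z' + 2 * g * (rho1 - rho2) by case/V => _; lra.
have D x' z' : O' x' z' -> [/\ rho1 * gam1 * pdx w1 x' z' = rho2 * gam2 * pdx w2 x' z',
   rho1 * gam1 * pdx a1 x' z' = rho2 * gam2 * pdx a2 x' z' &
   rho1 * gam1 * (pdx w1 x' z' + gam1) = rho2 * gam2 * (pdx w2 x' z' + gam2)].
  move=> Op'; have [Op _] := Op'.
  have [ax1 az1 wx1 wz1 _] := cr1 Op; have [ax2 az2 wx2 wz2 _] := cr2 Op.
  have du1 := derivD ax1 (derivC (gam1 * z') x').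
  have du2 := derivD ax2 (derivC (gam2 * z') x').
  have dz1 := derivD az1 (derivZ gam1 (derivI z')).
  have dz2 := derivD az2 (derivZ gam2 (derivI z')).
  have K := (2 * g * (rho1 - rho2)).
  have F1 := (deriv_agree _ _ oO' Op' V1).1 (derivZ (rho1 * gam1) wx1) (derivZ (rho2 * gam2) wx2).
  have F2 := (deriv_agree _ _ oO' Op' V2).1 (derivZ (rho1 * gam1) du1) (derivD (derivZ (rho2 * gam2) du2) (derivC (2 * g * (rho1 - rho2)) x')).
  have F3 := (deriv_agree _ _ oO' Op' V2).2 (derivZ (rho1 * gam1) dz1) (derivD (derivZ (rho2 * gam2) dz2) (derivC (2 * g * (rho1 - rho2)) z')).
  by split; [exact: F1|move: F2; rewrite !addr0|move: F3; rewrite addr0 !mulr1].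
have Op' : O' x z by [].
have [D1 D2 D3] := D x z Op'.
have G : rho1 * gam1 ^+ 2 = rho2 * gam2 ^+ 2 by lra.
have [ax1 _ wx1 _ _] := (cr_pdx oO cr1) x z Oxz; have [ax2 _ wx2 _ _] := (cr_pdx oO cr2) x z Oxz.
have D1' x' z' : O' x' z' -> rho1 * gam1 * pdx w1 x' z' = rho2 * gam2 * pdx w2 x' z' by case/D.
have D2' x' z' : O' x' z' -> rho1 * gam1 * pdx a1 x' z' = rho2 * gam2 * pdx a2 x' z' by case/D.
have F1 := (deriv_agree _ _ oO' Op' D1').1 (derivZ (rho1 * gam1) wx1) (derivZ (rho2 * gam2) wx2).
have F2 := (deriv_agree _ _ oO' Op' D2').1 (derivZ (rho1 * gam1) ax1) (derivZ (rho2 * gam2) ax2).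
have [h1 h2] := g12 Oxz; have [h4 h5] := e45 Oxz.
have n2 := N12 Oxz n1.
have [Eu Ev E3 E4] := ratio_algebra rho1_gt0 rho2_gt0 n2 h1 h2 h4 h5 (second_order_agree Oxz) (e1 Oxz) (e2 Oxz).
have rg : rho1 * gam1 != 0 by rewrite mulf_neq0// gt_eqF.
move: F1 F2 Eu Ev n2; rewrite /N2.
set A1 := pdx (pdx a1) x z; set B1 := pdx (pdx w1) x z; set A2 := pdx (pdx a2) x z; set B2 := pdx (pdx w2) x z.
set U1 := vel _ _ _ _; set U2 := vel _ _ _ _ => F1 F2 Eu Ev n2.
have n2n : A2 ^+ 2 + B2 ^+ 2 != 0 by rewrite gt_eqF.
have s0 : A1 * B2 - B1 * A2 = 0.
  apply: (mulfI rg); rewrite mulr0.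
  transitivity ((rho1 * gam1 * A1) * B2 - (rho1 * gam1 * B1) * A2); first by ring.
  by rewrite F1 F2; ring.
have k0 : rho1 * gam1 * ((A1 * A2 + B1 * B2) / (A2 ^+ 2 + B2 ^+ 2)) = rho2 * gam2.
  apply: (mulIf n2n); rewrite mulrA divfK//.
  transitivity ((rho1 * gam1 * A1) * A2 + (rho1 * gam1 * B1) * B2); first by ring.
  by rewrite F1 F2; ring.
move: Eu Ev; rewrite s0 mul0r !mul0r subr0 addr0; set k := _ / _ in k0 * => Eu Ev.
have kk : k * gam2 = gam1.
  apply: (mulfI rg); rewrite mulrA k0; lra.
have E5 : gam2 * U1 = gam1 * U2 by rewrite Eu -kk; ring.
have E6 : gam2 * w1 x z = gam1 * w2 x z by rewrite Ev -kk; ring.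
have R12 : rho1 = rho2.
  have : 2 * g * (rho1 - rho2) = 0.
    rewrite -E4 -/U1 -/U2; apply: (mulfI gam2_neq0); rewrite mulr0.
    transitivity (rho1 * gam1 * (gam2 * U1) - rho2 * gam2 ^+ 2 * U2); first by ring.
    by rewrite E5 -G; ring.
  by move/eqP; rewrite !mulf_eq0 pnatr_eq0 (negbTE g_neq0)/= subr_eq0 => /eqP.
split => //.
by move: G; rewrite R12 => /mulfI; apply; rewrite gt_eqF.
Qed.
End data.
End reconstruction.

(** * Reduction of a layer to a planar flow *)

Section layer.
Context {R : realType}.
Implicit Types (x y z t : R).

Section facts.
Variables (dom : R -> R -> R -> Prop) (zb r0 rho g gam M : R).
Variables (u v w p ux uy uz vx vy vz wx wy wz px py pz : R -> R -> R -> R).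
Hypotheses (r0_gt0 : 0 < r0) (rho_gt0 : 0 < rho) (gam_neq0 : gam != 0).
Hypothesis dom_open : forall x y z, dom x y z -> exists2 r : R, 0 < r &
  forall x' y' z', `|x' - x| < r -> `|y' - y| < r -> `|z' - z| < r -> dom x' y' z'.
Hypothesis dom_base : forall x y z, `|z - zb| < r0 -> dom x y z.
Hypothesis dom_star : forall x y z t, dom x y z -> btw zb z t -> dom x y t.
Hypothesis du : forall x y z, dom x y z -> [/\ deriv (fun s => u s y z) x (ux x y z),
  deriv (fun s => u x s z) y (uy x y z) & deriv (fun s => u x y s) z (uz x y z)].
Hypothesis dv : forall x y z, dom x y z -> [/\ deriv (fun s => v s y z) x (vx x y z),
  deriv (fun s => v x s z) y (vy x y z) & deriv (fun s => v x y s) z (vz x y z)].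
Hypothesis dw : forall x y z, dom x y z -> [/\ deriv (fun s => w s y z) x (wx x y z),
  deriv (fun s => w x s z) y (wy x y z) & deriv (fun s => w x y s) z (wz x y z)].
Hypothesis dp : forall x y z, dom x y z -> [/\ deriv (fun s => p s y z) x (px x y z),
  deriv (fun s => p x s z) y (py x y z) & deriv (fun s => p x y s) z (pz x y z)].
Hypothesis cux : forall x y z, dom x y z -> cont2 (fun x z => ux x y z) x z.
Hypothesis cwx : forall x y z, dom x y z -> cont2 (fun x z => wx x y z) x z.
Hypothesis div0 : forall x y z, dom x y z -> ux x y z + vy x y z + wz x y z = 0.
Hypothesis curl1 : forall x y z, dom x y z ->
  [/\ wy x y z = vz x y z, uz x y z - wx x y z = gam & vx x y z = uy x y z].
Hypothesis momentum : forall x y z, dom x y z ->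
  [/\ px x y z = - rho * (u x y z * ux x y z + v x y z * uy x y z + w x y z * uz x y z),
      py x y z = - rho * (u x y z * vx x y z + v x y z * vy x y z + w x y z * vz x y z) &
      pz x y z = - rho * (u x y z * wx x y z + v x y z * wy x y z + w x y z * wz x y z + g)].
Hypothesis bound_v : forall x y z, dom x y z -> `|v x y z| <= M.

Let B x y z := p x y z + rho * ((u x y z ^+ 2 + v x y z ^+ 2 + w x y z ^+ 2) / 2 + g * z).

(** The Bernoulli function: its gradient is the density times the vector
    product of velocity and vorticity, so it is independent of y. *)
Let dB x y z : dom x y z -> [/\ deriv (fun s => B s y z) x (- (rho * gam) * w x y z),
  deriv (fun s => B x s z) y 0 & deriv (fun s => B x y s) z (rho * gam * u x y z)].
Proof.
move=> D; have [dux duy duz] := du D; have [dvx dvy dvz] := dv D.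
have [dwx dwy dwz] := dw D; have [dpx dpy dpz] := dp D.
have [c1 c2 c3] := curl1 D; have [e1 e2 e3] := momentum D.
have half (f1 f2 f3 fg f : R -> R) s a1 a2 a3 a4 a5 : deriv f1 s a1 -> deriv f2 s a2 -> deriv f3 s a3 ->
   deriv fg s a4 -> deriv f s a5 ->
   deriv (fun t => f t + rho * ((f1 t ^+ 2 + f2 t ^+ 2 + f3 t ^+ 2) / 2 + fg t)) s
     (a5 + rho * (f1 s * a1 + f2 s * a2 + f3 s * a3 + a4)).
  move=> d1 d2 d3 d4 d5.
  have Q := derivZ rho (derivD (derivZ 2^-1 (derivD (derivD (derivX2 d1) (derivX2 d2)) (derivX2 d3))) d4).
  apply: deriv_eq (deriv_ext _ (derivD d5 Q)) _ => [t /=|/=]; [|by field].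
  by rewrite [_ / 2]mulrC.
have gI : deriv (fun s => g * s) z g.
  by apply: deriv_eq (derivZ g (derivI z)) _; rewrite mulr1.
split.
- by apply: deriv_eq (@half (fun s => u s y z) (fun s => v s y z) (fun s => w s y z) (fun=> g * z) (fun s => p s y z) _ _ _ _ _ _ dux dvx dwx (derivC (g * z) x) dpx) _; rewrite e1 c3 -c2; ring.
- by apply: deriv_eq (@half (fun s => u x s z) (fun s => v x s z) (fun s => w x s z) (fun=> g * z) (fun s => p x s z) _ _ _ _ _ _ duy dvy dwy (derivC (g * z) y) dpy) _; rewrite e2 c3 c1; ring.
- by apply: deriv_eq (@half (fun s => u x y s) (fun s => v x y s) (fun s => w x y s) (fun s => g * s) (fun s => p x y s) _ _ _ _ _ _ duz dvz dwz gI dpz) _; rewrite e3 c1 -c2; ring.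
Qed.

(** On a box the Bernoulli function does not depend on y, hence neither do
    its derivatives in x and z, which are multiples of w and u. *)
Let local_y x y z : dom x y z -> exists2 r : R, 0 < r & forall x' y' z',
  `|x' - x| < r -> `|y' - y| < r -> `|z' - z| < r ->
  [/\ dom x' y' z', u x' y' z' = u x' y z' & w x' y' z' = w x' y z'].
Proof.
move=> D; have [r r_gt0 Hr] := dom_open D.
have y0 : `|y - y| < r by rewrite subrr normr0.
have inb y' t : `|y' - y| < r -> btw y y' t -> `|t - y| < r.
  rewrite /btw !ltr_norml => /andP[? ?] /orP[]/andP[? ?]; apply/andP; split; lra.
have BB x' y' z' : `|x' - x| < r -> `|y' - y| < r -> `|z' - z| < r -> B x' y' z' = B x' y z'.
  move=> hx hy hz; apply: (@deriv0_const _ (fun s => B x' s z')) => t bt.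
  by have [_] := dB (Hr _ _ _ hx (inb _ _ hy bt) hz).
have nb x0 x' t : `|x' - x0| < r -> `|t - x'| < r - `|x' - x0| -> `|t - x0| < r.
  move=> h1 h2; have : `|t - x0| <= `|t - x'| + `|x' - x0|.
    by apply: le_trans (ler_normD _ _); rewrite addrA subrK.
  lra.
exists r => // x' y' z' hx hy hz; split; first exact: Hr.
- apply: (@mulfI _ (rho * gam)); first by rewrite mulf_neq0// gt_eqF.
  have [_ _ d1] := dB (Hr _ _ _ hx hy hz); have [_ _ d2] := dB (Hr _ _ _ hx y0 hz).
  apply: deriv_uniq d2; apply: deriv_near d1; first by rewrite -subr_gt0 in hz; exact: hz.
  by move=> t ht; apply: BB => //; apply: nb ht.
- apply: (@mulfI _ (- (rho * gam))); first by rewrite oppr_eq0 mulf_neq0// gt_eqF.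
  have [d1 _ _] := dB (Hr _ _ _ hx hy hz); have [d2 _ _] := dB (Hr _ _ _ hx y0 hz).
  apply: deriv_uniq d2; apply: (@deriv_near _ _ _ _ _ (r - `|x' - x|)) d1; first by rewrite subr_gt0.
  by move=> t ht; apply: BB => //; apply: nb ht.
Qed.

Let transverse x y z : dom x y z -> [/\ uy x y z = 0, wy x y z = 0, vx x y z = 0 & vz x y z = 0].
Proof.
move=> D; have [c1 c2 c3] := curl1 D.
have [r r_gt0 Hr] := local_y D.
have x0 : `|x - x| < r by rewrite subrr normr0.
have z0 : `|z - z| < r by rewrite subrr normr0.
have [_ duy _] := du D; have [_ dwy _] := dw D.
have U0 : uy x y z = 0.
  apply: deriv_uniq (derivC (u x y z) y); apply: deriv_near duy => [|t ht]; first exact: r_gt0.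
  by have [] := Hr _ _ _ x0 ht z0.
have W0 : wy x y z = 0.
  apply: deriv_uniq (derivC (w x y z) y); apply: deriv_near dwy => [|t ht]; first exact: r_gt0.
  by have [] := Hr _ _ _ x0 ht z0.
by split=> //; rewrite ?c3 // -c1.
Qed.

Let vy_local x y z : dom x y z -> exists2 r : R, 0 < r & forall y',
  `|y' - y| < r -> vy x y' z = vy x y z.
Proof.
move=> D; have [r r_gt0 Hr] := local_y D.
have x0 : `|x - x| < r by rewrite subrr normr0.
have z0 : `|z - z| < r by rewrite subrr normr0.
exists r => // y' hy; have [D' _ _] := Hr _ _ _ x0 hy z0.
have [d1 _ _] := du D; have [d1' _ _] := du D'; have [_ _ d3] := dw D; have [_ _ d3'] := dw D'.
have E1 : ux x y' z = ux x y z.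
  by apply: deriv_uniq d1; apply: deriv_near d1' => [|t ht]; [exact: r_gt0|have [] := Hr _ _ _ ht hy z0].
have E3 : wz x y' z = wz x y z.
  by apply: deriv_uniq d3; apply: deriv_near d3' => [|t ht]; [exact: r_gt0|have [] := Hr _ _ _ x0 hy ht].
by have := div0 D; have := div0 D'; lra.
Qed.

Let base_dom x y : dom x y zb. Proof. by apply: dom_base; rewrite subrr normr0. Qed.

Let vy_base x y y' : vy x y' zb = vy x y zb.
Proof.
apply: (@deriv0_const _ (fun s => vy x s zb)) => t _.
have [r r_gt0 Hr] := vy_local (base_dom x t).
by apply: (deriv_near r_gt0) (derivC (vy x t zb) t) => s hs; rewrite Hr.
Qed.

Let vy_base0 x y : vy x y zb = 0.
Proof.
apply/eqP/negPn/negP => n0.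
pose c := vy x y zb.
have L s : v x s zb - c * s = v x 0 zb.
  have K : v x s zb - c * s = v x 0 zb - c * 0.
    apply: (@deriv0_const _ (fun s => v x s zb - c * s)) => t _.
    have [_ d _] := dv (base_dom x t).
    apply: deriv_eq (derivB d (derivZ c (derivI t))) _; rewrite (vy_base x y t) -/c; ring.
  by rewrite K mulr0 subr0.
have M0 : 0 <= M by apply: le_trans (bound_v (base_dom x y)).
have := bound_v (base_dom x ((2 * M + 1) / c)); have := bound_v (base_dom x 0).
have -> : v x ((2 * M + 1) / c) zb = v x 0 zb + (2 * M + 1).
  by rewrite -(L ((2 * M + 1) / c)); field.
by rewrite !ler_norml => /andP[? ?] /andP[? ?]; lra.
Qed.

(** The derivatives of v in x and z vanish with the transverse derivatives
    of u and w. On the base plane the y-derivative does not depend on y, and v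
    would be unbounded if it were not zero. *)
Lemma transverse_const x y z : dom x y z -> v x y z = v 0 0 zb.
Proof.
move=> D; transitivity (v x y zb).
  apply: (@deriv0_const _ (fun s => v x y s)) => t bt.
  have D' := dom_star D bt; have [_ _ d] := dv D'.
  by have [_ _ _ E] := transverse D'; rewrite E in d.
transitivity (v x 0 zb).
  apply: (@deriv0_const _ (fun s => v x s zb)) => t bt.
  by have [_ d _] := dv (base_dom x t); rewrite vy_base0 in d.
apply: (@deriv0_const _ (fun s => v s 0 zb)) => t bt.
have [d _ _] := dv (base_dom t 0).
by have [_ _ E _] := transverse (base_dom t 0); rewrite E in d.
Qed.

Let vy0 x y z : dom x y z -> vy x y z = 0.
Proof.
move=> D; have [_ d _] := dv D.
apply: deriv_uniq (derivC (v 0 0 zb) y).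
have [r r_gt0 Hr] := dom_open D.
have n0 (s : R) : `|s - s| < r by rewrite subrr normr0.
by apply: (deriv_near r_gt0) d => t ht; apply: transverse_const; apply: Hr.
Qed.

Let col y x z := dom x y z.
Let col_open y : open2 (col y).
Proof.
move=> x z D; have [r r_gt0 Hr] := dom_open D; exists r => // x' z' hx hz.
by apply: Hr => //; rewrite subrr normr0.
Qed.

Let col_cr y : cr (col y) (fun x z => u x y z - gam * z) (fun x z => w x y z) /\
  (forall x z, dom x y z -> pdx (fun x z => u x y z - gam * z) x z = ux x y z /\
      pdx (fun x z => w x y z) x z = wx x y z).
Proof.
apply: cr_intro => [|x z D]; first exact: col_open.
have [d1 _ d2] := du D; have [d3 _ d4] := dw D; have [_ c2 _] := curl1 D.
have dz : deriv (fun z => gam * z) z gam.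
  by apply: deriv_eq (derivZ gam (derivI z)) _; rewrite mulr1.
split.
- by apply: deriv_eq (derivB d1 (derivC (gam * z) x)) _; rewrite subr0.
- by apply: deriv_eq (derivB d2 dz) _; lra.
- exact: d3.
- by apply: deriv_eq d4 _; have := div0 D; rewrite (vy0 D); lra.
- by split; [exact: cux|exact: cwx].
Qed.

(** The fibres of the layer in the direction y need not be connected. The
    fields in two columns agree near the base plane, hence by unique
    continuation up to the height where one of the columns ends. *)
Lemma spanwise_indep x y y' z : dom x y z -> dom x y' z ->
  u x y z = u x y' z /\ w x y z = w x y' z.
Proof.
move=> D D'.
pose O x z := dom x y z /\ dom x y' z.
have oO : open2 O.
  move=> x1 z1 [h1 h2]; have [r r1 Hr] := col_open h1; have [r' r1' Hr'] := col_open h2.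
  exists (Num.min r r'); first by rewrite lt_min r1.
  by move=> x2 z2; rewrite !lt_min => /andP[? ?] /andP[? ?]; split; [exact: Hr|exact: Hr'].
have cy := cr_sub (fun x z (h : O x z) => h.1) (col_cr y).1.
have cy' := cr_sub (fun x z (h : O x z) => h.2) (col_cr y').1.
have [cd _] := cr_comb 1 oO cy cy'.
have base x1 z1 : `|z1 - zb| < r0 -> u x1 y z1 = u x1 y' z1 /\ w x1 y z1 = w x1 y' z1.
  move=> hz; split; apply/esym.
    apply: (@deriv0_const _ (fun s => u x1 s z1)) => t _.
    have Dt := dom_base x1 t hz; have [_ d _] := du Dt.
    by have [E _ _ _] := transverse Dt; rewrite E in d.
  apply: (@deriv0_const _ (fun s => w x1 s z1)) => t _.
  have Dt := dom_base x1 t hz; have [_ d _] := dw Dt.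
  by have [_ E _ _] := transverse Dt; rewrite E in d.
have j0 := @jet0_near R (fun x z => u x y z - gam * z - 1 * (u x y' z - gam * z)) (fun x z => w x y z - 1 * w x y' z) x zb r0 r0_gt0.
have [t bt|x1 z1 _ hz|] := (jet_vert oO cd _ (j0 _) (btwr zb z) 0%N).
- by split; apply: dom_star bt.
- by rewrite /=; have [-> ->] := base x1 z1 hz; split; ring.
by move=> /= h1 h2; split; lra.
Qed.

(** The vertical derivatives agree in the two columns, and the pressures
    agree on the base plane. *)
Lemma pressure_indep x y y' z : dom x y z -> dom x y' z -> p x y z = p x y' z.
Proof.
move=> D D'; apply/eqP; rewrite -subr_eq0; apply/eqP.
have dpy x1 y1 z1 : dom x1 y1 z1 -> deriv (fun s => p x1 s z1) y1 0.
  move=> D1; have [_ d _] := dp D1; have [_ E _] := momentum D1.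
  by apply: deriv_eq d _; rewrite E; have [_ _ -> ->] := transverse D1; rewrite (vy0 D1); ring.
transitivity (p x y zb - p x y' zb); last first.
  apply/eqP; rewrite subr_eq0; apply/eqP.
  by apply: (@deriv0_const _ (fun s => p x s zb)) => t _; exact: dpy.
apply: (@deriv0_const _ (fun s => p x y s - p x y' s)) => t bt.
have Dt := dom_star D bt; have Dt' := dom_star D' bt.
have [_ _ d] := dp Dt; have [_ _ d'] := dp Dt'.
apply: deriv_eq (derivB d d') _.
have [_ _ ->] := momentum Dt; have [_ _ ->] := momentum Dt'.
have [_ -> _ _] := transverse Dt; have [_ -> _ _] := transverse Dt'.
have [Eu Ew] := spanwise_indep Dt Dt'.
have [cy py1] := col_cr y; have [cy' py1'] := col_cr y'.
have [E1 E2] := py1 _ _ Dt; have [E1' E2'] := py1' _ _ Dt'.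
have [r r_gt0 Hr] := col_open Dt; have [r' r_gt0' Hr'] := col_open Dt'.
have n0 (s : R) : `|s - s| < Num.min r r' by rewrite subrr normr0 lt_min r_gt0.
have sp x1 z1 : `|x1 - x| < Num.min r r' -> `|z1 - t| < Num.min r r' ->
    u x1 y z1 = u x1 y' z1 /\ w x1 y z1 = w x1 y' z1.
  rewrite !lt_min => /andP[? ?] /andP[? ?].
  by apply: spanwise_indep; [exact: Hr|exact: Hr'].
have m0 : 0 < Num.min r r' by rewrite lt_min r_gt0.
have Ewx : wx x y t = wx x y' t.
  have [d1 _ _] := dw Dt; have [d1' _ _] := dw Dt'.
  by apply: deriv_uniq d1'; apply: (deriv_near m0) d1 => s hs; exact: (sp _ _ hs (n0 t)).2.
have Ewz : wz x y t = wz x y' t.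
  have [_ _ d1] := dw Dt; have [_ _ d1'] := dw Dt'.
  by apply: deriv_uniq d1'; apply: (deriv_near m0) d1 => s hs; exact: (sp _ _ (n0 x) hs).2.
by rewrite Eu Ew Ewx Ewz; ring.
Qed.

Definition shadow x z := exists y, dom x y z.

Let slice (f : R -> R -> R -> R) x z : R :=
  if pselect (shadow x z) is left h then f x (sval (cid h)) z else 0.
Let sliceE f x y z : (forall x y y' z, dom x y z -> dom x y' z -> f x y z = f x y' z) ->
  dom x y z -> f x y z = slice f x z.
Proof.
move=> H D; rewrite /slice; case: pselect => [h|[]]; last by exists y.
by case: cid => y' D' /=; exact: H.
Qed.

(** The three-dimensional flow in the layer is the lift of a planar flow on
    the projected domain; this is where the third dimension disappears from
    the equations and survives in the shape of the interface only. *)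
Lemma planar_layer : exists (U W Q : R -> R -> R) (V : R),
  [/\ forall x y z, dom x y z ->
        [/\ u x y z = U x z, v x y z = V, w x y z = W x z & p x y z = Q x z],
      open2 shadow, cr shadow (fun x z => U x z - gam * z) W &
      forall x z, shadow x z ->
        deriv (Q^~ z) x (- rho * accx gam (fun x z => U x z - gam * z) W x z) /\
        deriv (Q x) z (- rho * accz g gam (fun x z => U x z - gam * z) W x z)].
Proof.
exists (slice u), (slice w), (slice p), (v 0 0 zb).
have Eu x y z : dom x y z -> u x y z = slice u x z.
  by apply: sliceE => ? ? ? ? D D'; have [] := spanwise_indep D D'.
have Ew x y z : dom x y z -> w x y z = slice w x z.
  by apply: sliceE => ? ? ? ? D D'; have [] := spanwise_indep D D'.
have Ep x y z : dom x y z -> p x y z = slice p x z.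
  by apply: sliceE => ? ? ? ?; exact: pressure_indep.
have os : open2 shadow.
  by move=> x z [y D]; have [r r1 Hr] := col_open D; exists r => // x' z' hx hz; exists y; exact: Hr.
have col' y : cr (col y) (fun x z => slice u x z - gam * z) (slice w).
  apply: cr_near (col_cr y).1; first exact: col_open.
  by move=> x z D; rewrite (Eu _ _ _ D) (Ew _ _ _ D).
have pd x y z : dom x y z -> pdx (fun x z => slice u x z - gam * z) x z = ux x y z /\ pdx (slice w) x z = wx x y z.
  move=> D; have [r r1 Hr] := col_open D.
  have n0 : `|z - z| < r by rewrite subrr normr0.
  have [d1 _ _] := du D; have [d2 _ _] := dw D.
  split; apply: pdxE.
    apply: (deriv_near r1) (deriv_eq (derivB d1 (derivC (gam * z) x)) (subr0 _)) => s hs /=.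
    by rewrite (Eu s y z)//; exact: Hr.
  by apply: (deriv_near r1) d2 => s hs /=; rewrite (Ew s y z)//; exact: Hr.
split=> //.
- by move=> x y z D; rewrite (transverse_const D) -(Eu _ _ _ D) -(Ew _ _ _ D) -(Ep _ _ _ D).
- by move=> x z [y D]; exact: col' D.
move=> x z [y D]; have [r r1 Hr] := col_open D.
have n0 (s : R) : `|s - s| < r by rewrite subrr normr0.
have [d1 _ d2] := dp D; have [e1 e2 e3] := momentum D; have [h1 h2] := pd _ _ _ D.
have [t1 t2 t3 t4] := transverse D; have [_ c2 _] := curl1 D.
have -> : accx gam (fun x z => slice u x z - gam * z) (slice w) x z =
   u x y z * ux x y z + v x y z * uy x y z + w x y z * uz x y z.
  by rewrite /accx /vel h1 h2 -(Eu _ _ _ D) -(Ew _ _ _ D) t1 -c2; ring.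
have -> : accz g gam (fun x z => slice u x z - gam * z) (slice w) x z =
   u x y z * wx x y z + v x y z * wy x y z + w x y z * wz x y z + g.
  rewrite /accz /vel h1 h2 -(Eu _ _ _ D) -(Ew _ _ _ D) t2.
  have -> : wz x y z = - ux x y z by have := div0 D; rewrite (vy0 D); lra.
  by ring.
rewrite -e1 -e3; split.
  by apply: (deriv_near r1) d1 => s hs; apply: Ep; exact: Hr.
by apply: (deriv_near r1) d2 => s hs; apply: Ep; exact: Hr.
Qed.
End facts.
End layer.

(** * Surfaces carried by a planar flow *)

Section waves.
Context {R : realType}.
Implicit Types (x y z t : R).

Definition band (E : R -> Prop) (lo hi x z : R) := E x /\ lo < z < hi.

(** A planar flow (U, W) of constant vorticity gam in a band, and a surface
    eta in three dimensions that is a stream surface for the velocity (U, V, W).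
    E is an open set of stations x outside which the surface is level across
    the stream, that is, in the direction of y. *)
Record wave (E : R -> Prop) (lo hi m0 m1 M gam V : R) (U W eta ex ey : R -> R -> R) : Prop := Wave {
  wave_open : forall x, E x -> exists2 r : R, 0 < r & forall x', `|x' - x| < r -> E x';
  wave_lo : lo < m0;
  wave_hi : m1 < hi;
  wave_range : forall x y, m0 <= eta x y <= m1;
  wave_dx : forall x y, deriv (eta^~ y) x (ex x y);
  wave_dy : forall x y, deriv (eta x) y (ey x y);
  wave_cont : forall x y, cont2 eta x y;
  wave_contx : forall x y, cont2 ex x y;
  wave_conty : forall x y, cont2 ey x y;
  wave_cr : cr (band E lo hi) (fun x z => U x z - gam * z) W;
  wave_bound : forall x z, band E lo hi x z -> `|U x z| <= M /\ `|W x z| <= M;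
  wave_walls : forall x, E x -> forall e, 0 < e -> exists2 d : R, 0 < d &
     forall x' z', `|x' - x| < d -> lo < z' < hi -> z' < lo + d \/ hi - d < z' -> `|W x' z'| < e;
  wave_kin : forall x y, E x -> U x (eta x y) * ex x y + V * ey x y = W x (eta x y);
  wave_flat : forall x y, ~ E x -> ey x y = 0
}.

(** Continuity in y at the one station x, and a Lipschitz bound in x that
    is uniform nearby. *)
Lemma cont2_local_lip (f : R -> R -> R) x y r (L : R) : 0 < r ->
  (forall x' y', `|x' - x| < r -> `|y' - y| < r -> `|f x' y' - f x y'| <= L * `|x' - x|) ->
  {for y, continuous (f x)} -> cont2 f x y.
Proof.
move=> r0 HL /contP cf; apply/cont2P => e e0.
have e2 : 0 < e / 2 by lra.
have [d d0 Hd] := cf _ e2.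
have L0 : 0 < `|L| + 1 by have := normr_ge0 L; lra.
exists (Num.min (Num.min r d) (e / 2 / (`|L| + 1))) => [|x' y'].
  by rewrite !lt_min r0 d0 divr_gt0.
rewrite !lt_min => /andP[/andP[x1 _]] x3 /andP[/andP[y1 y2] _].
have := HL _ _ x1 y1; have := Hd _ y2; rewrite ltr_pdivlMr// in x3.
have : `|f x' y' - f x y| <= `|f x' y' - f x y'| + `|f x y' - f x y|.
  by apply: le_trans (ler_normD _ _); rewrite addrA subrK.
have : L * `|x' - x| <= `|x' - x| * (`|L| + 1).
  rewrite mulrC; apply: ler_wpM2l => //; have := ler_norm L; lra.
lra.
Qed.

Lemma cont2_bounded (f : R -> R -> R) x y : cont2 f x y ->
  exists2 r : R, 0 < r & forall x' y', `|x' - x| < r -> `|y' - y| < r -> `|f x' y'| <= `|f x y| + 1.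
Proof.
move=> /cont2P/(_ 1 ltr01)[r r0 Hr]; exists r => // x' y' hx hy.
have := Hr _ _ hx hy; have : `|f x' y'| <= `|f x' y' - f x y| + `|f x y|.
  by apply: le_trans (ler_normD _ _); rewrite subrK.
lra.
Qed.

Lemma cont_snd (f : R -> R -> R) x y : cont2 f x y -> {for y, continuous (f x)}.
Proof.
move=> cf; apply: (@cont2_comp1 _ f (fun=> x) (fun t => t)) => //; exact: cvg_cst.
Qed.

Lemma cont_fst (f : R -> R -> R) x y : cont2 f x y -> {for x, continuous (f^~ y)}.
Proof.
move=> cf; apply: (@cont2_comp1 _ f (fun t => t) (fun=> y)) => //; exact: cvg_cst.
Qed.

Lemma prim_param_cont2 (f : R -> R -> R) b x y : (forall x y, cont2 f x y) ->
  cont2 (fun x y => prim (f^~ y) b x) x y.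
Proof.
move=> cf; have cx y' t : {for t, continuous (f^~ y')} by apply: cont_fst.
have [r r0 Hr] := cont2_bounded (cf x y).
apply: (@cont2_local_lip _ _ _ r (`|f x y| + 1)) => // [x' y' hx hy|].
  apply: (@deriv_lip _ _ (f^~ y')) => t bt; first by apply: primT_deriv.
  apply: Hr => //; move: bt hx; rewrite /btw !ltr_norml => /orP[]/andP[? ?] /andP[? ?].
    by apply/andP; split; lra.
  by apply/andP; split; lra.
apply: (@param_cont _ (fun y t => f t y) (fun y x => prim (f^~ y) b x) b x y 1) => //.
- by move=> t _; apply: cont2_swap.
- by move=> y' t _ _; exact: primT_deriv.
- by move=> y' _; exact: primxx.
Qed.

Section sym.
Variables (E : R -> Prop) (lo hi m0 m1 M gam V : R) (U W eta ex ey : R -> R -> R).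
Hypothesis wv : wave E lo hi m0 m1 M gam V U W eta ex ey.

Let bopen : open2 (band E lo hi).
Proof.
move=> x z [Ex /andP[zl zh]]; have [r r0 Hr] := wave_open wv Ex.
exists (Num.min r (Num.min (z - lo) (hi - z))) => [|x' z'].
  by rewrite !lt_min r0 !subr_gt0 zl.
rewrite !lt_min !ltr_norml => /andP[hx _] /and3P[_ /andP[z1 z2] /andP[z3 z4]].
by split; [apply: Hr; rewrite ltr_norml|apply/andP; split; lra].
Qed.

Lemma band_open : open2 (band E lo hi). Proof. exact: bopen. Qed.

Lemma wave_field x z : band E lo hi x z ->
  let Ux := pdx (fun x z => U x z - gam * z) in let Wx := pdx W in
  [/\ deriv (U^~ z) x (Ux x z), deriv (U x) z (gam + Wx x z),
      deriv (W^~ z) x (Wx x z), deriv (W x) z (- Ux x z) &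
      cont2 U x z /\ cont2 W x z].
Proof.
move=> D Ux Wx; have [d1 d2 d3 d4 _] := wave_cr wv D.
have [c1 c2] := cr_cont2 bopen (wave_cr wv) D.
split=> //; last split=> //.
- apply: (deriv_ext _ (deriv_eq (derivD d1 (derivC (gam * z) x)) (addr0 _))) => t /=; ring.
- apply: (deriv_ext _ (deriv_eq (derivD d2 (derivZ gam (derivI z))) _)) => [t /=|]; last by rewrite addrC mulr1.
  by ring.
have c3 : cont2 (fun _ z => gam * z) x z by apply: cont2M; [exact: cont2C|exact: cont2Y].
apply: cont2_near (cont2D c1 c3) => [|x' z' _ _]; first exact: ltr01.
by ring.
Qed.

Lemma wave_const_off x y y' : ~ E x -> eta x y = eta x y'.
Proof.
move=> nE; apply: (@deriv0_const _ (eta x)) => t _.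
by have := wave_dy wv x t; rewrite (wave_flat wv).
Qed.

Lemma wave_scale : V != 0 -> wave E lo hi m0 m1 M gam 1 U W
  (fun x y => eta x (V * y)) (fun x y => ex x (V * y)) (fun x y => V * ey x (V * y)).
Proof.
move=> V0.
have dV y : deriv (fun y => V * y) y V by apply: deriv_eq (derivZ V (derivI y)) _; rewrite mulr1.
have cV f x y : cont2 f x (V * y) -> cont2 (fun x y => f x (V * y)) x y.
  by move=> cf; apply: (@cont2_comp _ f (fun x => x) (fun y => V * y)) => //; apply: deriv_cont (dV y).
split.
- exact: wave_open wv.
- exact: wave_lo wv.
- exact: wave_hi wv.
- by move=> x y; exact: wave_range wv _ _.
- by move=> x y; exact: wave_dx wv _ _.
- by move=> x y; apply: deriv_eq (@deriv_comp _ (eta x) _ _ _ _ (dV y) (wave_dy wv _ _)) _; ring.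
- by move=> x y; apply: cV; exact: wave_cont wv _ _.
- by move=> x y; apply: cV; exact: wave_contx wv _ _.
- by move=> x y; apply: cont2M; [exact: cont2C|apply: cV; exact: wave_conty wv _ _].
- exact: wave_cr wv.
- exact: wave_bound wv.
- exact: wave_walls wv.
- by move=> x y Ex; rewrite mul1r; exact: wave_kin wv _ _ Ex.
- by move=> x y nE; rewrite (wave_flat wv)// mulr0.
Qed.

Let dN y : deriv (fun y : R => - y) y (-1) := derivN (derivI y).

Lemma wave_mirror : wave (fun x => E (- x)) lo hi m0 m1 M (- gam) V
  (fun x z => - U (- x) z) (fun x z => W (- x) z)
  (fun x y => eta (- x) y) (fun x y => - ex (- x) y) (fun x y => ey (- x) y).
Proof.
have cN f x y : cont2 f (- x) y -> cont2 (fun x y => f (- x) y) x y.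
  by move=> cf; apply: (@cont2_comp _ f (fun x => - x) (fun y => y)) => //; apply: deriv_cont (dN x).
have nN (x x' : R) : `|- x' - - x| = `|x' - x| by rewrite -opprD normrN.
have bN x z : band (fun x => E (- x)) lo hi x z -> band E lo hi (- x) z by [].
have oN : open2 (band (fun x => E (- x)) lo hi).
  move=> x z D; have [r r0 Hr] := bopen (bN _ _ D); exists r => // x' z' hx hz.
  by apply: (Hr (- x') z') => //; rewrite nN.
split.
- move=> x Ex; have [r r0 Hr] := wave_open wv Ex; exists r => // x' hx.
  by apply: Hr; rewrite nN.
- exact: wave_lo wv.
- exact: wave_hi wv.
- by move=> x y; exact: wave_range wv _ _.
- move=> x y; apply: deriv_eq (@deriv_comp _ (eta^~ y) _ _ _ _ (dN x) (wave_dx wv _ _)) _; ring.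
- by move=> x y; exact: wave_dy wv _ _.
- by move=> x y; apply: cN; exact: wave_cont wv _ _.
- by move=> x y; apply: cont2N; apply: cN; exact: wave_contx wv _ _.
- by move=> x y; apply: cN; exact: wave_conty wv _ _.
- apply: (cr_intro oN (a1 := fun x z => pdx (fun x z => U x z - gam * z) (- x) z)
     (b1 := fun x z => - pdx W (- x) z) _).1 => x z D.
  have [d1 d2 d3 d4 [c1 c2]] := wave_cr wv (bN _ _ D).
  split.
  + apply: deriv_ext (deriv_eq (derivN (@deriv_comp _ (fun t => U t z - gam * z) _ _ _ _ (dN x) d1)) _) => [t /=|]; ring.
  + by apply: deriv_ext (derivN d2) => t /=; ring.
  + by apply: deriv_eq (@deriv_comp _ (W^~ z) _ _ _ _ (dN x) d3) _; ring.
  + exact: d4.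
  + by split; [apply: cN|apply: cont2N; apply: cN].
- by move=> x z D; rewrite normrN; have := wave_bound wv (bN _ _ D).
- move=> x Ex e e0; have [d d0 Hd] := wave_walls wv Ex e0; exists d => // x' z' hx.
  by apply: Hd; rewrite nN.
- by move=> x y Ex; rewrite mulrNN; exact: wave_kin wv _ _ Ex.
- by move=> x y nE; rewrite (wave_flat wv).
Qed.

Lemma wave_flip : wave E lo hi m0 m1 M (- gam) V
  (fun x z => - U x z) (fun x z => - W x z)
  (fun x y => eta x (- y)) (fun x y => ex x (- y)) (fun x y => - ey x (- y)).
Proof.
have cN f x y : cont2 f x (- y) -> cont2 (fun x y => f x (- y)) x y.
  by move=> cf; apply: (@cont2_comp _ f (fun x => x) (fun y => - y)) => //; apply: deriv_cont (dN y).
split.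
- exact: wave_open wv.
- exact: wave_lo wv.
- exact: wave_hi wv.
- by move=> x y; exact: wave_range wv _ _.
- by move=> x y; exact: wave_dx wv _ _.
- move=> x y; apply: deriv_eq (@deriv_comp _ (eta x) _ _ _ _ (dN y) (wave_dy wv _ _)) _; ring.
- by move=> x y; apply: cN; exact: wave_cont wv _ _.
- by move=> x y; apply: cN; exact: wave_contx wv _ _.
- by move=> x y; apply: cont2N; apply: cN; exact: wave_conty wv _ _.
- apply: (cr_intro bopen (a1 := fun x z => - pdx (fun x z => U x z - gam * z) x z)
     (b1 := fun x z => - pdx W x z) _).1 => x z D.
  have [d1 d2 d3 d4 [c1 c2]] := wave_cr wv D.
  split.
  + by apply: deriv_ext (derivN d1) => t /=; ring.
  + by apply: deriv_ext (derivN d2) => t /=; ring.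
  + exact: derivN d3.
  + exact: derivN d4.
  + by split; apply: cont2N.
- by move=> x z D; rewrite !normrN; have := wave_bound wv D.
- move=> x Ex e e0; have [d d0 Hd] := wave_walls wv Ex e0; exists d => // x' z' hx h1 h2.
  by rewrite normrN; exact: Hd.
- by move=> x y Ex; have := wave_kin wv (- y) Ex; lra.
- by move=> x y nE; rewrite (wave_flat wv)// oppr0.
Qed.
End sym.
End waves.

(** * Stream function, mass and energy *)

Section interval.
Context {R : realType}.
Implicit Types (x y z t : R).

Section stream.
Variables (E : R -> Prop) (lo hi m0 m1 M gam V : R) (U W eta ex ey : R -> R -> R).
Hypothesis wv : wave E lo hi m0 m1 M gam V U W eta ex ey.
Variables (bet top xb : R).
Hypotheses (xb_gt : bet < xb) (xb_lt : xb < top).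
Hypothesis E_in : forall x, bet < x < top -> E x.
Hypothesis E_bet : ~ E bet.

(** The stream function, normalized at the point (xb, m0). *)
Definition psi x z := prim (U x) m0 z - prim (W^~ m0) xb x.
(** Both are integrals from the station bet, where the surface is level:
    flux_x = - V eta, flux_y = mass and mass_x = - V eta_y. *)
Definition mass x y := - V * prim (ey^~ y) bet x.
Definition flux x y := - V * prim (eta^~ y) bet x.

Lemma mass_dx x y : deriv (mass^~ y) x (- V * ey x y).
Proof. by apply: derivZ; apply: primT_deriv => t; apply: cont_fst; exact: (wave_conty wv). Qed.

Lemma flux_dx x y : deriv (flux^~ y) x (- V * eta x y).
Proof. by apply: derivZ; apply: primT_deriv => t; apply: cont_fst; exact: (wave_cont wv). Qed.

Lemma flux_dy x y : deriv (flux x) y (mass x y).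
Proof.
apply: derivZ.
apply: (@param_deriv _ (fun y t => eta t y) (fun y t => ey t y) (fun y x => prim (eta^~ y) bet x)
  (prim (ey^~ y) bet) bet x y 1 ltr01).
- by move=> y' t _ _; exact: (wave_dy wv).
- by move=> t _; apply: cont2_swap; exact: (wave_conty wv).
- by move=> y' t _ _; apply: primT_deriv => s; apply: cont_fst; exact: (wave_cont wv).
- by move=> t _; apply: primT_deriv => s; apply: cont_fst; exact: (wave_conty wv).
- by move=> y' _; exact: primxx.
- exact: primxx.
Qed.

Lemma mass_cont2 x y : cont2 mass x y.
Proof. by apply: cont2M; [exact: cont2C|apply: prim_param_cont2 => *; exact: (wave_conty wv)]. Qed.

Lemma flux_cont2 x y : cont2 flux x y.
Proof. by apply: cont2M; [exact: cont2C|apply: prim_param_cont2 => *; exact: (wave_cont wv)]. Qed.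

Let m01 : m0 <= m1. Proof. by case/andP: (wave_range wv 0 0) => /le_trans; apply. Qed.
Lemma m0_in : lo < m0 < hi.
Proof. by have := wave_lo wv; have := wave_hi wv; have := m01; move=> *; apply/andP; split; lra. Qed.

Let inb x z : bet < x < top -> lo < z < hi -> band E lo hi x z.
Proof. by move=> hx hz; split=> //; exact: E_in. Qed.

Definition Ux := pdx (fun x z => U x z - gam * z).
Definition Wx := pdx W.

Lemma wave_f x z : bet < x < top -> lo < z < hi ->
  [/\ deriv (U^~ z) x (Ux x z), deriv (U x) z (gam + Wx x z),
      deriv (W^~ z) x (Wx x z), deriv (W x) z (- Ux x z) &
      cont2 U x z /\ cont2 W x z].
Proof. by move=> hx hz; exact: (wave_field wv (inb hx hz)). Qed.

Lemma psi_dz x z : bet < x < top -> lo < z < hi -> deriv (psi x) z (U x z).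
Proof.
move=> hx hz; apply: deriv_eq (derivB _ (derivC _ z)) (subr0 _).
apply: prim_deriv m0_in hz _ => t ht.
by have [_ _ _ _ [c _]] := wave_f hx ht; exact: cont_snd c.
Qed.

Let near_in x : bet < x < top -> exists2 r : R, 0 < r & forall x', `|x' - x| < r -> bet < x' < top.
Proof.
move=> /andP[h1 h2]; exists (Num.min (x - bet) (top - x)).
  by rewrite lt_min !subr_gt0 h1.
by move=> x'; rewrite lt_min !ltr_norml => /andP[/andP[? ?] /andP[? ?]]; apply/andP; split; lra.
Qed.

Let btw_in z t : lo < z < hi -> btw m0 z t -> lo < t < hi.
Proof.
move: m0_in => /andP[? ?] /andP[? ?]; rewrite /btw => /orP[]/andP[? ?]; apply/andP; split; lra.
Qed.

Lemma psi_dx x z : bet < x < top -> lo < z < hi -> deriv (psi^~ z) x (- W x z).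
Proof.
move=> hx hz; have [r r0 Hr] := near_in hx.
have d1 : deriv (fun x => prim (U x) m0 z) x (W x m0 - W x z).
  apply: (@param_deriv _ U Ux (fun x z => prim (U x) m0 z) (fun z => W x m0 - W x z) m0 z x r r0).
  - by move=> x' t hx' bt; have [] := wave_f (Hr _ hx') (btw_in hz bt).
  - move=> t bt; have [_ _ _ _ [c _]] := wave_cr wv (inb hx (btw_in hz bt)); exact: c.
  - move=> x' t hx' bt; apply: prim_deriv m0_in (btw_in hz bt) _ => s hs.
    by have [_ _ _ _ [c _]] := wave_f (Hr _ hx') hs; exact: cont_snd c.
  - move=> t bt; have [_ _ _ d _] := wave_f hx (btw_in hz bt).
    by apply: deriv_eq (derivB (derivC (W x m0) t) d) _; rewrite sub0r opprK.
  - by move=> x' _; exact: primxx.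
  - by rewrite subrr.
have d2 : deriv (prim (W^~ m0) xb) x (W x m0).
  apply: (@prim_deriv _ (W^~ m0) bet top xb x) => //; first by rewrite xb_gt.
  by move=> t ht; have [_ _ _ _ [_ c]] := wave_f ht m0_in; exact: cont_fst c.
by apply: deriv_eq (derivB d1 d2) _; ring.
Qed.

Lemma eta_in x y : lo < eta x y < hi.
Proof.
have /andP[? ?] := wave_range wv x y; have := wave_lo wv; have := wave_hi wv.
by move=> *; apply/andP; split; lra.
Qed.

Definition off := mass xb 0 - psi xb (eta xb 0).

Let gap x y := mass x y - psi x (eta x y).

(** By the kinematic condition the x-derivative of the gap is zero. *)
Let gap_x x x' y : bet < x < top -> bet < x' < top -> gap x y = gap x' y.
Proof.
move=> hx hx'; apply/esym.
apply: (@deriv0_const _ (gap^~ y)) => t bt.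
have ht : bet < t < top.
  by move: bt hx hx'; rewrite /btw => /orP[]/andP[? ?] /andP[? ?] /andP[? ?]; apply/andP; split; lra.
have [r r0 Hr] := near_in ht.
have [r' r0' Hr'] := band_open wv (inb ht (eta_in t y)).
have [_ _ _ _ [cU cW]] := wave_f ht (eta_in t y).
have rr : 0 < Num.min r r' by rewrite lt_min r0.
have nt : `|t - t| < r' by rewrite subrr normr0.
have Q := @chain2 _ psi (fun x z => - W x z) U (fun x => x) (eta^~ y) t 1 (ex t y) _ rr _ _ cU (derivI t) (wave_dx wv t y).
apply: deriv_eq (derivB (mass_dx t y) (Q _ _)) _ => [x1 z1||].
- rewrite !lt_min => /andP[h1 h2] /andP[h3 h4].
  have [_ hz1] := Hr' _ _ nt h4.
  by split; [apply: psi_dx => //; exact: Hr|apply: psi_dz => //; exact: Hr].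
- exact: cont2N.
- by have := wave_kin wv y (E_in ht); lra.
Qed.

Lemma U_bound x z : bet < x < top -> lo < z < hi -> `|U x z| <= M /\ `|W x z| <= M.
Proof. by move=> hx hz; have := wave_bound wv (inb hx hz). Qed.

Lemma psi_lip_z x z z' : bet < x < top -> lo < z < hi -> lo < z' < hi ->
  `|psi x z - psi x z'| <= M * `|z - z'|.
Proof.
move=> hx hz hz'; have H t : btw z' z t -> lo < t < hi.
  by move: hz hz' => /andP[? ?] /andP[? ?]; rewrite /btw => /orP[]/andP[? ?]; apply/andP; split; lra.
apply: (@deriv_lip _ (psi x) (U x)) => t bt; first by apply: psi_dz => //; exact: H.
by have [] := U_bound hx (H _ bt).
Qed.

(** At bet the mass vanishes and the surface is level across the stream, so
    the difference of the gaps tends to zero there; by the preceding lemma it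
    is constant. *)
Let gap_y x y y' : bet < x < top -> gap x y = gap x y'.
Proof.
move=> hx; apply/eqP/negPn/negP => ne.
have e0 : 0 < `|gap x y - gap x y'| by rewrite normr_gt0 subr_eq0.
set e := `|_| in e0.
have M0 : 0 <= M by have [] := U_bound hx m0_in; move=> + _; apply: le_trans.
have e3 : 0 < e / 4 / (M + 1) by rewrite divr_gt0//; lra.
have e4 : 0 < e / 4 by lra.
have cm y1 : {for bet, continuous (mass^~ y1)} by apply: cont_fst; exact: mass_cont2.
have ce y1 : {for bet, continuous (eta^~ y1)} by apply: cont_fst; exact: (wave_cont wv).
have [d1 d10 H1] := (contP _ _).1 (cm y) _ e4.
have [d2 d20 H2] := (contP _ _).1 (cm y') _ e4.
have [d3 d30 H3] := (contP _ _).1 (ce y) _ e3.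
have [d4 d40 H4] := (contP _ _).1 (ce y') _ e3.
pose d := Num.min (Num.min d1 d2) (Num.min (Num.min d3 d4) (top - bet)).
have d0 : 0 < d by rewrite !lt_min d10 d20 d30 d40 subr_gt0 (lt_trans xb_gt xb_lt).
pose t := bet + d / 2.
have [dd1 dd2 dd3 dd4 dd5] : [/\ d <= d1, d <= d2, d <= d3, d <= d4 & d <= top - bet].
  by rewrite /d !ge_min !lexx !orbT.
have nt : `|t - bet| < d by rewrite /t addrC addKr gtr0_norm; lra.
have ht : bet < t < top by rewrite /t; apply/andP; split; lra.
have mbet s : mass bet s = 0 by rewrite /mass primxx mulr0.
have := H1 t (lt_le_trans nt dd1); have := H2 t (lt_le_trans nt dd2).
have := H3 t (lt_le_trans nt dd3); have := H4 t (lt_le_trans nt dd4).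
rewrite !mbet !subr0 (wave_const_off wv y y' E_bet).
move=> h4 h3 h2 h1.
have h5 := psi_lip_z ht (eta_in t y) (eta_in t y').
have h6 : `|eta t y - eta t y'| < e / 2 / (M + 1).
  have : `|eta t y - eta t y'| <= `|eta t y - eta bet y'| + `|eta t y' - eta bet y'|.
    by rewrite [X in _ <= _ + X]distrC; apply: le_trans (ler_normD _ _); rewrite addrA subrK.
  have -> : e / 2 / (M + 1) = e / 4 / (M + 1) + e / 4 / (M + 1) by field; lra.
  lra.
rewrite ltr_pdivlMr in h6; last by lra.
have : e <= `|mass t y| + `|mass t y'| + `|psi t (eta t y) - psi t (eta t y')|.
  have -> : e = `|(mass t y - mass t y') - (psi t (eta t y) - psi t (eta t y'))|.
    by rewrite /e (gap_x y hx ht) (gap_x y' hx ht) /gap; congr (`|_|); ring.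
  apply: le_trans (ler_normB _ _) _; apply: lerD => //; exact: ler_normB.
have : M * `|eta t y - eta t y'| <= `|eta t y - eta t y'| * (M + 1).
  by rewrite mulrDr mulr1 mulrC lerDl.
lra.
Qed.

Lemma mass_psi x y : bet < x < top -> mass x y = psi x (eta x y) + off.
Proof.
move=> hx; have hb : bet < xb < top by rewrite xb_gt.
have : gap x y = gap xb 0 by rewrite (gap_x y hx hb); exact: gap_y.
by rewrite /gap /off => <-; ring.
Qed.

(** It controls the mass in the mean over y and grows with y. *)
Definition energy x y := prim (fun s => mass x s ^+ 2) 0 y.

Let cm2 x y : cont2 (fun x y => mass x y ^+ 2) x y.
Proof. by apply: cont2M; exact: mass_cont2. Qed.

Lemma energy_dy x y : deriv (energy x) y (mass x y ^+ 2).
Proof. by apply: (@primT_deriv _ (fun s => mass x s ^+ 2)) => t; apply: (@cont_snd _ (fun x y => mass x y ^+ 2)). Qed.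

Let prof x z := prim (fun z => psi x z + off) m0 z.

Let prof_dz x z : bet < x < top -> lo < z < hi -> deriv (prof x) z (psi x z + off).
Proof.
move=> hx hz; have base := m0_in; apply: (@prim_deriv _ (fun z => psi x z + off) lo hi) => // t ht.
apply: contD; [exact: deriv_cont (psi_dz hx ht)|exact: cvg_cst].
Qed.

(** As mass is a function of eta at each station, mass times eta_y is a
    y-derivative and the integral over y is a boundary term; this is the reason
    why the energy stays bounded. *)
Lemma energy_dx x y : bet < x < top ->
  deriv (energy^~ y) x (- 2 * V * (prof x (eta x y) - prof x (eta x 0))).
Proof.
move=> hx.
apply: (@param_deriv _ (fun x y => mass x y ^+ 2) (fun x y => 2 * mass x y * (- V * ey x y))
  energy (fun y => - 2 * V * (prof x (eta x y) - prof x (eta x 0))) 0 y x 1 ltr01).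
- move=> x' t _ _; exact: derivX2 (mass_dx _ _).
- move=> t _; apply: cont2M.
    by apply: cont2M; [exact: cont2C|exact: mass_cont2].
  by apply: cont2M; [exact: cont2C|exact: (wave_conty wv)].
- by move=> x' t _ _; exact: energy_dy.
- move=> t _; have d := deriv_comp (wave_dy wv x t) (prof_dz hx (eta_in x t)).
  apply: deriv_eq (derivZ (- 2 * V) (derivB d (derivC (prof x (eta x 0)) t))) _.
  by rewrite -mass_psi//; ring.
- by move=> x' _; exact: primxx.
- by rewrite subrr mulr0.
Qed.

Lemma energy_bet y : energy bet y = 0.
Proof.
rewrite -(primxx (fun s => mass bet s ^+ 2) 0).
apply: (@deriv0_const _ (energy bet)) => t _.
by apply: deriv_eq (energy_dy _ _) _; rewrite /mass primxx mulr0 expr0n.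
Qed.

Lemma psi_bound X x z : bet <= X -> bet < x < top -> x <= X -> lo < z < hi ->
  `|psi x z| <= M * (hi - lo) + M * (X - bet + (xb - bet)).
Proof.
move=> bX hx xX hz; have base := m0_in; have hb : bet < xb < top by rewrite xb_gt.
have M0 : 0 <= M by have [] := U_bound hx m0_in; move=> + _; apply: le_trans.
have H t : btw xb x t -> bet < t < top.
  by move: hx hb => /andP[? ?] /andP[? ?]; rewrite /btw => /orP[]/andP[? ?]; apply/andP; split; lra.
have h1 := psi_lip_z hx hz m0_in.
have h2 : `|psi x m0 - psi xb m0| <= M * `|x - xb|.
  apply: (@deriv_lip _ (psi^~ m0) (fun x => - W x m0)) => t bt; first by apply: psi_dx => //; exact: H.
  by rewrite normrN; have [] := U_bound (H _ bt) m0_in.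
have p0 : psi xb m0 = 0 by rewrite /psi !primxx subr0.
rewrite p0 subr0 in h2.
have h3 : `|psi x z| <= `|psi x z - psi x m0| + `|psi x m0|.
  by apply: le_trans (ler_normD _ _); rewrite subrK.
have h4 : M * `|z - m0| <= M * (hi - lo).
  by apply: ler_wpM2l => //; move: base hz => /andP[? ?] /andP[? ?]; rewrite ler_norml; apply/andP; split; lra.
have h5 : M * `|x - xb| <= M * (X - bet + (xb - bet)).
  by apply: ler_wpM2l => //; move: hx hb => /andP[? ?] /andP[? ?]; rewrite ler_norml; apply/andP; split; lra.
lra.
Qed.

Let energy_dx_bounded X : bet <= X -> X <= top -> exists2 C, 0 <= C & forall x y, bet < x < top ->
  x <= X -> `|- 2 * V * (prof x (eta x y) - prof x (eta x 0))| <= C.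
Proof.
move=> bX Xt; have base := m0_in.
have hb : bet < xb < top by rewrite xb_gt.
have M0 : 0 <= M by have [] := U_bound hb m0_in; move=> + _; apply: le_trans.
pose C1 := M * (hi - lo) + M * (X - bet + (xb - bet)) + `|off|.
pose C2 := `|- 2 * V| * (C1 * (hi - lo)).
have key x y : bet < x < top -> x <= X -> `|- 2 * V * (prof x (eta x y) - prof x (eta x 0))| <= C2.
  move=> hx xX; rewrite normrM; apply: ler_wpM2l => //.
  have H t : btw (eta x 0) (eta x y) t -> lo < t < hi.
    by move: (eta_in x 0) (eta_in x y) => /andP[? ?] /andP[? ?]; rewrite /btw => /orP[]/andP[? ?]; apply/andP; split; lra.
  have B t : lo < t < hi -> `|psi x t + off| <= C1.
    by move=> ht; apply: le_trans (ler_normD _ _) _; apply: lerD => //; exact: psi_bound.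
  have C10 : 0 <= C1 by apply: le_trans (B _ m0_in).
  have : `|prof x (eta x y) - prof x (eta x 0)| <= C1 * `|eta x y - eta x 0|.
    apply: (@deriv_lip _ (prof x) (fun z => psi x z + off)) => t bt; first by apply: prof_dz => //; exact: H.
    exact: B (H _ bt).
  move=> h; apply: le_trans h _; apply: ler_wpM2l => //.
  by move: (eta_in x 0) (eta_in x y) => /andP[? ?] /andP[? ?]; rewrite ler_norml; apply/andP; split; lra.
have C20 : 0 <= C2.
  have h : bet < Num.min X xb \/ X = bet.
    by have [->|Xb] := eqVneq X bet; [right|left; rewrite lt_min xb_gt lt_def Xb bX].
  case: h => [h|XE]; last first.
    rewrite /C2 mulr_ge0// mulr_ge0//; last by case/andP: base; lra.
    by rewrite /C1 !addr_ge0// mulr_ge0//; [case/andP: base|]; lra.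
  apply: le_trans (key (Num.min X xb) 0 _ _) => //; last by rewrite ge_min lexx.
  by rewrite h gt_min xb_lt orbT.
by exists C2.
Qed.

Lemma energy_bounded X : bet <= X -> X <= top -> exists C, forall x y, bet <= x <= X -> `|energy x y| <= C.
Proof.
move=> bX Xt; have [C2 C20 key] := energy_dx_bounded bX Xt.
have cE x y : {for x, continuous (energy^~ y)}.
  apply: (@param_cont _ (fun x y => mass x y ^+ 2) energy 0 y x 1 ltr01).
  - by move=> t _; exact: cm2.
  - by move=> x' t _ _; exact: energy_dy.
  - by move=> x' _; exact: primxx.
exists (C2 * (X - bet)) => x y /andP[]; rewrite le_eqVlt => /orP[/eqP<- _|bx xX].
  by rewrite energy_bet normr0 mulr_ge0// subr_ge0.
(* the bound first on the open interval, then by continuity at its end *)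
have step x1 : bet < x1 < top -> x1 <= X -> `|energy x1 y| <= C2 * (X - bet).
  move=> h1 x1X; have near t : bet < t <= x1 -> `|energy x1 y - energy t y| <= C2 * (x1 - t).
    move=> /andP[ht tx]; have -> : x1 - t = `|x1 - t| by rewrite ger0_norm// subr_ge0.
    have H s : btw t x1 s -> bet < s < top /\ s <= X.
      by move: h1 => /andP[? ?]; rewrite /btw => /orP[]/andP[? ?]; split; [apply/andP; split; lra|lra| apply/andP; split; lra|lra].
    apply: (@deriv_lip _ (energy^~ y) (fun x => - 2 * V * (prof x (eta x y) - prof x (eta x 0)))) => s bs.
      exact: energy_dx (H _ bs).1.
    by have [] := H _ bs; exact: key.
  rewrite leNgt; apply/negP => gt.
  have e0 : 0 < `|energy x1 y| - C2 * (X - bet) by rewrite subr_gt0.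
  have [d d0 Hd] := (contP _ _).1 (cE bet y) _ e0.
  have [b1 _] := andP h1.
  pose t := Num.min x1 (bet + d / 2).
  have tb : bet < t by rewrite lt_min b1; lra.
  have tx : t <= x1 by rewrite ge_min lexx.
  have td : t <= bet + d / 2 by rewrite ge_min lexx orbT.
  clearbody t.
  have := near t; rewrite tb tx => /(_ isT) h2.
  have := Hd t; rewrite energy_bet subr0 gtr0_norm ?subr_gt0// => /(_ _) h3.
  have h4 : `|energy t y| < `|energy x1 y| - C2 * (X - bet) by apply: h3; lra.
  have h5 : `|energy x1 y| <= `|energy x1 y - energy t y| + `|energy t y|.
    by apply: le_trans (ler_normD _ _); rewrite subrK.
  have h6 : C2 * (x1 - t) <= C2 * (X - bet) by rewrite ler_wpM2l// lerB// ltW.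
  lra.
have [xt|xt] := ltP x top; first by apply: step => //; rewrite bx.
rewrite leNgt; apply/negP => gt.
have e0 : 0 < `|energy x y| - C2 * (X - bet) by rewrite subr_gt0.
have [d d0 Hd] := (contP _ _).1 (cE x y) _ e0.
pose t := Num.max ((bet + x) / 2) (x - d / 2).
have tb : bet < t by rewrite lt_max; apply/orP; left; lra.
have tx : t < x by rewrite gt_max; apply/andP; split; lra.
have td : x - d / 2 <= t by rewrite le_max lexx orbT.
clearbody t.
have h1 : `|energy t y| <= C2 * (X - bet) by apply: step; [apply/andP; split|]; lra.
have : `|t - x| < d by rewrite ltr_norml; apply/andP; split; lra.
move=> /Hd h2.
have h3 : `|energy x y| <= `|energy t y - energy x y| + `|energy t y|.
  by rewrite [X in _ <= X + _]distrC; apply: le_trans (ler_normD _ _); rewrite subrK.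
lra.
Qed.
End stream.
End interval.

(** * The flux through a window *)

Section windows.
Context {R : realType}.
Implicit Types (x y z t : R).

Section at_wave.
Variables (E : R -> Prop) (lo hi m0 m1 M gam V : R) (U W eta ex ey : R -> R -> R).
Hypothesis wv : wave E lo hi m0 m1 M gam V U W eta ex ey.
Variables (bet top xb : R).
Hypotheses (xb_gt : bet < xb) (xb_lt : xb < top).
Hypothesis E_in : forall x, bet < x < top -> E x.
Hypothesis E_bet : ~ E bet.

Let ms := mass V ey bet.
Let fl := flux V eta bet.
Let en := energy V ey bet.

(** Without a transverse velocity the mass vanishes, so the surface lies in a
    level set of the stream function. Where eta_y is not zero its points fill an
    open set, on which the velocity is zero and has no vorticity. *)
Lemma parallel_absurd x1 y1 : V = 0 -> gam != 0 -> bet < x1 < top -> ey x1 y1 != 0 -> False.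
Proof.
move=> V0 gam0 hx1 ne.
have [r r0 Hr] : exists2 r : R, 0 < r & forall x y, `|x - x1| < r -> `|y - y1| < r ->
    bet < x < top /\ ey x y != 0.
  have e0 : 0 < `|ey x1 y1| by rewrite normr_gt0.
  have cy : cont2 ey x1 y1 by exact: (wave_conty wv).
  have [d d0 Hd] := (cont2P _ _ _).1 cy _ e0.
  have [h1 h2] := andP hx1.
  exists (Num.min d (Num.min (x1 - bet) (top - x1))); first by rewrite !lt_min d0 !subr_gt0 h1.
  move=> x y; rewrite !lt_min => /and3P[x2 x3 x4] /and3P[y2 _ _]; split.
    by move: x3 x4; rewrite !ltr_norml => /andP[? ?] /andP[? ?]; apply/andP; split; lra.
  by apply/eqP => h; have := Hd _ _ x2 y2; rewrite h sub0r normrN ltxx.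
have UW x y : `|x - x1| < r -> `|y - y1| < r -> U x (eta x y) = 0 /\ W x (eta x y) = 0.
  move=> hx hy; have [hx' ne'] := Hr _ _ hx hy.
  have U0 : U x (eta x y) = 0.
    have Q := derivD (deriv_comp (wave_dy wv x y) (psi_dz wv xb E_in hx' (eta_in wv x y)))
      (derivC (off m0 V U W eta ey bet xb) y).
    have : U x (eta x y) * ey x y + 0 = 0.
      apply: deriv_uniq (derivC 0 y); apply: deriv_ext Q => t /=.
      by rewrite -(mass_psi wv xb_gt xb_lt E_in E_bet _ hx') /mass V0 oppr0 mul0r.
    by rewrite addr0 => /eqP; rewrite mulf_eq0 (negbTE ne') orbF => /eqP.
  by split=> //; have := wave_kin wv y (E_in hx'); rewrite V0 U0 !mul0r addr0.
have n0 (s : R) : `|s - s| < r by rewrite subrr normr0.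
have [d1 d2 d3 d4 [c1 c2]] := wave_f wv E_in hx1 (eta_in wv x1 y1).
have e1 : (gam + Wx W x1 (eta x1 y1)) * ey x1 y1 = 0.
  apply: deriv_uniq (derivC 0 y1); apply: (deriv_near r0) (deriv_comp (wave_dy wv x1 y1) d2) => t ht /=.
  by have [] := UW _ _ (n0 x1) ht.
have e2 : - Ux gam U x1 (eta x1 y1) * ey x1 y1 = 0.
  apply: deriv_uniq (derivC 0 y1); apply: (deriv_near r0) (deriv_comp (wave_dy wv x1 y1) d4) => t ht /=.
  by have [] := UW _ _ (n0 x1) ht.
have e3 : Wx W x1 (eta x1 y1) * 1 + - Ux gam U x1 (eta x1 y1) * ex x1 y1 = 0.
  have [r' r0' Hr'] := band_open wv (conj (E_in hx1) (eta_in wv x1 y1)).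
  have [_ _ _ _ [cx cz]] := wave_cr wv (conj (E_in hx1) (eta_in wv x1 y1)).
  apply: deriv_uniq (derivC 0 x1).
  apply: (deriv_near r0) (@chain2 _ W (Wx W) (fun x z => - Ux gam U x z) (fun x => x) (eta^~ y1) x1 1 (ex x1 y1) r' r0' _ cz _ (derivI x1) (wave_dx wv x1 y1)) => [t ht /=|x z hx hz|].
  - by have [] := UW _ _ ht (n0 y1).
  - by have [] := wave_field wv (Hr' _ _ hx hz).
  - exact: cont2N.
move/eqP: e1; rewrite mulf_eq0 (negbTE ne) orbF => /eqP e1.
move/eqP: e2; rewrite mulf_eq0 (negbTE ne) orbF oppr_eq0 => /eqP e2.
move: e3; rewrite e2 oppr0 mul0r addr0 mulr1 => e3.
by move: e1; rewrite e3 addr0 => e1; rewrite e1 eqxx in gam0.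
Qed.

(** The inequality |m| <= e/2 + m^2/(2e), integrated over the window. *)
Lemma flux_energy x y T e : 0 < T -> 0 < e ->
  `|fl x (y + T) - fl x y| <= e * T / 2 + (en x (y + T) - en x y) / (2 * e).
Proof.
move=> T0 e0.
have key s : s ^+ 2 = 1 -> s * (fl x (y + T) - fl x y) <= e * T / 2 + (en x (y + T) - en x y) / (2 * e).
  move=> s1; pose f t := (2 * e)^-1 * en x t + e / 2 * t - s * fl x t.
  have : f y <= f (y + T).
    apply: (@deriv_ge0_le _ f (fun t => (2 * e)^-1 * ms x t ^+ 2 + e / 2 * 1 - s * ms x t)); first lra.
      move=> t _; apply: derivB; last by apply: derivZ; exact: (flux_dy wv).
      by apply: derivD; apply: derivZ; [exact: (energy_dy wv)|exact: derivI].
    move=> t _; have -> : (2 * e)^-1 * ms x t ^+ 2 + e / 2 * 1 - s * ms x t =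
      (2 * e)^-1 * (ms x t - s * e) ^+ 2 + e / 2 * (1 - s ^+ 2) by field; lra.
    by rewrite s1 subrr mulr0 addr0 mulr_ge0 ?sqr_ge0// invr_ge0; lra.
  by rewrite /f [_ / (2 * e)]mulrC; lra.
have := key 1; have := key (-1); rewrite sqrrN expr1n => /(_ erefl) h1 /(_ erefl) h2.
by rewrite ler_norml; apply/andP; split; lra.
Qed.

Lemma energy_mono x : {homo en x : y z / y <= z}.
Proof.
move=> y z yz; apply: (@deriv_ge0_le _ _ (fun t => ms x t ^+ 2)) => // t _; first exact: (energy_dy wv).
exact: sqr_ge0.
Qed.

Definition far (Y T y : R) := Y <= y \/ y + T <= - Y.

Lemma farW Y Y' T y : Y <= Y' -> far Y' T y -> far Y T y.
Proof. by move=> ? [?|?]; [left|right]; lra. Qed.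

Lemma flux_tail_at X x T e : bet <= X -> X <= top -> bet <= x <= X -> 0 < T -> 0 < e ->
  exists Y, forall y, far Y T y -> `|fl x (y + T) - fl x y| <= e.
Proof.
move=> bX Xt hx T0 e0.
have [C HC] := energy_bounded wv xb_gt xb_lt E_in E_bet bX Xt.
pose d := e / T; have d0 : 0 < d by rewrite divr_gt0.
have de : 0 < d * e by rewrite mulr_gt0.
have HC1 y : en x y <= C by apply: le_trans (HC _ y hx); rewrite ler_norm.
have HC2 y : - en x (- y) <= C.
  by apply: le_trans (HC _ (- y) hx); rewrite -normrN ler_norm.
have m2 : {homo (fun y => - en x (- y)) : y z / y <= z}.
  by move=> y z yz; rewrite lerN2; apply: energy_mono; rewrite lerN2.
have [Y1 H1] := nondecreasing_cauchy (@energy_mono x) HC1 de.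
have [Y2 H2] := nondecreasing_cauchy m2 HC2 de.
exists (Num.max Y1 Y2) => y hy.
have hE : en x (y + T) - en x y < d * e.
  case: hy => hy.
    by apply: H1; [apply: le_trans hy; rewrite le_max lexx|apply: le_trans (le_trans hy _); [rewrite le_max lexx|lra]].
  have := H2 (- (y + T)) (- y); rewrite !opprK => H.
  have h2 : Y2 <= Num.max Y1 Y2 by rewrite le_max lexx orbT.
  by have := H _ _; rewrite -[_ - en x y]addrC; (apply; lra) || (rewrite addrC opprK; lra).
have := flux_energy x y T0 d0.
have -> : d * T / 2 = e / 2 by rewrite /d; field; lra.
have : (en x (y + T) - en x y) / (2 * d) <= e / 2.
  by rewrite ler_pdivrMr; [lra|lra].
lra.
Qed.

Let L := `|V| * (`|m0| + `|m1|).

Let flux_lip x x' y : `|fl x' y - fl x y| <= L * `|x' - x|.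
Proof.
apply: (@deriv_lip _ (fl^~ y) (fun x => - V * eta x y)) => t _; first exact: (flux_dx wv).
rewrite normrM normrN ler_wpM2l//; have /andP[h1 h2] := wave_range wv t y.
rewrite ler_norml; have := ler_norm m1; have := ler_norm (- m0); rewrite normrN.
by have := normr_ge0 m0; have := normr_ge0 m1 => *; apply/andP; split; lra.
Qed.

(** At one station this follows from the convergence of the bounded
    monotone energy at both ends; the flux is Lipschitz in x, so finitely many
    stations suffice. *)
Lemma flux_tail X T e : bet <= X -> X <= top -> 0 < T -> 0 < e ->
  exists Y, forall x y, bet <= x <= X -> far Y T y -> `|fl x (y + T) - fl x y| <= e.
Proof.
move=> bX Xt T0 e0.
have L0 : 0 <= L by rewrite /L mulr_ge0// addr_ge0.
(* on a step of length d the increment changes by at most e / 2 *)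
pose d := e / 2 / (2 * L + 1).
have d0 : 0 < d by rewrite divr_gt0//; lra.
have step n : exists Y, forall x y, bet <= x <= X -> x <= bet + n%:R * d -> far Y T y -> `|fl x (y + T) - fl x y| <= e.
  elim: n => [|n [Y HY]].
    have hb : bet <= bet <= X by rewrite lexx.
    have [Y HY] := flux_tail_at bX Xt hb T0 e0; exists Y => x y /andP[h1 h2]; rewrite mul0r addr0 => h3.
    by have -> : x = bet; [lra|exact: HY].
  have [le_nX|gt_nX] := leP (bet + n%:R * d) X; last first.
    by exists Y => x y hx _; apply: HY => //; case/andP: hx; lra.
  have hn : bet <= bet + n%:R * d <= X by rewrite le_nX andbT lerDl mulr_ge0// ltW.
  have e2 : 0 < e / 2 by lra.
  have [Y' HY'] := flux_tail_at bX Xt hn T0 e2.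
  exists (Num.max Y Y') => x y hx hxn hy.
  have [h|h] := leP x (bet + n%:R * d); first by apply: HY => //; apply: farW hy; rewrite le_max lexx.
  have h1 : `|x - (bet + n%:R * d)| <= d.
    by rewrite gtr0_norm ?subr_gt0//; move: hxn; rewrite -natr1 mulrDl mul1r; lra.
  have h2 := flux_lip (bet + n%:R * d) x (y + T); have h3 := flux_lip (bet + n%:R * d) x y.
  have h4 : `|fl (bet + n%:R * d) (y + T) - fl (bet + n%:R * d) y| <= e / 2.
    by apply: HY'; apply: farW hy; rewrite le_max lexx orbT.
  set xn := bet + _ in h1 h2 h3 h4.
  have h5 : 2 * (L * `|x - xn|) <= e / 2.
    have : 2 * L * `|x - xn| <= 2 * L * d by apply: ler_wpM2l => //; lra.
    have : (2 * L + 1) * d = e / 2 by rewrite /d; field; lra.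
    lra.
  have -> : fl x (y + T) - fl x y =
    ((fl x (y + T) - fl xn (y + T)) - (fl x y - fl xn y)) + (fl xn (y + T) - fl xn y) by ring.
  apply: le_trans (ler_normD _ _) _; apply: le_trans (lerD (ler_normB _ _) (lexx _)) _; lra.
have [n Hn] : exists n : nat, X <= bet + n%:R * d.
  exists (Num.bound ((X - bet) / d)); rewrite -lerBlDl -ler_pdivrMr// ltW//.
  by rewrite archi_boundP// divr_ge0 ?subr_ge0// ltW.
have [Y HY] := step n; exists Y => x y hx; apply: HY => //; case/andP: hx => _ h; exact: le_trans h Hn.
Qed.
Hypothesis V_neq0 : V != 0.

(** The maximum principle for the increment of the flux over a window of
    length T. Where the increment has vanishing x-derivative the heights at the
    two ends of the window agree, hence also the masses, and the y-derivative
    vanishes. The sign s selects an upper or lower bound; r = - 1 reverses the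
    direction of transport. *)
Lemma window X T s r K : s ^+ 2 = 1 -> r ^+ 2 = 1 -> bet < X <= top -> 0 < T -> 0 <= K ->
  (forall y, s * (fl X (y + T) - fl X y) <= K \/
     (0 <= s * (- V * eta X (y + T) - - V * eta X y) -> s * r * (ms X (y + T) - ms X y) <= 0)) ->
  forall x y, bet <= x <= X -> s * (fl x (y + T) - fl x y) <= K.
Proof.
move=> s1 r1 /andP[bX Xt] T0 K0 HX x y hx.
apply/ler_addgt0Pr => e e0.
have [Y HY] := flux_tail (ltW bX) Xt T0 e0.
pose D x y := s * (fl x (r * y + T) - fl x (r * y)).
pose Dx x y := s * (- V * eta x (r * y + T) - - V * eta x (r * y)).
pose Dy x y := s * (ms x (r * y + T) * r - ms x (r * y) * r).
(* so large that for y = - N the window lies in a tail of the flux *)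
pose N := `|Y| + T + `|y| + 1.
have sle a : s * a <= `|a|.
  have : `|s * a| <= `|a|.
    have /eqP := s1; rewrite sqrf_eq1 normrM => /orP[]/eqP->; rewrite ?normrN normr1 mul1r//.
  exact: le_trans (ler_norm _).
have rr : r * (r * y) = y by rewrite mulrA -expr2 r1 mul1r.
have rN a : `|a| <= N -> - N <= r * a <= N.
  have /eqP := r1; rewrite sqrf_eq1 ler_norml => /orP[]/eqP-> /andP[? ?]; apply/andP; split; lra.
have dr t : deriv (fun t => r * t) t r by apply: deriv_eq (derivZ r (derivI t)) _; rewrite mulr1.
have drT t : deriv (fun t => r * t + T) t r by apply: deriv_eq (derivD (dr t) (derivC T t)) _; rewrite addr0.
rewrite -{1}rr -{2}rr.
have NN : - N <= N by have := normr_ge0 Y; have := normr_ge0 y; rewrite /N; lra.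
apply: (@transport_max _ D Dx Dy bet X (- N) N (K + e) bX NN).
- move=> x' y' _ _; apply: cont2M; first exact: cont2C.
  apply: cont2B; (apply: (@cont2_comp _ fl (fun x => x) (fun y => r * y + T)) ||
    apply: (@cont2_comp _ fl (fun x => x) (fun y => r * y))) => //.
  + exact: deriv_cont (drT y').
  + exact: (flux_cont2 wv).
  + exact: deriv_cont (dr y').
  + exact: (flux_cont2 wv).
- move=> x' y' _ _; split; first by apply: derivZ; apply: derivB; exact: (flux_dx wv).
  apply: derivZ; apply: derivB.
    exact: (deriv_comp (drT y') (flux_dy wv bet x' _)).
  exact: (deriv_comp (dr y') (flux_dy wv bet x' _)).
- move=> x' y' /andP[h1 h2] _ h.
  have hx' : bet < x' < top by rewrite h1 (lt_le_trans h2 Xt).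
  have s0 : s != 0 by apply/eqP => s0; move: s1; rewrite s0 expr0n => /eqP; rewrite eq_sym oner_eq0.
  move/eqP: h; rewrite /Dx mulf_eq0 (negbTE s0)/= -mulrBr mulf_eq0 oppr_eq0 (negbTE V_neq0)/= subr_eq0 => /eqP h.
  by rewrite /Dy /ms !(mass_psi wv xb_gt xb_lt E_in E_bet)// h subrr mulr0.
- move=> y' _; case: (HX (r * y')) => h; [left|right] => //.
    by rewrite /D; lra.
  by move=> /h; rewrite /Dy; lra.
- move=> y' _; rewrite /D /fl /flux !primxx mulr0 subrr mulr0; lra.
- move=> x' hx'; apply: le_trans (sle _) _; apply: le_trans (HY _ _ hx' _) _; last lra.
  have hN : Y + T <= N by rewrite /N; have := ler_norm Y; have := normr_ge0 y; lra.
  have /eqP := r1; rewrite sqrf_eq1 => /orP[]/eqP->.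
    by right; lra.
  by left; lra.
- exact: hx.
- by apply: rN; rewrite /N; have := normr_ge0 Y; lra.
Qed.

Lemma flat_below X : bet < X <= top ->
  (forall T, 0 < T -> forall x y, bet <= x <= X -> fl x (y + T) = fl x y) ->
  forall x y, bet < x < X -> ey x y = 0.
Proof.
move=> hX H x y /andP[bx xX].
have fy x' t t' : bet <= x' <= X -> fl x' t = fl x' t'.
  move=> hx'; have [tt|tt|->//] := ltgtP t t'.
    by rewrite -(H (t' - t) _ x' t)// ?subr_gt0// addrC subrK.
  by rewrite -(H (t - t') _ x' t')// ?subr_gt0// addrC subrK.
have m0' x' : bet <= x' <= X -> ms x' y = 0.
  move=> hx'; apply: deriv_uniq (derivC (fl x' y) y).
  by apply: deriv_ext (flux_dy wv bet x' y) => t; exact: fy.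
have : - V * ey x y = 0.
  apply: deriv_uniq (derivC 0 x).
  apply: (@deriv_near _ (ms^~ y) _ _ _ (Num.min (x - bet) (X - x))); last exact: (mass_dx wv).
    by rewrite lt_min !subr_gt0 bx.
  move=> t; rewrite lt_min !ltr_norml => /andP[/andP[? ?] /andP[? ?]].
  by apply: m0'; apply/andP; split; lra.
by move/eqP; rewrite mulf_eq0 oppr_eq0 (negbTE V_neq0) => /eqP.
Qed.

Lemma flat_of_windows X : bet < X <= top ->
  (forall T s K, 0 < T -> s ^+ 2 = 1 -> 0 < K -> forall x y, bet <= x <= X ->
     s * (fl x (y + T) - fl x y) <= K) ->
  forall x y, bet < x < X -> ey x y = 0.
Proof.
move=> hX H; apply: flat_below hX _ => T T0 x y hx; apply/eqP; rewrite -subr_eq0; apply/eqP.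
have z s : s ^+ 2 = 1 -> s * (fl x (y + T) - fl x y) <= 0.
  by move=> s1; apply/ler_addgt0Pr => e e0; rewrite add0r; exact: H.
by have := z 1; have := z (-1); rewrite sqrrN expr1n => /(_ erefl) ? /(_ erefl) ?; lra.
Qed.

(** The mass is Lipschitz in the height, and the heights at y and y' approach
    each other as x tends to the level station top. *)
Lemma mass_top y y' : ~ E top -> ms top y = ms top y'.
Proof.
move=> nE; apply/eqP/negPn/negP => ne.
have e0 : 0 < `|ms top y - ms top y'| by rewrite normr_gt0 subr_eq0.
set e := `|_| in e0.
have hb : bet < xb < top by rewrite xb_gt.
have M0 : 0 <= M by have [] := U_bound wv E_in hb (m0_in wv); move=> + _; apply: le_trans.
have e3 : 0 < e / 4 / (M + 1) by rewrite divr_gt0//; lra.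
have e4 : 0 < e / 4 by lra.
have cm y1 : {for top, continuous (ms^~ y1)} by apply: cont_fst; exact: (mass_cont2 wv).
have ce y1 : {for top, continuous (eta^~ y1)} by apply: cont_fst; exact: (wave_cont wv).
have [d1 d10 H1] := (contP _ _).1 (cm y) _ e4.
have [d2 d20 H2] := (contP _ _).1 (cm y') _ e4.
have [d3 d30 H3] := (contP _ _).1 (ce y) _ e3.
have [d4 d40 H4] := (contP _ _).1 (ce y') _ e3.
pose d := Num.min (Num.min d1 d2) (Num.min (Num.min d3 d4) (top - bet)).
have d0 : 0 < d by rewrite !lt_min d10 d20 d30 d40 subr_gt0 (lt_trans xb_gt xb_lt).
have [dd1 dd2 dd3 dd4 dd5] : [/\ d <= d1, d <= d2, d <= d3, d <= d4 & d <= top - bet].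
  by rewrite /d !ge_min !lexx !orbT.
clearbody d.
have [t nt ht] : exists2 t, `|t - top| < d & bet < t < top.
  exists (top - d / 2); last by apply/andP; split; lra.
  by rewrite distrC opprB addrC subrK gtr0_norm; lra.
have := H1 t (lt_le_trans nt dd1); have := H2 t (lt_le_trans nt dd2).
have := H3 t (lt_le_trans nt dd3); have := H4 t (lt_le_trans nt dd4).
rewrite (wave_const_off wv y y' nE) => h4 h3 h2 h1.
have h5 := psi_lip_z wv xb E_in ht (eta_in wv t y) (eta_in wv t y').
have h6 : `|eta t y - eta t y'| < e / 2 / (M + 1).
  have : `|eta t y - eta t y'| <= `|eta t y - eta top y'| + `|eta t y' - eta top y'|.
    by rewrite [X in _ <= _ + X]distrC; apply: le_trans (ler_normD _ _); rewrite addrA subrK.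
  have -> : e / 2 / (M + 1) = e / 4 / (M + 1) + e / 4 / (M + 1) by field; lra.
  lra.
rewrite ltr_pdivlMr in h6; last by lra.
have h7 : `|ms t y - ms t y'| <= M * `|eta t y - eta t y'|.
  rewrite /ms !(mass_psi wv xb_gt xb_lt E_in E_bet)//.
  by rewrite [X in `|X|](_ : _ = psi m0 U W xb t (eta t y) - psi m0 U W xb t (eta t y'))//; ring.
have h8 : e <= `|ms t y - ms t y'| + `|ms t y - ms top y| + `|ms t y' - ms top y'|.
  have -> : e = `|(ms t y - ms t y') - (ms t y - ms top y) + (ms t y' - ms top y')|.
    by rewrite /e; congr (`|_|); ring.
  by apply: le_trans (ler_normD _ _) _; apply: lerD => //; exact: ler_normB.
have h9 : M * `|eta t y - eta t y'| <= `|eta t y - eta t y'| * (M + 1).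
  by rewrite mulrDr mulr1 mulrC lerDl.
lra.
Qed.

(** The increment of the flux is constant in y at the station top and tends
    to zero as y grows, so it vanishes on the outflow side as well. *)
Lemma finite_flat x y : ~ E top -> bet < x < top -> ey x y = 0.
Proof.
move=> nE; have bt : bet < top := lt_trans xb_gt xb_lt.
have hb : bet < top <= top by rewrite bt lexx.
apply: (flat_of_windows hb) => T s K T0 s1 K0 x' y'; apply: (window s1 (expr1n _ 2)) => //; first exact: ltW.
move=> z; left.
have [Y HY] := flux_tail (ltW bt) (lexx top) T0 K0.
have -> : fl top (z + T) - fl top z = fl top (Y + T) - fl top Y.
  apply: (@deriv0_const _ (fun z => fl top (z + T) - fl top z)) => t _.
  have dT : deriv (fun t => t + T) t 1 by apply: deriv_eq (derivD (derivI t) (derivC T t)) _; rewrite addr0.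
  apply: deriv_eq (derivB (deriv_comp dT (flux_dy wv bet top _)) (flux_dy wv bet top t)) _.
  by rewrite mulr1 -/ms (mass_top (t + T) t nE) subrr.
have h : bet <= top <= top by rewrite ltW//=.
have := HY _ Y h (or_introl (lexx Y)).
by move: s1 => /eqP; rewrite sqrf_eq1 ler_norml => /orP[]/eqP-> /andP[? ?]; lra.
Qed.
End at_wave.
End windows.

(** * The far field of a half line *)

Section half_line.
Context {R : realType}.
Implicit Types (x y z t : R).

Lemma tube_sub (a m0 m1 b zi dl z : R) : dl <= m0 - a -> dl <= b - m1 -> m0 <= zi <= m1 ->
  `|z - zi| <= dl -> a <= z <= b.
Proof. by move=> ? ? /andP[? ?]; rewrite ler_norml => /andP[? ?]; apply/andP; split; lra. Qed.

(** The distance decreases at the rate g at least, so it vanishes in finite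
    time. *)
Lemma catch_up (Y1 Y2 v1 v2 : R -> R) X g : 0 < g -> Y1 X < Y2 X ->
  (forall x, X <= x -> deriv Y1 x (v1 x) /\ deriv Y2 x (v2 x)) ->
  (forall x, X <= x -> g <= v1 x - v2 x) -> exists2 x, X <= x & Y1 x = Y2 x.
Proof.
move=> g0 YX dY dv.
pose T := (Y2 X - Y1 X) / g.
have T0 : 0 < T by rewrite divr_gt0//; lra.
have XT : X <= X + T by lra.
have G1 : Y1 X - Y2 X - g * X <= Y1 (X + T) - Y2 (X + T) - g * (X + T).
  apply: (@deriv_ge0_le _ (fun x => Y1 x - Y2 x - g * x) (fun x => v1 x - v2 x - g * 1)) => // x /andP[hx _].
    have [d1 d2] := dY _ hx.
    by apply: derivB; [exact: derivB|apply: derivZ; exact: derivI].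
  by have := dv x hx; lra.
have gT : g * T = Y2 X - Y1 X by rewrite /T mulrC divfK// gt_eqF.
have cG x : X <= x <= X + T -> {for x, continuous (fun x => Y1 x - Y2 x)}.
  by move=> /andP[hx _]; have [d1 d2] := dY _ hx; exact: deriv_cont (derivB d1 d2).
have [|x /andP[hx _] EY] := @IVTc _ (fun x => Y1 x - Y2 x) X (X + T) 0 XT cG.
  by left; apply/andP; split; lra.
by exists x => //; lra.
Qed.

Lemma crosses (f : R -> R) yl yr p q : (forall y, {for y, continuous f}) -> yl <= yr ->
  f yl <= p /\ p < q /\ q <= f yr \/ p <= f yl /\ q < p /\ f yr <= q ->
  exists y1 y2, [/\ y1 < y2, f y1 = p & f y2 = q].
Proof.
move=> cf lr H.
have [y2 /andP[l2 r2] f2] : exists2 y, yl <= y <= yr & f y = q.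
  apply: IVTc => //; case: H => [[? [? ?]]|[? [? ?]]]; [left|right]; apply/andP; split; lra.
have [y1 /andP[l1 r1] f1] : exists2 y, yl <= y <= y2 & f y = p.
  apply: IVTc => //; rewrite f2; case: H => [[? [? ?]]|[? [? ?]]]; [left|right]; apply/andP; split; lra.
exists y1, y2; split=> //; rewrite lt_neqAle r1 andbT; apply/eqP => E.
by move: H; rewrite -f1 -f2 E ltxx; case=> -[_ []].
Qed.

Section at_wave.
Variables (E : R -> Prop) (lo hi m0 m1 M gam : R) (U W eta ex ey : R -> R -> R).
Hypothesis wv : wave E lo hi m0 m1 M gam 1 U W eta ex ey.
Variable bet : R.
Hypothesis gam_gt0 : 0 < gam.
Hypothesis E_in : forall x, bet < x -> E x.
Hypothesis E_bet : ~ E bet.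

Let xb := bet + 1.
Let xb_gt : bet < xb. Proof. by rewrite ltrDl. Qed.
Let E_top top x : bet < x < top -> E x. Proof. by case/andP => + _; exact: E_in. Qed.
Let top_lt x : x < Num.max x xb + 1. Proof. by rewrite ltr_pwDr// le_max lexx. Qed.
Let xb_top x : xb < Num.max x xb + 1. Proof. by rewrite ltr_pwDr// le_max lexx orbT. Qed.
Let top_in x : bet < x -> bet < x < Num.max x xb + 1. Proof. by move=> ->; rewrite top_lt. Qed.

Let ms := mass 1 ey bet.
Let fl := flux 1 eta bet.
Let phi x z := psi m0 U W xb x z + off m0 1 U W eta ey bet xb.

Let phi_dz x z : bet < x -> lo < z < hi -> deriv (phi x) z (U x z).
Proof.
move=> hx hz; apply: deriv_eq (derivD (psi_dz wv xb (@E_top _) (top_in hx) hz) (derivC _ _)) _.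
by rewrite addr0.
Qed.

Let phi_dx x z : bet < x -> lo < z < hi -> deriv (phi^~ z) x (- W x z).
Proof.
move=> hx hz; apply: deriv_eq (derivD (psi_dx wv xb_gt (xb_top x) (@E_top _) (top_in hx) hz) (derivC _ _)) _.
by rewrite addr0.
Qed.

Let ms_phi x y : bet < x -> ms x y = phi x (eta x y).
Proof. by move=> hx; exact: (mass_psi wv xb_gt (xb_top x) (@E_top _) E_bet y (top_in hx)). Qed.

Let a := (lo + m0) / 2.
Let b := (m1 + hi) / 2.
Let m01 : m0 <= m1. Proof. by case/andP: (wave_range wv 0 0) => /le_trans; apply. Qed.
Let ab : [/\ lo < a, a < m0, m0 <= m1, m1 < b & b < hi].
Proof. by have := wave_lo wv; have := wave_hi wv; have := m01; rewrite /a /b => *; split=> //; lra. Qed.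
Let ab_in z : a <= z <= b -> lo < z < hi.
Proof. by move=> /andP[? ?]; have [? ? ? ? ?] := ab; apply/andP; split; lra. Qed.
Let eta_ab x y : a <= eta x y <= b.
Proof. by have /andP[? ?] := wave_range wv x y; have [? ? ? ? ?] := ab; apply/andP; split; lra. Qed.
Let m0_ab : a <= m0 <= b.
Proof. by have [? ? ? ? ?] := ab; apply/andP; split; lra. Qed.
Let btw_ab z z' t : a <= z <= b -> a <= z' <= b -> btw z z' t -> a <= t <= b.
Proof. by rewrite /btw => /andP[? ?] /andP[? ?] /orP[]/andP[? ?]; apply/andP; split; lra. Qed.

Let Ux := pdx (fun x z => U x z - gam * z).
Let Wx := pdx W.
Let field x z : bet < x -> a <= z <= b ->
  [/\ deriv (U^~ z) x (Ux x z), deriv (U x) z (gam + Wx x z),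
      deriv (W^~ z) x (Wx x z), deriv (W x) z (- Ux x z) &
      cont2 U x z /\ cont2 W x z].
Proof. by move=> hx hz; exact: (wave_field wv (conj (E_in hx) (ab_in hz))). Qed.

Let decay_ (k : R) := exists K X0, [/\ 0 < k, 0 <= K, bet < X0 & forall x z, X0 <= x -> a <= z <= b ->
  [/\ `|W x z| <= K * expR (- k * x), `|Ux x z| <= K * expR (- k * x) & `|Wx x z| <= K * expR (- k * x)]].

(** The vertical velocity is bounded and vanishes on the walls of a half
    strip; it decays exponentially, and the Cauchy estimates pass this on to
    the gradient. *)
Let decay : exists k, decay_ k.
Proof.
have lohi : lo < hi by have [? ? ? ? ?] := ab; lra.
have H0 : 0 < hi - lo by rewrite subr_gt0.
pose k := (2 * (hi - lo))^-1; have k0 : 0 < k by rewrite invr_gt0; lra.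
have MM x z : bet < x -> lo < z < hi -> `|W x z| <= M + 1.
  by move=> hx hz; have [_] := wave_bound wv (conj (E_in hx) hz); lra.
have M0 : 0 < M + 1.
  have [? ? ? ? ?] := ab; have /MM h : bet < xb by [].
  have : `|W xb m0| <= M by have [|_] := wave_bound wv (x := xb) (z := m0); [split; [exact: E_in|apply/andP; split; lra]|].
  by have := normr_ge0 (W xb m0); lra.
pose K0 := 4 * (M + 1) * expR (k * xb).
have K00 : 0 <= K0 by rewrite /K0 mulr_ge0 ?expR_ge0//; lra.
have Wdec x z : xb <= x -> lo < z < hi -> `|W x z| <= K0 * expR (- k * x).
  move=> hx hz.
  have h := @strip_bound R (band E lo hi) lo hi (M + 1) xb (2 * x - xb) (band_open wv) lohi M0.
  have x12 : xb <= 2 * x - xb by lra.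
  have := h x12 _ _ _ (wave_cr wv) _ _ x z _ hz.
  rewrite /edge -/k => /(_ _ _ _ _) H.
  have -> : K0 * expR (- k * x) = 2 * (M + 1) * (expR (- k * (x - xb)) + expR (- k * (2 * x - xb - x))).
    have -> : 2 * x - xb - x = x - xb by ring.
    have -> : - k * (x - xb) = k * xb + - k * x by ring.
    by rewrite /K0 expRD; ring.
  apply: H.
  - by move=> x' z' /andP[h1 _] hz'; split=> //; apply: E_in; have := xb_gt; lra.
  - by move=> x' z' /andP[h1 _] hz'; apply: MM => //; have := xb_gt; lra.
  - by move=> x' /andP[h1 _] e e0; apply: (wave_walls wv _ e0); apply: E_in; have := xb_gt; lra.
  - by apply/andP; split; lra.
pose R0 := Num.min (a - lo) (hi - b).
have R00 : 0 < R0 by have [? ? ? ? ?] := ab; rewrite lt_min !subr_gt0; apply/andP.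
have [R1 R2] : R0 <= a - lo /\ R0 <= hi - b by rewrite /R0 !ge_min !lexx orbT.
pose K1 := 4 * (K0 * expR (k * R0)) / R0.
have K10 : 0 <= K1 by apply: divr_ge0; [apply: mulr_ge0 => //; apply: mulr_ge0 => //; exact: expR_ge0|exact: ltW].
exists k, (K0 + K1), (xb + R0); split => //; first exact: addr_ge0.
  by have := xb_gt; lra.
move=> x z hx hz.
have e0 := expR_ge0 (- k * x).
have sqx : sq (band E lo hi) x z R0.
  move=> x' z'; rewrite !ltr_norml => /andP[h1 _] /andP[h3 h4]; split.
    by apply: E_in; have := xb_gt; lra.
  by move: hz => /andP[? ?]; apply/andP; split; lra.
have bd x' z' : `|x' - x| < R0 -> `|z' - z| < R0 -> `|W x' z'| <= K0 * expR (k * R0) * expR (- k * x).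
  move=> h1 h2; have [_ hz'] := sqx _ _ h1 h2.
  move: h1; rewrite ltr_norml => /andP[h1 _].
  apply: le_trans (Wdec x' z' _ hz') _; first lra.
  rewrite -mulrA -expRD ler_wpM2l// ler_expR.
  have -> : k * R0 + - k * x = - k * (x - R0) by ring.
  by rewrite !mulNr lerN2 ler_wpM2l//; lra.
have [g1 g2] := cauchy_est (band_open wv) (wave_cr wv) R00 sqx bd.
have E1 : 4 * (K0 * expR (k * R0) * expR (- k * x)) / R0 = K1 * expR (- k * x) by rewrite /K1; field; lra.
rewrite E1 in g1 g2; rewrite mulrDl.
have p0 : 0 <= K0 * expR (- k * x) by rewrite mulr_ge0.
have p1 : 0 <= K1 * expR (- k * x) by rewrite mulr_ge0.
split; [|rewrite /Ux; lra|rewrite /Wx; lra].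
by have : `|W x z| <= K0 * expR (- k * x); [apply: Wdec; [lra|exact: ab_in]|lra].
Qed.

(** The flow approaches the shear flow with speed gam (z - z0), with the
    corresponding quadratic stream function. *)
Lemma far_field : exists z0 d, forall e, 0 < e -> exists2 X0, bet < X0 & forall x z, X0 <= x -> a <= z <= b ->
  [/\ `|U x z - gam * (z - z0)| <= e, `|Ux x z| <= e, `|Wx x z| <= e &
      `|phi x z - (gam * (z - z0) ^+ 2 / 2 - d)| <= e].
Proof.
have [k [K [X0 [k0 K0 hX0 H]]]] := decay.
have Hb x : X0 <= x -> bet < x by move=> h; lra.
have [l0 Hl0] := @exp_decay_limit R (U^~ m0) (Ux^~ m0) K k X0 k0 (fun x hx => let: And5 d _ _ _ _ := field (Hb x hx) m0_ab in d)
   (fun x hx => let: And3 _ d _ := H x m0 hx m0_ab in d).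
have [l1 Hl1] := @exp_decay_limit R (phi^~ m0) (fun x => - W x m0) K k X0 k0 (fun x hx => phi_dx (Hb x hx) (ab_in m0_ab))
   (fun x hx => let: And3 d _ _ := H x m0 hx m0_ab in le_trans (eq_ind_r (fun t => t <= _) (lexx _) (normrN _)) d).
pose z0 := m0 - l0 / gam.
pose d := gam * (m0 - z0) ^+ 2 / 2 - l1.
have g0 : gam != 0 by rewrite gt_eqF.
have Ez z : gam * (z - z0) = l0 + gam * (z - m0) by rewrite /z0; field.
pose K2 := K / k + K * (b - a).
have ba : 0 <= b - a by have [? ? ? ? ?] := ab; lra.
have K20 : 0 <= K2 by rewrite /K2 addr_ge0 ?mulr_ge0// invr_ge0 ltW.
have nb z : a <= z <= b -> `|z - m0| <= b - a.
  by move=> /andP[? ?]; have [? ? ? ? ?] := ab; rewrite ler_norml; apply/andP; split; lra.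
have HU x z : X0 <= x -> a <= z <= b -> `|U x z - gam * (z - z0)| <= K2 * expR (- k * x).
  move=> hx hz; rewrite Ez.
  have h1 : `|(U x z - gam * z) - (U x m0 - gam * m0)| <= K * expR (- k * x) * `|z - m0|.
    apply: (@deriv_lip _ (fun z => U x z - gam * z) (Wx x)) => t bt; have ht := btw_ab m0_ab hz bt.
      have [_ dU _ _ _] := field (Hb _ hx) ht.
      by apply: deriv_eq (derivB dU (derivZ gam (derivI t))) _; rewrite mulr1; ring.
    by have [] := H _ _ hx ht.
  have h2 : K * expR (- k * x) * `|z - m0| <= K * expR (- k * x) * (b - a).
    by rewrite ler_wpM2l ?mulr_ge0 ?expR_ge0// nb.
  have -> : U x z - (l0 + gam * (z - m0)) = ((U x z - gam * z) - (U x m0 - gam * m0)) + (U x m0 - l0) by ring.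
  apply: le_trans (ler_normD _ _) _; have := Hl0 x hx; rewrite /K2; lra.
pose K3 := K / k + K2 * (b - a).
have K30 : 0 <= K3 by rewrite /K3 addr_ge0 ?mulr_ge0// invr_ge0 ltW.
have HP x z : X0 <= x -> a <= z <= b -> `|phi x z - (gam * (z - z0) ^+ 2 / 2 - d)| <= K3 * expR (- k * x).
  move=> hx hz.
  have h1 : `|(phi x z - gam * (z - z0) ^+ 2 / 2) - (phi x m0 - gam * (m0 - z0) ^+ 2 / 2)| <= K2 * expR (- k * x) * `|z - m0|.
    apply: (@deriv_lip _ (fun z => phi x z - gam * (z - z0) ^+ 2 / 2) (fun z => U x z - gam * (z - z0))) => t bt; have ht := btw_ab m0_ab hz bt; last exact: HU.
    have dq : deriv (fun z => gam * (z - z0) ^+ 2 / 2) t (gam * (t - z0)).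
      have Q := derivZ (gam / 2) (derivX2 (derivB (derivI t) (derivC z0 t))).
      apply: deriv_ext (deriv_eq Q _) => [s /=|]; [by field|by rewrite subr0; field].
    exact: derivB (phi_dz (Hb _ hx) (ab_in ht)) dq.
  have h2 : K2 * expR (- k * x) * `|z - m0| <= K2 * expR (- k * x) * (b - a).
    by rewrite ler_wpM2l ?mulr_ge0 ?expR_ge0// nb.
  have -> : phi x z - (gam * (z - z0) ^+ 2 / 2 - d) =
    ((phi x z - gam * (z - z0) ^+ 2 / 2) - (phi x m0 - gam * (m0 - z0) ^+ 2 / 2)) + (phi x m0 - l1) by rewrite /d; ring.
  apply: le_trans (ler_normD _ _) _; have := Hl1 x hx; rewrite /K3; lra.
exists z0, d => e e0.
pose C := K + K2 + K3.
have C0 : 0 <= C by apply: addr_ge0 => //; exact: addr_ge0.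
exists (Num.max X0 (C / (e * k))); first by rewrite lt_max hX0.
move=> x z; rewrite ge_max => /andP[hx hx2] hz.
have Ce : C * expR (- k * x) <= e.
  rewrite mulNr expRN ler_pdivrMr ?expR_gt0//.
  have h1 : C <= e * (k * x) by move: hx2; rewrite ler_pdivrMr ?mulr_gt0//; lra.
  have : e * (k * x) <= e * expR (k * x).
    by rewrite ler_pM2l//; have := expR_ge1Dx (k * x); lra.
  lra.
have ex0 := expR_ge0 (- k * x).
have q1 : K * expR (- k * x) <= e by apply: le_trans Ce; rewrite ler_wpM2r// /C; lra.
have q2 : K2 * expR (- k * x) <= e by apply: le_trans Ce; rewrite ler_wpM2r// /C; lra.
have q3 : K3 * expR (- k * x) <= e by apply: le_trans Ce; rewrite ler_wpM2r// /C; lra.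
have [_ h1 h2] := H x z hx hz.
split; [exact: le_trans (HU _ _ hx hz) q2|exact: le_trans h1 q1|exact: le_trans h2 q1|exact: le_trans (HP _ _ hx hz) q3].
Qed.
Section tube.
Variables (u zi dl X0 X : R).
Hypotheses (u_neq0 : u != 0) (dl_gt0 : 0 < dl) (X0_gt : bet < X0) (X0X : X0 < X).
Hypothesis tube_in : forall z, `|z - zi| <= dl -> a <= z <= b.
Hypothesis U_near : forall x z, X0 <= x -> `|z - zi| <= dl -> `|U x z - u| <= `|u| / 2.
Hypothesis phi_near : forall x, X0 <= x -> `|phi x zi - phi X zi| <= `|u| * dl / 4.

Let Xb x : X0 <= x -> bet < x. Proof. exact: lt_le_trans. Qed.
Let u0 : 0 < `|u|. Proof. by rewrite normr_gt0. Qed.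

Lemma tube_speed x z : X0 <= x -> `|z - zi| <= dl -> `|u| / 2 <= `|U x z|.
Proof.
move=> hx hz; have h := U_near hx hz; have : `|u| <= `|U x z| + `|U x z - u|.
  by rewrite [X in _ <= _ + X]distrC; apply: le_trans (ler_normD _ _); rewrite addrCA subrr addr0.
by lra.
Qed.

Let uU x z : X0 <= x -> `|z - zi| <= dl -> `|u| ^+ 2 / 2 <= u * U x z.
Proof.
move=> hx hz; have h := U_near hx hz.
have : `|u * (U x z - u)| <= `|u| * (`|u| / 2) by rewrite normrM ler_wpM2l.
rewrite ler_norml => /andP[h1 _]; move: h1.
have -> : u * (U x z - u) = u * U x z - `|u| ^+ 2 by rewrite real_normK ?num_real//; ring.
by rewrite expr2; lra.
Qed.

Let dist_btw z z' t : `|z - zi| <= dl -> `|z' - zi| <= dl -> btw z z' t -> `|t - zi| <= dl.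
Proof.
rewrite !ler_norml /btw => /andP[? ?] /andP[? ?] /orP[]/andP[? ?]; apply/andP; split; lra.
Qed.

Let phi_inc x z z' : X0 <= x -> `|z - zi| <= dl -> `|z' - zi| <= dl ->
  `|u| / 2 * `|z' - z| <= `|phi x z' - phi x z|.
Proof.
move=> hx hz hz'.
have [t bt ->] := @mvt _ (phi x) (U x) z z' (fun t bt => phi_dz (Xb hx) (ab_in (tube_in (dist_btw hz hz' bt)))).
by rewrite normrM ler_wpM2r//; apply: tube_speed => //; exact: dist_btw bt.
Qed.

Let zz : `|zi - zi| <= dl. Proof. by rewrite subrr normr0 ltW. Qed.

Let level x : X0 <= x -> exists z, `|z - zi| <= dl /\ phi x z = phi X zi.
Proof.
move=> hx; pose h z := u * (phi x z - phi X zi).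
have dh z : `|z - zi| <= dl -> deriv h z (u * U x z).
  move=> hz; apply: derivZ; apply: deriv_eq (derivB (phi_dz (Xb hx) (ab_in (tube_in hz))) (derivC _ _)) _.
  by rewrite subr0.
have h0 : `|h zi| <= `|u| ^+ 2 * dl / 4.
  rewrite /h normrM; have -> : `|u| ^+ 2 * dl / 4 = `|u| * (`|u| * dl / 4) by ring.
  by rewrite ler_wpM2l// phi_near.
have mono z z' : z <= z' -> `|z - zi| <= dl -> `|z' - zi| <= dl -> `|u| ^+ 2 / 2 * (z' - z) <= h z' - h z.
  move=> zz' hz hz'.
  have [t bt ->] := @mvt _ h (fun z => u * U x z) z z' (fun t bt => dh t (dist_btw hz hz' bt)).
  by rewrite ler_wpM2r ?subr_ge0//; apply: uU => //; exact: dist_btw bt.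
have pr : `|zi + dl - zi| <= dl by rewrite addrC addKr gtr0_norm.
have pl : `|zi - dl - zi| <= dl by rewrite addrC addKr normrN gtr0_norm.
have [le1 le2] : zi <= zi + dl /\ zi - dl <= zi by split; have := dl_gt0; lra.
have h1 := mono _ _ le1 zz pr; have h2 := mono _ _ le2 pl zz.
have u2 : 0 < `|u| ^+ 2 * dl by rewrite mulr_gt0// exprn_gt0.
have hr : 0 <= h (zi + dl).
  by move: h0; rewrite ler_norml => /andP[? ?]; lra.
have hl : h (zi - dl) <= 0.
  by move: h0; rewrite ler_norml => /andP[? ?]; lra.
have inr t : zi - dl <= t <= zi + dl -> `|t - zi| <= dl.
  by move=> /andP[? ?]; rewrite ler_norml; apply/andP; split; lra.
have ch t : zi - dl <= t <= zi + dl -> {for t, continuous h}.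
  by move=> ht; apply: deriv_cont (dh t (inr t ht)).
have [z hz hz0] := @IVTc _ h (zi - dl) (zi + dl) 0 (le_trans le2 le1) ch (or_introl (introT andP (conj hl hr))).
exists z; split; first exact: inr.
by move/eqP: hz0; rewrite /h mulf_eq0 (negbTE u_neq0) subr_eq0 => /eqP.
Qed.

(** The implicit function theorem for a level line of the stream function:
    inside the tube the speed stays close to u, so the stream function is
    strictly monotone in z. *)
Lemma streamline : exists Z : R -> R, Z X = zi /\ forall x, X0 < x ->
  `|Z x - zi| <= dl /\ deriv Z x (W x (Z x) / U x (Z x)).
Proof.
have [Z HZ] : exists Z : R -> R, forall x, X0 <= x -> `|Z x - zi| <= dl /\ phi x (Z x) = phi X zi.
  have /choice[Z HZ] : forall x, exists z, X0 <= x -> `|z - zi| <= dl /\ phi x z = phi X zi.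
    by move=> x; have [h|h] := leP X0 x; [have [z ?] := level h; exists z|exists 0].
  by exists Z.
exists Z; split.
  have [h1 h2] := HZ X (ltW X0X).
  have := phi_inc (ltW X0X) zz h1; rewrite h2 subrr normr0 pmulr_rle0; last by have := u0; lra.
  by rewrite normr_le0 subr_eq0 => /eqP.
move=> x X0x.
have [h1 h2] := HZ x (ltW X0x); split => //.
set z := Z x in h1 h2 *.
have hz := tube_in h1.
have bx := Xb (ltW X0x).
have [_ _ _ _ [cU cW]] := field bx hz.
have [r r0 Hr] := band_open wv (conj (E_in bx) (ab_in hz)).
pose r1 := Num.min r (x - X0).
have r10 : 0 < r1 by rewrite lt_min r0 subr_gt0.
have rx x' : `|x' - x| < r1 -> X0 < x'.
  by rewrite lt_min ltr_norml => /andP[_]; rewrite ltr_norml => /andP[? _]; lra.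
have U0 := tube_speed (ltW X0x) h1.
have Ugt : 0 < `|U x z| by have := u0; lra.
have Un : U x z != 0 by rewrite -normr_gt0.
have M0 : 0 <= M by have [+ _] := wave_bound wv (conj (E_in bx) (ab_in hz)); apply: le_trans.
pose C := M / (`|u| / 2).
have C0 : 0 <= C by rewrite /C divr_ge0//; have := u0; lra.
have lipZ x' : `|x' - x| < r1 -> `|Z x' - z| <= C * `|x' - x|.
  move=> hx'; have x'0 := rx _ hx'; have [h1' h2'] := HZ x' (ltW x'0).
  have i1 := phi_inc (ltW x'0) h1 h1'.
  have i2 : `|phi x' z - phi x z| <= M * `|x' - x|.
    apply: (@deriv_lip _ (phi^~ z) (fun x => - W x z)) => t bt.
      by apply: phi_dx; [move: bt; rewrite /btw => /orP[]/andP[? ?]; have := X0_gt; lra|exact: ab_in].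
    rewrite normrN; have bt0 : bet < t by move: bt; rewrite /btw => /orP[]/andP[? ?]; have := X0_gt; lra.
    by have [] := wave_bound wv (conj (E_in bt0) (ab_in hz)).
  rewrite h2' -h2 (distrC (phi x z)) in i1.
  by rewrite /C mulrAC ler_pdivlMr; have := u0; lra.
clearbody C; apply/derivP => e e0.
have C1 : 0 < 1 + C by lra.
pose e' := e * `|U x z| / (1 + C).
have e'0 : 0 < e' by apply: divr_gt0 => //; exact: mulr_gt0.
have [d d0 Hd] : exists2 d, 0 < d & forall x' z', `|x' - x| < d -> `|z' - z| < d ->
   `|phi x' z' - phi x z - - W x z * (x' - x) - U x z * (z' - z)| <= e' * (`|x' - x| + `|z' - z|).
  apply: (@diff2 _ phi (fun x z => - W x z) U x z r1 r10) => // [x' z' hx' hz'|].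
    have [_ hz''] : band E lo hi x' z'.
      by move: hx' hz'; rewrite !lt_min => /andP[hx' _] /andP[hz' _]; exact: Hr.
    have bx' := lt_trans X0_gt (rx _ hx').
    by split; [apply: phi_dx|apply: phi_dz].
  exact: cont2N.
exists (Num.min r1 (d / (C + 1))); first by rewrite lt_min r10 divr_gt0//; lra.
move=> h; rewrite lt_min => /andP[hr1]; rewrite ltr_pdivlMr; last by lra.
move=> hd; have hx' : `|(x + h) - x| < r1 by rewrite addrC addKr.
have l1 := lipZ _ hx'; have [_ c1] := HZ _ (ltW (rx _ hx')).
have eh : `|x + h - x| = `|h| by rewrite addrC addKr.
rewrite eh in l1.
have hC : `|h| <= `|h| * (C + 1) by rewrite mulrDr mulr1 lerDr mulr_ge0.
have hC' : C * `|h| <= `|h| * (C + 1) by rewrite mulrDr mulr1 mulrC lerDl.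
have := Hd (x + h) (Z (x + h)); rewrite eh c1 h2 subrr sub0r mulNr opprK.
have -> : x + h - x = h by ring.
move=> /(_ _ _) D.
have {}D : `|W x z * h - U x z * (Z (x + h) - z)| <= e' * (`|h| + `|Z (x + h) - z|).
  by apply: D; lra.
rewrite -(ler_pM2l Ugt) -normrM.
have -> : U x z * (Z (x + h) - Z x - W x z / U x z * h) = - (W x z * h - U x z * (Z (x + h) - z)) by rewrite -/z; field.
rewrite normrN; apply: le_trans D _.
have -> : `|U x z| * (e * `|h|) = e' * ((1 + C) * `|h|) by rewrite /e'; field; lra.
by rewrite ler_pM2l//; lra.
Qed.
Hypothesis grad_near : forall x z, X0 <= x -> a <= z <= b -> `|Ux x z| <= 1 /\ `|Wx x z| <= 1.

Let field_lip x z z' : X0 <= x -> a <= z <= b -> a <= z' <= b ->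
  `|U x z' - U x z| <= (gam + 1) * `|z' - z| /\ `|W x z' - W x z| <= 1 * `|z' - z|.
Proof.
move=> hx hz hz'; split.
  apply: (@deriv_lip _ (U x) (fun z => gam + Wx x z)) => t bt; have ht := btw_ab hz hz' bt.
    by have [] := field (Xb hx) ht.
  apply: le_trans (ler_normD _ _) _; have [_ h] := grad_near hx ht.
  by rewrite gtr0_norm ?lerD2l.
apply: (@deriv_lip _ (W x) (fun z => - Ux x z)) => t bt; have ht := btw_ab hz hz' bt.
  by have [] := field (Xb hx) ht.
by rewrite normrN; have [] := grad_near hx ht.
Qed.

(** Along the curve Y with Y' = 1 / U(x, Z), where Z is the streamline, the
    surface carries its height with it: the difference of eta and Z along the
    curve satisfies a linear differential inequality. *)
Lemma characteristic yi : eta X yi = zi -> exists Y v : R -> R, Y X = yi /\ forall x, X <= x ->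
  [/\ deriv Y x (v x), `|eta x (Y x) - zi| <= dl & exists2 z, `|z - zi| <= dl & v x = (U x z)^-1].
Proof.
move=> etaX; have [Z [ZX HZ]] := streamline.
pose v x := (U x (Z x))^-1.
have X0r x : X <= x -> X0 < x by exact: lt_le_trans.
have Un x : X0 < x -> U x (Z x) != 0.
  move=> hx; have [h _] := HZ _ hx; rewrite -normr_gt0.
  by have := tube_speed (ltW hx) h; have := u0; lra.
have cv x : X0 < x -> {for x, continuous v}.
  move=> hx; have [h dZ] := HZ _ hx.
  have [_ _ _ _ [cU _]] := field (Xb (ltW hx)) (tube_in h).
  have cUZ : {for x, continuous (fun x => U x (Z x))}.
    by apply: (@cont2_comp1 _ U (fun x => x) Z) => //; exact: deriv_cont dZ.
  exact: (cvgV (Un _ hx) cUZ).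
pose Y x := yi + prim v X x.
have dY x : X0 < x -> deriv Y x (v x).
  move=> hx; apply: deriv_eq (derivD (derivC yi x) _) (add0r _).
  apply: (@prim_deriv _ v X0 (Num.max X x + 1)).
  - by rewrite X0X ltr_pwDr// le_max lexx.
  - by rewrite hx ltr_pwDr// le_max lexx orbT.
  - by move=> t /andP[ht _]; exact: cv.
exists Y, v; split; first by rewrite /Y primxx addr0.
move=> x hx; have X0x := X0r _ hx.
suff E0 : eta x (Y x) - Z x = 0.
  split; [exact: dY| |by exists (Z x) => //; have [] := HZ _ X0x].
  by rewrite (_ : eta x (Y x) = Z x); [have [] := HZ _ X0x|lra].
have cex t : X <= t -> {for t, continuous (fun t => ex t (Y t))}.
  move=> ht; apply: (@cont2_comp1 _ ex (fun x => x) Y) => //; last exact: (wave_contx wv).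
  exact: deriv_cont (dY _ (X0r _ ht)).
have [B HB] : exists B, forall t, X <= t <= x -> `|ex t (Y t)| <= B.
  have [|t0 [y0 [_ _ H]]] := @EVT2 _ (fun t _ => ex t (Y t) ^+ 2) X x 0 0 hx (lexx 0).
    move=> t y /andP[ht _] _; apply/cont2P => e e0.
    have [d d0 Hd] := (contP _ _).1 (contM (cex _ ht) (cex _ ht)) _ e0.
    by exists d => // x' y' hx' _; exact: Hd.
  exists (ex t0 (Y t0) ^+ 2 + 1) => t ht.
  have h : ex t (Y t) ^+ 2 <= ex t0 (Y t0) ^+ 2 by apply: (H t 0 ht); rewrite lexx.
  have : `|ex t (Y t)| <= `|ex t (Y t)| ^+ 2 + 1.
    have := sqr_ge0 (`|ex t (Y t)| - 2^-1); rewrite sqrrB; lra.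
  by rewrite real_normK ?num_real//; lra.
pose L' t := ex t (Y t) * 1 + ey t (Y t) * v t - W t (Z t) / U t (Z t).
apply: (@gronwall _ (fun t => eta t (Y t) - Z t) L' (((gam + 1) * B + 1) / (`|u| / 2)) X x hx).
- move=> t /andP[ht _]; have X0t := X0r _ ht; have [_ dZ] := HZ _ X0t.
  apply: derivB dZ.
  by apply: (@chain2 _ eta ex ey (fun t => t) Y t 1 (v t) 1 ltr01 _ _ _ (derivI t) (dY _ X0t));
    [split; [exact: (wave_dx wv)|exact: (wave_dy wv)]|exact: (wave_contx wv)|exact: (wave_conty wv)].
- move=> t htx; have /andP[ht _] := htx; have X0t := X0r _ ht; have [hZ _] := HZ _ X0t.
  have un := Un _ X0t.
  have sp := tube_speed (ltW X0t) hZ.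
  have [f1 f2] := field_lip (ltW X0t) (tube_in hZ) (eta_ab t (Y t)).
  have kin := wave_kin wv (Y t) (E_in (Xb (ltW X0t))).
  rewrite mul1r in kin f2.
  have E1 : U t (Z t) * L' t = (W t (eta t (Y t)) - W t (Z t)) - (U t (eta t (Y t)) - U t (Z t)) * ex t (Y t).
    by rewrite /L' /v -kin; field.
  have E2 : `|U t (Z t)| * `|L' t| <= ((gam + 1) * B + 1) * `|eta t (Y t) - Z t|.
    rewrite -normrM E1; apply: le_trans (ler_normB _ _) _; rewrite normrM.
    have q : `|U t (eta t (Y t)) - U t (Z t)| * `|ex t (Y t)| <= (gam + 1) * `|eta t (Y t) - Z t| * B.
      by apply: ler_pM => //; exact: HB.
    lra.
  have E3 : `|u| / 2 * `|L' t| <= `|U t (Z t)| * `|L' t| by rewrite ler_wpM2r.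
  by rewrite mulrAC ler_pdivlMr; have := u0; lra.
- by rewrite /Y primxx addr0 etaX ZX subrr.
Qed.
End tube.

Definition slow_after z1 z2 := exists2 X0, bet < X0 &
  forall X y1 y2, X0 < X -> y1 < y2 -> eta X y1 = z1 -> eta X y2 = z2 -> False.

Definition far_from z0 d := forall e, 0 < e -> exists2 X0, bet < X0 & forall x z, X0 <= x -> a <= z <= b ->
  [/\ `|U x z - gam * (z - z0)| <= e, `|Ux x z| <= e, `|Wx x z| <= e &
      `|phi x z - (gam * (z - z0) ^+ 2 / 2 - d)| <= e].

(** Far downstream the height z travels across the stream at the rate
    1 / (gam (z - z0)). A faster height cannot lie behind a slower one, as it
    would catch up with it and the surface would have two heights there. *)
Lemma no_crossing z0 d z1 z2 : far_from z0 d -> z1 != z0 -> z2 != z0 ->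
  (gam * (z2 - z0))^-1 < (gam * (z1 - z0))^-1 -> slow_after z1 z2.
Proof.
move=> far n1 n2 sp.
have [r1|r1] := boolP (m0 <= z1 <= m1); last first.
  by exists xb => // X y1 y2 _ _ e1; move: r1; rewrite -e1 (wave_range wv).
have [r2|r2] := boolP (m0 <= z2 <= m1); last first.
  by exists xb => // X y1 y2 _ _ _ e2; move: r2; rewrite -e2 (wave_range wv).
set u1 := gam * (z1 - z0) in sp; set u2 := gam * (z2 - z0) in sp.
have g0 : gam != 0 by rewrite gt_eqF.
have u10 : u1 != 0 by rewrite mulf_neq0// subr_eq0.
have u20 : u2 != 0 by rewrite mulf_neq0// subr_eq0.
have zz : z1 != z2 by apply: contraTneq sp => E1; rewrite /u1 /u2 E1 ltxx.
(* g is the difference of the two rates; far enough downstream half of it is left *)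
pose g := u1^-1 - u2^-1; have g_gt0 : 0 < g by rewrite subr_gt0.
have gE : g = u1^-1 - u2^-1 by [].
clearbody g.
have inv_near w : w != 0 -> exists2 r : R, 0 < r & forall v, `|v - w| < r -> `|v^-1 - w^-1| < g / 4.
  move=> w0; have cw := deriv_cont (@derivV _ (fun y => y) w 1 w0 (derivI w)).
  by apply: (contP _ _).1 cw _ _; lra.
have [p1 p10 P1] := inv_near u1 u10; have [p2 p20 P2] := inv_near u2 u20.
have [p [p0 [pp1 pp2 pu1 pu2]]] : exists p, 0 < p /\ [/\ p <= p1, p <= p2, p <= `|u1| / 2 & p <= `|u2| / 2].
  exists (Num.min (Num.min p1 p2) (Num.min (`|u1| / 2) (`|u2| / 2))).
  by rewrite !lt_min p10 p20 !divr_gt0 ?normr_gt0// !ge_min !lexx !orbT.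
have phalf : p / 2 < p by lra.
have [aa bb] : 0 < m0 - a /\ 0 < b - m1 by have [? ? ? ? ?] := ab; split; lra.
have [dl [dl0 [dl1 dl2 dl3 dl4]]] : exists dl, 0 < dl /\
    [/\ dl <= p / gam / 4, dl <= `|z1 - z2| / 3, dl <= m0 - a & dl <= b - m1].
  exists (Num.min (Num.min (p / gam / 4) (`|z1 - z2| / 3)) (Num.min (m0 - a) (b - m1))).
  by rewrite !lt_min aa bb !divr_gt0 ?normr_gt0 ?subr_eq0// !ge_min !lexx !orbT.
have gdl : gam * dl <= p / 4.
  have : gam * dl <= gam * (p / gam / 4) by rewrite ler_pM2l.
  by have -> : gam * (p / gam / 4) = p / 4 by field.
have v10 : 0 < `|u1| by rewrite normr_gt0.
have v20 : 0 < `|u2| by rewrite normr_gt0.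
have [e [e0 [e1 e2 e3 e4]]] : exists e, 0 < e /\
    [/\ e <= p / 4, e <= `|u1| * dl / 8, e <= `|u2| * dl / 8 & e <= 1].
  exists (Num.min (Num.min (p / 4) (`|u1| * dl / 8)) (Num.min (`|u2| * dl / 8) 1)).
  by rewrite !lt_min ltr01 !divr_gt0 ?mulr_gt0// !ge_min !lexx !orbT.
have [X0 hX0 H] := far e e0.
have tin zi : m0 <= zi <= m1 -> forall z, `|z - zi| <= dl -> a <= z <= b.
  by move=> hi' z; exact: (tube_sub dl3 dl4 hi').
have Unr zi z x : m0 <= zi <= m1 -> X0 <= x -> `|z - zi| <= dl -> `|U x z - gam * (zi - z0)| <= p / 2.
  move=> hi' hx hz; have [h _ _ _] := H x z hx (tin _ hi' _ hz).
  have h' : `|gam * (z - zi)| <= gam * dl by rewrite normrM gtr0_norm// ler_pM2l.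
  have -> : U x z - gam * (zi - z0) = (U x z - gam * (z - z0)) + gam * (z - zi) by ring.
  apply: le_trans (ler_normD _ _) _; lra.
have phn zi X x : m0 <= zi <= m1 -> X0 <= x -> X0 <= X -> `|phi x zi - phi X zi| <= 2 * e.
  move=> hi' hx hX.
  have hz : a <= zi <= b by apply: (tin _ hi'); rewrite subrr normr0 ltW.
  have [_ _ _ h1] := H x zi hx hz; have [_ _ _ h2] := H X zi hX hz.
  set q := gam * _ / 2 - d in h1 h2.
  have -> : phi x zi - phi X zi = (phi x zi - q) - (phi X zi - q) by ring.
  apply: le_trans (ler_normB _ _) _; lra.
have grd x z : X0 <= x -> a <= z <= b -> `|Ux x z| <= 1 /\ `|Wx x z| <= 1.
  by move=> hx hz; have [_ h1 h2 _] := H x z hx hz; split; lra.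
exists X0 => // X y1 y2 hX y12 E1 E2.
have C1 : exists Y v : R -> R, Y X = y1 /\ forall x, X <= x ->
  [/\ deriv Y x (v x), `|eta x (Y x) - z1| <= dl & exists2 z, `|z - z1| <= dl & v x = (U x z)^-1].
  apply: (@characteristic u1 z1 dl X0 X) => //; first exact: tin.
    by move=> x z hx hz; apply: le_trans (Unr _ _ _ r1 hx hz) _; lra.
  by move=> x hx; apply: le_trans (phn _ _ _ r1 hx (ltW hX)) _; lra.
have C2 : exists Y v : R -> R, Y X = y2 /\ forall x, X <= x ->
  [/\ deriv Y x (v x), `|eta x (Y x) - z2| <= dl & exists2 z, `|z - z2| <= dl & v x = (U x z)^-1].
  apply: (@characteristic u2 z2 dl X0 X) => //; first exact: tin.
    by move=> x z hx hz; apply: le_trans (Unr _ _ _ r2 hx hz) _; lra.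
  by move=> x hx; apply: le_trans (phn _ _ _ r2 hx (ltW hX)) _; lra.
case: C1 => Y1 [v1 [YX1 H1]]; case: C2 => Y2 [v2 [YX2 H2]].
have dv x : X <= x -> g / 2 <= v1 x - v2 x.
  move=> hx; have X0x : X0 <= x by lra.
  have [_ _ [t1 k1 ->]] := H1 x hx; have [_ _ [t2 k2 ->]] := H2 x hx.
  have q1 : `|(U x t1)^-1 - u1^-1| < g / 4.
    by apply: P1; apply: le_lt_trans (Unr _ _ _ r1 X0x k1) (lt_le_trans phalf pp1).
  have q2 : `|(U x t2)^-1 - u2^-1| < g / 4.
    by apply: P2; apply: le_lt_trans (Unr _ _ _ r2 X0x k2) (lt_le_trans phalf pp2).
  by move: q1 q2; rewrite !ltr_norml => /andP[? ?] /andP[? ?]; lra.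
have [x hx1 EY'] : exists2 x, X <= x & Y1 x = Y2 x.
  apply: (@catch_up Y1 Y2 v1 v2 X (g / 2)) => //; [by rewrite divr_gt0|by rewrite YX1 YX2|].
  by move=> x hx; have [d1 _ _] := H1 x hx; have [d2 _ _] := H2 x hx.
have [_ k1 _] := H1 x hx1; have [_ k2 _] := H2 x hx1.
rewrite EY' in k1.
have : `|z1 - z2| <= `|eta x (Y2 x) - z1| + `|eta x (Y2 x) - z2|.
  by rewrite [X in _ <= X + _]distrC; apply: le_trans (ler_normD _ _); rewrite addrA subrK.
have : 0 < `|z1 - z2| by rewrite normr_gt0 subr_eq0.
lra.
Qed.

(** Otherwise the energy would grow linearly in y. *)
Lemma mass_recurs x e N : bet < x -> 0 < e ->
  (exists2 y, N <= y & `|ms x y| < e) /\ (exists2 y, y <= N & `|ms x y| < e).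
Proof.
move=> hx e0.
have [C HC] := energy_bounded wv xb_gt (xb_top x) (@E_top _) E_bet (ltW hx) (ltW (top_lt x)).
have {}HC y : `|energy 1 ey bet x y| <= C by apply: HC; rewrite lexx ltW.
have C0 : 0 <= C by apply: le_trans (HC 0).
pose T := (2 * C + 1) / e ^+ 2.
have e2 : 0 < e ^+ 2 by rewrite exprn_gt0.
have T0 : 0 < T by rewrite divr_gt0//; lra.
have eT : e ^+ 2 * T = 2 * C + 1 by rewrite /T mulrC divfK// gt_eqF.
have grow y : (forall t, y <= t <= y + T -> e <= `|ms x t|) -> False.
  move=> H; have yT : y <= y + T by lra.
  have : energy 1 ey bet x y - e ^+ 2 * y <= energy 1 ey bet x (y + T) - e ^+ 2 * (y + T).
    apply: (@deriv_ge0_le _ (fun t => energy 1 ey bet x t - e ^+ 2 * t) (fun t => ms x t ^+ 2 - e ^+ 2 * 1)) => // t ht.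
      by apply: derivB; [exact: (energy_dy wv)|apply: derivZ; exact: derivI].
    rewrite mulr1 subr_ge0 -(real_normK (num_real (ms x t))).
    by apply: lerXn2r; rewrite ?nnegrE ?normr_ge0 ?(ltW e0)//; exact: H.
  have := HC y; have := HC (y + T); rewrite !ler_norml => /andP[? ?] /andP[? ?].
  lra.
split.
  have [//|n0] := pselect (exists2 y, N <= y & `|ms x y| < e).
  case: (grow N) => t /andP[ht _]; rewrite leNgt; apply/negP => h; apply: n0; by exists t.
have [//|n0] := pselect (exists2 y, y <= N & `|ms x y| < e).
case: (grow (N - T)) => t /andP[_ ht]; rewrite leNgt; apply/negP => h; apply: n0; exists t => //; lra.
Qed.

Let top X := Num.max X xb + 1.

Let flat X : bet < X -> (forall T s K, 0 < T -> s ^+ 2 = 1 -> 0 < K -> forall x y, bet <= x <= X ->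
     s * (fl x (y + T) - fl x y) <= K) -> forall x y, bet < x < X -> ey x y = 0.
Proof.
move=> hX H; have hX' : bet < X <= top X by rewrite hX ltW.
exact: (flat_of_windows wv (oner_neq0 R) hX' H).
Qed.

Let win X T s r K : bet < X -> s ^+ 2 = 1 -> r ^+ 2 = 1 -> 0 < T -> 0 <= K ->
  (forall y, s * (fl X (y + T) - fl X y) <= K \/
     (s * (eta X (y + T) - eta X y) <= 0 -> s * r * (phi X (eta X (y + T)) - phi X (eta X y)) <= 0)) ->
  forall x y, bet <= x <= X -> s * (fl x (y + T) - fl x y) <= K.
Proof.
move=> hX s1 r1 T0 K0 H; have hX' : bet < X <= top X by rewrite hX ltW.
apply: (window wv xb_gt (xb_top X) (@E_top _) E_bet (oner_neq0 R) s1 r1 hX' T0 K0) => y.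
case: (H y) => h; [by left|right => h1].
rewrite -/ms !ms_phi//; apply: h; move: h1; lra.
Qed.

Section limits.
Variables z0 d : R.
Hypothesis far : far_from z0 d.

Let ms_far e : 0 < e -> exists2 X0, bet < X0 & forall X y, X0 <= X ->
  `|ms X y - (gam * (eta X y - z0) ^+ 2 / 2 - d)| <= e.
Proof.
move=> e0; have [X0 h0 H] := far e0; exists X0 => // X y hX.
by rewrite ms_phi ?(lt_le_trans h0)//; have [] := H X _ hX (eta_ab X y).
Qed.

(** For d < 0 the stream function stays away from zero far downstream,
    whereas the mass comes close to zero. *)
Lemma deficit_ge0 : 0 <= d.
Proof.
rewrite leNgt; apply/negP => d0.
have e0 : 0 < - d / 2 by lra.
have [X0 h0 H] := ms_far e0; have [[y _ h] _] := mass_recurs 0 h0 e0.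
have := H X0 y (lexx _).
have := mulr_ge0 (ltW gam_gt0) (sqr_ge0 (eta X0 y - z0)).
by move: h; rewrite ltr_norml ler_norml => /andP[? ?] ? /andP[? ?]; lra.
Qed.

Let speed_lt (s t : R) : 0 < s * t -> s < t -> (gam * (z0 + t - z0))^-1 < (gam * (z0 + s - z0))^-1.
Proof.
move=> st lt; have n (c : R) : z0 + c - z0 = c by ring.
have s0 : s != 0 by apply: contraTneq st => ->; rewrite mul0r ltxx.
have t0 : t != 0 by apply: contraTneq st => ->; rewrite mulr0 ltxx.
rewrite !n !invfM ltr_pM2l ?invr_gt0// -subr_gt0.
have -> : s^-1 - t^-1 = (t - s) / (s * t) by field; rewrite s0 t0.
by rewrite divr_gt0// subr_gt0.
Qed.

Let cross_no s t : s != 0 -> t != 0 -> (gam * (z0 + t - z0))^-1 < (gam * (z0 + s - z0))^-1 ->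
  slow_after (z0 + s) (z0 + t).
Proof.
move=> s0 t0; apply: (no_crossing far); rewrite -subr_eq0 addrAC subrr add0r//.
Qed.

Let ceta X y : {for y, continuous (eta X)}.
Proof. exact: deriv_cont (wave_dy wv X y). Qed.

(** Near both ends the surface comes close to z0. If it left the band of
    width e in between, it would take the values z0 + e/2 and z0 + e in the
    wrong order on the way up, or z0 - e and z0 - e/2 on the way back. *)
Lemma settles : d = 0 -> forall e, 0 < e -> exists2 X0, bet < X0 & forall X y, X0 < X -> `|eta X y - z0| <= e.
Proof.
move=> d0 e e0.
have gen0 := gam_gt0.
have q0 : 0 < gam * e ^+ 2 / 32 by rewrite divr_gt0// mulr_gt0// exprn_gt0.
have [X1 h1 H1] := ms_far q0.
have [X2 h2 H2] : slow_after (z0 + e / 2) (z0 + e).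
  by apply: cross_no; [lra|lra|apply: speed_lt; [rewrite mulr_gt0//|]; lra].
have [X3 h3 H3] : slow_after (z0 + - e) (z0 + - (e / 2)).
  apply: cross_no; [lra|lra|apply: speed_lt; [|lra]].
  by rewrite mulrNN mulr_gt0//; lra.
exists (Num.max X1 (Num.max X2 X3)); first by rewrite lt_max h1.
move=> X y; rewrite !gt_max => /and3P[k1 k2 k3].
have near t : `|ms X t| < gam * e ^+ 2 / 32 -> `|eta X t - z0| < e / 2.
  move=> h; have := H1 X t (ltW k1); rewrite d0 subr0 => h'.
  rewrite ltNge; apply/negP => le.
  have : gam * (e / 2) ^+ 2 <= gam * (eta X t - z0) ^+ 2.
    rewrite ler_pM2l// -(real_normK (num_real (eta X t - z0))) lerXn2r// ?nnegrE//; lra.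
  rewrite expr_div_n.
  move: h h'; rewrite ltr_norml ler_norml => /andP[? ?] /andP[? ?]; lra.
have [[yr hr nr] [yl hl nl]] := mass_recurs y (lt_trans h1 k1) q0.
have := near _ nr; have := near _ nl; rewrite !ltr_norml => /andP[l1 l2] /andP[r1 r2].
rewrite leNgt; apply/negP; rewrite ltr_normr => /orP[] h.
  have [|y1 [y2 [y12 e1 e2]]] := @crosses (eta X) yl y (z0 + e / 2) (z0 + e) (@ceta X) hl.
    by left; split; [lra|split; lra].
  exact: (H2 X y1 y2).
have [|y1 [y2 [y12 e1 e2]]] := @crosses (eta X) y yr (z0 + - e) (z0 + - (e / 2)) (@ceta X) hr.
  by left; split; [lra|split; lra].
exact: (H3 X y1 y2).
Qed.

(** Near both ends the surface comes close to z0 + r or to z0 - r. All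
    passages that would let it take both a value below z0 + r/3 and a value
    above z0 - r/3 occur in the order excluded by the crossing lemma. *)
Lemma splits r : 0 < r -> gam * r ^+ 2 / 2 = d -> exists2 X0, bet < X0 & forall X, X0 < X ->
  (forall y, z0 + r / 3 < eta X y) \/ (forall y, eta X y < z0 - r / 3).
Proof.
move=> r0 rd.
have q0 : 0 < d / 9 by rewrite -rd divr_gt0// divr_gt0// mulr_gt0// exprn_gt0.
have [X1 h1 H1] := ms_far q0.
(* the crossings excluded: within z > z0, within z < z0, and from above z0
   to below it *)
have [X2 h2 H2] : slow_after (z0 + r / 3) (z0 + 2 * r / 3).
  by apply: cross_no; [lra|lra|apply: speed_lt; [rewrite mulr_gt0//|]; lra].
have [X3 h3 H3] : slow_after (z0 + - (2 * r / 3)) (z0 + - (r / 3)).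
  apply: cross_no; [lra|lra|apply: speed_lt; [|lra]].
  by rewrite mulrNN mulr_gt0//; lra.
have [X4 h4 H4] : slow_after (z0 + 2 * r / 3) (z0 + - (2 * r / 3)).
  apply: cross_no; [lra|lra|].
  have n (c : R) : z0 + c - z0 = c by ring.
  apply: (@lt_trans _ _ 0).
    by rewrite n invr_lt0 mulrN oppr_lt0 mulr_gt0//; lra.
  by rewrite n invr_gt0 mulr_gt0//; lra.
exists (Num.max (Num.max X1 X2) (Num.max X3 X4)); first by rewrite !lt_max h1.
move=> X; rewrite !gt_max => /andP[/andP[k1 k2] /andP[k3 k4]].
have good t : `|ms X t| < d / 9 -> z0 + 2 * r / 3 <= eta X t \/ eta X t <= z0 - 2 * r / 3.
  move=> h; have h' := H1 X t (ltW k1).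
  have [le|lt] := leP (2 * r / 3) `|eta X t - z0|.
    by move: le; rewrite ler_normr => /orP[] ?; [left|right]; lra.
  have : gam * (eta X t - z0) ^+ 2 <= gam * (2 * r / 3) ^+ 2.
    rewrite ler_pM2l// -(real_normK (num_real (eta X t - z0))) lerXn2r// ?nnegrE//; lra.
  rewrite expr_div_n exprMn.
  move: h h'; rewrite ltr_norml ler_norml => /andP[? ?] /andP[? ?]; lra.
have [|n1] := pselect (forall y, z0 + r / 3 < eta X y); first by left.
right=> y2; rewrite ltNge; apply/negP => hy2; apply: n1 => y1.
rewrite ltNge; apply/negP => hy1.
have bX := lt_trans h1 k1.
have [[yr hr /good gr] _] := mass_recurs (Num.max y1 y2) bX q0.
have [_ [yl hl /good gl]] := mass_recurs (Num.min y1 y2) bX q0.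
move: hr hl; rewrite ge_max le_min => /andP[y1r y2r] /andP[ly1 ly2].
case: gl => gl; last first.
  have [|t1 [t2 [t12 e1 e2]]] := @crosses (eta X) yl y2 (z0 + - (2 * r / 3)) (z0 + - (r / 3)) (@ceta X) ly2.
    by left; split; [lra|split; lra].
  exact: (H3 X t1 t2).
case: gr => gr.
  have [|t1 [t2 [t12 e1 e2]]] := @crosses (eta X) y1 yr (z0 + r / 3) (z0 + 2 * r / 3) (@ceta X) y1r.
    by left; split; [lra|split; lra].
  exact: (H2 X t1 t2).
have [|t1 [t2 [t12 e1 e2]]] := @crosses (eta X) yl yr (z0 + 2 * r / 3) (z0 + - (2 * r / 3)) (@ceta X) (le_trans ly1 y1r).
  by right; split; [lra|split; lra].
exact: (H4 X t1 t2).
Qed.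

(** The mass is small far downstream, so the increment of the flux is small
    on the outflow side. *)
Lemma settled_flat x y : d = 0 -> bet < x -> ey x y = 0.
Proof.
move=> d0 hx; have hx1 : bet < x + 1 by lra.
apply: (flat hx1); last by apply/andP; split; lra.
move=> T s K T0 s1 K0 x' y' /andP[hx' hx'1].
have g0 := gam_gt0.
have k0 : 0 < K / T / 2 by rewrite !divr_gt0.
pose e := Num.min 1 (K / T / gam).
have e0 : 0 < e by rewrite lt_min ltr01 !divr_gt0.
have [X1 h1 H1] := ms_far k0; have [X2 h2 H2] := settles d0 e0.
pose X := Num.max (Num.max X1 X2) x + 1.
have [XX1 XX2 XX3] : [/\ X1 < X, X2 < X & x + 1 <= X].
  by rewrite /X lerD2r; split; rewrite ?ltr_pwDr// !le_max lexx ?orbT.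
have bX := lt_trans h1 XX1.
apply: (win bX s1 (expr1n _ 2) T0 (ltW K0)); last by rewrite hx'/=; lra.
move=> z; left.
have ms_small t : `|ms X t| <= K / T.
  have := H1 X t (ltW XX1); rewrite d0 subr0 => h.
  have : gam * (eta X t - z0) ^+ 2 <= K / T.
    have -> : K / T = gam * (K / T / gam) by field; rewrite !gt_eqF.
    rewrite ler_pM2l// -(real_normK (num_real (eta X t - z0))).
    have h2' := H2 X t XX2.
    have e1 : e <= 1 by rewrite /e ge_min lexx.
    have e2 : e <= K / T / gam by rewrite /e ge_min lexx orbT.
    apply: (le_trans _ e2); apply: (le_trans _ h2').
    by rewrite expr2 ler_piMl// (le_trans h2' e1).
  have := mulr_ge0 (ltW g0) (sqr_ge0 (eta X t - z0)).
  by move: h; rewrite !ler_norml => /andP[? ?] ? ?; apply/andP; split; lra.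
have : `|fl X (z + T) - fl X z| <= K / T * `|z + T - z|.
  by apply: (@deriv_lip _ (fl X) (ms X)) => t _; [exact: (flux_dy wv)|exact: ms_small].
have -> : z + T - z = T by ring.
rewrite (gtr0_norm T0) divfK ?gt_eqF//.
by move: s1 => /eqP; rewrite sqrf_eq1 ler_norml => /orP[]/eqP-> /andP[? ?]; lra.
Qed.

(** On the range of the surface far downstream U has a sign, so mass is a
    monotone function of the height there and the outflow condition of the
    maximum principle holds, in one of the two directions. *)
Lemma split_flat x y : 0 < d -> bet < x -> ey x y = 0.
Proof.
move=> d0 hx.
have g0 := gam_gt0.
pose r := Num.sqrt (2 * d / gam).
have q0 : 0 < 2 * d / gam by rewrite divr_gt0//; lra.
have r0 : 0 < r by rewrite sqrtr_gt0.
have rd : gam * r ^+ 2 / 2 = d by rewrite sqr_sqrtr ?ltW//; field; lra.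
clearbody r.
have [X1 h1 H1] := splits r0 rd.
have k0 : 0 < gam * (r / 3) by rewrite mulr_gt0//; lra.
have [X2 h2 H2] := far k0.
pose X := Num.max (Num.max X1 X2) x + 1.
have [XX1 XX2 XX3] : [/\ X1 < X, X2 < X & x + 1 <= X].
  by rewrite /X lerD2r; split; rewrite ?ltr_pwDr// !le_max lexx ?orbT.
have bX := lt_trans h1 XX1.
clearbody X.
apply: (flat bX); last by rewrite hx/=; lra.
move=> T s K T0 s1 K0 x' y' hx'.
have dphi (p q : R) : a <= p <= b -> a <= q <= b -> exists2 c, btw p q c & phi X q - phi X p = U X c * (q - p).
  move=> hp hq; apply: mvt => t bt; apply: phi_dz => //; apply: ab_in; exact: btw_ab bt.
have [Hp|Hm] := H1 X XX1.
  apply: (win bX s1 (expr1n _ 2) T0 (ltW K0)) => // z; right => hs; rewrite mulr1.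
  have [c bc ->] := dphi _ _ (eta_ab X z) (eta_ab X (z + T)).
  have [hU _ _ _] := H2 X c (ltW XX2) (btw_ab (eta_ab X z) (eta_ab X (z + T)) bc).
  rewrite mulrCA; apply: mulr_ge0_le0 => //.
  have : gam * (r / 3) <= gam * (c - z0).
    rewrite ler_pM2l//; have := Hp z; have := Hp (z + T); move: bc; rewrite /btw => /orP[]/andP[? ?]; lra.
  by move: hU; rewrite ler_norml => /andP[? ?]; lra.
have r1 : (-1 : R) ^+ 2 = 1 by rewrite sqrrN expr1n.
apply: (win bX s1 r1 T0 (ltW K0)) => // z; right => hs.
have [c bc ->] := dphi _ _ (eta_ab X z) (eta_ab X (z + T)).
have [hU _ _ _] := H2 X c (ltW XX2) (btw_ab (eta_ab X z) (eta_ab X (z + T)) bc).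
have -> : s * -1 * (U X c * (eta X (z + T) - eta X z)) = - U X c * (s * (eta X (z + T) - eta X z)) by ring.
apply: mulr_ge0_le0 => //; rewrite oppr_ge0.
have : gam * (c - z0) <= gam * - (r / 3).
  rewrite ler_pM2l//; have := Hm z; have := Hm (z + T); move: bc; rewrite /btw => /orP[]/andP[? ?]; lra.
by move: hU; rewrite ler_norml => /andP[? ?]; lra.
Qed.
End limits.

Lemma half_line_flat x y : bet < x -> ey x y = 0.
Proof.
move=> hx; have [z0 [d far]] := far_field.
have := deficit_ge0 far; rewrite le_eqVlt => /orP[/eqP d0|d0].
  exact: (settled_flat far).
exact: (split_flat far).
Qed.
End at_wave.
End half_line.

(** * Surfaces with a level station *)

Section components.
Context {R : realType}.
Implicit Types (x y z t : R).

Lemma last_exit (E : R -> Prop) b x1 :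
  (forall x, E x -> exists2 r : R, 0 < r & forall x', `|x' - x| < r -> E x') ->
  b < x1 -> ~ E b -> E x1 -> exists bet, [/\ b <= bet, bet < x1, ~ E bet & forall x, bet < x <= x1 -> E x].
Proof.
move=> oE bx nb Ex1.
pose S := [set t | t <= x1 /\ ~ E t].
have Sb : S b by split=> //; exact: ltW.
have ubS : ubound S x1 by move=> t [].
have sS : has_sup S by split; [exists b|exists x1].
have bs : b <= sup S by apply: sup_upper_bound.
have sx : sup S <= x1 by apply: ge_sup => //; exists b.
have ns : ~ E (sup S).
  move=> Es; have [r r0 Hr] := oE _ Es.
  have [t St] := sup_adherent r0 sS.
  have [_ nt] := St; have ts : t <= sup S by apply: sup_upper_bound.
  by move=> lt; apply: nt; apply: Hr; rewrite ler0_norm; lra.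
exists (sup S); split=> //.
  by rewrite lt_neqAle sx andbT; apply: contra_notN ns => /eqP ->.
move=> x /andP[sxx xx1]; apply: contrapT => nx.
have : x <= sup S by apply: sup_upper_bound.
lra.
Qed.

(** The component of the non-level stations to the right of b is a bounded
    interval between two level stations or a half line. Scaling y makes V = 1,
    and reversing y together with the flow makes gam positive. *)
Lemma right_flat (E : R -> Prop) lo hi m0 m1 M gam V (U W eta ex ey : R -> R -> R) b x1 y1 :
  wave E lo hi m0 m1 M gam V U W eta ex ey -> gam != 0 -> ~ E b -> b < x1 -> ey x1 y1 = 0.
Proof.
move=> wv g0 nb bx; apply: contrapT => /eqP ne.
have Ex1 : E x1 by apply: contrapT => nE; move: ne; rewrite (wave_flat wv)// eqxx.
have [bet [_ bx1 nbet Ebet]] := last_exit (wave_open wv) bx nb Ex1.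
have oN : forall x, E (- x) -> exists2 r : R, 0 < r & forall x', `|x' - x| < r -> E (- x').
  by move=> x Ex; have [r r0 Hr] := wave_open wv Ex; exists r => // x' h; apply: Hr; rewrite -opprD normrN.
have finite top : x1 < top -> (forall x, bet < x < top -> E x) -> V = 0 \/ ~ E top -> False.
  move=> xt Et h.
  have [xb1 xb2] : bet < (bet + top) / 2 /\ (bet + top) / 2 < top by split; lra.
  have hx1 : bet < x1 < top by rewrite bx1.
  have [V0|Vn] := eqVneq V 0; first exact: (parallel_absurd wv xb1 xb2 Et nbet V0 g0 hx1 ne).
  case: h => [V0|nt]; first by rewrite V0 eqxx in Vn.
  by move: ne; rewrite (finite_flat wv xb1 xb2 Et nbet Vn y1 nt hx1) eqxx.
have [[c [xc nc]]|noc] := pselect (exists c, x1 < c /\ ~ E c).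
  have nc' : ~ E (- - c) by rewrite opprK.
  have Ex1' : E (- - x1) by rewrite opprK.
  have xc' : - c < - x1 by rewrite ltrN2.
  have [top' [_ tx nt Et]] := @last_exit (fun x => E (- x)) (- c) (- x1) oN xc' nc' Ex1'.
  apply: (finite (- top')); [lra| |by right].
  move=> x /andP[h1 h2]; have [le|lt] := leP x x1; first by apply: Ebet; rewrite h1.
  by rewrite -[x]opprK; apply: Et; apply/andP; split; lra.
have Er x : bet < x -> E x.
  move=> h1; have [le|lt] := leP x x1; first by apply: Ebet; rewrite h1.
  by apply: contrapT => nx; apply: noc; exists x.
have [V0|Vn] := eqVneq V 0.
  by apply: (finite (x1 + 1)); [lra|move=> x /andP[? _]; exact: Er|left].
have wv1 := wave_scale wv Vn.
have ne1 : V * ey x1 (V * (y1 / V)) != 0.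
  by rewrite [V * (_ / _)]mulrC divfK// mulf_neq0.
have [gp|gn] := ltP 0 gam.
  by move: ne1; rewrite (half_line_flat wv1 gp Er nbet (y1 / V) bx1) eqxx.
have gp : 0 < - gam by rewrite oppr_gt0 lt_neqAle g0.
have := half_line_flat (wave_flip wv1) gp Er nbet (- (y1 / V)) bx1.
by rewrite /= opprK => /eqP; rewrite oppr_eq0 (negbTE ne1).
Qed.

Lemma wave_all_flat (E : R -> Prop) lo hi m0 m1 M gam V (U W eta ex ey : R -> R -> R) b x y :
  wave E lo hi m0 m1 M gam V U W eta ex ey -> gam != 0 -> ~ E b -> ey x y = 0.
Proof.
move=> wv g0 nb; have [bx|xb|bx] := ltgtP b x.
- exact: right_flat wv g0 nb bx.
- have gN : - gam != 0 by rewrite oppr_eq0.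
  have nb' : ~ E (- - b) by rewrite opprK.
  have xb' : - b < - x by rewrite ltrN2.
  by have := @right_flat _ _ _ _ _ _ _ _ _ _ _ _ _ (- b) (- x) y (wave_mirror wv) gN nb' xb'; rewrite opprK.
- by rewrite (wave_flat wv)// -bx.
Qed.
End components.

(** * Uniform shears *)

Section two_layers.
Context {R : realType}.
Implicit Types (x y z t : R).

(** Domains in which any two points are joined by a vertical, a horizontal
    and a vertical segment, the horizontal one at the height zb. The projection
    of a layer is of this kind. *)
Definition comb (sh : R -> R -> Prop) zb r0 := [/\ open2 sh, 0 < r0,
  forall x z, `|z - zb| < r0 -> sh x z & forall x z t, sh x z -> btw zb z t -> sh x t].

Lemma comb_base sh zb r0 x : comb sh zb r0 -> sh x zb.
Proof. by move=> [_ r0_gt0 H _]; apply: H; rewrite subrr normr0. Qed.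

Lemma comb_path sh zb r0 (P : R -> R -> Prop) x z x' z' : comb sh zb r0 ->
  (forall x z1 z2, (forall t, btw z1 z2 t -> sh x t) -> P x z1 -> P x z2) ->
  (forall x1 x2 z, (forall t, btw x1 x2 t -> sh t z) -> P x1 z -> P x2 z) ->
  sh x z -> sh x' z' -> P x z -> P x' z'.
Proof.
move=> cb Pv Ph Sz Sz' Pz; have [_ _ _ star] := cb.
apply: (Pv x' zb) => [t bt|]; first exact: star bt.
apply: (Ph x) => [t _|]; first exact: comb_base cb.
apply: (Pv x z) => // t; rewrite btwC; exact: star.
Qed.

Lemma comb_zero sh zb r0 A B x z : comb sh zb r0 -> cr sh A B -> sh x z -> jet0 A B x z ->
  forall x' z', sh x' z' -> A x' z' = 0 /\ B x' z' = 0.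
Proof.
move=> cb c Sz jz x' z' Sz'; have [oS _ _ _] := cb.
suff : jet0 A B x' z' by move=> /(_ 0%N).
apply: (@comb_path _ _ _ (jet0 A B) x z x' z' cb _ _ Sz Sz' jz) => [x1 z1 z2 H j|x1 x2 z1 H j].
  exact: (jet_vert oS c H j (btwr _ _)).
exact: (jet_hor oS c H j (btwr _ _)).
Qed.

Lemma comb_const sh zb r0 (f : R -> R -> R) x z x' z' : comb sh zb r0 ->
  (forall x z, sh x z -> deriv (f^~ z) x 0 /\ deriv (f x) z 0) -> sh x z -> sh x' z' -> f x' z' = f x z.
Proof.
move=> cb df Sz Sz'.
apply: (@comb_path _ _ _ (fun x' z' => f x' z' = f x z) x z x' z' cb _ _ Sz Sz' erefl) => [x1 z1 z2 H <-|x1 x2 z1 H <-].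
  by apply: (@deriv0_const _ (f x1)) => t bt; have [] := df _ _ (H _ bt).
by apply: (@deriv0_const _ (f^~ z1)) => t bt; have [] := df _ _ (H _ bt).
Qed.

Lemma linear_bounded (f : R -> R) c M : (forall x, deriv f x c) -> (forall x, `|f x| <= M) -> c = 0.
Proof.
move=> df bf; apply: contrapT => /eqP c0.
have L x : f x - c * x = f 0 - c * 0.
  apply: (@deriv0_const _ (fun x => f x - c * x)) => t _.
  by apply: deriv_eq (derivB (df t) (derivZ c (derivI t))) _; rewrite mulr1 subrr.
have M0 : 0 <= M by apply: le_trans (bf 0).
have := L ((2 * M + 1) / c); rewrite [c * (_ / _)]mulrC divfK// mulr0 subr0 => L1.
have := bf ((2 * M + 1) / c); have := bf 0; rewrite !ler_norml => /andP[? ?] /andP[? ?]; lra.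
Qed.

(** The gradient is constant and, by boundedness along the base line, equal
    to zero. *)
Lemma comb_shear sh zb r0 gam M (U W : R -> R -> R) : comb sh zb r0 ->
  let a := fun x z => U x z - gam * z in cr sh a W ->
  (forall x z, sh x z -> `|U x z| <= M /\ `|W x z| <= M) ->
  (forall x z, sh x z -> pdx (pdx a) x z = 0 /\ pdx (pdx W) x z = 0) ->
  exists k c, forall x z, sh x z -> [/\ U x z = gam * z + k, W x z = c, pdx a x z = 0 & pdx W x z = 0].
Proof.
move=> cb a ca bd z2; have [oS _ _ _] := cb.
have b0 x := comb_base x cb.
have ca1 := cr_pdx oS ca.
have cA x z : sh x z -> pdx a x z = pdx a 0 zb.
  move=> S; apply: (comb_const cb _ (b0 0) S) => x1 z1 S1.
  by have [d1 d2 _ _ _] := ca1 _ _ S1; have [e1 e2] := z2 _ _ S1; rewrite e1 in d1; rewrite e2 in d2.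
have cB x z : sh x z -> pdx W x z = pdx W 0 zb.
  move=> S; apply: (comb_const cb _ (b0 0) S) => x1 z1 S1.
  by have [_ _ d1 d2 _] := ca1 _ _ S1; have [e1 e2] := z2 _ _ S1; rewrite e2 in d1; rewrite e1 oppr0 in d2.
have A0 : pdx a 0 zb = 0.
  apply: (@linear_bounded (a^~ zb) _ (M + `|gam * zb|)) => x.
    by have [d _ _ _ _] := ca _ _ (b0 x); rewrite -(cA x zb (b0 x)).
  by apply: le_trans (ler_normB _ _) _; rewrite lerD2r; have [] := bd _ _ (b0 x).
have B0 : pdx W 0 zb = 0.
  apply: (@linear_bounded (W^~ zb) _ M) => x; last by have [] := bd _ _ (b0 x).
  by have [_ _ d _ _] := ca _ _ (b0 x); rewrite -(cB x zb (b0 x)).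
exists (a 0 zb), (W 0 zb) => x z S.
have pa x1 z1 : sh x1 z1 -> pdx a x1 z1 = 0 by move=> /cA ->.
have pw x1 z1 : sh x1 z1 -> pdx W x1 z1 = 0 by move=> /cB ->.
split; [| |exact: pa|exact: pw].
  rewrite -(comb_const cb _ (b0 0) S) /a; first by ring.
  by move=> x1 z1 S1; have [d1 d2 _ _ _] := ca _ _ S1; rewrite (pa _ _ S1) in d1; rewrite (pw _ _ S1) in d2.
apply: (comb_const cb _ (b0 0) S) => x1 z1 S1.
by have [_ _ d1 d2 _] := ca _ _ S1; rewrite (pw _ _ S1) in d1; rewrite (pa _ _ S1) oppr0 in d2.
Qed.

Lemma seg_bounded (f : R -> R) p q : p <= q -> (forall t, p <= t <= q -> {for t, continuous f}) ->
  exists B, forall t, p <= t <= q -> `|f t| <= B.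
Proof.
move=> pq cf; have [|t0 [y0 [_ _ H]]] := @EVT2 _ (fun t _ => f t ^+ 2) p q 0 0 pq (lexx 0).
  move=> t y ht _; apply/cont2P => e e0.
  have [d d0 Hd] := (contP _ _).1 (contM (cf _ ht) (cf _ ht)) _ e0.
  by exists d => // x' y' hx' _; exact: Hd.
exists (f t0 ^+ 2 + 1) => t ht.
have h : f t ^+ 2 <= f t0 ^+ 2 by apply: (H t 0 ht); rewrite lexx.
have : `|f t| <= `|f t| ^+ 2 + 1.
  have := sqr_ge0 (`|f t| - 2^-1); rewrite sqrrB; lra.
by rewrite real_normK ?num_real//; lra.
Qed.

(** Along the line the difference to the initial height satisfies a linear
    differential inequality. *)
Lemma burgers_line (eta ex ey : R -> R -> R) al k x0 y : 0 <= y ->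
  (forall x y, deriv (eta^~ y) x (ex x y)) -> (forall x y, deriv (eta x) y (ey x y)) ->
  (forall x y, cont2 ex x y) -> (forall x y, cont2 ey x y) ->
  (forall x y, ey x y = - (al * eta x y + k) * ex x y) ->
  eta (x0 + (al * eta x0 0 + k) * y) y = eta x0 0.
Proof.
move=> y0 dx dy cx cy eq; set s := al * eta x0 0 + k.
have dl t : deriv (fun t => x0 + s * t) t s.
  by apply: deriv_eq (derivD (derivC x0 t) (derivZ s (derivI t))) _; rewrite add0r mulr1.
have cl t : {for t, continuous (fun t => ex (x0 + s * t) t)}.
  by apply: (@cont2_comp1 _ ex (fun t => x0 + s * t) (fun t => t)) => //; exact: deriv_cont (dl t).
have [B HB] := seg_bounded y0 (fun t _ => cl t).
suff : eta (x0 + s * y) y - eta x0 0 = 0 by lra.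
apply: (@gronwall _ (fun t => eta (x0 + s * t) t - eta x0 0)
  (fun t => ex (x0 + s * t) t * s + ey (x0 + s * t) t * 1 - 0) (`|al| * B) 0 y y0).
- move=> t _; apply: derivB (derivC _ _).
  apply: (@chain2 _ eta ex ey (fun t => x0 + s * t) (fun t => t) t s 1 1 ltr01 _ _ _ (dl t) (derivI t)) => //.
- move=> t ht; set x := x0 + s * t.
  have -> : ex x t * s + ey x t * 1 - 0 = - (ex x t) * (al * (eta x t - eta x0 0)) by rewrite eq /s; ring.
  rewrite normrM normrN normrM mulrCA mulrA ler_wpM2r// ler_wpM2l//; exact: HB.
- by rewrite mulr0 addr0 subrr.
Qed.

(** Two different heights at the same y would be carried by lines of
    different slopes, which meet. *)
Lemma burgers_flat (eta ex ey : R -> R -> R) al k : al != 0 ->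
  (forall x y, deriv (eta^~ y) x (ex x y)) -> (forall x y, deriv (eta x) y (ey x y)) ->
  (forall x y, cont2 ex x y) -> (forall x y, cont2 ey x y) ->
  (forall x y, ey x y = - (al * eta x y + k) * ex x y) ->
  forall x y, ey x y = 0.
Proof.
move=> al0 dx dy cx cy eq x y.
have shiftd (f : R -> R) c d : deriv f c d -> forall b, deriv (fun t => f (b + t)) (c - b) d.
  move=> df b; have db : deriv (fun t => b + t) (c - b) 1.
    by apply: deriv_eq (derivD (derivC b _) (derivI _)) _; rewrite add0r.
  apply: deriv_eq (@deriv_comp _ f _ _ _ _ db _) (mulr1 _).
  by rewrite addrC subrK.
have shiftn (f : R -> R) c d : deriv f c d -> forall b, deriv (fun t => f (b - t)) (b - c) (- d).
  move=> df b; have db : deriv (fun t => b - t) (b - c) (-1).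
    by apply: deriv_eq (derivB (derivC b _) (derivI _)) _; rewrite sub0r.
  apply: deriv_eq (@deriv_comp _ f _ _ _ _ db _) (mulrN1 _).
  by rewrite opprB addrC subrK.
have cS f b : (forall x y, cont2 f x y) -> forall x y, cont2 (fun x y => f x (b + y)) x y.
  move=> cf x1 y1; apply: (@cont2_comp _ f (fun x => x) (fun y => b + y)) => //.
  exact: deriv_cont (derivD (derivC b _) (derivI _)).
have cN f b : (forall x y, cont2 f x y) -> forall x y, cont2 (fun x y => f x (b - y)) x y.
  move=> cf x1 y1; apply: (@cont2_comp _ f (fun x => x) (fun y => b - y)) => //.
  exact: deriv_cont (derivB (derivC b _) (derivI _)).
have line x0 t : eta (x0 + (al * eta x0 y + k) * t) (y + t) = eta x0 y.
  have [t0|t0] := leP 0 t.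
    have := @burgers_line (fun x t => eta x (y + t)) (fun x t => ex x (y + t)) (fun x t => ey x (y + t)) al k x0 t t0.
    rewrite addr0; apply => // [x1 y1|x1 y1|x1 y1].
    - by have := shiftd _ _ _ (dy x1 (y + y1)) y; rewrite [y + y1]addrC addrK addrC.
    - exact: cS.
    - exact: cS.
  have t0' : 0 <= - t by lra.
  have := @burgers_line (fun x t => eta x (y - t)) (fun x t => ex x (y - t)) (fun x t => - ey x (y - t)) (- al) (- k) x0 (- t) t0'.
  rewrite subr0 opprK mulNr -opprD mulrNN; apply => // [x1 y1|x1 y1|x1 y1|x1 y1].
  - by have := shiftn _ _ _ (dy x1 (y - y1)) y; have -> : y - (y - y1) = y1 by ring.
  - exact: cN.
  - by apply: cont2N; apply: cN.
  - by rewrite eq; ring.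
have const x1 x2 : eta x1 y = eta x2 y.
  apply: contrapT => /eqP ne.
  pose s x := al * eta x y + k.
  have sn : s x1 - s x2 != 0.
    have -> : s x1 - s x2 = al * (eta x1 y - eta x2 y) by rewrite /s; ring.
    by rewrite mulf_neq0// subr_eq0.
  pose t := (x2 - x1) / (s x1 - s x2).
  have E : x1 + s x1 * t = x2 + s x2 * t by rewrite /t; field.
  by move: ne; rewrite -(line x1 t) -(line x2 t) -/(s x1) -/(s x2) E eqxx.
have ex0 : ex x y = 0.
  by apply: deriv_uniq (dx x y) _; apply: (deriv_ext (f := fun=> eta x y)) (derivC _ _) => t; exact: const.
by rewrite eq ex0 mulr0.
Qed.
End two_layers.

(** * Two planar flows separated by an interface *)

Section interface_problem.
Context {R : realType}.
Implicit Types (x y z t : R).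

(** One-sided limits at the interface: the fields are continuous up to the
    interface but not across it. *)
Definition lim_below (lo : R) (eta f : R -> R -> R) x y l := forall e, 0 < e -> exists2 d : R, 0 < d &
  forall s, lo < s < eta x y -> eta x y - d < s -> `|f x s - l| < e.
Definition lim_above (hi : R) (eta f : R -> R -> R) x y l := forall e, 0 < e -> exists2 d : R, 0 < d &
  forall s, eta x y < s < hi -> s < eta x y + d -> `|f x s - l| < e.

Lemma lim_below_eq lo eta f x y l : lo < eta x y -> lim_below lo eta f x y l ->
  {for eta x y, continuous (f x)} -> l = f x (eta x y).
Proof.
move=> lt L /contP cf; apply: contrapT => /eqP; rewrite -subr_eq0 -normr_gt0 => e0.
have e2 : 0 < `|l - f x (eta x y)| / 2 by lra.
have [d d0 Hd] := L _ e2; have [d' d0' Hd'] := cf _ e2.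
have [s [s1 s2 s3 s4]] : exists s, [/\ lo < s, s < eta x y, eta x y - d < s & eta x y - d' < s].
  pose q := Num.min (eta x y - lo) (Num.min d d').
  have q0 : 0 < q by rewrite !lt_min subr_gt0 lt d0.
  have [q1 q2 q3] : [/\ q <= eta x y - lo, q <= d & q <= d'] by rewrite /q !ge_min !lexx !orbT.
  clearbody q; exists (eta x y - q / 2); split; lra.
have h1 := Hd s _ s3; have h2 := Hd' s.
have {}h1 : `|f x s - l| < `|l - f x (eta x y)| / 2 by apply: h1; rewrite s1.
have {}h2 : `|f x s - f x (eta x y)| < `|l - f x (eta x y)| / 2 by apply: h2; rewrite ltr0_norm; lra.
have : `|l - f x (eta x y)| <= `|f x s - l| + `|f x s - f x (eta x y)|.
  by rewrite [X in _ <= X + _]distrC; apply: le_trans (ler_normD _ _); rewrite addrA subrK.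
lra.
Qed.

Lemma lim_above_eq hi eta f x y l : eta x y < hi -> lim_above hi eta f x y l ->
  {for eta x y, continuous (f x)} -> l = f x (eta x y).
Proof.
move=> lt L cf.
have := @lim_below_eq (- hi) (fun x y => - eta x y) (fun x s => f x (- s)) x y l.
rewrite opprK; apply; first by rewrite ltrN2.
  move=> e e0; have [d d0 Hd] := L _ e0; exists d => // s /andP[? ?] ?; apply: Hd; last lra.
  by apply/andP; split; lra.
apply: (@cont2_comp1 _ (fun _ b => f x b) (fun=> 0) (fun s => - s)).
- exact: cvg_cst.
- exact: deriv_cont (derivN (derivI _)).
apply/cont2P => e e0; have [d d0 Hd] := (contP _ _).1 cf _ e0.
by exists d => // x' y' _ /=; rewrite !opprK; exact: Hd.
Qed.

Section data.
Variables (h1 h2 rho1 rho2 g m0 m1 M gam1 gam2 V1 V2 : R).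
Variables (eta ex ey U1 W1 Q1 U2 W2 Q2 : R -> R -> R).
Let sh1 := shadow (fun x y z => - h1 < z < eta x y).
Let sh2 := shadow (fun x y z => eta x y < z < h2).
Let a1 x z := U1 x z - gam1 * z.
Let a2 x z := U2 x z - gam2 * z.
Hypotheses (rho1_gt0 : 0 < rho1) (rho2_gt0 : 0 < rho2) (g_neq0 : g != 0)
  (gam1_neq0 : gam1 != 0) (gam2_neq0 : gam2 != 0).
Hypotheses (m0_gt : - h1 < m0) (m1_lt : m1 < h2).
Hypothesis range : forall x y, m0 <= eta x y <= m1.
Hypothesis dx : forall x y, deriv (eta^~ y) x (ex x y).
Hypothesis dy : forall x y, deriv (eta x) y (ey x y).
Hypothesis ceta : forall x y, cont2 eta x y.
Hypothesis cex : forall x y, cont2 ex x y.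
Hypothesis cey : forall x y, cont2 ey x y.
Hypotheses (os1 : open2 sh1) (os2 : open2 sh2).
Hypotheses (c1 : cr sh1 a1 W1) (c2 : cr sh2 a2 W2).
Hypothesis dp1 : forall x z, sh1 x z ->
  deriv (Q1^~ z) x (- rho1 * accx gam1 a1 W1 x z) /\ deriv (Q1 x) z (- rho1 * accz g gam1 a1 W1 x z).
Hypothesis dp2 : forall x z, sh2 x z ->
  deriv (Q2^~ z) x (- rho2 * accx gam2 a2 W2 x z) /\ deriv (Q2 x) z (- rho2 * accz g gam2 a2 W2 x z).
Hypothesis bd1 : forall x z, sh1 x z -> `|U1 x z| <= M /\ `|W1 x z| <= M.
Hypothesis bd2 : forall x z, sh2 x z -> `|U2 x z| <= M /\ `|W2 x z| <= M.
Hypothesis bed : forall x e, 0 < e -> exists2 d : R, 0 < d & forall x' z', `|x' - x| < d ->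
  - h1 < z' -> z' < - h1 + d -> sh1 x' z' -> `|W1 x' z'| < e.
Hypothesis lid : forall x e, 0 < e -> exists2 d : R, 0 < d & forall x' z', `|x' - x| < d ->
  z' < h2 -> h2 - d < z' -> sh2 x' z' -> `|W2 x' z'| < e.
Hypothesis kin1 : forall x y, exists u w, [/\ lim_below (- h1) eta U1 x y u,
  lim_below (- h1) eta W1 x y w & u * ex x y + V1 * ey x y = w].
Hypothesis kin2 : forall x y, exists u w, [/\ lim_above h2 eta U2 x y u,
  lim_above h2 eta W2 x y w & u * ex x y + V2 * ey x y = w].
Hypothesis dyn : forall x y, exists p, lim_below (- h1) eta Q1 x y p /\ lim_above h2 eta Q2 x y p.

Let below x y : - h1 < eta x y. Proof. by have /andP[? ?] := range x y; have := m0_gt; lra. Qed.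
Let above x y : eta x y < h2. Proof. by have /andP[? ?] := range x y; have := m1_lt; lra. Qed.
Let m01 : m0 <= m1. Proof. by have /andP[] := range 0 0; exact: le_trans. Qed.

Let zb1 := (m0 - h1) / 2.
Let r1 := (m0 + h1) / 2.
Let zb2 := (m1 + h2) / 2.
Let r2 := (h2 - m1) / 2.

Let comb1 : comb sh1 zb1 r1.
Proof.
split=> //; first by rewrite /r1; have := m0_gt; lra.
  move=> x z; rewrite /zb1 /r1 ltr_norml => /andP[? ?]; exists 0.
  by have /andP[? ?] := range x 0; apply/andP; split; lra.
move=> x z t [y /andP[? ?]]; have /andP[? ?] := range x y; have := m0_gt.
by rewrite /zb1 /btw => ? /orP[]/andP[? ?]; exists y; apply/andP; split; lra.
Qed.

Let comb2 : comb sh2 zb2 r2.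
Proof.
split=> //; first by rewrite /r2; have := m1_lt; lra.
  move=> x z; rewrite /zb2 /r2 ltr_norml => /andP[? ?]; exists 0.
  by have /andP[? ?] := range x 0; apply/andP; split; lra.
move=> x z t [y /andP[? ?]]; have /andP[? ?] := range x y; have := m1_lt.
by rewrite /zb2 /btw => ? /orP[]/andP[? ?]; exists y; apply/andP; split; lra.
Qed.

Let O x z := sh1 x z /\ sh2 x z.
Let oO : open2 O.
Proof.
move=> x z [S1 S2]; have [r r0 Hr] := os1 S1; have [r' r0' Hr'] := os2 S2.
exists (Num.min r r'); first by rewrite lt_min r0.
by move=> x' z'; rewrite !lt_min => /andP[? ?] /andP[? ?]; split; [exact: Hr|exact: Hr'].
Qed.
Let c1O : cr O a1 W1. Proof. exact: cr_sub (fun x z (h : O x z) => h.1) c1. Qed.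
Let c2O : cr O a2 W2. Proof. exact: cr_sub (fun x z (h : O x z) => h.2) c2. Qed.

Let field1 x z : sh1 x z -> cont2 U1 x z /\ cont2 W1 x z.
Proof.
move=> S; have [ca cw] := cr_cont2 os1 c1 S; split=> //.
have c3 : cont2 (fun _ z => gam1 * z) x z by apply: cont2M; [exact: cont2C|exact: cont2Y].
by apply: cont2_near (cont2D ca c3) => [|x' z' _ _]; [exact: ltr01|rewrite /a1; ring].
Qed.
Let field2 x z : sh2 x z -> cont2 U2 x z /\ cont2 W2 x z.
Proof.
move=> S; have [ca cw] := cr_cont2 os2 c2 S; split=> //.
have c3 : cont2 (fun _ z => gam2 * z) x z by apply: cont2M; [exact: cont2C|exact: cont2Y].
by apply: cont2_near (cont2D ca c3) => [|x' z' _ _]; [exact: ltr01|rewrite /a2; ring].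
Qed.

Let K1 x y : sh1 x (eta x y) -> U1 x (eta x y) * ex x y + V1 * ey x y = W1 x (eta x y).
Proof.
move=> S; have [u [w [hu hw E]]] := kin1 x y; have [cu cw] := field1 S.
by rewrite -(lim_below_eq (below x y) hu (cont_snd cu)) -(lim_below_eq (below x y) hw (cont_snd cw)).
Qed.

Let K2 x y : sh2 x (eta x y) -> U2 x (eta x y) * ex x y + V2 * ey x y = W2 x (eta x y).
Proof.
move=> S; have [u [w [hu hw E]]] := kin2 x y; have [cu cw] := field2 S.
by rewrite -(lim_above_eq (above x y) hu (cont_snd cu)) -(lim_above_eq (above x y) hw (cont_snd cw)).
Qed.

(** Points that belong to both projected layers are heights of the
    interface, where the two pressures agree. *)
Let pp x z : O x z -> Q1 x z = Q2 x z.
Proof.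
move=> [S1 S2]; have [y1 /andP[_ l1]] := S1; have [y2 /andP[l2 _]] := S2.
have cy t : {for t, continuous (eta x)} by exact: deriv_cont (dy x t).
have [y Ey] : exists y, eta x y = z.
  have [le|lt] := leP y1 y2.
    by have [y _ Ey] := @IVTc _ (eta x) y1 y2 z le (fun t _ => cy t) (or_intror (introT andP (conj (ltW l2) (ltW l1)))); exists y.
  by have [y _ Ey] := @IVTc _ (eta x) y2 y1 z (ltW lt) (fun t _ => cy t) (or_introl (introT andP (conj (ltW l2) (ltW l1)))); exists y.
rewrite -Ey in S1 S2 *; have [p [hp1 hp2]] := dyn x y.
have [_ d1] := dp1 S1; have [_ d2] := dp2 S2.
rewrite -(lim_below_eq (below x y) hp1 (deriv_cont d1)).
exact: lim_above_eq (above x y) hp2 (deriv_cont d2).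
Qed.
Let E x := exists y, ey x y <> 0.

Let N x z := pdx (pdx a1) x z ^+ 2 + pdx (pdx W1) x z ^+ 2.

Let N_ge0 x z : 0 <= N x z. Proof. by rewrite addr_ge0 ?sqr_ge0. Qed.
Let N_eq0 x z : N x z = 0 -> pdx (pdx a1) x z = 0 /\ pdx (pdx W1) x z = 0.
Proof.
by move/eqP; rewrite paddr_eq0 ?sqr_ge0// !sqrf_eq0 => /andP[/eqP-> /eqP->].
Qed.

(** By unique continuation in the projected lower layer. *)
Let N_zero x z r : 0 < r -> sh1 x z -> (forall x' z', `|x' - x| < r -> `|z' - z| < r -> N x' z' = 0) ->
  forall x' z', sh1 x' z' -> N x' z' = 0.
Proof.
move=> r_gt0 S H x' z' S'.
have cxx := cr_pdx os1 (cr_pdx os1 c1).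
have j := jet0_near r_gt0 (fun x' z' hx hz => N_eq0 (H x' z' hx hz)).
by have [E1 E2] := comb_zero comb1 cxx S j S'; rewrite /N E1 E2 expr0n addr0.
Qed.

Section curved.
Variables xs zs : R.
Hypotheses (Os : O xs zs) (Ns : 0 < N xs zs).

Let agree x z : O x z -> 0 < N x z ->
  [/\ rho1 = rho2, gam1 ^+ 2 = gam2 ^+ 2, gam2 * U1 x z = gam1 * U2 x z & gam2 * W1 x z = gam1 * W2 x z].
Proof.
move=> Oxz n; have [e1 e2 e3 e4] := reconstruction oO c1O c2O rho1_gt0 rho2_gt0 g_neq0 gam1_neq0 gam2_neq0
  (fun x z (h : O x z) => dp1 h.1) (fun x z (h : O x z) => dp2 h.2) pp Oxz n.
by split=> //; move: e3; rewrite /vel /a1 /a2 !subrK.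
Qed.

(** The second derivatives of the lower flow vanish on no open set, so the
    relations obtained where they do not vanish extend by continuity. *)
Let zero_dense (f : R -> R -> R) x z : O x z -> (forall x z, O x z -> cont2 f x z) ->
  (forall x z, O x z -> 0 < N x z -> f x z = 0) -> f x z = 0.
Proof.
move=> Oxz cf H; apply: contrapT => /eqP; rewrite -normr_gt0 => f0.
have [d d0 Hd] := (cont2P _ _ _).1 (cf _ _ Oxz) _ f0.
have [r r0 Hr] := oO Oxz.
have m0' : 0 < Num.min r d by rewrite lt_min r0.
suff Nz : N xs zs = 0 by have := Ns; rewrite Nz ltxx.
apply: (N_zero m0' Oxz.1 _ Os.1) => x' z'; rewrite !lt_min => /andP[x1 x2] /andP[z1 z2].
apply/eqP; rewrite eq_le N_ge0 andbT leNgt; apply/negP => n.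
by have := Hd _ _ x2 z2; rewrite (H _ _ (Hr _ _ x1 z1) n) sub0r normrN ltxx.
Qed.

Let match_U x z : O x z -> gam2 * U1 x z = gam1 * U2 x z /\ gam2 * W1 x z = gam1 * W2 x z.
Proof.
move=> Oxz.
suff [h h'] : gam2 * U1 x z - gam1 * U2 x z = 0 /\ gam2 * W1 x z - gam1 * W2 x z = 0 by split; lra.
split.
  apply: (@zero_dense (fun x z => gam2 * U1 x z - gam1 * U2 x z)) => // x' z' Oxz'.
    have [k1 _] := field1 Oxz'.1; have [k2 _] := field2 Oxz'.2.
    by apply: cont2B; apply: cont2M => //; exact: cont2C.
  by move=> n; have [_ _ -> _] := agree Oxz' n; rewrite subrr.
apply: (@zero_dense (fun x z => gam2 * W1 x z - gam1 * W2 x z)) => // x' z' Oxz'.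
  have [_ k1] := field1 Oxz'.1; have [_ k2] := field2 Oxz'.2.
  by apply: cont2B; apply: cont2M => //; exact: cont2C.
by move=> n; have [_ _ _ ->] := agree Oxz' n; rewrite subrr.
Qed.

Let kp := gam1 / gam2.
Let kp2 : kp ^+ 2 = 1.
Proof.
have [_ e _ _] := agree Os Ns.
by rewrite /kp expr_div_n e divff// sqrf_eq0.
Qed.
Let kp_norm : `|kp| = 1.
Proof. by have /eqP := kp2; rewrite sqrf_eq1 => /orP[]/eqP->; rewrite ?normrN normr1. Qed.

(** The flow below the interface and the multiple of the flow above it agree
    where the projected layers overlap. Over the stations where the interface
    is not level the projected layers cover the whole band, so one obtains a
    single planar flow between two flat walls. *)
Let glue (f1 f2 : R -> R -> R) x z := if pselect (sh1 x z) then f1 x z else kp * f2 x z.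
Let U := glue U1 U2.
Let W := glue W1 W2.
Let glue1 f1 f2 x z : sh1 x z -> glue f1 f2 x z = f1 x z.
Proof. by move=> S; rewrite /glue; case: pselect. Qed.
Let glueU2 x z : sh2 x z -> U x z = kp * U2 x z.
Proof.
rewrite /U /glue => S; case: pselect => // S1; have [h _] := match_U (conj S1 S).
by apply: (mulfI gam2_neq0); rewrite h /kp; field.
Qed.
Let glueW2 x z : sh2 x z -> W x z = kp * W2 x z.
Proof.
rewrite /W /glue => S; case: pselect => // S1; have [_ h] := match_U (conj S1 S).
by apply: (mulfI gam2_neq0); rewrite h /kp; field.
Qed.

Let openE x : E x -> exists2 r : R, 0 < r & forall x', `|x' - x| < r -> E x'.
Proof.
move=> [y /eqP]; rewrite -normr_gt0 => e0.
have cy : cont2 ey x y by exact: cey.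
have [d d0 Hd] := (cont2P _ _ _).1 cy _ e0.
exists d => // x' hx; exists y => h; have := Hd x' y hx; rewrite subrr normr0 => /(_ d0).
by rewrite h sub0r normrN ltxx.
Qed.

Let cover x z : band E (- h1) h2 x z -> sh1 x z \/ sh2 x z.
Proof.
move=> [[y /eqP ny] /andP[z1 z2]].
have [S1|n1] := pselect (sh1 x z); first by left.
have [S2|n2] := pselect (sh2 x z); first by right.
have Ez y' : eta x y' = z.
  apply/eqP; rewrite eq_le; apply/andP; split; rewrite leNgt; apply/negP => h.
    by apply: n1; exists y'; rewrite z1.
  by apply: n2; exists y'; rewrite h.
exfalso; move: ny; apply/negP/negPn/eqP.
by apply: deriv_uniq (dy x y) _; apply: (deriv_ext (f := fun=> z)) (derivC _ _) => t; rewrite Ez.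
Qed.

Let cr_scaled : cr sh2 (fun x z => kp * a2 x z) (fun x z => kp * W2 x z).
Proof.
have [c _] := cr_comb (1 - kp) os2 c2 c2; apply: cr_near c => // x z _; split; ring.
Qed.

Let kg : kp * gam2 = gam1. Proof. by rewrite /kp divfK. Qed.

Let cr1' : cr sh1 (fun x z => U x z - gam1 * z) W.
Proof. by apply: cr_near c1 => // x z S; rewrite /U /W !glue1. Qed.
Let cr2' : cr sh2 (fun x z => U x z - gam1 * z) W.
Proof.
apply: cr_near cr_scaled => // x z S; rewrite glueU2// glueW2//; split=> //.
by rewrite /a2 -kg; ring.
Qed.

Let glued_wave : wave E (- h1) h2 m0 m1 M gam1 V1 U W eta ex ey.
Proof.
split=> //.
- by move=> x z B; case: (cover B) => S; [exact: cr1'|exact: cr2'].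
- move=> x z B; case: (cover B) => S; first by rewrite /U /W !glue1//; exact: bd1.
  by rewrite glueU2// glueW2// !(normrM kp) kp_norm !mul1r; exact: bd2.
- move=> x _ e e0; have [d d0 Hd] := bed x e0; have [d' d0' Hd'] := lid x e0.
  pose q := Num.min (Num.min d d') (Num.min (m0 + h1) (h2 - m1)).
  have q0 : 0 < q by rewrite !lt_min d0 d0'; have := m0_gt; have := m1_lt => *; apply/andP; split; lra.
  have [q1 q2 q3 q4] : [/\ q <= d, q <= d', q <= m0 + h1 & q <= h2 - m1].
    by rewrite /q !ge_min !lexx !orbT.
  clearbody q; exists q => // x' z' hx /andP[z1 z2] [hz|hz].
    have S : sh1 x' z' by exists 0; have /andP[? ?] := range x' 0; apply/andP; split; lra.
    by rewrite /W glue1//; apply: Hd => //; lra.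
  have S : sh2 x' z' by exists 0; have /andP[? ?] := range x' 0; apply/andP; split; lra.
  by rewrite glueW2// (normrM kp) kp_norm mul1r; apply: Hd' => //; lra.
- move=> x y Ex; have [S1|nS1] := pselect (sh1 x (eta x y)).
    by rewrite /U /W !glue1//; exact: K1.
  have [//|S2] : sh1 x (eta x y) \/ sh2 x (eta x y).
    by apply: cover; split=> //; rewrite below above.
  (* at the top of the lower layer the interface is level across the stream *)
  have ey0 : ey x y = 0.
    have le y' : eta x y' <= eta x y.
      by rewrite leNgt; apply/negP => h; apply: nS1; exists y'; rewrite below.
    apply/eqP; rewrite eq_le; apply/andP; split.
      by apply: deriv_max_right (dy x y) ltr01 _ => t _.
    by apply: deriv_max_left (dy x y) ltr01 _ => t _.
  rewrite ey0 mulr0 addr0 glueU2// glueW2//; have := K2 S2; rewrite ey0 mulr0 addr0 => <-.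
  by rewrite mulrA.
- by move=> x y nE; apply: contrapT => h; apply: nE; exists y.
Qed.

(** If some station is level, the analysis of waves applies. If none is, the
    vertical velocity is a bounded harmonic function on a full strip with zero
    boundary values, hence zero, and the second derivatives vanish. *)
Lemma curved_flat x y : ey x y = 0.
Proof.
have [[b nb]|all] := pselect (exists b, ~ E b); first exact: wave_all_flat glued_wave gam1_neq0 nb.
have Eall b : E b by apply: contrapT => nb; apply: all; exists b.
have lohi : - h1 < h2 by have := m0_gt; have := m1_lt; have := m01; lra.
have M0 : 0 < M + 1.
  by have [h _] := bd1 (comb_base 0 comb1); have := normr_ge0 (U1 0 zb1); lra.
have W0 x1 z1 : - h1 < z1 < h2 -> W x1 z1 = 0.
  move=> hz; apply/eqP; rewrite -normr_eq0 eq_le normr_ge0 andbT.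
  apply/ler_addgt0Pr => e e0; rewrite add0r.
  pose k := (2 * (h2 - - h1))^-1.
  have k0 : 0 < k by rewrite invr_gt0; lra.
  (* half the length of a rectangle on whose middle line the barrier is below e *)
  pose L := 4 * (M + 1) / (e * k).
  have L0 : 0 < L by apply: divr_gt0; apply: mulr_gt0.
  have xx : x1 - L <= x1 + L by lra.
  have := @strip_bound R (band E (- h1) h2) (- h1) h2 (M + 1) (x1 - L) (x1 + L) (band_open glued_wave) lohi M0 xx.
  move=> /(_ _ _ _ (wave_cr glued_wave) _ _ x1 z1 _ hz); rewrite /edge -/k => h.
  apply: le_trans (h _ _ _ _) _.
  - by move=> x' z' _ hz'; split.
  - move=> x' z' _ hz'; have [_] := wave_bound glued_wave (conj (Eall x') hz'); lra.
  - by move=> x' _ e' e'0; have := wave_walls glued_wave (Eall x') e'0.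
  - by apply/andP; split; lra.
  have -> : x1 - (x1 - L) = L by ring.
  have -> : x1 + L - x1 = L by ring.
  rewrite mulNr expRN.
  have kL : k * L <= expR (k * L) by have := expR_ge1Dx (k * L); lra.
  have kL0 : 0 < k * L by rewrite mulr_gt0.
  have E0 : 0 < expR (k * L) by exact: expR_gt0.
  have -> : 2 * (M + 1) * ((expR (k * L))^-1 + (expR (k * L))^-1) = 4 * (M + 1) / expR (k * L) by ring.
  rewrite ler_pdivrMr//; apply: le_trans (_ : e * (k * L) <= _); last by rewrite ler_pM2l.
  by rewrite /L le_eqVlt; apply/orP; left; apply/eqP; field; rewrite !gt_eqF.
have W10 x1 z1 : sh1 x1 z1 -> W1 x1 z1 = 0.
  move=> S; have [y1 /andP[k1 k2]] := S; rewrite -(W0 x1 z1) /W ?glue1//.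
  by rewrite k1 (lt_trans k2 (above x1 y1)).
have pW x1 z1 : sh1 x1 z1 -> pdx a1 x1 z1 = 0 /\ pdx W1 x1 z1 = 0.
  move=> S; have [r r0 Hr] := os1 S; have [_ _ d3 d4 _] := c1 S.
  have n0 (s : R) : `|s - s| < r by rewrite subrr normr0.
  split.
    have : - pdx a1 x1 z1 = 0.
      apply: deriv_uniq d4 _; apply: (deriv_near (f := fun=> 0) r0) (derivC _ _) => t ht.
      by rewrite W10//; exact: Hr.
    by move/eqP; rewrite oppr_eq0 => /eqP.
  apply: deriv_uniq d3 _; apply: (deriv_near (f := fun=> 0) r0) (derivC _ _) => t ht.
  by rewrite W10//; exact: Hr.
exfalso; move: Ns; rewrite lt0r => /andP[/negP + _]; apply; apply/eqP.
have S := Os.1; have [r r0 Hr] := os1 S.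
have n0 (s : R) : `|s - s| < r by rewrite subrr normr0.
have z0 f : (forall x z, sh1 x z -> f x z = 0) -> pdx f xs zs = 0.
  move=> f0; apply: pdxE; apply: (deriv_near (f := fun=> 0) r0) (derivC _ _) => t ht.
  by rewrite f0//; exact: Hr.
by rewrite /N !z0 ?expr0n ?addr0// => x1 z1 /pW[].
Qed.
End curved.
Section straight.
Variables x0 y0 : R.
Hypotheses (Nz : forall x z, O x z -> N x z = 0) (ey0 : ey x0 y0 <> 0).

(** Above a station where the interface is not level the projected layers
    overlap. *)
Let O_inhab : exists z, O x0 z.
Proof.
have [[y1 [y2 lt]]|no] := pselect (exists y1 y2, eta x0 y1 < eta x0 y2).
  exists ((eta x0 y1 + eta x0 y2) / 2); split; [exists y2|exists y1]; apply/andP; split;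
    by have := below x0 y1; have := above x0 y2; lra.
have Ey y : eta x0 y = eta x0 y0.
  by apply/eqP; rewrite eq_le !leNgt; apply/andP; split; apply/negP => h; apply: no; [exists y0, y|exists y, y0].
exfalso; apply: ey0; apply: deriv_uniq (dy x0 y0) _.
by apply: (deriv_ext (f := fun=> eta x0 y0)) (derivC _ _) => t; rewrite Ey.
Qed.

Let flat1 x z : sh1 x z -> pdx (pdx a1) x z = 0 /\ pdx (pdx W1) x z = 0.
Proof.
move=> S; have [zs Os] := O_inhab; have [r r0 Hr] := oO Os.
by apply: N_eq0; apply: (N_zero r0 Os.1) S => x' z' hx hz; apply: Nz; exact: Hr.
Qed.

Let flat2 x z : sh2 x z -> pdx (pdx a2) x z = 0 /\ pdx (pdx W2) x z = 0.
Proof.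
move=> S; have [zs Os] := O_inhab; have [r r0 Hr] := oO Os.
have cxx := cr_pdx os2 (cr_pdx os2 c2).
have Z x' z' : O x' z' -> pdx (pdx a2) x' z' = 0 /\ pdx (pdx W2) x' z' = 0.
  move=> O'; have := second_order_agree oO c1O c2O (fun x z (h : O x z) => dp1 h.1) (fun x z (h : O x z) => dp2 h.2) pp O'.
  have [-> ->] := N_eq0 (Nz O'); rewrite expr0n addr0 mulr0 => /esym/eqP.
  rewrite mulf_eq0 gt_eqF//= paddr_eq0 ?sqr_ge0// !sqrf_eq0 => /andP[/eqP-> /eqP->] //.
have j := jet0_near r0 (fun x' z' hx hz => Z _ _ (Hr x' z' hx hz)).
exact: (comb_zero comb2 cxx Os.2 j).
Qed.

Let lim_at (f : R -> R -> R) (k c l : R) x y : (forall x z, sh1 x z -> f x z = k * z + c) ->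
  lim_below (- h1) eta f x y l -> l = k * eta x y + c.
Proof.
move=> fE L; apply: (@lim_below_eq (- h1) eta (fun _ s => k * s + c) x y) => //.
  move=> e e0; have [d d0 Hd] := L e e0; exists d => // s hs hs'.
  by rewrite -(fE x); [exact: Hd|exists y].
exact: deriv_cont (derivD (derivZ k (derivI _)) (derivC c _)).
Qed.

Let lim_at2 (f : R -> R -> R) (k c l : R) x y : (forall x z, sh2 x z -> f x z = k * z + c) ->
  lim_above h2 eta f x y l -> l = k * eta x y + c.
Proof.
move=> fE L; apply: (@lim_above_eq h2 eta (fun _ s => k * s + c) x y) => //.
  move=> e e0; have [d d0 Hd] := L e e0; exists d => // s hs hs'.
  by rewrite -(fE x); [exact: Hd|exists y].
exact: deriv_cont (derivD (derivZ k (derivI _)) (derivC c _)).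
Qed.

Let transport_absurd al k V : al != 0 -> (forall x y, (al * eta x y + k) * ex x y + V * ey x y = 0) -> V = 0.
Proof.
move=> al0 H; apply: contrapT => /eqP V0; apply: ey0.
apply: (@burgers_flat _ eta ex ey (al / V) (k / V)) => //.
  by rewrite mulf_neq0// invr_neq0.
move=> x y; apply: (mulfI V0); have := H x y => /eqP; rewrite addrC addr_eq0 => /eqP ->.
by field.
Qed.

(** Both layers are uniform shears, so the vertical pressure gradients are
    - rho g, and their agreement gives equal densities. The kinematic conditions
    become Burgers equations, which force a level interface unless the
    transverse velocities vanish. *)
Lemma straight_shear : [/\ rho1 = rho2, V1 = 0, V2 = 0, forall x y, ex x y = 0 &
  exists k1 k2, (forall x z, sh1 x z -> U1 x z = gam1 * z + k1 /\ W1 x z = 0) /\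
                (forall x z, sh2 x z -> U2 x z = gam2 * z + k2 /\ W2 x z = 0)].
Proof.
have [k1 [w1 H1]] := comb_shear comb1 c1 bd1 flat1.
have [k2 [w2 H2]] := comb_shear comb2 c2 bd2 flat2.
have w10 : w1 = 0.
  apply: contrapT => /eqP; rewrite -normr_gt0 => e0; have [d d0 Hd] := bed 0 e0.
  pose q := Num.min d (m0 + h1).
  have q0 : 0 < q by rewrite lt_min d0; have := m0_gt; lra.
  have [q1 q2] : q <= d /\ q <= m0 + h1 by rewrite /q !ge_min !lexx orbT.
  clearbody q; have S : sh1 0 (- h1 + q / 2).
    by exists 0; have /andP[? ?] := range 0 0; apply/andP; split; lra.
  have F : `|W1 0 (- h1 + q / 2)| < `|w1|.
    by apply: (Hd 0) => //; [rewrite subrr normr0|lra|lra].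
  by move: F; have [_ -> _ _] := H1 _ _ S; rewrite ltxx.
have w20 : w2 = 0.
  apply: contrapT => /eqP; rewrite -normr_gt0 => e0; have [d d0 Hd] := lid 0 e0.
  pose q := Num.min d (h2 - m1).
  have q0 : 0 < q by rewrite lt_min d0; have := m1_lt; lra.
  have [q1 q2] : q <= d /\ q <= h2 - m1 by rewrite /q !ge_min !lexx orbT.
  clearbody q; have S : sh2 0 (h2 - q / 2).
    by exists 0; have /andP[? ?] := range 0 0; apply/andP; split; lra.
  have F : `|W2 0 (h2 - q / 2)| < `|w2|.
    by apply: (Hd 0) => //; [rewrite subrr normr0|lra|lra].
  by move: F; have [_ -> _ _] := H2 _ _ S; rewrite ltxx.
have F1 x y : (gam1 * eta x y + k1) * ex x y + V1 * ey x y = 0.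
  have [u [w [hu hw E1]]] := kin1 x y.
  rewrite -(@lim_at U1 gam1 k1 u) => [|x' z' /H1[]//|//].
  by rewrite E1 (@lim_at W1 0 0 w x y) ?mul0r ?addr0// => x' z' /H1[_ -> _ _]; rewrite w10 mul0r addr0.
have F2 x y : (gam2 * eta x y + k2) * ex x y + V2 * ey x y = 0.
  have [u [w [hu hw E2]]] := kin2 x y.
  rewrite -(@lim_at2 U2 gam2 k2 u) => [|x' z' /H2[]//|//].
  by rewrite E2 (@lim_at2 W2 0 0 w x y) ?mul0r ?addr0// => x' z' /H2[_ -> _ _]; rewrite w20 mul0r addr0.
have V10 := transport_absurd gam1_neq0 F1; have V20 := transport_absurd gam2_neq0 F2.
split=> //; last first.
- exists k1, k2; split=> x z S.
    by have [-> -> _ _] := H1 _ _ S.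
  by have [-> -> _ _] := H2 _ _ S.
- move=> x y; apply: contrapT => /eqP n.
  have s0 t : (gam1 * eta t y + k1) ^+ 2 = 0.
    have ds t' : deriv (fun t => gam1 * eta t y + k1) t' (gam1 * ex t' y).
      by apply: deriv_eq (derivD (derivZ gam1 (dx t' y)) (derivC k1 t')) _; rewrite addr0.
    transitivity ((gam1 * eta x y + k1) ^+ 2); last first.
      have /eqP := F1 x y; rewrite V10 mul0r addr0 mulf_eq0 (negbTE n) orbF => /eqP ->.
      by rewrite expr0n.
    apply: (@deriv0_const _ (fun t => (gam1 * eta t y + k1) ^+ 2)) => t' _.
    apply: deriv_eq (derivX2 (ds t')) _.
    have := F1 t' y; rewrite V10 mul0r addr0 => E1.
    by rewrite mulrCA -!mulrA E1 !mulr0.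
  have c t : eta t y = - k1 / gam1.
    apply: (mulfI gam1_neq0); rewrite mulrCA divff// mulr1.
    by have /eqP := s0 t; rewrite sqrf_eq0 addr_eq0 => /eqP.
  move: n; apply/negP/negPn/eqP; apply: deriv_uniq (dx x y) _.
  by apply: (deriv_ext (f := fun=> - k1 / gam1)) (derivC _ _) => t; rewrite c.
have [zs Os] := O_inhab; have [S1 S2] := Os.
have [_ d1] := dp1 S1; have [_ d2] := dp2 S2.
have := (deriv_agree _ _ oO Os pp).2 d1 d2.
have [_ _ p1 p2] := H1 _ _ S1; have [_ _ p3 p4] := H2 _ _ S2.
rewrite /accz -/a1 -/a2 p1 p2 p3 p4 !mulr0 !subr0 !add0r => /(mulIf g_neq0) /eqP.
by rewrite eqr_opp => /eqP.
Qed.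
End straight.

(** The alternative is decided by the second derivatives of the velocity
    where the projected layers overlap. *)
Theorem flat_or_shear : (forall x y, ey x y = 0) \/
  [/\ rho1 = rho2, V1 = 0, V2 = 0, forall x y, ex x y = 0 &
  exists k1 k2, (forall x z, sh1 x z -> U1 x z = gam1 * z + k1 /\ W1 x z = 0) /\
                (forall x z, sh2 x z -> U2 x z = gam2 * z + k2 /\ W2 x z = 0)].
Proof.
have [flat|nf] := pselect (forall x y, ey x y = 0); [by left|right].
have [x0 [y0 n]] : exists x y, ey x y <> 0.
  by apply: contrapT => h; apply: nf => x y; apply: contrapT => n; apply: h; exists x, y.
apply: (straight_shear _ n) => x z Oxz; apply: contrapT => /eqP nz.
apply: n; apply: (curved_flat Oxz); by rewrite lt0r nz N_ge0.
Qed.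
End data.
End interface_problem.

(** * Coordinates in spaces of row vectors *)

Section row_vectors.
Context {R : realType}.
Implicit Types (x y z t : R).

Lemma vec3E (x y z : R) : (vec3 x y z 0 0 = x) * (vec3 x y z 0 1 = y) * (vec3 x y z 0 2 = z).
Proof. by rewrite /vec3 !mxE. Qed.

Lemma vec2E (x y : R) : (vec2 x y 0 0 = x) * (vec2 x y 0 1 = y).
Proof. by rewrite /vec2 !mxE. Qed.

Lemma vec3_eta (p : 'rV[R]_3) : p = vec3 (p 0 0) (p 0 1) (p 0 2).
Proof.
apply/rowP => -[[|[|[|//]]] i]; rewrite /vec3 !mxE/=; congr (p 0 _); exact/val_inj.
Qed.

Lemma vec3_add (x y z x' y' z' : R) : vec3 x y z + vec3 x' y' z' = vec3 (x + x') (y + y') (z + z').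
Proof. by apply/rowP => -[[|[|[|//]]] i]; rewrite /vec3 !mxE. Qed.

Lemma vec3_scale (k x y z : R) : k *: vec3 x y z = vec3 (k * x) (k * y) (k * z).
Proof. by apply/rowP => -[[|[|[|//]]] i]; rewrite /vec3 !mxE. Qed.

Lemma vec3_delta (j : 'I_3) : delta_mx 0 j = vec3 (j == 0)%:R (j == 1)%:R (j == 2)%:R :> 'rV[R]_3.
Proof. by apply/rowP => -[[|[|[|//]]] i]; rewrite /vec3 !mxE/=; case: j => -[|[|[|//]]]. Qed.

Lemma vec2_add (x y x' y' : R) : vec2 x y + vec2 x' y' = vec2 (x + x') (y + y').
Proof. by apply/rowP => -[[|[|//]] i]; rewrite /vec2 !mxE. Qed.

Lemma vec2_scale (k x y : R) : k *: vec2 x y = vec2 (k * x) (k * y).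
Proof. by apply/rowP => -[[|[|//]] i]; rewrite /vec2 !mxE. Qed.

Lemma vec2_delta (j : 'I_2) : delta_mx 0 j = vec2 (j == 0)%:R (j == 1)%:R :> 'rV[R]_2.
Proof. by apply/rowP => -[[|[|//]] i]; rewrite /vec2 !mxE/=; case: j => -[|[|//]]. Qed.

Section closure.
Variables (n : nat) (D : set 'rV[R]_n.+1).

Lemma closure_limit (V : normedModType R) (f : 'rV[R]_n.+1 -> V) p e :
  {within closure D, continuous f} -> closure D p -> 0 < e ->
  exists2 d : R, 0 < d & forall q, closure D q -> (forall j, `|q 0 j - p 0 j| < d) -> `|f q - f p| < e.
Proof.
move=> /subspace_continuousP/(_ p) cf Dp e0.
have /cvgrPdist_lt/(_ e e0) := cf Dp.
rewrite near_withinE => /nbhs_ballP[d /= d0 Hd]; exists d => // q Dq hq.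
rewrite distrC; apply: Hd => //; split=> // i j; rewrite ord1 /ball/= distrC; exact: hq.
Qed.

Lemma closure_point (p : 'rV[R]_n.+1) : (forall e : R, 0 < e -> exists2 q, D q & forall j, `|q 0 j - p 0 j| < e) -> closure D p.
Proof.
move=> H B /nbhs_ballP[e /= e0 He]; have [q Dq hq] := H e e0.
by exists q; split => //; apply: He; split=> // i j; rewrite ord1 /ball/= distrC.
Qed.
End closure.

Lemma entry_norm n (p : 'rV[R]_n) (j : 'I_n) : `|p 0 j| <= `|p|.
Proof. by rewrite [leRHS]/Num.Def.normr /= mx_normrE; apply/bigmax_geP; right => /=; exists (0, j). Qed.

Lemma derivable_line n (f : 'rV[R]_n.+1 -> R) (j : 'I_n.+1) p : derivable f p (delta_mx 0 j) ->
  deriv (fun h => f (h *: delta_mx 0 j + p)) 0 (partial j f p).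
Proof.
move=> df; have d1 := (derivable1P f p (delta_mx 0 j)).1 df.
apply: DeriveDef => //.
apply: (congr1 (fun F : R -> R => lim (F @ 0^'))); apply/funext => h /=.
by rewrite addr0 scale0r add0r [h *: 1]mulr1.
Qed.

Lemma partial_entry n m (f : 'rV[R]_n.+1 -> 'rV[R]_m.+1) (j : 'I_n.+1) k p : derivable f p (delta_mx 0 j) ->
  derivable (fun q => f q 0 k) p (delta_mx 0 j) /\ partial j (fun q => f q 0 k) p = partial j f p 0 k.
Proof.
move=> df; split; first exact: (derivable_mxP _ _ _).1 df _ _.
by rewrite /partial derive_mx// mxE.
Qed.
End row_vectors.

(** * Rotation of a layer *)

Section curried_fields.
Context {R : realType}.
Implicit Types (x y z t : R) (f g : R -> R -> R -> R) (dom : R -> R -> R -> Prop).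

Definition cont3 f x y z := forall e, 0 < e -> exists2 d : R, 0 < d &
  forall x' y' z', `|x' - x| < d -> `|y' - y| < d -> `|z' - z| < d -> `|f x' y' z' - f x y z| < e.

Definition open3 dom := forall x y z, dom x y z -> exists2 r : R, 0 < r &
  forall x' y' z', `|x' - x| < r -> `|y' - y| < r -> `|z' - z| < r -> dom x' y' z'.

(** Continuously differentiable functions with explicit partial derivatives,
    so that rotations and linear combinations act on the derivatives by
    formulas. *)
Definition C1on dom f fx fy fz := forall x y z, dom x y z ->
  [/\ deriv (fun s => f s y z) x (fx x y z), deriv (fun s => f x s z) y (fy x y z),
      deriv (fun s => f x y s) z (fz x y z) & [/\ cont3 fx x y z, cont3 fy x y z & cont3 fz x y z]].

Lemma C1on_deriv dom f fx fy fz : C1on dom f fx fy fz -> forall x y z, dom x y z ->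
  [/\ deriv (fun s => f s y z) x (fx x y z), deriv (fun s => f x s z) y (fy x y z) &
      deriv (fun s => f x y s) z (fz x y z)].
Proof. by move=> C x y z D; have [d1 d2 d3 _] := C x y z D. Qed.

Lemma cont3_lin f g (a b : R) x y z : cont3 f x y z -> cont3 g x y z ->
  cont3 (fun x y z => a * f x y z + b * g x y z) x y z.
Proof.
move=> cf cg e e0.
have q0 : 0 < `|a| + `|b| + 1 by have := normr_ge0 a; have := normr_ge0 b; lra.
have e1 : 0 < e / (`|a| + `|b| + 1) by rewrite divr_gt0.
have [d d0 Hd] := cf _ e1; have [d' d0' Hd'] := cg _ e1.
exists (Num.min d d'); first by rewrite lt_min d0.
move=> x' y' z'; rewrite !lt_min => /andP[x1 x2] /andP[y1 y2] /andP[z1 z2].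
have h1 := Hd _ _ _ x1 y1 z1; have h2 := Hd' _ _ _ x2 y2 z2.
set F := f x' y' z' - _ in h1; set G := g x' y' z' - _ in h2.
have -> : a * f x' y' z' + b * g x' y' z' - (a * f x y z + b * g x y z) = a * F + b * G.
  by rewrite /F /G; ring.
rewrite ltr_pdivlMr// in h1; rewrite ltr_pdivlMr// in h2.
apply: le_lt_trans (ler_normD _ _) _; rewrite !normrM.
have [k1|k1] := leP `|F| `|G|.
  have : `|a| * `|F| <= `|a| * `|G| by rewrite ler_wpM2l.
  have : `|b| * `|G| <= `|G| * `|b| by rewrite mulrC.
  by have := normr_ge0 G; nra.
have : `|b| * `|G| <= `|b| * `|F| by rewrite ler_wpM2l// ltW.
by have := normr_ge0 F; nra.
Qed.

Lemma cont3_cont2xz f x y z : cont3 f x y z -> cont2 (fun x z => f x y z) x z.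
Proof.
move=> cf; apply/cont2P => e e0; have [d d0 Hd] := cf e e0.
by exists d => // x' z' hx hz; apply: Hd => //; rewrite subrr normr0.
Qed.

Lemma cont3_cont2xy f x y z : cont3 f x y z -> cont2 (fun x y => f x y z) x y.
Proof.
move=> cf; apply/cont2P => e e0; have [d d0 Hd] := cf e e0.
by exists d => // x' y' hx hy; apply: Hd => //; rewrite subrr normr0.
Qed.

Lemma C1on_lin dom f fx fy fz g gx gy gz a b : C1on dom f fx fy fz -> C1on dom g gx gy gz ->
  C1on dom (fun x y z => a * f x y z + b * g x y z) (fun x y z => a * fx x y z + b * gx x y z)
    (fun x y z => a * fy x y z + b * gy x y z) (fun x y z => a * fz x y z + b * gz x y z).
Proof.
move=> Cf Cg x y z D; have [f1 f2 f3 [f4 f5 f6]] := Cf _ _ _ D; have [g1 g2 g3 [g4 g5 g6]] := Cg _ _ _ D.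
split; [| | |split]; try exact: cont3_lin.
- exact: derivD (derivZ a f1) (derivZ b g1).
- exact: derivD (derivZ a f2) (derivZ b g2).
- exact: derivD (derivZ a f3) (derivZ b g3).
Qed.

(** The integral of v over 0 <= y <= L has x-derivative
    om L + u(x, L) - u(x, 0), which for large L has a sign and is bounded away
    from zero. *)
Lemma bounded_plane_irrotational (u v uy vx : R -> R -> R) (om M : R) :
  (forall x y, deriv (u x) y (uy x y)) -> (forall x y, deriv (v^~ y) x (vx x y)) ->
  (forall x y, cont2 vx x y) -> (forall x y, {for y, continuous (v x)}) ->
  (forall x y, `|u x y| <= M /\ `|v x y| <= M) ->
  (forall x y, vx x y - uy x y = om) -> om = 0.
Proof.
move=> du dv cv cv1 bd curl0; apply: contrapT => /eqP om0.
have M0 : 0 <= M by have [+ _] := bd 0 0; apply: le_trans.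
have om_gt0 : 0 < `|om| by rewrite normr_gt0.
(* om L then exceeds in absolute value what u contributes by 1 *)
pose L := (2 * M + 1) / `|om|.
have L0 : 0 < L by rewrite divr_gt0//; lra.
have oL : `|om| * L = 2 * M + 1 by rewrite /L mulrC divfK// gt_eqF.
pose s := Num.sg om; have som : s * om = `|om| by rewrite -normrEsg.
have s1 : `|s| = 1 by rewrite normr_sg om0.
pose G x := prim (v x) 0 L.
have dG x : deriv G x (u x L - u x 0 + om * L).
  apply: (@param_deriv _ v vx (fun x y => prim (v x) 0 y) (fun y => u x y - u x 0 + om * y) 0 L x 1 ltr01).
  - by move=> x' t _ _.
  - by move=> t _.
  - by move=> x' t _ _; exact: primT_deriv.
  - move=> t _; have -> : vx x t = uy x t - 0 + om * 1 by rewrite -(curl0 x t); ring.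
    by apply: derivD; [apply: derivB => //; exact: derivC|apply: derivZ; exact: derivI].
  - by move=> x' _; exact: primxx.
  - by rewrite subrr mulr0 addr0.
have GL x : `|G x| <= M * L.
  have : `|prim (v x) 0 L - prim (v x) 0 0| <= M * `|L - 0|.
    apply: (@deriv_lip _ (prim (v x) 0) (v x)) => t _; first exact: primT_deriv.
    by have [] := bd x t.
  by rewrite primxx !subr0 (gtr0_norm L0).
pose X := 2 * M * L + 1.
have ML0 : 0 <= 2 * M * L by apply: mulr_ge0; [exact: mulr_ge0|exact: ltW].
have X0 : 0 <= X by rewrite /X; lra.
have : s * G 0 - 1 * 0 <= s * G X - 1 * X.
  apply: (@deriv_ge0_le _ (fun x => s * G x - 1 * x) (fun x => s * (u x L - u x 0 + om * L) - 1 * 1)) => // x _.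
    by apply: derivB; apply: derivZ; [exact: dG|exact: derivI].
  have : `|s * (u x L - u x 0)| <= 2 * M.
    rewrite normrM s1 mul1r; apply: le_trans (ler_normB _ _) _.
    by have [? _] := bd x L; have [? _] := bd x 0; lra.
  have -> : s * (u x L - u x 0 + om * L) = s * (u x L - u x 0) + s * om * L by ring.
  by rewrite som oL ler_norml => /andP[? ?]; lra.
have sG x : `|s * G x| <= M * L by rewrite normrM s1 mul1r.
have := sG 0; have := sG X; rewrite !ler_norml => /andP[? ?] /andP[? ?].
rewrite /X; lra.
Qed.

Section rotation.
Variables (c s : R).
Hypothesis cs1 : c ^+ 2 + s ^+ 2 = 1.

(** Here c and s are the cosine and sine of the angle by which the
    coordinates are turned. *)
Definition turn f x y z := f (c * x + s * y) (- s * x + c * y) z.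

Let c_le : `|c| <= 1.
Proof. by rewrite -[leRHS]normr1 -ler_sqr ?nnegrE// ?real_normK ?num_real// expr1n -cs1 lerDl sqr_ge0. Qed.
Let s_le : `|s| <= 1.
Proof. by rewrite -(@ler_pXn2r _ 2) ?nnegrE// real_normK ?num_real// expr1n -cs1 lerDr sqr_ge0. Qed.

Let rot_near x y x' y' r : `|x' - x| < r / 2 -> `|y' - y| < r / 2 ->
  `|(c * x' + s * y') - (c * x + s * y)| < r /\ `|(- s * x' + c * y') - (- s * x + c * y)| < r.
Proof.
move=> hx hy; have k (a b : R) : `|a| <= 1 -> `|b| <= 1 -> `|a * (x' - x) + b * (y' - y)| < r.
  move=> ha hb; apply: le_lt_trans (ler_normD _ _) _; rewrite !normrM.
  have : `|a| * `|x' - x| <= `|x' - x| by rewrite ler_piMl.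
  have : `|b| * `|y' - y| <= `|y' - y| by rewrite ler_piMl.
  lra.
have -> : (c * x' + s * y') - (c * x + s * y) = c * (x' - x) + s * (y' - y) by ring.
have -> : (- s * x' + c * y') - (- s * x + c * y) = - s * (x' - x) + c * (y' - y) by ring.
by split; apply: k => //; rewrite normrN.
Qed.

Lemma turn_cont3 f x y z : cont3 f (c * x + s * y) (- s * x + c * y) z -> cont3 (turn f) x y z.
Proof.
move=> cf e e0; have [d d0 Hd] := cf e e0; exists (d / 2); first by rewrite divr_gt0.
move=> x' y' z' hx hy hz; have [k1 k2] := rot_near hx hy.
by apply: Hd => //; lra.
Qed.

Definition turn_dom dom x y z := dom (c * x + s * y) (- s * x + c * y) z.

Lemma turn_open dom : open3 dom -> open3 (turn_dom dom).
Proof.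
move=> od x y z D; have [r r0 Hr] := od _ _ _ D; exists (r / 2); first by rewrite divr_gt0.
move=> x' y' z' hx hy hz; have [k1 k2] := rot_near hx hy.
by apply: Hr => //; lra.
Qed.

Lemma turn_C1on dom f fx fy fz : open3 dom -> C1on dom f fx fy fz ->
  C1on (turn_dom dom) (turn f) (fun x y z => c * turn fx x y z + - s * turn fy x y z)
    (fun x y z => s * turn fx x y z + c * turn fy x y z) (turn fz).
Proof.
move=> od Cf x y z D; have [r r0 Hr] := od _ _ _ D.
have [d1 d2 d3 [k1 k2 k3]] := Cf _ _ _ D.
have loc a b : `|a - (c * x + s * y)| < r -> `|b - (- s * x + c * y)| < r ->
   deriv (fun t => f t b z) a (fx a b z) /\ deriv (fun t => f a t z) b (fy a b z).
  by move=> ha hb; have [|h1 h2 _ _] := Cf a b z; [apply: Hr => //; rewrite subrr normr0|].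
have lin (a b t : R) : deriv (fun t => a * t + b) t a.
  by apply: deriv_eq (derivD (derivZ a (derivI t)) (derivC b t)) _; rewrite mulr1 addr0.
have lin2 (a b t : R) : deriv (fun t => b + a * t) t a.
  by apply: deriv_eq (derivD (derivC b t) (derivZ a (derivI t))) _; rewrite mulr1 add0r.
have cx := cont3_cont2xy k1; have cy := cont3_cont2xy k2.
split; [| |exact: d3|split].
- apply: deriv_eq (@chain2 _ (fun a b => f a b z) (fun a b => fx a b z) (fun a b => fy a b z)
    (fun t => c * t + s * y) (fun t => - s * t + c * y) x c (- s) r r0 loc cx cy (lin _ _ _) (lin _ _ _)) _.
  by rewrite /turn; ring.
- apply: deriv_eq (@chain2 _ (fun a b => f a b z) (fun a b => fx a b z) (fun a b => fy a b z)
    (fun t => c * x + s * t) (fun t => - s * x + c * t) y s c r r0 loc cx cy (lin2 _ _ _) (lin2 _ _ _)) _.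
  by rewrite /turn; ring.
- by apply: cont3_lin; exact: turn_cont3.
- by apply: cont3_lin; exact: turn_cont3.
- exact: turn_cont3.
Qed.

Section layer.
Variables (dom : R -> R -> R -> Prop) (zb r0 rho g M wx0 wy0 : R).
Variables (u v w p ux uy uz vx vy vz wx wy wz px py pz : R -> R -> R -> R).
Hypotheses (r0_gt0 : 0 < r0) (rho_gt0 : 0 < rho).
Hypothesis dom_open : open3 dom.
Hypothesis dom_base : forall x y z, `|z - zb| < r0 -> dom x y z.
Hypothesis dom_star : forall x y z t, dom x y z -> btw zb z t -> dom x y t.
Hypotheses (Cu : C1on dom u ux uy uz) (Cv : C1on dom v vx vy vz) (Cw : C1on dom w wx wy wz)
  (Cp : C1on dom p px py pz).
Hypothesis div0 : forall x y z, dom x y z -> ux x y z + vy x y z + wz x y z = 0.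
Hypothesis vorticity : forall x y z, dom x y z ->
  [/\ wy x y z - vz x y z = wx0, uz x y z - wx x y z = wy0 & vx x y z - uy x y z = 0].
Hypothesis momentum : forall x y z, dom x y z ->
  [/\ px x y z = - rho * (u x y z * ux x y z + v x y z * uy x y z + w x y z * uz x y z),
      py x y z = - rho * (u x y z * vx x y z + v x y z * vy x y z + w x y z * vz x y z) &
      pz x y z = - rho * (u x y z * wx x y z + v x y z * wy x y z + w x y z * wz x y z + g)].
Hypothesis bd : forall x y z, dom x y z -> `|u x y z| <= M /\ `|v x y z| <= M.
Hypothesis aligned : c * wx0 - s * wy0 = 0.
Hypothesis gam_neq0 : s * wx0 + c * wy0 != 0.
Let gam := s * wx0 + c * wy0.

(** In the turned coordinates the vorticity points in the direction of y, and
    the equations keep their form. *)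
Lemma turned_layer : exists (U W Q : R -> R -> R) (V : R),
  let sh := shadow (turn_dom dom) in
  [/\ forall x y z, turn_dom dom x y z ->
        [/\ c * turn u x y z + - s * turn v x y z = U x z, s * turn u x y z + c * turn v x y z = V,
            turn w x y z = W x z & turn p x y z = Q x z],
      open2 sh, cr sh (fun x z => U x z - gam * z) W &
      forall x z, sh x z ->
        deriv (Q^~ z) x (- rho * accx gam (fun x z => U x z - gam * z) W x z) /\
        deriv (Q x) z (- rho * accz g gam (fun x z => U x z - gam * z) W x z)].
Proof.
have Tu := turn_C1on dom_open Cu; have Tv := turn_C1on dom_open Cv.
have Tw := turn_C1on dom_open Cw; have Tp := turn_C1on dom_open Cp.
have C1 := C1on_lin c (- s) Tu Tv; have C2 := C1on_lin s c Tu Tv.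
have cs : c * c + s * s = 1 by rewrite -!expr2.
apply: (@planar_layer _ (turn_dom dom) zb r0 rho g gam (M + M)
  (fun x y z => c * turn u x y z + - s * turn v x y z) (fun x y z => s * turn u x y z + c * turn v x y z) (turn w) (turn p)
  _ _ _ _ _ _ _ _ _ _ _ _ r0_gt0 rho_gt0 gam_neq0 (turn_open dom_open) _ _
  (C1on_deriv C1)
  (C1on_deriv C2)
  (C1on_deriv Tw)
  (C1on_deriv Tp)).
- by move=> x y z hz; exact: dom_base.
- by move=> x y z t D; exact: dom_star.
- by move=> x y z D; have [_ _ _ [k _ _]] := C1 x y z D; exact: (cont3_cont2xz k).
- by move=> x y z D; have [_ _ _ [k _ _]] := Tw x y z D; exact: (cont3_cont2xz k).
- move=> x y z D; have := div0 D; rewrite -/(turn ux x y z) -/(turn vy x y z) -/(turn wz x y z) => h.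
  transitivity ((c * c + s * s) * turn ux x y z + (c * c + s * s) * turn vy x y z + turn wz x y z); first by ring.
  by rewrite cs !mul1r.
- move=> x y z D; have [h1 h2 h3] := vorticity D.
  rewrite -/(turn wy x y z) -/(turn vz x y z) in h1; rewrite -/(turn uz x y z) -/(turn wx x y z) in h2.
  rewrite -/(turn vx x y z) -/(turn uy x y z) in h3.
  split.
  + by apply/eqP; rewrite -subr_eq0; apply/eqP; rewrite -aligned -h1 -h2; ring.
  + by rewrite /gam -h1 -h2; ring.
  + apply/eqP; rewrite -subr_eq0; apply/eqP.
    transitivity ((c * c + s * s) * (turn vx x y z - turn uy x y z)); first by ring.
    by rewrite h3 mulr0.
- move=> x y z D; have [h1 h2 h3] := momentum D.
  rewrite -/(turn px x y z) in h1; rewrite -/(turn py x y z) in h2; rewrite -/(turn pz x y z) in h3.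
  set cu := turn u x y z; set cv := turn v x y z; set cw := turn w x y z.
  have q1 : turn px x y z = - rho * (cu * turn ux x y z + cv * turn uy x y z + cw * turn uz x y z) by [].
  have q2 : turn py x y z = - rho * (cu * turn vx x y z + cv * turn vy x y z + cw * turn vz x y z) by [].
  have q3 : turn pz x y z = - rho * (cu * turn wx x y z + cv * turn wy x y z + cw * turn wz x y z + g) by [].
  have ss : s ^+ 2 = 1 - c ^+ 2 by rewrite -cs1; ring.
  by split; rewrite ?q1 ?q2 ?q3; ring: ss.
- move=> x y z D; have [k1 k2] := bd D.
  apply: le_trans (ler_normD _ _) _; rewrite !normrM; apply: lerD.
    by apply: le_trans k1; rewrite ler_piMl.
  by apply: le_trans k2; rewrite ler_piMl.
Qed.
End layer.
End rotation.
End curried_fields.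

(** * From the equations of motion to planar flows *)

Section layers.
Context {R : realType}.
Implicit Types (x y z t : R) (D : set 'rV[R]_3).

Lemma horizE (x y z : R) : horiz (vec3 x y z) = vec2 x y.
Proof. by rewrite /horiz !vec3E. Qed.

Lemma rot3E t (p : 'rV[R]_3) : rot3 (- t) p =
  vec3 (cos t * p 0 0 + sin t * p 0 1) (- sin t * p 0 0 + cos t * p 0 1) (p 0 2).
Proof. by rewrite /rot3 cosN sinN mulNr opprK. Qed.

Lemma rot2E t (p : 'rV[R]_2) : rot2 (- t) p =
  vec2 (cos t * p 0 0 + sin t * p 0 1) (- sin t * p 0 0 + cos t * p 0 1).
Proof. by rewrite /rot2 cosN sinN mulNr opprK. Qed.

Lemma deriv_shift (f : R -> R) x d : deriv (fun h => f (h + x)) 0 d -> deriv f x d.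
Proof.
move=> df; have dx : deriv (fun t => t - x) x 1.
  by apply: deriv_eq (derivB (derivI x) (derivC x x)) _; rewrite subr0.
have df' : deriv (fun h => f (h + x)) (x - x) d by rewrite subrr.
by apply: deriv_ext (deriv_eq (deriv_comp dx df') (mulr1 d)) => t /=; rewrite subrK.
Qed.

Definition curry3 (f : 'rV[R]_3 -> R) x y z := f (vec3 x y z).

Lemma C1_curry D f : open3 (fun x y z => D (vec3 x y z)) -> C1_closure D f ->
  C1on (fun x y z => D (vec3 x y z)) (curry3 f) (curry3 (partial 0 f)) (curry3 (partial 1 f)) (curry3 (partial 2 f)).
Proof.
move=> oD [_ C] x y z Dp.
have cp j : cont3 (curry3 (partial j f)) x y z.
  move=> e e0; have [_ [g [cg gE]]] := C j; have [r r0 Hr] := oD _ _ _ Dp.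
  have [d d0 Hd] := closure_limit cg (subset_closure Dp) e0.
  exists (Num.min r d); first by rewrite lt_min r0.
  move=> x' y' z'; rewrite !lt_min => /andP[x1 x2] /andP[y1 y2] /andP[z1 z2].
  have Dq := Hr _ _ _ x1 y1 z1; rewrite /curry3 -!gE//; apply: Hd; first exact: subset_closure.
  by move=> -[[|[|[|//]]] i]; rewrite /vec3 !mxE.
have dl j := derivable_line ((C j).1 _ Dp).
split; [| | |by split; exact: cp].
- apply: deriv_shift; apply: deriv_ext (dl 0) => h.
  by rewrite vec3_delta vec3_scale vec3_add /= mulr1 !mulr0 !add0r.
- apply: deriv_shift; apply: deriv_ext (dl 1) => h.
  by rewrite vec3_delta vec3_scale vec3_add /= mulr1 !mulr0 !add0r.
- apply: deriv_shift; apply: deriv_ext (dl 2) => h.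
  by rewrite vec3_delta vec3_scale vec3_add /= mulr1 !mulr0 !add0r.
Qed.

Lemma within_entry n m (A : set 'rV[R]_n.+1) (f : 'rV[R]_n.+1 -> 'rV[R]_m.+1) k :
  {within A, continuous f} -> {within A, continuous (fun q => f q 0 k)}.
Proof.
move=> /subspace_continuousP cf; apply/subspace_continuousP => p Ap.
exact: (@cvg_comp _ _ _ f (fun q : 'rV[R]_m.+1 => q 0 k) _ _ _ (cf p Ap) (@coord_continuous _ _ _ 0 k (f p))).
Qed.

Lemma within_lin n (A : set 'rV[R]_n.+1) (f g : 'rV[R]_n.+1 -> R) (a b : R) :
  {within A, continuous f} -> {within A, continuous g} -> {within A, continuous (fun q => a * f q + b * g q)}.
Proof.
move=> /subspace_continuousP cf /subspace_continuousP cg; apply/subspace_continuousP => p Ap.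
apply: cvgD; apply: cvgM; [exact: cvg_cst|exact: cf|exact: cvg_cst|exact: cg].
Qed.

Lemma C1_entry D (u : 'rV[R]_3 -> 'rV[R]_3) k : C1_closure D u -> C1_closure D (fun q => u q 0 k).
Proof.
move=> [cu C]; split; first exact: within_entry.
move=> j; have [dj [g [cg gE]]] := C j; split.
  by move=> p Dp; have [] := partial_entry k (dj p Dp).
exists (fun q => g q 0 k); split; first exact: within_entry.
by move=> p Dp; have [_ ->] := partial_entry k (dj p Dp); rewrite gE.
Qed.

Lemma partial_entryE D (u : 'rV[R]_3 -> 'rV[R]_3) j k p : C1_closure D u -> D p ->
  partial j u p 0 k = partial j (fun q => u q 0 k) p.
Proof. by move=> [_ C] Dp; have [_ ->] := partial_entry k ((C j).1 p Dp). Qed.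

Lemma approach D (f : 'rV[R]_3 -> R) x y z : {within closure D, continuous f} ->
  (forall e : R, 0 < e -> exists2 s, `|s - z| < e & D (vec3 x y s)) ->
  forall e, 0 < e -> exists2 d : R, 0 < d & forall x' y' z', `|x' - x| < d -> `|y' - y| < d -> `|z' - z| < d ->
    D (vec3 x' y' z') -> `|f (vec3 x' y' z') - f (vec3 x y z)| < e.
Proof.
move=> cf H e e0.
have cl : closure D (vec3 x y z).
  apply: closure_point => d d0; have [s hs Ds] := H d d0; exists (vec3 x y s) => //.
  by move=> -[[|[|[|//]]] i]; rewrite /vec3 !mxE//= subrr normr0.
have [d d0 Hd] := closure_limit cf cl e0.
exists d => // x' y' z' hx hy hz D'; apply: Hd; first exact: subset_closure.
by move=> -[[|[|[|//]]] i]; rewrite /vec3 !mxE.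
Qed.

Lemma sum3 (V : zmodType) (F : 'I_3 -> V) : \sum_(j < 3) F j = F 0 + F 1 + F 2.
Proof.
rewrite !big_ord_recl big_ord0 addr0 addrA.
by congr (F _ + F _ + F _); exact/val_inj.
Qed.

Lemma lin3_entry (a b c : R) (A B C : 'rV[R]_3) k :
  (a *: A + b *: B + c *: C) 0 k = a * A 0 k + b * B 0 k + c * C 0 k.
Proof. by rewrite !mxE. Qed.

Lemma balance_entry (a : R) (A B C : 'rV[R]_3) k : a *: A = - B + a *: C -> a * A 0 k = - B 0 k + a * C 0 k.
Proof. by move=> /rowP/(_ k); rewrite !mxE. Qed.

Lemma grad_entry (P : 'rV[R]_3 -> R) p k : grad P p 0 k = partial k P p.
Proof. by rewrite /grad mxE. Qed.

Lemma solve_pressure (r a p k : R) : r * a = - p + r * - k -> p = - r * (a + k).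
Proof. lra. Qed.

Lemma solve_pressure0 (r a p : R) : r * a = - p + r * 0 -> p = - r * a.
Proof. lra. Qed.

Section one_layer.
Variables (D : set 'rV[R]_3) (u : 'rV[R]_3 -> 'rV[R]_3) (P : 'rV[R]_3 -> R).
Variables (rho g M zb r0 : R) (w : 'rV[R]_3).
Let dom x y z := D (vec3 x y z).
Hypotheses (rho_gt0 : 0 < rho) (r0_gt0 : 0 < r0).
Hypothesis dom_open : open3 dom.
Hypothesis dom_base : forall x y z, `|z - zb| < r0 -> dom x y z.
Hypothesis dom_star : forall x y z t, dom x y z -> btw zb z t -> dom x y t.
Hypotheses (uC1 : C1_closure D u) (PC1 : C1_closure D P).
Hypotheses (eul : euler rho g D u P) (inc : incompressible D u).
Hypothesis vort : forall p, D p -> curl u p = w.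
Hypothesis bd : forall p, D p -> `|u p| <= M.

Let uk k := curry3 (fun q => u q 0 k).
Let du j k := curry3 (partial j (fun q => u q 0 k)).
Let Cu k : C1on dom (uk k) (du 0 k) (du 1 k) (du 2 k).
Proof. by apply: C1_curry => //; exact: C1_entry. Qed.

Let pe j k p (Dp : D p) := partial_entryE j k uC1 Dp.

Let vorticity x y z : dom x y z -> [/\ du 1 2 x y z - du 2 1 x y z = w 0 0,
  du 2 0 x y z - du 0 2 x y z = w 0 1 & du 0 1 x y z - du 1 0 x y z = w 0 2].
Proof.
move=> Dp; have E := vort Dp.
split; rewrite -E /curl vec3E.
- by rewrite (pe 1 2 Dp) (pe 2 1 Dp).
- by rewrite (pe 2 0 Dp) (pe 0 2 Dp).
- by rewrite (pe 0 1 Dp) (pe 1 0 Dp).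
Qed.

Let u_bd k x y z : dom x y z -> `|uk k x y z| <= M.
Proof. by move=> Dp; apply: le_trans (entry_norm _ _) (bd Dp). Qed.

Let base_dom x y : dom x y zb. Proof. by apply: dom_base; rewrite subrr normr0. Qed.

(** The layer contains a horizontal plane, on which the velocity is bounded. *)
Lemma vertical_vorticity0 : w 0 2 = 0.
Proof.
apply: (@bounded_plane_irrotational _ (fun x y => uk 0 x y zb) (fun x y => uk 1 x y zb)
  (fun x y => du 1 0 x y zb) (fun x y => du 0 1 x y zb) _ M) => x y.
- by have [_ d _ _] := Cu 0 (base_dom x y).
- by have [d _ _ _] := Cu 1 (base_dom x y).
- by have [_ _ _ [k _ _]] := Cu 1 (base_dom x y); exact: cont3_cont2xy k.
- by have [_ d _ _] := Cu 1 (base_dom x y); exact: deriv_cont d.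
- by split; exact: u_bd.
- by have [] := vorticity (base_dom x y).
Qed.

(** The angle t turns the vorticity into the direction of y. *)
Lemma fluid_layer t : cos t * w 0 0 - sin t * w 0 1 = 0 -> sin t * w 0 0 + cos t * w 0 1 != 0 ->
  let gam := sin t * w 0 0 + cos t * w 0 1 in
  exists (U W Q : R -> R -> R) (V : R), let sh := shadow (turn_dom (cos t) (sin t) dom) in
  [/\ forall x y z, turn_dom (cos t) (sin t) dom x y z ->
        let q := rot3 (- t) (vec3 x y z) in rot3 t (u q) = vec3 (U x z) V (W x z) /\ P q = Q x z,
      open2 sh, cr sh (fun x z => U x z - gam * z) W,
      forall x z, sh x z ->
        deriv (Q^~ z) x (- rho * accx gam (fun x z => U x z - gam * z) W x z) /\
        deriv (Q x) z (- rho * accz g gam (fun x z => U x z - gam * z) W x z) &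
      forall x z, sh x z -> `|U x z| <= M + M /\ `|W x z| <= M + M].
Proof.
move=> al gn gam.
have cs1 : cos t ^+ 2 + sin t ^+ 2 = 1 by exact: cos2Dsin2.
have [||||U [W [Q [V [E1 E2 E3 E4]]]]] := @turned_layer _ (cos t) (sin t) cs1 dom zb r0 rho g M (w 0 0) (w 0 1)
  _ _ _ (curry3 P) _ _ _ _ _ _ _ _ _ (curry3 (partial 0 P)) (curry3 (partial 1 P)) (curry3 (partial 2 P))
  r0_gt0 rho_gt0 dom_open dom_base dom_star (Cu 0) (Cu 1) (Cu 2) (C1_curry dom_open PC1) _ _ _ _ al gn.
- move=> x y z Dp; have := inc Dp; rewrite /divergence sum3 (pe 0 0 Dp) (pe 1 1 Dp) (pe 2 2 Dp) //.
- by move=> x y z Dp; have [h1 h2 h3] := vorticity Dp; rewrite h1 h2 h3 vertical_vorticity0.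
- move=> x y z Dp; have := eul Dp; set p := vec3 x y z in Dp *.
  move=> E; have Ek k : rho * (uk 0 x y z * du 0 k x y z + uk 1 x y z * du 1 k x y z + uk 2 x y z * du 2 k x y z) =
      - curry3 (partial k P) x y z + rho * vec3 0 0 (- g) 0 k.
    have := balance_entry k E; rewrite grad_entry /convect sum3 lin3_entry (pe 0 k Dp) (pe 1 k Dp) (pe 2 k Dp).
    by rewrite /uk /du /curry3.
  have := Ek 0; have := Ek 1; have := Ek 2; rewrite !vec3E => e2 e1 e0.
  by split; [exact: solve_pressure0 e0|exact: solve_pressure0 e1|exact: solve_pressure e2].
- by move=> x y z Dp; split; exact: u_bd.
exists U, W, Q, V => sh.
have rotu x y z : turn_dom (cos t) (sin t) dom x y z ->
    rot3 t (u (rot3 (- t) (vec3 x y z))) = vec3 (U x z) V (W x z) /\ P (rot3 (- t) (vec3 x y z)) = Q x z.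
  move=> Dp; have [<- <- <- <-] := E1 _ _ _ Dp.
  by rewrite rot3E !vec3E /rot3 /turn /uk /curry3 -mulNr.
split=> // x z [y Dp]; have [<- _ <- _] := E1 _ _ _ Dp.
have b0 := u_bd 0 Dp; have b1 := u_bd 1 Dp; have b2 := u_bd 2 Dp.
have M0 : 0 <= M by apply: le_trans b0.
split; last by apply: le_trans b2 _; rewrite lerDl.
have cl : `|cos t| <= 1 by rewrite ler_norml cos_geN1 cos_le1.
have sl : `|sin t| <= 1 by rewrite ler_norml sin_geN1 sin_le1.
apply: le_trans (ler_normD _ _) _; rewrite !normrM normrN; apply: lerD.
  by apply: le_trans b0; rewrite ler_piMl.
by apply: le_trans b1; rewrite ler_piMl.
Qed.
End one_layer.
End layers.

(** * Alignment and boundary values *)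

Section conclusion.
Context {R : realType}.
Implicit Types (x y z t : R).

Lemma polar (c s : R) : c ^+ 2 + s ^+ 2 = 1 -> exists t, cos t = c /\ sin t = s.
Proof.
move=> cs; have c1 : -1 <= c <= 1.
  rewrite -ler_norml -(@ler_pXn2r _ 2) ?nnegrE// real_normK ?num_real// expr1n -cs lerDl sqr_ge0 //.
have s2 : Num.sqrt (1 - c ^+ 2) = `|s| by rewrite -sqrtr_sqr; congr Num.sqrt; lra.
have ca : cos (acos c) = c by rewrite acosK// in_itv.
have [s0|s0] := leP 0 s.
  by exists (acos c); rewrite ca sin_acos// s2 ger0_norm.
by exists (- acos c); rewrite cosN sinN ca sin_acos// s2 ltr0_norm// opprK.
Qed.

Lemma align (a b : R) : a ^+ 2 + b ^+ 2 != 0 ->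
  exists t, cos t * a - sin t * b = 0 /\ sin t * a + cos t * b != 0.
Proof.
move=> n; have p : 0 < a ^+ 2 + b ^+ 2 by rewrite lt0r n addr_ge0// sqr_ge0.
pose r := Num.sqrt (a ^+ 2 + b ^+ 2).
have r0 : 0 < r by rewrite sqrtr_gt0.
have r2 : r ^+ 2 = a ^+ 2 + b ^+ 2 by rewrite sqr_sqrtr// ltW.
have rn : r != 0 by rewrite gt_eqF.
have [|t [ct st]] := @polar (b / r) (a / r).
  by rewrite !expr_div_n -mulrDl [b ^+ 2 + _]addrC -r2 divff// sqrf_eq0.
exists t; rewrite ct st; split; first by field.
have -> : a / r * a + b / r * b = r.
  by apply: (mulIf rn); rewrite -expr2 r2; field.
by [].
Qed.

Lemma parallel_multiple (v1 v2 : 'rV[R]_3) : ~~ free [:: v1; v2] -> v1 != 0 -> v2 != 0 ->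
  exists k, v1 = k *: v2.
Proof.
move=> nf n1 n2; move: nf; rewrite free_cons seq1_free n2 andbT negbK span_seq1 => /vlineP[k ->].
by exists k.
Qed.

Lemma C1_curry2 (e : 'rV[R]_2 -> R) : C1_closure setT e ->
  C1on (fun _ _ _ => True) (fun x y _ => e (vec2 x y)) (fun x y _ => partial 0 e (vec2 x y))
    (fun x y _ => partial 1 e (vec2 x y)) (fun _ _ _ => 0) /\
  forall x y z, cont3 (fun x y _ => e (vec2 x y)) x y z.
Proof.
move=> [ce C].
have cl (q : 'rV[R]_2) : closure setT q by rewrite closureT.
have lim (g : 'rV[R]_2 -> R) : {within closure setT, continuous g} -> forall x y z, cont3 (fun x y _ => g (vec2 x y)) x y z.
  move=> cg x y z ep e0; have [d d0 Hd] := closure_limit cg (cl (vec2 x y)) e0.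
  exists d => // x' y' z' hx hy _; apply: Hd; first exact: cl.
  by move=> -[[|[|//]] i]; rewrite /vec2 !mxE.
split; last exact: lim.
move=> x y z _; have dl j := derivable_line ((C j).1 (vec2 x y) I).
have cp j : cont3 (fun x y _ => partial j e (vec2 x y)) x y z.
  have [_ [g [cg gE]]] := C j; move=> ep e0; have [d d0 Hd] := lim g cg x y z ep e0.
  by exists d => // x' y' z' hx hy hz; rewrite -!gE//; exact: (Hd x' y' z').
split; [| |exact: derivC|split => //].
- by apply: deriv_shift; apply: deriv_ext (dl 0) => h; rewrite vec2_delta vec2_scale vec2_add /= mulr1 mulr0 add0r.
- by apply: deriv_shift; apply: deriv_ext (dl 1) => h; rewrite vec2_delta vec2_scale vec2_add /= mulr1 mulr0 add0r.
- by move=> ep e0; exists 1 => // *; rewrite subrr normr0.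
Qed.

Lemma elevation_bounds (h1 h2 : R) (e : 'rV[R]_2 -> R) :
  ((- h1)%:E < ereal_inf [set (e q)%:E | q in setT])%E ->
  (ereal_sup [set (e q)%:E | q in setT] < h2%:E)%E ->
  exists m0 m1, [/\ - h1 < m0, m1 < h2 & forall q, m0 <= e q <= m1].
Proof.
set S := [set (e q)%:E | q in setT] => lo hi.
have Sq q : S (e q)%:E by exists q.
have lb q : (ereal_inf S <= (e q)%:E)%E by apply: ereal_inf_lbound.
have ub q : ((e q)%:E <= ereal_sup S)%E by apply: ereal_sup_ubound.
case: (ereal_inf S) lo lb => [m0| |] lo lb; last 2 first.
- by have := lb 0; rewrite leye_eq.
- by move: lo; rewrite ltNge leNye.
case: (ereal_sup S) hi ub => [m1| |] hi ub; last 2 first.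
- by move: hi; rewrite ltNge leey.
- by have := ub 0; rewrite leeNy_eq.
by exists m0, m1; split=> // q; have := lb q; have := ub q; rewrite !lee_fin => -> ->.
Qed.

Lemma bounded_on (D : set 'rV[R]_3) (u : 'rV[R]_3 -> 'rV[R]_3) : [bounded u p | p in D] ->
  exists M, forall p, D p -> `|u p| <= M.
Proof. by move=> /ex_strict_bound_gt0[M _ H]; exists M => p Dp; apply: ltW; exact: H. Qed.

Lemma kinematic_turn (c s u v w e0 e1 : R) : c ^+ 2 + s ^+ 2 = 1 -> u * e0 + v * e1 = w ->
  (c * u + - s * v) * (c * e0 + - s * e1) + (s * u + c * v) * (s * e0 + c * e1) = w.
Proof.
move=> cs <-; transitivity ((c ^+ 2 + s ^+ 2) * (u * e0 + v * e1)); first by ring.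
by rewrite cs mul1r.
Qed.

Section trace.
Variables (D : set 'rV[R]_3) (c s : R).
Hypothesis cs1 : c ^+ 2 + s ^+ 2 = 1.
Let dom := turn_dom c s (fun x y z => D (vec3 x y z)).
Let pt x y z := vec3 (c * x + s * y) (- s * x + c * y) z.

(** The boundary values of a planar field, read off from the closure of the
    layer in three dimensions at any y at which the layer reaches the boundary
    point. *)
Lemma trace (f : 'rV[R]_3 -> R) (G : R -> R -> R) x y z : {within closure D, continuous f} ->
  (forall x y z, dom x y z -> f (pt x y z) = G x z) ->
  (forall e : R, 0 < e -> exists2 s, `|s - z| < e & dom x y s) ->
  forall e, 0 < e -> exists2 d : R, 0 < d & forall x' z', `|x' - x| < d -> `|z' - z| < d ->
    dom x' y z' -> `|G x' z' - f (pt x y z)| < e.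
Proof.
move=> cf fG H e e0; have [d d0 Hd] := approach cf H e0.
have le (a : R) : a ^+ 2 <= 1 -> `|a| <= 1.
  by move=> h; rewrite -(@expr_le1 _ 2)// real_normK ?num_real.
have cl : `|c| <= 1 by apply: le; rewrite -cs1 lerDl sqr_ge0.
have sl : `|s| <= 1 by apply: le; rewrite -cs1 lerDr sqr_ge0.
exists d => // x' z' hx hz D'; rewrite -(fG _ _ _ D'); apply: Hd => //.
  have -> : c * x' + s * y - (c * x + s * y) = c * (x' - x) by ring.
  by rewrite normrM; apply: le_lt_trans hx; rewrite ler_piMl.
have -> : - s * x' + c * y - (- s * x + c * y) = - s * (x' - x) by ring.
by rewrite normrM normrN; apply: le_lt_trans hx; rewrite ler_piMl.
Qed.
End trace.
End conclusion.

(** * The internal wave problem *)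

Section layer_domains.
Context {R : realType}.
Variables (h m0 m1 : R) (e : 'rV[R]_2 -> R).
Hypothesis ce : forall x y z, cont3 (fun x y _ => e (vec2 x y)) x y z.
Hypothesis range : forall q, m0 <= e q <= m1.

Lemma lowerE x y z : lower_layer h e (vec3 x y z) = (- h < z < e (vec2 x y)) :> Prop.
Proof. by rewrite /lower_layer /= vec3E horizE. Qed.

Lemma upperE x y z : upper_layer h e (vec3 x y z) = (e (vec2 x y) < z < h) :> Prop.
Proof. by rewrite /upper_layer /= vec3E horizE. Qed.

Lemma lower_open : open3 (fun x y z => lower_layer h e (vec3 x y z)).
Proof.
move=> x y z; rewrite lowerE => /andP[z1 z2].
have e0 : 0 < (e (vec2 x y) - z) / 2 by lra.
have [d d0 Hd] := ce x y z e0.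
exists (Num.min d (Num.min (z + h) ((e (vec2 x y) - z) / 2))).
  by rewrite !lt_min d0 e0 andbT; lra.
move=> x' y' z'; rewrite !lt_min lowerE => /andP[hx _] /andP[hy _] /and3P[_ k1 k2].
have := Hd x' y' z hx hy; rewrite subrr normr0 => /(_ d0).
move: k1 k2; rewrite !ltr_norml => /andP[? ?] /andP[? ?] /andP[? ?].
by apply/andP; split; lra.
Qed.

Lemma upper_open : open3 (fun x y z => upper_layer h e (vec3 x y z)).
Proof.
move=> x y z; rewrite upperE => /andP[z1 z2].
have e0 : 0 < (z - e (vec2 x y)) / 2 by lra.
have [d d0 Hd] := ce x y z e0.
exists (Num.min d (Num.min (h - z) ((z - e (vec2 x y)) / 2))).
  by rewrite !lt_min d0 e0 andbT; lra.
move=> x' y' z'; rewrite !lt_min upperE => /andP[hx _] /andP[hy _] /and3P[_ k1 k2].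
have := Hd x' y' z hx hy; rewrite subrr normr0 => /(_ d0).
move: k1 k2; rewrite !ltr_norml => /andP[? ?] /andP[? ?] /andP[? ?].
by apply/andP; split; lra.
Qed.

Lemma lower_base x y z : `|z - (m0 - h) / 2| < (m0 + h) / 2 -> lower_layer h e (vec3 x y z).
Proof.
rewrite lowerE ltr_norml => /andP[? ?]; have /andP[? ?] := range (vec2 x y).
by apply/andP; split; lra.
Qed.

Lemma upper_base x y z : `|z - (m1 + h) / 2| < (h - m1) / 2 -> upper_layer h e (vec3 x y z).
Proof.
rewrite upperE ltr_norml => /andP[? ?]; have /andP[? ?] := range (vec2 x y).
by apply/andP; split; lra.
Qed.

Lemma lower_star x y z t : - h < m0 -> lower_layer h e (vec3 x y z) -> btw ((m0 - h) / 2) z t ->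
  lower_layer h e (vec3 x y t).
Proof.
rewrite !lowerE /btw => ? /andP[? ?]; have /andP[? ?] := range (vec2 x y).
by move=> /orP[]/andP[? ?]; apply/andP; split; lra.
Qed.

Lemma upper_star x y z t : m1 < h -> upper_layer h e (vec3 x y z) -> btw ((m1 + h) / 2) z t ->
  upper_layer h e (vec3 x y t).
Proof.
rewrite !upperE /btw => ? /andP[? ?]; have /andP[? ?] := range (vec2 x y).
by move=> /orP[]/andP[? ?]; apply/andP; split; lra.
Qed.
End layer_domains.

Section one_sided.
Context {R : realType}.
Implicit Types (a q lo hi z : R).

Lemma near_left a q lo : lo < a -> 0 < q -> exists2 z, `|z - a| < q & lo < z < a.
Proof.
move=> la q0; pose r := Num.min q (a - lo).
have r0 : 0 < r by rewrite lt_min q0 subr_gt0.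
have [rq rl] : r <= q /\ r <= a - lo by rewrite /r !ge_min !lexx orbT.
clearbody r; exists (a - r / 2); last by apply/andP; split; lra.
by rewrite ltr_norml; apply/andP; split; lra.
Qed.

Lemma near_right a q hi : a < hi -> 0 < q -> exists2 z, `|z - a| < q & a < z < hi.
Proof.
move=> ah q0; have [|z hz /andP[z1 z2]] := @near_left (- a) q (- hi) _ q0; first by rewrite ltrN2.
by exists (- z); [rewrite -normrN opprB addrC in hz|apply/andP; split; lra].
Qed.

Lemma dist_left a q z : z < a -> a - q < z -> `|z - a| < q.
Proof. by move=> ? ?; rewrite ltr_norml; apply/andP; split; lra. Qed.

Lemma dist_right a q z : a < z -> z < a + q -> `|z - a| < q.
Proof. by move=> ? ?; rewrite ltr_norml; apply/andP; split; lra. Qed.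
End one_sided.

Section assembly.
Context {R : realType}.
Variables (h1 h2 rho1 rho2 g : R).
Hypotheses (rho1_gt0 : 0 < rho1) (rho2_gt0 : 0 < rho2) (g_gt0 : 0 < g).
Variables (F : flow R).
Hypothesis solF : classical_solution h1 h2 rho1 rho2 g F.
Variables w1 w2 : 'rV[R]_3.
Hypotheses
  (vorticity1 : forall p, lower_layer h1 (elevation F) p -> curl (u1 F) p = w1)
  (vorticity2 : forall p, upper_layer h2 (elevation F) p -> curl (u2 F) p = w2)
  (w_parallel : ~~ free [:: w1; w2])
  (w1_neq0 : w1 != 0) (w2_neq0 : w2 != 0)
  (u1_bounded : [bounded u1 F p | p in lower_layer h1 (elevation F)])
  (u2_bounded : [bounded u2 F p | p in upper_layer h2 (elevation F)]).
Let e := elevation F.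

(** A surface that is level in the turned y-direction gives a two-dimensional
    solution, since the layers are planar flows in any case. *)
Lemma flat_or_shear_flow : exists t, two_dim_form h1 h2 (rotate t F) \/
  rho1 = rho2 /\ shear_form h1 h2 (rotate t F).
Proof.
have [m0 [m1 [lo hi range]]] := elevation_bounds (eta_inf solF) (eta_sup solF).
have [C1e ce] := C1_curry2 (eta_C1 solF).
have [M1 B1] := bounded_on u1_bounded; have [M2 B2] := bounded_on u2_bounded.
have r1_gt0 : 0 < (m0 + h1) / 2 by lra.
have r2_gt0 : 0 < (h2 - m1) / 2 by lra.
have o1 := lower_open (h := h1) ce; have o2 := upper_open (h := h2) ce.
have b1 := lower_base (h := h1) range; have b2 := upper_base (h := h2) range.
have s1 x y z t := @lower_star _ h1 m0 m1 e range x y z t lo.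
have s2 x y z t := @upper_star _ h2 m0 m1 e range x y z t hi.
have v10 := vertical_vorticity0 r1_gt0 o1 b1 (u1_C1 solF) vorticity1 B1.
have v20 := vertical_vorticity0 r2_gt0 o2 b2 (u2_C1 solF) vorticity2 B2.
have [k w12] := parallel_multiple w_parallel w1_neq0 w2_neq0.
have n1 : w1 0 0 ^+ 2 + w1 0 1 ^+ 2 != 0.
  apply: contra w1_neq0; rewrite paddr_eq0 ?sqr_ge0// !sqrf_eq0 => /andP[/eqP a /eqP b].
  rewrite (vec3_eta w1) a b v10; apply/eqP/rowP => -[[|[|[|//]]] i]; by rewrite /vec3 !mxE.
have [t [al1 gn1]] := align n1.
have k0 : k != 0 by apply: contraNneq w1_neq0 => k0; rewrite w12 k0 scale0r.
have wk j : w1 0 j = k * w2 0 j by rewrite w12 mxE.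
have al2 : cos t * w2 0 0 - sin t * w2 0 1 = 0.
  apply: (mulfI k0); rewrite mulr0 -al1 !wk; ring.
have gn2 : sin t * w2 0 0 + cos t * w2 0 1 != 0.
  apply: contraNneq gn1 => z; have -> : sin t * w1 0 0 + cos t * w1 0 1 = k * (sin t * w2 0 0 + cos t * w2 0 1).
    by rewrite !wk; ring.
  by rewrite z mulr0.
have [U1 [W1 [Q1 [V1]]]] := fluid_layer rho1_gt0 r1_gt0 o1 b1 s1 (u1_C1 solF) (P1_C1 solF) (euler1 solF) (div1 solF)
  vorticity1 B1 al1 gn1.
have [U2 [W2 [Q2 [V2]]]] := fluid_layer rho2_gt0 r2_gt0 o2 b2 s2 (u2_C1 solF) (P2_C1 solF) (euler2 solF) (div2 solF)
  vorticity2 B2 al2 gn2.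
have cs1 : cos t ^+ 2 + sin t ^+ 2 = 1 by exact: cos2Dsin2.
move: al1 gn1 al2 gn2; set gam1 := sin t * w1 0 0 + _; set gam2 := sin t * w2 0 0 + _ => al1 gn1 al2 gn2.
pose eta x y := e (vec2 (cos t * x + sin t * y) (- sin t * x + cos t * y)).
pose pt x y z := vec3 (cos t * x + sin t * y) (- sin t * x + cos t * y) z.
have TD1 : turn_dom (cos t) (sin t) (fun x y z => lower_layer h1 e (vec3 x y z)) = (fun x y z => - h1 < z < eta x y).
  by apply/funext => x; apply/funext => y; apply/funext => z; rewrite /turn_dom lowerE.
have TD2 : turn_dom (cos t) (sin t) (fun x y z => upper_layer h2 e (vec3 x y z)) = (fun x y z => eta x y < z < h2).
  by apply/funext => x; apply/funext => y; apply/funext => z; rewrite /turn_dom upperE.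
rewrite /= TD1 TD2 => -[E2 os2 cr2 dp2 bd2] [E1 os1 cr1 dp1 bd1].
have Te := turn_C1on cs1 (dom := fun _ _ _ => True) (fun x y z _ => ex_intro2 _ _ 1 ltr01 (fun _ _ _ _ _ _ => I)) C1e.
pose ex x y := cos t * partial 0 e (vec2 (cos t * x + sin t * y) (- sin t * x + cos t * y)) +
  - sin t * partial 1 e (vec2 (cos t * x + sin t * y) (- sin t * x + cos t * y)).
pose ey x y := sin t * partial 0 e (vec2 (cos t * x + sin t * y) (- sin t * x + cos t * y)) +
  cos t * partial 1 e (vec2 (cos t * x + sin t * y) (- sin t * x + cos t * y)).
have dx x y : deriv (eta^~ y) x (ex x y) by have [d _ _ _] := Te x y 0 I.
have dy x y : deriv (eta x) y (ey x y) by have [_ d _ _] := Te x y 0 I.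
have cex x y : cont2 ex x y by have [_ _ _ [d _ _]] := Te x y 0 I; exact: (cont3_cont2xy d).
have cey x y : cont2 ey x y by have [_ _ _ [_ d _]] := Te x y 0 I; exact: (cont3_cont2xy d).
have ceta x y : cont2 eta x y.
  by have d := turn_cont3 cs1 (ce (cos t * x + sin t * y) (- sin t * x + cos t * y) 0); exact: (cont3_cont2xy d).
have rg x y : m0 <= eta x y <= m1 by exact: range.
have ptE x y z : rot3 (- t) (vec3 x y z) = pt x y z by rewrite rot3E !vec3E.
have entries (p : 'rV[R]_3) (a b d : R) : rot3 t p = vec3 a b d ->
    [/\ cos t * p 0 0 + - sin t * p 0 1 = a, sin t * p 0 0 + cos t * p 0 1 = b & p 0 2 = d].
  by move=> /rowP E; split; [have := E 0|have := E 1|have := E 2]; rewrite /rot3 !vec3E// mulNr.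
have F1 x y z : - h1 < z < eta x y -> [/\ cos t * u1 F (pt x y z) 0 0 + - sin t * u1 F (pt x y z) 0 1 = U1 x z,
    sin t * u1 F (pt x y z) 0 0 + cos t * u1 F (pt x y z) 0 1 = V1, u1 F (pt x y z) 0 2 = W1 x z &
    P1 F (pt x y z) = Q1 x z].
  by move=> D; have [] := E1 x y z D; rewrite ptE => /entries[].
have F2 x y z : eta x y < z < h2 -> [/\ cos t * u2 F (pt x y z) 0 0 + - sin t * u2 F (pt x y z) 0 1 = U2 x z,
    sin t * u2 F (pt x y z) 0 0 + cos t * u2 F (pt x y z) 0 1 = V2, u2 F (pt x y z) 0 2 = W2 x z &
    P2 F (pt x y z) = Q2 x z].
  by move=> D; have [] := E2 x y z D; rewrite ptE => /entries[].
have cu1 k' : {within closure (lower_layer h1 e), continuous (fun q => u1 F q 0 k')} by exact: within_entry (u1_C1 solF).1.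
have cu2 k' : {within closure (upper_layer h2 e), continuous (fun q => u2 F q 0 k')} by exact: within_entry (u2_C1 solF).1.
have tr1 := @trace _ (lower_layer h1 e) _ _ cs1; rewrite TD1 in tr1.
have tr2 := @trace _ (upper_layer h2 e) _ _ cs1; rewrite TD2 in tr2.
have below x y : - h1 < eta x y by have /andP[h _] := rg x y; exact: lt_le_trans lo h.
have above x y : eta x y < h2 by have /andP[_ h] := rg x y; exact: le_lt_trans h hi.
have lim1 (f : 'rV[R]_3 -> R) (G : R -> R -> R) : {within closure (lower_layer h1 e), continuous f} ->
    (forall x y z, - h1 < z < eta x y -> f (pt x y z) = G x z) ->
    forall x y, lim_below (- h1) eta G x y (f (pt x y (eta x y))).
  move=> cf fG x y ep ep0; have [|d d0 Hd] := tr1 f G x y (eta x y) cf fG _ ep ep0.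
    by move=> q q0; exact: near_left (below x y) q0.
  exists d => // z /andP[z1 z2] z3; apply: Hd; last by rewrite z1.
    by rewrite subrr normr0.
  exact: dist_left z2 z3.
have lim2 (f : 'rV[R]_3 -> R) (G : R -> R -> R) : {within closure (upper_layer h2 e), continuous f} ->
    (forall x y z, eta x y < z < h2 -> f (pt x y z) = G x z) ->
    forall x y, lim_above h2 eta G x y (f (pt x y (eta x y))).
  move=> cf fG x y ep ep0; have [|d d0 Hd] := tr2 f G x y (eta x y) cf fG _ ep ep0.
    by move=> q q0; exact: near_right (above x y) q0.
  exists d => // z /andP[z1 z2] z3; apply: Hd; last by rewrite z1.
    by rewrite subrr normr0.
  exact: dist_right z1 z3.
have onI x y : interface e (pt x y (eta x y)) by rewrite /interface /= /pt vec3E horizE.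
have kin1 x y : exists u w, [/\ lim_below (- h1) eta U1 x y u, lim_below (- h1) eta W1 x y w &
    u * ex x y + V1 * ey x y = w].
  have lU := lim1 _ U1 (@within_lin _ _ _ _ _ (cos t) (- sin t) (cu1 0) (cu1 1)) (fun x y z D => let: And4 a _ _ _ := F1 x y z D in a) x y.
  have lV := lim1 _ (fun _ _ => V1) (@within_lin _ _ _ _ _ (sin t) (cos t) (cu1 0) (cu1 1)) (fun x y z D => let: And4 _ a _ _ := F1 x y z D in a) x y.
  have lW := lim1 _ W1 (cu1 2) (fun x y z D => let: And4 _ _ a _ := F1 x y z D in a) x y.
  do 2 eexists; split; [exact: lU|exact: lW|].
  rewrite -(lim_below_eq (below x y) lV) /=; last exact: cvg_cst.
  apply: kinematic_turn => //.
  by have := kinematic1 solF (onI x y); rewrite /pt horizE.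
have kin2 x y : exists u w, [/\ lim_above h2 eta U2 x y u, lim_above h2 eta W2 x y w &
    u * ex x y + V2 * ey x y = w].
  have lU := lim2 _ U2 (@within_lin _ _ _ _ _ (cos t) (- sin t) (cu2 0) (cu2 1)) (fun x y z D => let: And4 a _ _ _ := F2 x y z D in a) x y.
  have lV := lim2 _ (fun _ _ => V2) (@within_lin _ _ _ _ _ (sin t) (cos t) (cu2 0) (cu2 1)) (fun x y z D => let: And4 _ a _ _ := F2 x y z D in a) x y.
  have lW := lim2 _ W2 (cu2 2) (fun x y z D => let: And4 _ _ a _ := F2 x y z D in a) x y.
  do 2 eexists; split; [exact: lU|exact: lW|].
  rewrite -(lim_above_eq (above x y) lV) /=; last exact: cvg_cst.
  apply: kinematic_turn => //.
  by have := kinematic2 solF (onI x y); rewrite /pt horizE.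
have dyn x y : exists p, lim_below (- h1) eta Q1 x y p /\ lim_above h2 eta Q2 x y p.
  exists (P1 F (pt x y (eta x y))); split.
    exact: lim1 _ Q1 (P1_C1 solF).1 (fun x y z D => let: And4 _ _ _ a := F1 x y z D in a) x y.
  rewrite (dynamic solF (onI x y)).
  exact: lim2 _ Q2 (P2_C1 solF).1 (fun x y z D => let: And4 _ _ _ a := F2 x y z D in a) x y.
have bed x ep : 0 < ep -> exists2 d : R, 0 < d & forall x' z', `|x' - x| < d ->
    - h1 < z' -> z' < - h1 + d -> shadow (fun x y z => - h1 < z < eta x y) x' z' -> `|W1 x' z'| < ep.
  move=> ep0; have [|d d0 Hd] := tr1 _ W1 x 0 (- h1) (cu1 2) (fun x y z D => let: And4 _ _ a _ := F1 x y z D in a) _ ep ep0.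
    by move=> q q0; exact: near_right (below x 0) q0.
  have d'0 : 0 < Num.min d (m0 + h1) by rewrite lt_min d0 -ltrBlDr sub0r.
  exists (Num.min d (m0 + h1)) => // x' z'; rewrite lt_min => /andP[hx _] z1.
  rewrite -ltrBlDl lt_min => /andP[z2 z3] _.
  have := Hd x' z' hx; rewrite (bed_bc solF) ?vec3E// subr0; apply.
    by apply: dist_right z1 _; rewrite -ltrBlDl.
  have /andP[zm _] := rg x' 0; rewrite z1 /=; apply: lt_le_trans zm.
  by move: z3; rewrite opprK ltrD2r.
have lid x ep : 0 < ep -> exists2 d : R, 0 < d & forall x' z', `|x' - x| < d ->
    z' < h2 -> h2 - d < z' -> shadow (fun x y z => eta x y < z < h2) x' z' -> `|W2 x' z'| < ep.
  move=> ep0; have [|d d0 Hd] := tr2 _ W2 x 0 h2 (cu2 2) (fun x y z D => let: And4 _ _ a _ := F2 x y z D in a) _ ep ep0.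
    by move=> q q0; exact: near_left (above x 0) q0.
  have d'0 : 0 < Num.min d (h2 - m1) by rewrite lt_min d0 subr_gt0.
  exists (Num.min d (h2 - m1)) => // x' z'; rewrite lt_min => /andP[hx _] z1.
  rewrite ltrBlDl -ltrBlDr lt_min => /andP[z2 z3] _.
  have := Hd x' z' hx; rewrite (lid_bc solF) ?vec3E// subr0; apply.
    by apply: dist_left z1 _; rewrite ltrBlDl -ltrBlDr.
  have /andP[_ zm] := rg x' 0; rewrite z1 andbT; apply: le_lt_trans zm _.
  by move: z3; rewrite ltrD2l ltrN2.
pose M := Num.max (M1 + M1) (M2 + M2).
have bd1' x z : shadow (fun x y z => - h1 < z < eta x y) x z -> `|U1 x z| <= M /\ `|W1 x z| <= M.
  by move=> /bd1[? ?]; rewrite !le_max; split; apply/orP; left.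
have bd2' x z : shadow (fun x y z => eta x y < z < h2) x z -> `|U2 x z| <= M /\ `|W2 x z| <= M.
  by move=> /bd2[? ?]; rewrite !le_max; split; apply/orP; right.
have gn : g != 0 by rewrite gt_eqF.
have elE q : elevation (rotate t F) q = eta (q 0 0) (q 0 1) by rewrite /= rot2E.
have lowP p : lower_layer h1 (elevation (rotate t F)) p -> - h1 < p 0 2 < eta (p 0 0) (p 0 1).
  by move=> D; have : - h1 < p 0 2 < elevation (rotate t F) (horiz p) := D; rewrite elE /horiz !vec2E.
have upP p : upper_layer h2 (elevation (rotate t F)) p -> eta (p 0 0) (p 0 1) < p 0 2 < h2.
  by move=> D; have : elevation (rotate t F) (horiz p) < p 0 2 < h2 := D; rewrite elE /horiz !vec2E.
have := flat_or_shear rho1_gt0 rho2_gt0 gn gn1 gn2 lo hi rg dx dy ceta cex cey os1 os2 cr1 cr2 dp1 dp2 bd1' bd2'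
  bed lid kin1 kin2 dyn.
move=> alt; exists t; case: alt => [flat|[rr V10 V20 ex0 [k1 [k2 [S1 S2]]]]]; [left|right].
  split.
  - exists (fun x => eta x 0) => q; rewrite elE.
    by apply: (@deriv0_const _ (eta (q 0 0))) => z _; rewrite -(flat (q 0 0) z).
  - exists U1, W1, Q1, V1 => p /lowP D; have := E1 _ _ _ D; rewrite -vec3_eta => -[] //.
  - exists U2, W2, Q2, V2 => p /upP D; have := E2 _ _ _ D; rewrite -vec3_eta => -[] //.
split=> //; split.
  exists gam1, gam2, k1, k2; split=> p.
    move=> /lowP D; have [E _] := E1 _ _ _ D; rewrite -vec3_eta in E; rewrite /= E V10.
    by have [|-> ->] := S1 (p 0 0) (p 0 2); first by exists (p 0 1).
  move=> /upP D; have [E _] := E2 _ _ _ D; rewrite -vec3_eta in E; rewrite /= E V20.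
  by have [|-> ->] := S2 (p 0 0) (p 0 2); first by exists (p 0 1).
exists (eta 0); split.
- by move=> y; have [d _] := dy 0 y.
- have -> : derive1 (eta 0) = ey 0 by apply/funext => y; rewrite derive1E; have [_ ->] := dy 0 y.
  by move=> y; exact: cont_snd (cey 0 y).
- by move=> y; rewrite below above.
- move=> q; rewrite elE; apply: (@deriv0_const _ (eta^~ (q 0 1))) => z _; rewrite -(ex0 z (q 0 1)) //.
Qed.
End assembly.

Theorem theorem1p2 (R : realType) (h1 h2 rho1 rho2 g : R)
  (h1_gt0 : 0 < h1) (h2_gt0 : 0 < h2)
  (rho1_gt0 : 0 < rho1) (rho2_gt0 : 0 < rho2) (g_gt0 : 0 < g)
  (F : flow R) (solF : classical_solution h1 h2 rho1 rho2 g F)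
  (w1 w2 : 'rV[R]_3)
  (vorticity1 : forall p, lower_layer h1 (elevation F) p -> curl (u1 F) p = w1)
  (vorticity2 : forall p, upper_layer h2 (elevation F) p -> curl (u2 F) p = w2)
  (w_parallel : ~~ free [:: w1; w2])
  (w1_neq0 : w1 != 0) (w2_neq0 : w2 != 0)
  (u1_bounded : [bounded u1 F p | p in lower_layer h1 (elevation F)])
  (u2_bounded : [bounded u2 F p | p in upper_layer h2 (elevation F)]) :
  (trivially_3d_shear h1 h2 F \/ two_dimensional h1 h2 F) /\
  (rho1 <> rho2 -> two_dimensional h1 h2 F).
Proof.
have [t [flat|[rr shear]]] := flat_or_shear_flow rho1_gt0 rho2_gt0 g_gt0 solF vorticity1 vorticity2
  w_parallel w1_neq0 w2_neq0 u1_bounded u2_bounded.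
  by split=> [|_]; [right|]; exists t.
by split=> [|/(_ rr)//]; left; exists t.
Qed.
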